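(* Let $(u,p)$ be a weak solution (of the HHMO-model) with $u^*<\Psi(\alpha)$. Assume that $p$ satisfies condition (P), with associated function $p^*$, and that for a.e. $\eta\ge0$ the limit $$V(\eta)=\lim_{t\to\infty}u(\eta\sqrt t,t)$$ exists. Then the limits $$\lim_{x\to\infty}\frac1x\int_0^x\xi^2\,p^*(\xi)\,d\xi\qquad\text{and}\qquad\lim_{x\to\infty}x\int_x^\infty p^*(\xi)\,d\xi$$ exist and are equal; denoting their common value by $\gamma$, one has $V(\eta)=\Phi_\gamma(\eta)$, and $u$ converges uniformly to $\Phi_\gamma$, i.e. $\lim_{t\to\infty}\sup_{\eta\ge0}|u(\eta\sqrt t,t)-\Phi_\gamma(\eta)|=0$. Further, $\Phi_\gamma(\alpha)=u^*$ if $\gamma>0$, and $0<\Phi_\gamma(\alpha)\le u^*$ if $\gamma=0$.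
   Context: Let $\alpha,\beta,u^*>0$ be constants. The HHMO-model is formally $u_t=u_{xx}+\frac{\alpha\beta}{2\sqrt t}\,\delta(x-\alpha\sqrt t)-p\,u$ for $x>0,t>0$, with $u_x(0,t)=0$ and $u(x,0)=0$ for $x>0$; it is extended to $x\in\mathbb{R}$ by even reflection. Let $$\Psi(\eta)=\frac{\alpha\beta}{2}e^{\alpha^2/4}\int_{\max\{|\eta|,\alpha\}}^\infty e^{-\zeta^2/4}\,d\zeta ,$$ and $\psi(x,t)=\Psi(x/\sqrt t)$ for $t>0$; for $t=0$, $\psi(x,0)=0$ if $x\ne0$ and $\psi(0,0)=\Psi(\alpha)$. A weak solution is a pair $(u,p)$ of functions on $\mathbb{R}\times[0,\infty)$ such that: (i) $u(x,t)=u(-x,t)$ and $p(x,t)=p(-x,t)$ for all $x\in\mathbb{R}$, $t\ge0$; (ii) for every $T>0$, $u-\psi$ is bounded on $\mathbb{R}\times[0,T]$, and $u-\psi$ and $\partial_x(u-\psi)$ are continuous on $\mathbb{R}\times[0,T]$; (iii) $p$ is measurable and $p(x,t)=0$ if $\sup_{s\in[0,t]}u(x,s)<u^*$, $p(x,t)\in[0,1]$ if $\sup_{s\in[0,t]}u(x,s)=u^*$, $p(x,t)=1$ if $\sup_{s\in[0,t]}u(x,s)>u^*$; (iv) $p(x,t)$ is non-decreasing in $t$ for every $x\in\mathbb{R}$; (v) for every $T>0$, $$\int_0^T\!\!\int_{\mathbb{R}}\varphi_t\,(u-\psi)\,dy\,ds=\int_0^T\!\!\int_{\mathbb{R}}\bigl(\varphi_x\,(u-\psi)_x+p\,u\,\varphi\bigr)\,dy\,ds$$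 for every $\varphi$ with $\varphi,\varphi_x,\varphi_t$ continuous on $\mathbb{R}\times[0,T]$ that vanishes for large $|x|$ and for $t=T$. Condition (P): there exists a measurable function $p^*$ on $(0,\infty)$ such that for a.e. $x>0$, $p(x,t)=p^*(x)$ for all $t>x^2/\alpha^2$. For $\gamma\ge0$ let $\kappa=\frac{1+\sqrt{4\gamma+1}}{2}$, let $M(a,b,z)=\sum_{n\ge0}\frac{(a)_n}{(b)_n}\frac{z^n}{n!}$ be Kummer's function, $\operatorname{erfc}(z)=\frac{2}{\sqrt\pi}\int_z^\infty e^{-y^2}dy$, and define $$u^*_\gamma=\left(\frac{\kappa\,M(\frac\kappa2+1,\kappa+\frac12,-\frac{\alpha^2}{4})}{\alpha\,M(\frac\kappa2,\kappa+\frac12,-\frac{\alpha^2}{4})}+\frac{\exp(-\frac{\alpha^2}{4})}{\sqrt\pi\,\operatorname{erfc}(\frac\alpha2)}\right)^{-1}\frac{\alpha\beta}{2},$$ $$\Phi_\gamma(\eta)=\begin{cases}\dfrac{u^*_\gamma\,\eta^\kappa\,M(\frac\kappa2,\kappa+\frac12,-\frac{\eta^2}{4})}{\alpha^\kappa\,M(\frac\kappa2,\kappa+\frac12,-\frac{\alpha^2}{4})}&\text{if }0\le\eta<\alpha,\\[2ex]\dfrac{u^*_\gamma}{\operatorname{erfc}(\frac\alpha2)}\,\operatorname{erfc}(\frac\eta2)&\text{if }\eta\ge\alpha.\end{cases}$$ *)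

(* Defs.v *)
(* MathComp-Analysis, over an arbitrary [R : realType]. *)
From HB Require Import structures.
From mathcomp Require Export all_boot all_order all_algebra.
From mathcomp Require Export all_classical all_reals all_analysis measurable_realfun.

Set Implicit Arguments.
Unset Strict Implicit.
Unset Printing Implicit Defensive.

Import Order.TTheory GRing.Theory Num.Theory.
Import numFieldNormedType.Exports.

Local Open Scope classical_set_scope.
Local Open Scope ring_scope.

(** Measurability with respect to the completion of [mu].  The library's
    [lebesgue_measure] lives on the Borel sigma-algebra, so Lebesgue measurable
    functions have to be measurable for its completion. *)
Definition completed_measurable_fun d (T : measurableType d) (R : realType)
    (mu : set T -> \bar R) (D : set T) (f : T -> R) : Prop :=
  @measurable_fun _ _ (g_sigma_algebraType (completed_algebra_gen mu))
    (measurableTypeR R) D f.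

Section SpecialFunctions.
Context {R : realType}.
Implicit Types a b z : R.
Local Notation mu := (@lebesgue_measure R).

(** Pochhammer symbol [(a)_n = a (a + 1) ... (a + n - 1)]. *)
Definition pochhammer a (n : nat) : R := \prod_(i < n) (a + i%:R).

Definition kummerM a b z : R :=
  limn (series (fun n : nat =>
    pochhammer a n / pochhammer b n * (z ^+ n / n`!%:R))).

Definition erfc z : R :=
  2 / Num.sqrt pi * \int[mu]_(y in `[z, +oo[) expR (- y ^+ 2).

End SpecialFunctions.

Section Model.
Context {R : realType}.
Variables alpha beta : R.
Local Notation mu := (@lebesgue_measure R).

Definition Psi (eta : R) : R :=
  alpha * beta / 2 * expR (alpha ^+ 2 / 4) *
  \int[mu]_(zeta in `[Num.max `|eta| alpha, +oo[) expR (- zeta ^+ 2 / 4).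

Definition psi (x t : R) : R :=
  if 0 < t then Psi (x / Num.sqrt t)
  else if x == 0 then Psi alpha else 0.

(** The closed strip [R x [0, T]]. *)
Definition strip (T : R) : set (R * R) := [set z | 0 <= z.2 <= T].

Definition continuous_on_strip (T : R) (f : R -> R -> R) : Prop :=
  {within strip T, continuous (fun z : R * R => f z.1 z.2)}.

Definition dx (f : R -> R -> R) (x t : R) : R := derive1 (f ^~ t) x.

Definition derivable_x_on_strip (T : R) (f : R -> R -> R) : Prop :=
  forall x t, 0 <= t <= T -> derivable (f ^~ t) x 1.

(** [ft] is the time derivative of [f] on the closed strip: difference quotients
    only use times in [0, T], so the derivative is one-sided at [0] and [T]. *)
Definition is_dt_on_strip (T : R) (f ft : R -> R -> R) : Prop :=
  forall x t, 0 <= t <= T ->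
    (f x s - f x t) / (s - t) @[s --> within `[0, T] t^'] --> ft x t.

Definition test_function (T : R) (phi phit : R -> R -> R) : Prop :=
  [/\ is_dt_on_strip T phi phit /\ derivable_x_on_strip T phi,
      [/\ continuous_on_strip T phi, continuous_on_strip T (dx phi)
        & continuous_on_strip T phit],
      exists r : R, forall x t, r < `|x| -> 0 <= t <= T -> phi x t = 0
    & forall x, phi x T = 0].

Variable ustar : R.

Definition running_sup (u : R -> R -> R) (x t : R) : R :=
  sup [set u x s | s in `[0, t]].

(** [u] and [p] are total functions, but only their values at times [0 <= t]
    matter.  By [ws_bounded], [s |-> u x s] is bounded on [[0, t]], so that
    [running_sup] is a genuine supremum; likewise all integrands in [ws_weak] are
    bounded and vanish for large [|x|], so the integrals are finite.  For the
    possibly non-Borel [p], the library integral, a supremum over Borel simple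
    functions, still takes the Lebesgue value. *)
Record weak_solution (u p : R -> R -> R) : Prop := WeakSolution {
  ws_even : forall x t, 0 <= t -> u (- x) t = u x t /\ p (- x) t = p x t;
  ws_bounded : forall T, 0 < T -> exists M : R,
    forall x t, 0 <= t <= T -> `|u x t - psi x t| <= M;
  ws_derivable : forall T, 0 < T ->
    derivable_x_on_strip T (fun x t => u x t - psi x t);
  ws_continuous : forall T, 0 < T ->
    continuous_on_strip T (fun x t => u x t - psi x t) /\
    continuous_on_strip T (dx (fun x t => u x t - psi x t));
  ws_p_measurable : completed_measurable_fun (mu \x mu)%E
    [set z : R * R | 0 <= z.2] (fun z => p z.1 z.2);
  ws_p_below : forall x t, 0 <= t -> running_sup u x t < ustar -> p x t = 0;
  ws_p_at : forall x t, 0 <= t -> running_sup u x t = ustar -> 0 <= p x t <= 1;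
  ws_p_above : forall x t, 0 <= t -> ustar < running_sup u x t -> p x t = 1;
  ws_p_nondecreasing : forall x s t, 0 <= s -> s <= t -> p x s <= p x t;
  ws_weak : forall T, 0 < T -> forall phi phit, test_function T phi phit ->
    \int[mu]_(s in `[0, T]) \int[mu]_y (phit y s * (u y s - psi y s)) =
    \int[mu]_(s in `[0, T]) \int[mu]_y
      (dx phi y s * dx (fun x t => u x t - psi x t) y s +
       p y s * u y s * phi y s)
}.

(** Condition (P), with [pstar] the associated function on [(0, +oo)]. *)
Definition conditionP (p : R -> R -> R) (pstar : R -> R) : Prop :=
  completed_measurable_fun mu `]0, +oo[ pstar /\
  {ae mu, forall x : R, 0 < x ->
     forall t, x ^+ 2 / alpha ^+ 2 < t -> p x t = pstar x}.

Definition kappa (gamma : R) : R := (1 + Num.sqrt (4 * gamma + 1)) / 2.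

Definition ustar_gamma (gamma : R) : R :=
  let k := kappa gamma in
  (k * kummerM (k / 2 + 1) (k + 1 / 2) (- alpha ^+ 2 / 4) /
     (alpha * kummerM (k / 2) (k + 1 / 2) (- alpha ^+ 2 / 4)) +
   expR (- alpha ^+ 2 / 4) / (Num.sqrt pi * erfc (alpha / 2)))^-1 *
  (alpha * beta / 2).

Definition Phi (gamma eta : R) : R :=
  let k := kappa gamma in
  if eta < alpha then
    ustar_gamma gamma * eta `^ k *
      kummerM (k / 2) (k + 1 / 2) (- eta ^+ 2 / 4) /
    (alpha `^ k * kummerM (k / 2) (k + 1 / 2) (- alpha ^+ 2 / 4))
  else ustar_gamma gamma / erfc (alpha / 2) * erfc (eta / 2).

End Model.

(* Main.v *)
(* Write [u = psi + w] and [S x t] for the integral of [p * u] over [[0, t]].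
   Testing the weak equation with products of ramps gives the flux balance: the
   integral of [w(., t) + S(., t)] over [[x, y]] is the integral of
   [w_x(y, s) - w_x(x, s)] over [[0, t]].  A comparison principle for functions
   satisfying a one-sided flux balance (a maximum of box averages is touched by
   smooth supersolutions) shows [0 <= u], [w <= 0] and that [w] decreases in time.
   Since [p] is eventually [1] near [x = 0], [u(0, t)] tends to [0]; with the
   existence of [V] and monotonicity, [w(k, k^2 t)] then converges to a continuous
   limit [fw t], and [u(eta sqrt t, t)] converges uniformly to the profile
   [P eta = fw (eta^-2) + Psi eta].

   The profile never exceeds [ustar], and stays strictly below it for
   [eta > alpha]; so [p] vanishes ahead of the front and [P] solves the source-free
   similarity equation there.  Behind the front, condition (P) turns the scaled
   flux balance into a relation between [P] and the means of [xi^2 * pstar xi].  If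
   [P alpha < ustar], then [pstar] vanishes far out and [gamma = 0].  If
   [P alpha = ustar], the relation on short windows next to the front bounds the
   oscillation of these means, so that they converge to some [gamma].  Inserting
   [gamma] back gives [P'' + eta / 2 * P' = gamma / eta^2 * P] on [(0, alpha)],
   whose solution vanishing at [0] is a multiple of
   [eta^kappa * M(kappa/2, kappa + 1/2, - eta^2/4)].  The flux is continuous at
   [alpha] for [w], i.e. jumps by the source for [P], which fixes the constant. *)

(* As [p] may jump and [u] is known only through the weak equation, no pointwise form of the PDE is
   at hand. Parabolic regularity is replaced by two facts about fluxes integrated over a time
   window. The source is nonnegative and [w] stays in [- Psi alpha, 0], so such a flux decreases in
   x at most at the rate Psi alpha, whatever the length d of the window. Hence it is of order sqrt
   d, because its primitive in x has a small range; and convergence of rescaled time integrals of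
   [w] entails convergence of the fluxes, as for derivatives of convex functions. The order sqrt d
   also yields w(x, t + d) <= w(y, t) + C |x - y| / sqrt d, the modulus of continuity behind the
   scaling limit.

   The weight xi^2 comes from the parabolic scaling: the front passes x at time x^2 / alpha^2,
   afterwards [p] is frozen at pstar(x) and u = Psi alpha + w, so the amount absorbed at x up to
   time x^2 t is about x^2 pstar(x) times the integral of fw + Psi alpha over [alpha^-2, t]. *)
Require Import Defs.
From mathcomp Require Import all_boot all_order all_algebra.
From mathcomp Require Import all_classical all_reals all_analysis.
From mathcomp Require Import ring lra.
Set Implicit Arguments.
Unset Strict Implicit.
Unset Printing Implicit Defensive.
Import Order.TTheory GRing.Theory Num.Theory.
Import numFieldNormedType.Exports.
Local Open Scope classical_set_scope.
Local Open Scope ring_scope.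

(** * Calculus and Lebesgue integration on bounded intervals *)

Section RealCalculus.
Context {R : realType}.
Implicit Types (f g : R -> R) (a b x y : R).
Local Notation mu := (@lebesgue_measure R).

Lemma is_derive_eps f x l :
  (forall e : R, 0 < e -> exists2 d : R, 0 < d &
     forall h, `|h| < d -> `|f (x + h) - f x - l * h| <= e * `|h|) ->
  is_derive x (1 : R) f l.
Proof.
move=> H.
have C : h^-1 * (f (h * 1 + x) - f x) @[h --> (0 : R)^'] --> l.
  apply/cvgrPdist_le => e e0; have [d d0 Hd] := H _ e0.
  near=> h.
  have h0 : h != 0 by near: h; exact: nbhs_dnbhs_neq.
  have hd : `|h| < d by near: h; apply: dnbhs0_lt.
  have := Hd _ hd; rewrite mulr1 (addrC h x) => K.
  rewrite -(@ler_pM2r _ `|h|) ?normr_gt0// -normrM (le_trans _ K)//.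
  have -> : (l - h^-1 * (f (x + h) - f x)) * h = - (f (x + h) - f x - l * h).
    by field.
  by rewrite normrN.
apply: DeriveDef; first by apply/cvg_ex; exists l.
exact/cvg_lim.
Unshelve. all: by end_near.
Qed.

Lemma is_derive_epsP f x l : is_derive x (1 : R) f l ->
  forall e : R, 0 < e -> exists2 d : R, 0 < d &
     forall h, `|h| < d -> `|f (x + h) - f x - l * h| <= e * `|h|.
Proof.
move=> H e e0.
have C : h^-1 * (f (h * 1 + x) - f x) @[h --> (0 : R)^'] --> l.
  have [D <-] := H; exact: D.
move/cvgrPdist_le : C => /(_ _ e0).
rewrite /prop_near1 /= /dnbhs /within /= => /nbhs_ballP[d /= d0 Hd].
exists d => // h hd; have [->|h0] := eqVneq h 0.
  by rewrite addr0 subrr mulr0 subr0 normr0 mulr0.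
have := Hd h; rewrite /ball /= sub0r normrN => /(_ hd h0).
rewrite mulr1 (addrC h x) => K.
have -> : f (x + h) - f x - l * h = - ((l - h^-1 * (f (x + h) - f x)) * h) by field.
by rewrite normrN normrM ler_wpM2r.
Qed.

Lemma is_derive_continuous f x l : is_derive x (1 : R) f l -> {for x, continuous f}.
Proof. by move=> [D _]; apply: differentiable_continuous; apply/derivable1_diffP. Qed.

Lemma MVT_le f df a b : a <= b ->
  (forall x, a <= x <= b -> is_derive x (1 : R) f (df x)) ->
  exists2 c, a <= c <= b & f b - f a = df c * (b - a).
Proof.
move=> ab D.
have [c|c|c cab E] := @MVT_segment R f df a b ab.
- by rewrite in_itv /= => /andP[ac cb]; apply: D; rewrite !ltW.
- apply: continuous_in_subspaceT => z; rewrite inE /= in_itv /= => zab.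
  exact: is_derive_continuous (D _ zab).
- by exists c.
Qed.

Lemma cont_eps f x : {for x, continuous f} -> forall e : R, 0 < e ->
  exists2 d : R, 0 < d & forall y, `|y - x| < d -> `|f y - f x| <= e.
Proof.
move=> /cvgrPdist_le H e e0; have := H _ e0.
rewrite /prop_near1 /= => /nbhs_ballP[d /= d0 Hd].
by exists d => // y xy; rewrite distrC; apply: Hd; rewrite /ball /= distrC.
Qed.

Lemma epscont f x : (forall e : R, 0 < e ->
  exists2 d : R, 0 < d & forall y, `|y - x| < d -> `|f y - f x| <= e) -> {for x, continuous f}.
Proof.
move=> H; apply/cvgrPdist_le => e e0; have [d d0 Hd] := H _ e0.
rewrite /prop_near1 /=; apply/nbhs_ballP; exists d => //= y.
by rewrite /ball /= distrC => xy; rewrite distrC; exact: Hd.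
Qed.

(** Locally bounded and Borel: a class closed under sums and products whose members are integrable
    on every segment. It settles the integrability side conditions. *)
Definition lbm f := measurable_fun setT f /\
  forall a b, exists M, forall x, a <= x <= b -> `|f x| <= M.

(** The integral is not oriented: it is 0 when [b < a]. *)
Definition itg a b f : R := \int[mu]_(x in `[a, b]) f x.

Lemma lbm_integrable f a b : lbm f -> mu.-integrable `[a, b] (EFin \o f).
Proof.
move=> [mf bf]; apply: measurable_bounded_integrable => //.
- by rewrite /= lebesgue_measure_itv /=; case: ifP => _; rewrite ?ltry// -EFinB ltry.
- exact: measurable_funTS.
- have [M HM] := bf a b; exists M; split; first exact: num_real.
  move=> x Mx y /=; rewrite in_itv /= => yab; apply: le_trans (HM _ yab) (ltW Mx).
Qed.

Lemma continuous_lbm f : continuous f -> lbm f.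
Proof.
move=> cf; split; first exact: continuous_measurable_fun.
move=> a b; have [ab|ba] := leP a b; last first.
  by exists 0 => x /andP[ax xb]; have := lt_le_trans ba (le_trans ax xb); rewrite ltxx.
have cn : {within `[a, b], continuous (fun x => `|f x|)}.
  apply: continuous_subspaceT => x.
  apply: continuous_comp; [exact: cf|exact: norm_continuous].
have [c _ Hc] := EVT_max ab cn.
by exists `|f c| => x xab; apply: Hc.
Qed.

Lemma lbmD f g : lbm f -> lbm g -> lbm (fun x => f x + g x).
Proof.
move=> [mf bf] [mg bg]; split; first exact: measurable_funD.
move=> a b; have [M HM] := bf a b; have [N HN] := bg a b; exists (M + N) => x xab.
by rewrite (le_trans (ler_normD _ _))// lerD ?HM ?HN.
Qed.

Lemma lbmM f g : lbm f -> lbm g -> lbm (fun x => f x * g x).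
Proof.
move=> [mf bf] [mg bg]; split; first exact: measurable_funM.
move=> a b; have [M HM] := bf a b; have [N HN] := bg a b; exists (M * N) => x xab.
by rewrite normrM ler_pM ?HM ?HN.
Qed.

Lemma lbm_cst c : lbm (fun=> c).
Proof. by apply: continuous_lbm => x; exact: cvg_cst. Qed.

Lemma lbmN f : lbm f -> lbm (fun x => - f x).
Proof.
move=> [mf bf]; split; first exact: measurableT_comp.
by move=> a b; have [M HM] := bf a b; exists M => x xab; rewrite normrN HM.
Qed.

Lemma lbmB f g : lbm f -> lbm g -> lbm (fun x => f x - g x).
Proof. by move=> lf lg; apply: lbmD => //; exact: lbmN. Qed.

Lemma itgD a b f g : lbm f -> lbm g ->
  itg a b (fun x => f x + g x) = itg a b f + itg a b g.
Proof. by move=> lf lg; rewrite /itg RintegralD//; exact: lbm_integrable. Qed.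

Lemma itgB a b f g : lbm f -> lbm g ->
  itg a b (fun x => f x - g x) = itg a b f - itg a b g.
Proof. by move=> lf lg; rewrite /itg RintegralB//; exact: lbm_integrable. Qed.

Lemma itgZ a b c f : lbm f -> itg a b (fun x => c * f x) = c * itg a b f.
Proof. by move=> lf; rewrite /itg RintegralZl//; exact: lbm_integrable. Qed.

Lemma itgN a b f : lbm f -> itg a b (fun x => - f x) = - itg a b f.
Proof.
move=> lf; rewrite -[RHS]mulN1r -itgZ//; congr itg.
by apply/funext => x; rewrite mulN1r.
Qed.

Lemma itg_cst a b c : a <= b -> itg a b (fun=> c) = c * (b - a).
Proof.
move=> ab; rewrite /itg Rintegral_cst//= lebesgue_measure_itv /= lte_fin.
case: ltP => [_|ba]; first by rewrite -EFinB.
have -> : a = b by apply/eqP; rewrite eq_le ab.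
by rewrite subrr.
Qed.

Lemma itg_eq a b f g : (forall x, a <= x <= b -> f x = g x) -> itg a b f = itg a b g.
Proof. by move=> fg; apply: eq_Rintegral => x; rewrite inE /= in_itv /= => /fg. Qed.

Lemma itg_le a b f g : lbm f -> lbm g ->
  (forall x, a <= x <= b -> f x <= g x) -> itg a b f <= itg a b g.
Proof.
move=> lf lg fg; apply: le_Rintegral => //; try exact: lbm_integrable.
Qed.

Lemma itg_split a b c f : lbm f -> a <= b -> b <= c ->
  itg a c f = itg a b f + itg b c f.
Proof.
move=> lf ab bc; rewrite /itg -(@Rintegral_itv_obnd_cbnd _ b).
  rewrite -(@Rintegral_itvB _ f (BLeft a) (BRight c) b) ?bnd_simp//.
    by rewrite addrC subrK.
  exact: lbm_integrable.
apply: (@integrableS _ _ _ mu `[b, c]) => //; last exact: lbm_integrable.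
by apply: subset_itvr; rewrite bnd_simp.
Qed.

Lemma itg_xx a f : itg a a f = 0.
Proof. by rewrite /itg set_itv1 Rintegral_set1. Qed.

Lemma itg_norm_le a b f M : lbm f -> a <= b ->
  (forall x, a <= x <= b -> `|f x| <= M) -> `|itg a b f| <= M * (b - a).
Proof.
move=> lf ab fM; rewrite ler_norml -mulNr -!itg_cst//; apply/andP; split; apply: itg_le => //;
 try exact: lbm_cst; by move=> x /fM; rewrite ler_norml => /andP[].
Qed.

(** [F] enters only through its increments, so no base point is fixed and both signs of [h] reduce
    to one estimate. *)
Lemma is_derive_itg F f : continuous f ->
  (forall x y, x <= y -> F y - F x = itg x y f) -> forall x, is_derive x (1 : R) F (f x).
Proof.
move=> cf HF x; apply: is_derive_eps => e e0.
have [d d0 Hd] := cont_eps (cf x) e0; exists d => // h hd.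
have lf := continuous_lbm cf.
have K u v : u <= v -> (forall z, u <= z <= v -> `|z - x| < d) ->
   `|F v - F u - f x * (v - u)| <= e * (v - u).
  move=> uv Hz; rewrite HF// -itg_cst// -itgB//; last exact: lbm_cst.
  apply: itg_norm_le => //; first by apply: lbmB => //; exact: lbm_cst.
  by move=> z /Hz /Hd.
have [h0|h0] := leP 0 h.
  have := K x (x + h); rewrite lerDl h0 => /(_ isT).
  have -> : x + h - x = h by lra.
  rewrite (ger0_norm h0); apply.
  by move=> z /andP[xz zx]; rewrite (le_lt_trans _ hd)// ger0_norm ?subr_ge0// (ger0_norm h0) lerBlDl.
have := K (x + h) x; rewrite gerDl (ltW h0) => /(_ isT).
have -> : x - (x + h) = - h by lra.
rewrite (ltr0_norm h0) -normrN; have -> : - (F x - F (x + h) - f x * - h) = F (x + h) - F x - f x * h by lra.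
apply => z /andP[xz zx]; rewrite (le_lt_trans _ hd)// ler0_norm ?subr_le0// (ltr0_norm h0) ; lra.
Qed.

End RealCalculus.

(** * Functions of two variables: joint continuity, uniformity on rectangles, measurability *)

Section TwoVariables.
Context {R : realType}.
Implicit Types (f g : R -> R -> R) (a b x y s t : R).
Local Notation mu := (@lebesgue_measure R).

Definition cont2 f := continuous (fun z : R * R => f z.1 z.2).

Lemma cont2P f : (forall x t (e : R), 0 < e -> exists2 d : R, 0 < d &
   forall y s, `|y - x| < d -> `|s - t| < d -> `|f y s - f x t| <= e) <-> cont2 f.
Proof.
split=> [H [x t]|H x t e e0].
  apply/cvgrPdist_le => e e0; have [d d0 Hd] := H x t e e0.
  exists (ball x d, ball t d) => /=; first by split; exact: nbhsx_ballx.
  move=> -[y s] [/=].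
  by rewrite /ball /= distrC => xy; rewrite distrC => st; rewrite distrC; exact: Hd.
have /cvgrPdist_le/(_ _ e0) := H (x, t).
rewrite /prop_near1 /= => /nbhs_ballP[d /= d0 Hd].
exists d => // y s xy st; rewrite distrC; apply: (Hd (y, s)).
by split; rewrite /ball /= distrC.
Qed.

Lemma cont2_l f t : cont2 f -> continuous (f ^~ t).
Proof.
move=> /cont2P H x; apply: epscont => e e0; have [d d0 Hd] := H x t e e0.
by exists d => // y xy; apply: Hd; rewrite ?subrr ?normr0.
Qed.

Lemma cont2_r f x : cont2 f -> continuous (f x).
Proof.
move=> /cont2P H t; apply: epscont => e e0; have [d d0 Hd] := H x t e e0.
by exists d => // y xy; apply: Hd; rewrite ?subrr ?normr0.
Qed.

Lemma cont2_swap f : cont2 f -> cont2 (fun x t => f t x).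
Proof.
move=> /cont2P H; apply/cont2P => x t e e0; have [d d0 Hd] := H t x e e0.
by exists d => // y s xy st; exact: Hd.
Qed.

Lemma cont2_comp f (u v : R -> R) : cont2 f -> continuous u -> continuous v ->
  cont2 (fun x t => f (u x) (v t)).
Proof.
move=> /cont2P H cu cv; apply/cont2P => x t e e0; have [d d0 Hd] := H (u x) (v t) e e0.
have d2 : 0 < d / 2 by rewrite divr_gt0.
have [d1 d10 H1] := cont_eps (cu x) d2; have [d3 d30 H3] := cont_eps (cv t) d2.
exists (Num.min d1 d3); first by rewrite lt_min d10.
move=> y s; rewrite !lt_min => /andP[y1 _] /andP[_ s3]; apply: Hd.
  by rewrite (le_lt_trans (H1 _ y1))// ltr_pdivrMr// ltr_pMr// ltr1n.
by rewrite (le_lt_trans (H3 _ s3))// ltr_pdivrMr// ltr_pMr// ltr1n.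
Qed.

Lemma cont2B f g : cont2 f -> cont2 g -> cont2 (fun x t => f x t - g x t).
Proof. by move=> cf cg z; apply: cvgB; [exact: cf|exact: cg]. Qed.

Lemma cont2N f : cont2 f -> cont2 (fun x t => - f x t).
Proof. by move=> cf z; apply: cvgN; exact: cf. Qed.

Lemma cont2M f g : cont2 f -> cont2 g -> cont2 (fun x t => f x t * g x t).
Proof. by move=> cf cg z; apply: cvgM; [exact: cf|exact: cg]. Qed.

(** Only the base point has to lie in the rectangle, and continuity is asked only there. Both matter
    in [comparison]: [psi] is jointly continuous only at positive times, and the averaging boxes
    stick out of the rectangle. *)
Lemma cont2_unif f a b s t (e : R) : (forall x r, a <= x <= b -> s <= r <= t ->
    {for (x, r), continuous (fun z : R * R => f z.1 z.2)}) -> 0 < e ->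
  exists2 d : R, 0 < d & forall x r y q, a <= x <= b -> s <= r <= t ->
    `|y - x| < d -> `|q - r| < d -> `|f y q - f x r| <= e.
Proof.
move=> cf e0.
have cK : compact (`[a, b] `*` `[s, t] : set (R * R)).
  by apply: compact_setX; exact: segment_compact.
move/compact_near_coveringP : cK => /(_ R (0 : R)^'+
  (fun d z => forall y q, `|y - z.1| < d -> `|q - z.2| < d -> `|f y q - f z.1 z.2| <= e)).
move=> /(_ _ _)/wrap[].
  move=> [x r] [/=]; rewrite !in_itv /= => xab rst.
  have e2 : 0 < e / 2 by rewrite divr_gt0.
  have /cvgrPdist_le/(_ _ e2) := cf _ _ xab rst.
  rewrite /prop_near1 /= => /nbhs_ballP[d /= d0 Hd].
  exists (ball (x, r) (d / 2), [set d' | d' < d / 2]) => /=.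
    split; first by apply: nbhsx_ballx; rewrite divr_gt0.
    by apply: nbhs_right_lt; rewrite divr_gt0.
  move=> [[x' r'] d'] [/= [/= xx' rr'] d'd] y q yx qr.
  have -> : f y q - f x' r' = (f x r - f x' r') - (f x r - f y q) by lra.
  rewrite (le_trans (ler_normB _ _))// [leRHS](splitr e) lerD//.
    apply: (Hd (x', r')); split; rewrite /ball /=.
      by apply: lt_le_trans xx' _; rewrite ler_pdivrMr// ler_pMr// ler1n.
    by apply: lt_le_trans rr' _; rewrite ler_pdivrMr// ler_pMr// ler1n.
  apply: (Hd (y, q)); split; rewrite /ball /=.
    rewrite [ltRHS]splitr; have -> : x - y = (x - x') - (y - x') by lra.
    by rewrite (le_lt_trans (ler_normB _ _))// ltrD// (lt_trans yx).
  rewrite [ltRHS]splitr; have -> : r - q = (r - r') - (q - r') by lra.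
  by rewrite (le_lt_trans (ler_normB _ _))// ltrD// (lt_trans qr).
move=> H; near (0 : R)^'+ => d.
exists d => // x r y q xab rst; apply: (near H d _ (x, r)) => //.
Unshelve. all: by end_near. Qed.

Lemma cont2_bounded f a b s t : cont2 f ->
  exists M, forall x r, a <= x <= b -> s <= r <= t -> `|f x r| <= M.
Proof.
move=> cf.
have [ab|ba] := leP a b; last first.
  by exists 0 => x r /andP[ax xb]; have := lt_le_trans ba (le_trans ax xb); rewrite ltxx.
have [st|ts] := leP s t; last first.
  by exists 0 => x r _ /andP[ax xb]; have := lt_le_trans ts (le_trans ax xb); rewrite ltxx.
have cK : compact (`[a, b] `*` `[s, t] : set (R * R)).
  by apply: compact_setX; exact: segment_compact.
have cn : {within (`[a, b] `*` `[s, t] : set (R * R)), continuous (fun z => `|f z.1 z.2|)}.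
  apply: continuous_subspaceT => x.
  by apply: (@continuous_comp _ _ _ (fun z : R * R => f z.1 z.2)); [exact: cf|exact: norm_continuous].
have ne : (`[a, b] `*` `[s, t] : set (R * R)) !=set0.
  by exists (a, s); split; rewrite /= in_itv /= lexx.
have [c _ Hc] := compact_EVT_max ne cK cn.
exists `|f c.1 c.2| => x r xab rst; apply: (Hc (x, r)).
by rewrite inE; split; rewrite /= in_itv.
Qed.

Lemma itg_param_cont f a b : cont2 f -> a <= b -> continuous (fun x => itg a b (f x)).
Proof.
move=> cf ab x; apply: epscont => e e0.
have e1 : 0 < e / (b - a + 1) by rewrite divr_gt0// ltr_wpDl// subr_ge0.
have [d d0 Hd] := @cont2_unif f x x a b _ (fun _ _ _ _ => cf _) e1.
exists d => // y yx; rewrite -itgB; try by apply: continuous_lbm; exact: cont2_r.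
apply: (@le_trans _ _ (e / (b - a + 1) * (b - a))).
  apply: itg_norm_le => //; first by apply: lbmB; apply: continuous_lbm; exact: cont2_r.
  by move=> r rab; apply: Hd; rewrite ?lexx ?subrr ?normr0.
by rewrite -mulrA ler_piMr ?(ltW e0)// mulrC ler_pdivrMr ?ltr_wpDl ?subr_ge0// mul1r lerDl.
Qed.

(** The sigma-algebra on the plane is the product one; an open set belongs to it as the countable
    union of the rational squares that it contains. *)
Lemma open2_measurable (U : set (R * R)) :
  (forall z, U z -> exists2 d : R, 0 < d &
     forall y : R * R, `|y.1 - z.1| < d -> `|y.2 - z.2| < d -> U y) -> measurable U.
Proof.
move=> HU.
pose box (i : rat * rat * rat) : set (R * R) :=
  [set x | `|x - ratr i.1.1| < ratr i.2] `*` [set x | `|x - ratr i.1.2| < ratr i.2].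
pose F i := if `[< box i `<=` U >] then box i else set0.
have -> : U = \bigcup_i F i.
  apply/seteqP; split => [z Uz|z [i _]]; last first.
    by rewrite /F; case: asboolP => // H /H.
  have [d d0 Hd] := HU _ Uz.
  have d4 : 0 < d / 2 by rewrite divr_gt0.
  have [r] := rat_in_itvoo d4; rewrite in_itv /= => /andP[r0 rd].
  have rr : forall c : R, c < c + ratr r by move=> c; rewrite ltrDl.
  have [q1] := rat_in_itvoo (rr z.1); rewrite in_itv /= => /andP[q1a q1b].
  have [q2] := rat_in_itvoo (rr z.2); rewrite in_itv /= => /andP[q2a q2b].
  have bU : box (q1, q2, r) `<=` U.
    move=> y [/= y1 y2]; apply: Hd.
      by move: y1; rewrite !ltr_norml => /andP[? ?]; apply/andP; split; lra.
    by move: y2; rewrite !ltr_norml => /andP[? ?]; apply/andP; split; lra.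
  exists (q1, q2, r) => //; rewrite /F asboolT//.
  by split; rewrite /= ltr_norml; apply/andP; split; lra.
apply: countable_bigcupT_measurable; first exact: countableP.
move=> i; rewrite /F; case: ifP => // _; apply: measurableX.
- suff -> : [set x | `|x - ratr i.1.1| < ratr i.2] = ball (ratr i.1.1 : R) (ratr i.2) by exact: measurable_ball.
  by apply/seteqP; split => x; rewrite /ball /= distrC.
- suff -> : [set x | `|x - ratr i.1.2| < ratr i.2] = ball (ratr i.1.2 : R) (ratr i.2) by exact: measurable_ball.
  by apply/seteqP; split => x; rewrite /ball /= distrC.
Qed.

Lemma cont2_measurable f : cont2 f -> measurable_fun setT (fun z : R * R => f z.1 z.2).
Proof.
move=> /cont2P cf.
apply: (measurability _ (RGenOInfty.measurableE R)) => //.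
move=> _ [_ [a ->] <-]; rewrite setTI; apply: open2_measurable => -[x t] /=.
rewrite in_itv /= andbT => axt.
have e0 : 0 < (f x t - a) / 2 by rewrite divr_gt0// subr_gt0.
have [d d0 Hd] := cf x t _ e0; exists d => // -[y s] /= xy st.
have := Hd _ _ xy st; rewrite ler_norml in_itv /= andbT => /andP[? ?]; lra.
Qed.
End TwoVariables.

(** * Null sets and measurability for the completion *)

Section NullSets.
Context d (T : measurableType d) (R : realType) (m : {measure set T -> \bar R}).

Lemma null_setD A N : measurable A -> measurable N -> m N = 0%E -> m (A `\` N) = m A.
Proof.
move=> mA mN N0; have E := measureDI m mA mN.
have Z : m (A `&` N) = 0%E.
  have mAN : measurable (A `&` N) by exact: measurableI.
  exact: (@subset_measure0 _ _ _ m _ N mAN mN (@subIsetr _ A N) N0).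
by apply/esym; rewrite E [X in (_ + X)%E]Z adde0.
Qed.

Lemma null_union A N : measurable A -> measurable N -> m A = 0%E -> m N = 0%E ->
  m (A `|` N) = 0%E.
Proof. by move=> mA mN A0 N0; apply/null_set_setU. Qed.

Lemma null_bigcup (I : countType) (F : I -> set T) :
  (forall i, measurable (F i) /\ m (F i) = 0%E) -> m (\bigcup_i F i) = 0%E.
Proof.
move=> HF; pose G k := if @unpickle I k is Some q then F q else set0.
have [|M [mM M0 FM]] := @negligible_bigcup _ _ _ m G.
  move=> k; rewrite /G; case: unpickle => [q|]; last exact: negligible_set0.
  by have [mF F0] := HF q; exists (F q); split.
apply: (@subset_measure0 _ _ _ m _ M) => //.
  by apply: countable_bigcupT_measurable; [exact: countableP|move=> i; have [] := HF i].
move=> x [q _ qx]; apply: FM; exists (pickle q) => //.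
by rewrite /G pickleK.
Qed.

Import HBNNSimple.

(* No measurability of [f] and [g] is assumed here: this is how the completed
   measurability of [p] is reduced to Borel measurability. *)
Lemma eq_integral_null (D N : set T) (f g : T -> \bar R) :
  measurable N -> m N = 0%E -> (forall x, D x -> ~ N x -> f x = g x) ->
  (\int[m]_(x in D) f x = \int[m]_(x in D) g x)%E.
Proof.
move=> mN N0 fg.
(* By symmetry, one inequality between the suprema that define the integral of a nonnegative part is
   enough. *)
suff H (f' g' : T -> \bar R) : (forall x, 0 <= g' x)%E -> (forall x, ~ N x -> f' x = g' x) ->
  (ereal_sup [set sintegral m h | h in [set h : {nnsfun T >-> R} | forall x, (h x)%:E <= f' x]]
   <= ereal_sup [set sintegral m h | h in [set h : {nnsfun T >-> R} | forall x, (h x)%:E <= g' x]])%E.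
  have fg' x : ~ N x -> (f \_ D) x = (g \_ D) x.
    by move=> Nx; rewrite !patchE; case: ifPn => //; rewrite inE => Dx; exact: fg.
  rewrite /integral; congr (_ - _)%E; apply/eqP; rewrite eq_le; apply/andP; split;
    apply: H => x; rewrite ?funepos_ge0 ?funeneg_ge0// => Nx.
  - by rewrite !funeposE fg'.
  - by rewrite !funeposE fg'.
  - by rewrite !funenegE fg'.
  - by rewrite !funenegE fg'.
move=> g0 E; apply: ge_ereal_sup => _ [h hf <-].
have mC : measurable (~` N) by exact: measurableC.
(* Cutting [h] off on [N] puts it below [g'] everywhere and leaves its integral unchanged. *)
apply: ereal_sup_ge; exists (sintegral m (proj_nnsfun h mC)).
  exists (proj_nnsfun h mC) => // x /=.
  rewrite /mindic/= indicE; have [xN|xN] := pselect (N x).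
    by rewrite (memNset (A := ~` N))//= ?mulr0//; exact: g0.
  by rewrite mem_set//= mulr1 -E.
rewrite !sintegralEnnsfun le_eqVlt; apply/orP; left; apply/eqP.
apply: eq_fsbigr => r; rewrite inE /= => r0; congr (_ * _)%E.
rewrite -(null_setD _ mN N0)//; congr (m _).
apply/seteqP; split=> x /=; rewrite /mindic/= indicE.
  by move=> [hr Nx]; rewrite mem_set//= mulr1.
have [xN|xN] := pselect (N x).
  by rewrite (memNset (A := ~` N))//= ?mulr0 => r00; move: r0; rewrite -r00 ltxx.
by rewrite mem_set//= mulr1.
Qed.

(** Sets that agree with a measurable set off a measurable null set form a sigma-algebra containing
    the generators of the completion. Applied to superlevel sets at rational thresholds, this leaves
    countably many exceptional sets, whose union serves for [f]. *)
Lemma completed_measurable_fun_null (D : set T) (f : T -> R) :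
  measurable D -> completed_measurable_fun m D f ->
  exists N, [/\ measurable N, m N = 0%E & measurable_fun (D `\` N) f].
Proof.
move=> mD mf.
pose P (A : set T) := exists B N, [/\ measurable B, measurable N, m N = 0%E &
  forall x, ~ N x -> (A x <-> B x)].
have PM : (completed_algebra_gen m).-sigma.-measurable `<=` P.
  apply: smallest_sub => /=; last first.
    move=> _ [A mA [N [M [mM M0 NM]] <-]]; exists A, M; split => // x Mx.
    by split=> [[|/NM]//|]; left.
  split => /=.
  - by exists set0, set0; split.
  - move=> A [B [N [mB mN N0 AB]]]; exists (~` B), N; split => //; first exact: measurableC.
    by move=> x Nx; rewrite setTD/=; split=> H Bx; apply: H; apply/AB.
  - move=> A PA.
    have {PA}[B HB] := choice PA; have {HB}[N HN] := choice HB.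
    exists (\bigcup_k B k), (\bigcup_k N k); split.
    + by apply: bigcupT_measurable => k; have [] := HN k.
    + by apply: bigcupT_measurable => k; have [] := HN k.
    + by apply: (@null_bigcup nat N) => k; have [_ mk k0 _] := HN k; split.
    + move=> x Nx; split=> -[k _ Hk]; exists k => //; have [_ _ _ H] := HN k; apply/H => // Nk.
        by apply: Nx; exists k.
      by apply: Nx; exists k.
have Q (q : rat) : exists BN : set T * set T, [/\ measurable BN.1, measurable BN.2, m BN.2 = 0%E &
  forall x, ~ BN.2 x -> ((D x /\ ratr q < f x) <-> BN.1 x)].
  have : P (D `&` f @^-1` [set x | ratr q < x]).
    apply: PM; apply: mf.
      apply: sub_sigma_algebra; exists D => //; exists set0; last by rewrite setU0.
      exact: negligible_set0.
    rewrite (_ : mkset _ = `]ratr q, +oo[%classic)//.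
    by apply/seteqP; split => x /=; rewrite in_itv /= andbT.
  by move=> [B [N HN]]; exists (B, N).
have {Q}[BN HBN] := choice Q.
pose N := \bigcup_q (BN q).2.
have mN : measurable N.
  by apply: countable_bigcupT_measurable; [exact: countableP|move=> q; have [] := HBN q].
exists N; split => //.
  by apply: (@null_bigcup rat (fun q => (BN q).2)) => q; have [_ mk k0 _] := HBN q; split.
have mDN : measurable (D `\` N) by exact: measurableD.
apply: (measurability _ (RGenOInfty.measurableE R)) => //.
move=> _ [_ [a ->] <-].
pose F (q : rat) := if a < ratr q then (D `\` N) `&` (BN q).1 else set0.
rewrite (_ : _ `&` _ = \bigcup_q F q).
  apply: countable_bigcupT_measurable; first exact: countableP.
  move=> q; rewrite /F; case: ifP => // _; apply: measurableI => //.
  by have [] := HBN q.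
apply/seteqP; split => x.
  move=> [[Dx Nx]] /=; rewrite in_itv /= andbT => /rat_in_itvoo[q].
  rewrite in_itv /= => /andP[aq qf]; exists q => //; rewrite /F aq; split => //.
  have [_ _ _ H] := HBN q; apply/H => //.
  by move=> Nq; apply: Nx; exists q.
move=> [q _]; rewrite /F; case: ifPn => // aq [[Dx Nx] Bx]; split => //=.
rewrite in_itv /= andbT; have [_ _ _ H] := HBN q.
have [|_ qf] := (H x _).2 Bx; first by move=> Nq; apply: Nx; exists q.
exact: lt_trans qf.
Qed.

End NullSets.

(** * Sections of null sets in a product *)

Section ProductNullSets.
Context d1 d2 (T1 : measurableType d1) (T2 : measurableType d2) (R : realType).
Variable m1 : {sigma_finite_measure set T1 -> \bar R}.
Variable m2 : {sigma_finite_measure set T2 -> \bar R}.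
Implicit Types (N : set (T1 * T2)).

Lemma null_xsection N : measurable N -> (m1 \x m2)%E N = 0%E ->
  {ae m1, forall x, m2 (xsection N x) = 0%E}.
Proof.
move=> mN; rewrite /product_measure1 => N0.
have mf : measurable_fun setT (m2 \o xsection N) by exact: measurable_fun_xsection.
have : ae_eq m1 setT (m2 \o xsection N) (cst 0%E).
  apply/ae_eq_integral_abs => //; rewrite -[RHS]N0; apply: eq_integral => x _ /=.
  by rewrite gee0_abs.
by apply: filterS => x /(_ I).
Qed.

Lemma null_ysection N : measurable N -> (m1 \x m2)%E N = 0%E ->
  {ae m2, forall y, m1 (ysection N y) = 0%E}.
Proof.
move=> mN; rewrite /product_measure1 => N0.
have mf : measurable_fun setT (m1 \o ysection N) by exact: measurable_fun_ysection.
have : ae_eq m2 setT (m1 \o ysection N) (cst 0%E).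
  apply/ae_eq_integral_abs => //.
  transitivity (\int[m2]_x (m1 \o ysection N) x)%E.
    by apply: eq_integral => x _ /=; rewrite gee0_abs.
  (* The product measure is defined by integrating x-sections; Tonelli for the indicator of [N]
     passes to y-sections. *)
  rewrite -(indic_fubini_tonelli_GE m1 mN) -(indic_fubini_tonelli m1 m2 mN).
  by rewrite (indic_fubini_tonelli_FE m2 mN).
by apply: filterS => x /(_ I).
Qed.

End ProductNullSets.

(** * Fubini on rectangles *)

Section IteratedIntegrals.
Context {R : realType}.
Implicit Types (F G : R -> R -> R) (a b c d x t : R).
Local Notation mu := (@lebesgue_measure R).

Definition lbm2 F := measurable_fun setT (fun z : R * R => F z.1 z.2) /\
  forall a b c d, exists M, forall x t, a <= x <= b -> c <= t <= d -> `|F x t| <= M.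

Lemma cont2_lbm2 F : cont2 F -> lbm2 F.
Proof.
by move=> cF; split; [exact: cont2_measurable|move=> a b c d; exact: cont2_bounded].
Qed.

Lemma lbm2M F G : lbm2 F -> lbm2 G -> lbm2 (fun x t => F x t * G x t).
Proof.
move=> [mF bF] [mG bG]; split; first exact: measurable_funM.
move=> a b c d; have [M HM] := bF a b c d; have [N HN] := bG a b c d.
by exists (M * N) => x t xab tcd; rewrite normrM ler_pM ?HM ?HN.
Qed.

Lemma lbm2D F G : lbm2 F -> lbm2 G -> lbm2 (fun x t => F x t + G x t).
Proof.
move=> [mF bF] [mG bG]; split; first exact: measurable_funD.
move=> a b c d; have [M HM] := bF a b c d; have [N HN] := bG a b c d.
by exists (M + N) => x t xab tcd; rewrite (le_trans (ler_normD _ _))// lerD ?HM ?HN.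
Qed.

Lemma lbm2_swap F : lbm2 F -> lbm2 (fun x t => F t x).
Proof.
move=> [mF bF]; split.
  rewrite (_ : (fun z : R * R => F z.2 z.1) = (fun z : R * R => F z.1 z.2) \o (fun z : R * R => (z.2, z.1)))//.
  apply: measurableT_comp; first exact: mF.
  by apply: measurable_fun_pair; [exact: measurable_snd|exact: measurable_fst].
by move=> a b c d; have [M HM] := bF c d a b; exists M => x t xab tcd; exact: HM.
Qed.

Lemma lbm2_r F x : lbm2 F -> lbm (F x).
Proof.
move=> [mF bF]; split; last first.
  by move=> a b; have [M HM] := bF x x a b; exists M => t tab; apply: HM => //; rewrite lexx.
rewrite (_ : F x = (fun z : R * R => F z.1 z.2) \o (fun t : R => (x, t)))//.
exact: measurableT_comp mF (pair1_measurable x).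
Qed.

Lemma lbm2_l F t : lbm2 F -> lbm (F ^~ t).
Proof. by move=> /lbm2_swap/(lbm2_r t). Qed.

Lemma lbm_lbm2_l (f : R -> R) : lbm f -> lbm2 (fun x _ => f x).
Proof.
move=> [mf bf]; split; first exact: measurableT_comp mf measurable_fst.
by move=> a b c d; have [M HM] := bf a b; exists M => x t xab _; exact: HM.
Qed.

Lemma itgE a b (f : R -> R) : lbm f ->
  ((itg a b f)%:E = \int[mu]_(x in `[a, b]) (f x)%:E)%E.
Proof.
move=> lf; rewrite /itg /Rintegral fineK//.
by apply: integrable_fin_num => //; exact: lbm_integrable.
Qed.

(** The restriction to [c, d] is put into the integrand, so that the Fubini and Tonelli statements
    for the whole product apply. *)
Let H F c d (z : R * R) : \bar R := (F z.1 z.2 * \1_(`[c, d] : set R) z.2)%:E.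

Let intH F c d x : (\int[mu]_t H F c d (x, t) = \int[mu]_(t in `[c, d]) (F x t)%:E)%E.
Proof.
rewrite [RHS]integral_mkcond; apply: eq_integral => t _.
by rewrite /H /= patchE indicE; case: ifP => _; rewrite /= ?mulr1 ?mulr0.
Qed.

Let mH F c d : lbm2 F -> measurable_fun setT (H F c d).
Proof.
move=> [mF _]; apply/measurable_EFinP; apply: measurable_funM => //.
by apply: measurableT_comp => //; exact: measurable_indic.
Qed.

Lemma lbm2_itg F c d : lbm2 F -> c <= d -> lbm (fun x => itg c d (F x)).
Proof.
move=> lF cd; split; last first.
  move=> a b; have [_ bF] := lF; have [M HM] := bF a b c d.
  exists (M * (d - c)) => x xab; apply: itg_norm_le => //; first exact: lbm2_r.
  by move=> t tcd; exact: HM.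
apply: (@measurableT_comp _ _ _ _ _ _ (@fine R)) => //.
rewrite (_ : (fun _ => _) = (fun x => \int[mu]_t (H F c d)^\+%E (x, t) - \int[mu]_t (H F c d)^\-%E (x, t)))%E.
  apply: emeasurable_funB.
    apply: (@measurable_fun_fubini_tonelli_F _ _ _ _ _ mu (H F c d)^\+%E).
      exact: (measurable_funepos (mH c d lF)).
    exact: funepos_ge0.
  apply: (@measurable_fun_fubini_tonelli_F _ _ _ _ _ mu (H F c d)^\-%E).
    exact: (measurable_funeneg (mH c d lF)).
  exact: funeneg_ge0.
apply/funext => x; rewrite -intH [LHS]integralE.
by congr (_ - _)%E; apply: eq_integral => t _; rewrite ?funeposE ?funenegE.
Qed.

Lemma itg_swap F a b c d : lbm2 F -> a <= b -> c <= d ->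
  itg a b (fun x => itg c d (F x)) = itg c d (fun t => itg a b (F ^~ t)).
Proof.
move=> lF ab cd.
pose K (z : R * R) : \bar R := (F z.1 z.2 * \1_(`[a, b] : set R) z.1 * \1_(`[c, d] : set R) z.2)%:E.
have mK : measurable_fun setT K.
  have [mF _] := lF; apply/measurable_EFinP; apply: measurable_funM => //.
    apply: measurable_funM => //.
    by apply: measurableT_comp => //; exact: measurable_indic.
  by apply: measurableT_comp => //; exact: measurable_indic.
have [M HM] := lF.2 a b c d.
have M0 : 0 <= M.
  apply: le_trans (HM a c _ _); rewrite ?normr_ge0// ?lexx ?ab ?cd//.
have Kr x : (\int[mu]_t K (x, t) = (\1_(`[a, b] : set R) x)%:E * (itg c d (F x))%:E)%E.
  rewrite itgE; last exact: lbm2_r.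
  rewrite indicE; have [xa|xa] := boolP (x \in `[a, b]%classic).
    rewrite mul1e -intH; apply: eq_integral => t _.
    by rewrite /K /H /= indicE xa mulr1.
  rewrite mul0e (eq_integral (fun=> 0%E)) ?integral0// => t _.
  by rewrite /K /= indicE (negbTE xa) mulr0 mul0r.
have Kl t : (\int[mu]_x K (x, t) = (\1_(`[c, d] : set R) t)%:E * (itg a b (F ^~ t))%:E)%E.
  rewrite itgE; last exact: lbm2_l.
  rewrite indicE; have [xa|xa] := boolP (t \in `[c, d]%classic).
    rewrite mul1e [RHS]integral_mkcond; apply: eq_integral => x _.
    by rewrite /K /= patchE !indicE xa mulr1; case: ifP => _; rewrite ?mulr1 ?mulr0.
  rewrite mul0e (eq_integral (fun=> 0%E)) ?integral0// => x _.
  by rewrite /K /= [X in _ * X]indicE (negbTE xa) mulr0.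
have iK : (mu \x mu)%E.-integrable setT K.
  apply/integrable12ltyP => //.
  apply: (@le_lt_trans _ _ (\int[mu]_(x in `[a, b]) (M * (d - c))%:E)%E); last first.
    rewrite integral_cst//= lebesgue_measure_itv /=; case: ifP => _; last by rewrite mule0 ltry.
    by rewrite -EFinB -EFinM ltry.
  rewrite [leRHS]integral_mkcond; apply: ge0_le_integral => //.
  - by move=> x _; apply: integral_ge0 => t _.
  - apply: (@measurable_fun_fubini_tonelli_F _ _ _ _ _ mu (fun z => `|K z|%E)) => //.
    exact: measurableT_comp.
  - apply: (measurable_restrictT _ _).1; last exact: measurable_cst.
    exact: measurable_itv.
  move=> x _; rewrite patchE; case: ifPn => xab; last first.
    rewrite (eq_integral (fun=> 0%E)) ?integral0// => t _.
    by rewrite /K /= indicE (negbTE xab) mulr0 mul0r normr0.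
  apply: (@le_trans _ _ (\int[mu]_(t in `[c, d]) M%:E)%E); last first.
    rewrite integral_cst//= lebesgue_measure_itv /= lte_fin.
    case: ltP => dc; last by rewrite mule0 lee_fin mulr_ge0// subr_ge0.
    by rewrite -EFinB -EFinM.
  rewrite [leRHS]integral_mkcond; apply: ge0_le_integral => //.
  - apply: measurableT_comp => //; exact: measurableT_comp mK (pair1_measurable x).
  - apply: (measurable_restrictT _ _).1; last exact: measurable_cst.
    exact: measurable_itv.
  move=> t _; rewrite patchE /K /= !indicE xab mulr1; case: ifPn => tcd.
    rewrite mulr1 lee_fin; apply: HM.
      by move: xab; rewrite inE /= in_itv.
    by move: tcd; rewrite inE /= in_itv.
  by rewrite mulr0 normr0.
have E : (\int[mu]_x ((\1_(`[a, b] : set R) x)%:E * (itg c d (F x))%:E) =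
          \int[mu]_t ((\1_(`[c, d] : set R) t)%:E * (itg a b (F ^~ t))%:E))%E.
  transitivity (\int[mu]_x \int[mu]_t K (x, t))%E.
    by apply: eq_integral => x _; rewrite Kr.
  by apply: (etrans (Fubini iK)); apply: eq_integral => t _; exact: Kl.
have lL : lbm (fun x => itg c d (F x)) by exact: lbm2_itg.
have lR : lbm (fun t => itg a b (F ^~ t)) by apply: (lbm2_itg (lbm2_swap lF)).
apply: EFin_inj; rewrite (itgE a b lL) (itgE c d lR).
rewrite integral_mkcond [RHS]integral_mkcond.
transitivity (\int[mu]_x ((\1_`[a, b] x)%:E * (itg c d (F x))%:E))%E.
  by apply: eq_integral => x _; rewrite patchE indicE; case: ifP => _; rewrite ?mul1e ?mul0e.
rewrite E.
by apply: eq_integral => x _; rewrite patchE indicE; case: ifP => _; rewrite ?mul1e ?mul0e.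
Qed.

End IteratedIntegrals.

(** * Derivative rules, differentiation under the integral, derivatives at maxima *)

Section Primitives.
Context {R : realType}.
Implicit Types (f g j : R -> R) (F G : R -> R -> R) (a b c d k x t : R).

Lemma derB f g (x : R) (df dg : R) : is_derive x (1 : R) f df -> is_derive x (1 : R) g dg ->
  is_derive x (1 : R) (fun y => f y - g y) (df - dg).
Proof. by move=> Df Dg; exact: is_deriveB. Qed.

Lemma derD f g (x : R) (df dg : R) : is_derive x (1 : R) f df -> is_derive x (1 : R) g dg ->
  is_derive x (1 : R) (fun y => f y + g y) (df + dg).
Proof. by move=> Df Dg; exact: is_deriveD. Qed.

Lemma derZ f c (x : R) (df : R) : is_derive x (1 : R) f df ->
  is_derive x (1 : R) (fun y => c * f y) (c * df).
Proof. by move=> Df; exact: is_deriveZ. Qed.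

Lemma derM f g (x : R) (df dg : R) : is_derive x (1 : R) f df -> is_derive x (1 : R) g dg ->
  is_derive x (1 : R) (fun y => f y * g y) (df * g x + f x * dg).
Proof.
move=> Df Dg; have H := is_deriveM Df Dg; apply: is_derive_eq H _.
by rewrite /GRing.scale /= addrC (mulrC (g x)).
Qed.

Lemma derC f g (x : R) (df dg : R) : is_derive (g x) (1 : R) f df ->
  is_derive x (1 : R) g dg -> is_derive x (1 : R) (fun y => f (g y)) (df * dg).
Proof. by move=> Df Dg; exact: (is_derive1_comp Df Dg). Qed.

Lemma der_cst (c x : R) : is_derive x (1 : R) (fun=> c) 0.
Proof. exact: is_derive_cst. Qed.

Lemma der_id (x : R) : is_derive x (1 : R) (fun y => y) 1.
Proof. exact: is_derive_id. Qed.

Lemma der_eq f (x : R) (df dg : R) : is_derive x (1 : R) f df -> df = dg ->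
  is_derive x (1 : R) f dg.
Proof. by move=> Df <-. Qed.

Lemma itg_FTC (F0 : R -> R) f a b : continuous f -> (forall x, is_derive x (1 : R) F0 (f x)) ->
  a <= b -> itg a b f = F0 b - F0 a.
Proof.
move=> cf DF; rewrite le_eqVlt => /predU1P[->|ab]; first by rewrite itg_xx subrr.
have cF : continuous F0 by move=> x; exact: is_derive_continuous (DF x).
rewrite /itg /Rintegral (@continuous_FTC2 R f F0 a b ab)//.
- exact: continuous_subspaceT.
- split; first by move=> x _; have [] := DF x.
    exact: cvg_at_right_filter (cF a).
  exact: cvg_at_left_filter (cF b).
- by move=> x _; rewrite derive1E; have [_ ->] := DF x.
Qed.

Lemma primitive j : continuous j -> exists P, (forall x, is_derive x (1 : R) P (j x)) /\
  forall a b, a <= b -> itg a b j = P b - P a.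
Proof.
move=> cj; have lj := continuous_lbm cj.
(* The sign has to be supplied because [itg] is not oriented. *)
pose P x := if 0 <= x then itg 0 x j else - itg x 0 j.
have H a b : a <= b -> P b - P a = itg a b j.
  move=> ab; rewrite /P; have [a0|a0] := leP 0 a.
    by rewrite (le_trans a0 ab) (itg_split lj a0 ab) addrC addKr.
  have [b0|b0] := leP 0 b.
    by rewrite opprK addrC (itg_split lj (ltW a0) b0).
  by rewrite opprK addrC (itg_split lj ab (ltW b0)) addrK.
by exists P; split=> [x|a b /H//]; exact: is_derive_itg.
Qed.

Lemma der_shift f l k x : is_derive (x + k) (1 : R) f l ->
  is_derive x (1 : R) (fun x => f (x + k)) l.
Proof.
move=> /is_derive_epsP H; apply: is_derive_eps => e e0; have [d d0 Hd] := H e e0.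
by exists d => // h /Hd; rewrite (addrAC x k h).
Qed.

Lemma is_derive_window j k t : continuous j -> 0 <= k ->
  is_derive t (1 : R) (fun t => itg t (t + k) j) (j (t + k) - j t).
Proof.
move=> cj k0; have [P [DP HP]] := primitive cj.
rewrite (_ : (fun _ => _) = (fun t => P (t + k) - P t)); last first.
  by apply/funext => s; rewrite HP// lerDl.
apply: is_deriveB; exact: der_shift.
Qed.

(** Fubini and the fundamental theorem turn the increments in [x] into integrals of the continuous
    function [itg c d (Fx x)], so that [is_derive_itg] applies. *)
Lemma is_derive_param F Fx c d x : cont2 Fx ->
  (forall x t, is_derive x (1 : R) (F ^~ t) (Fx x t)) -> cont2 F -> c <= d ->
  is_derive x (1 : R) (fun x => itg c d (F x)) (itg c d (Fx x)).
Proof.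
move=> cFx DF cF cd; apply: (@is_derive_itg _ _ (fun x => itg c d (Fx x))).
  by move=> y; exact: itg_param_cont.
move=> a b ab; rewrite itg_swap//; last exact: cont2_lbm2.
rewrite -itgB; try by apply: continuous_lbm; exact: cont2_r.
apply: itg_eq => t _; rewrite (@itg_FTC (F ^~ t))//; exact: cont2_l.
Qed.

Lemma subr_eq_of_addr (a b c d : R) : a + b = c + d -> b - c = d - a.
Proof. by move=> *; lra. Qed.

Lemma cont2_window F k : 0 <= k -> cont2 F -> cont2 (fun x t => itg x (x + k) (F ^~ t)).
Proof.
move=> k0 cF; apply/cont2P => x t e e0.
have [M HM] := @cont2_bounded _ F (x - 1) (x + k + 1) (t - 1) (t + 1) cF.
have M0 : 0 <= M.
  by apply: le_trans (HM x t _ _); rewrite ?normr_ge0//; apply/andP; split; lra.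
have e2 : 0 < e / 2 / (k + 1) by rewrite !divr_gt0// ltr_wpDl.
have [d d0 Hd] := @cont2_unif _ F (x - 1) (x + k + 1) t t _ (fun _ _ _ _ => cF _) e2.
exists (Num.min d (Num.min 1 (e / 2 / (2 * M + 1)))).
  by rewrite !lt_min d0 ltr01/= !divr_gt0// ltr_wpDl// mulr_ge0.
move=> y s; rewrite !lt_min => /and3P[xd x1 xe] /and3P[sd s1 se].
have lF s' : lbm (F ^~ s') by apply: continuous_lbm; exact: cont2_l.
have -> : itg y (y + k) (F^~ s) - itg x (x + k) (F^~ t) =
  (itg y (y + k) (F^~ s) - itg x (x + k) (F^~ s)) +
  (itg x (x + k) (F^~ s) - itg x (x + k) (F^~ t)) by lra.
rewrite (le_trans (ler_normD _ _))// (splitr e) lerD//; last first.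
  rewrite -itgB//; apply: (@le_trans _ _ (e / 2 / (k + 1) * (x + k - x))).
    apply: itg_norm_le; [exact: lbmB|by rewrite lerDl|].
    move=> z /andP[z1 z2]; apply: Hd; rewrite ?lexx ?subrr ?normr0//.
    by apply/andP; split; lra.
  rewrite -mulrA ler_piMr ?divr_ge0 ?(ltW e0)// mulrC ler_pdivrMr ?ltr_wpDl//.
  lra.
(* Sliding the window from [u] to [v] changes the integral by two end pieces of length [v - u], on
   each of which the integrand is bounded by [M]. *)
have W u v : u <= v -> `|u - x| < 1 -> `|v - x| < 1 ->
   `|itg v (v + k) (F^~ s) - itg u (u + k) (F^~ s)| <= 2 * M * (v - u).
  move=> uv ux vx.
  have uvk : u + k <= v + k by rewrite lerD2r.
  have A := itg_split (lF s) uv (_ : v <= v + k); have := A _; rewrite lerDl => /(_ k0) {}A.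
  have B := itg_split (lF s) (_ : u <= u + k) uvk; have := B _; rewrite lerDl => /(_ k0) {}B.
  have -> : itg v (v + k) (F^~ s) - itg u (u + k) (F^~ s) = itg (u + k) (v + k) (F^~ s) - itg u v (F^~ s).
    by apply: (subr_eq_of_addr (etrans (esym A) B)).
  rewrite (le_trans (ler_normB _ _))//.
  move: ux vx s1; rewrite !ltr_norml => /andP[ux1 ux2] /andP[vx1 vx2] /andP[s1a s1b].
  have : `|itg (u + k) (v + k) (F^~ s)| <= M * (v + k - (u + k)).
    apply: itg_norm_le => // z /andP[z1 z2]; apply: HM; apply/andP;
      clear -z1 z2 ux1 ux2 vx1 vx2 s1a s1b uv k0; split; lra.
  have : `|itg u v (F^~ s)| <= M * (v - u).
    apply: itg_norm_le => // z /andP[z1 z2]; apply: HM; apply/andP;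
      clear -z1 z2 ux1 ux2 vx1 vx2 s1a s1b uv k0; split; lra.
  move=> h1 h2; apply: le_trans (lerD h2 h1) _.
  have -> : v + k - (u + k) = v - u by rewrite opprD addrACA subrr addr0.
  by rewrite -mulrA mulr_natl mulr2n.
have key : 2 * M * `|y - x| <= e / 2.
  apply: (@le_trans _ _ ((2 * M + 1) * `|y - x|)); first by rewrite ler_wpM2r// lerDl.
  by rewrite mulrC -ler_pdivlMr ?(ltW xe)// ltr_wpDl// mulr_ge0.
have xx : `|x - x| < 1 by rewrite subrr normr0.
have [xy|/ltW yx] := leP x y.
  by apply: le_trans (W _ _ xy xx x1) _; rewrite -(ger0_norm (_ : 0 <= y - x)) ?subr_ge0.
rewrite distrC; apply: le_trans (W _ _ yx x1 xx) _.
by rewrite -(ger0_norm (_ : 0 <= x - y)) ?subr_ge0// distrC.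
Qed.

Lemma left_max_derive f l t : is_derive t (1 : R) f l ->
  (exists2 d : R, 0 < d & forall s, t - d < s -> s <= t -> f s <= f t) -> 0 <= l.
Proof.
move=> /is_derive_epsP H [d d0 Hd]; rewrite leNgt; apply/negP => l0.
have l2 : 0 < - l / 2 by rewrite divr_gt0// oppr_gt0.
have [d' d'0 H'] := H _ l2.
pose h := - (Num.min d d' / 2).
have hm : 0 < Num.min d d' by rewrite lt_min d0.
have hd : Num.min d d' <= d by rewrite ge_min lexx.
have hd' : Num.min d d' <= d' by rewrite ge_min lexx orbT.
have := Hd (t + h); have := H' h.
have -> : `|h| = - h by rewrite ler0_norm// /h; lra.
move=> /(_ _)/wrap[|A]; first by rewrite /h; lra.
move=> /(_ _ _)/wrap[||B]; [by rewrite /h; lra|by rewrite /h; lra|].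
move: A; rewrite ler_norml => /andP[A1 A2].
have : 0 < l * h by rewrite nmulr_lgt0// /h; lra.
lra.
Qed.

Lemma right_max_derive f l t : is_derive t (1 : R) f l ->
  (exists2 d : R, 0 < d & forall s, t <= s -> s < t + d -> f s <= f t) -> l <= 0.
Proof.
move=> /is_derive_epsP H [d d0 Hd]; rewrite leNgt; apply/negP => l0.
have l2 : 0 < l / 2 by rewrite divr_gt0.
have [d' d'0 H'] := H _ l2.
pose h := Num.min d d' / 2.
have hm : 0 < Num.min d d' by rewrite lt_min d0.
have hd : Num.min d d' <= d by rewrite ge_min lexx.
have hd' : Num.min d d' <= d' by rewrite ge_min lexx orbT.
have := Hd (t + h); have := H' h.
have -> : `|h| = h by rewrite ger0_norm// /h; lra.
move=> /(_ _)/wrap[|A]; first by rewrite /h; lra.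
move=> /(_ _ _)/wrap[||B]; [by rewrite /h; lra|by rewrite /h; lra|].
move: A; rewrite ler_norml => /andP[A1 A2].
have : 0 < l * h by rewrite mulr_gt0// /h; lra.
lra.
Qed.

(** The second derivative exists only at [x], so there is no Taylor formula with remainder. Instead,
    [l > 0] would make [f1] positive just to the right of [x], where [f] would increase strictly. *)
Lemma max_second_derive f f1 l x : (forall y, is_derive y (1 : R) f (f1 y)) ->
  is_derive x (1 : R) f1 l ->
  (exists2 d : R, 0 < d & forall y, `|y - x| < d -> f y <= f x) -> l <= 0.
Proof.
move=> Df D1 [d d0 Hd].
have f10 : f1 x = 0.
  apply/eqP; rewrite eq_le; apply/andP; split.
    apply: (right_max_derive (Df x)); exists d => // s s1 s2; apply: Hd.
    by rewrite ger0_norm; lra.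
  apply: (left_max_derive (Df x)); exists d => // s s1 s2; apply: Hd.
  by rewrite ler0_norm; lra.
rewrite leNgt; apply/negP => l0.
have l2 : 0 < l / 2 by rewrite divr_gt0.
have [d' d'0 H'] := is_derive_epsP D1 l2.
pose h := Num.min d d' / 2.
have hm : 0 < Num.min d d' by rewrite lt_min d0.
have hd : Num.min d d' <= d by rewrite ge_min lexx.
have hd' : Num.min d d' <= d' by rewrite ge_min lexx orbT.
have h0 : 0 < h by rewrite /h; lra.
have hP y : 0 < y -> y < d' -> 0 < f1 (x + y).
  move=> y0 yd; have := H' y; rewrite (gtr0_norm y0) => /(_ yd).
  rewrite f10 ler_norml => /andP[A _].
  have : 0 < l * y by rewrite mulr_gt0.
  lra.
(* The mean value point lies in a closed interval and could be [x], where [f1] vanishes; on the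
   right half of [x, x + h] the slope is strictly positive. *)
have ab : x + h / 2 <= x + h by lra.
have ab' : x <= x + h / 2 by lra.
have [c /andP[c1 c2] E] := MVT_le ab (fun y _ => Df y).
have [c' /andP[c'1 c'2] E'] := MVT_le ab' (fun y _ => Df y).
have := Hd (x + h); rewrite addrAC subrr add0r (gtr0_norm h0) => /(_ _)/wrap[|A].
  by rewrite /h; lra.
have : 0 < f1 c * (x + h - (x + h / 2)).
  rewrite mulr_gt0//; last lra.
  have -> : c = x + (c - x) by lra.
  by apply: hP; rewrite /h in c1 c2 *; lra.
have : 0 <= f1 c' * (x + h / 2 - x).
  rewrite mulr_ge0//; last lra.
  move: c'1; rewrite le_eqVlt => /predU1P[<-|c'1]; first by rewrite f10.
  have -> : c' = x + (c' - x) by lra.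
  by rewrite ltW// hP//; rewrite /h in c'2 *; lra.
lra.
Qed.
End Primitives.

(** * Comparison principle *)

Section Comparison.
Context {R : realType}.
Implicit Types (g gx chi : R -> R -> R) (x y t : R).

(** Compactness of [- X, X] makes the initial inequality uniform. Only positive times occur, since
    [psi] is discontinuous at the origin. *)
Lemma init_unif g chi (X e : R) : (forall x0 e : R, 0 < e -> exists2 d : R, 0 < d &
    forall x t, `|x - x0| < d -> 0 < t < d -> g x t <= chi x t + e) ->
  0 < e -> exists2 d : R, 0 < d &
  forall x t, - X <= x <= X -> 0 < t < d -> g x t <= chi x t + e.
Proof.
move=> init e0; have cK : compact (`[- X, X] : set R) by exact: segment_compact.
move/compact_near_coveringP : cK => /(_ R (0 : R)^'+
  (fun d x => forall t, 0 < t < d -> g x t <= chi x t + e)).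
move=> /(_ _ _)/wrap[].
  move=> x _; have [d d0 Hd] := init x _ e0.
  exists (ball x d, [set d' | d' < d]) => /=.
    by split; [exact: nbhsx_ballx|exact: nbhs_right_lt].
  move=> [x' d'] [/= xx' d'd] t /andP[t0 td]; apply: Hd.
    by move: xx'; rewrite /ball /= distrC.
  by rewrite t0 (lt_trans td).
move=> H; near (0 : R)^'+ => d.
by exists d => // x t xX; apply: (near H d _ x).
Unshelve. all: by end_near. Qed.

(* At a maximum of the box average of [g], minus [chi] and a barrier, the flux
   inequality reads Z_t <= Z_xx and contradicts the strict supersolution. *)
Lemma comparison g gx chi x t :
  cont2 g -> cont2 gx -> (forall x t, is_derive x (1 : R) (g ^~ t) (gx x t)) ->
  (forall x t, 0 < t -> {for (x, t), continuous (fun z : R * R => chi z.1 z.2)}) ->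
  (forall T, exists M, forall x t, 0 < t <= T -> g x t - chi x t <= M) ->
  (forall x0 t0, 0 < t0 -> exists E Ex Exx Et,
    [/\ E x0 t0 = chi x0 t0 /\ (forall x t, 0 < t -> chi x t <= E x t),
      forall x, is_derive x (1 : R) (E ^~ t0) (Ex x),
      is_derive x0 (1 : R) Ex Exx, is_derive t0 (1 : R) (E x0) Et & Exx <= Et]) ->
  (forall x y t1 t2, x <= y -> 0 < t1 -> t1 <= t2 ->
    (forall xi s, x <= xi <= y -> t1 <= s <= t2 -> chi xi s < g xi s) ->
    itg x y (fun xi => g xi t2 - g xi t1) <= itg t1 t2 (fun s => gx y s - gx x s)) ->
  (forall x0 e : R, 0 < e -> exists2 d : R, 0 < d &
    forall x t, `|x - x0| < d -> 0 < t < d -> g x t <= chi x t + e) ->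
  0 < t -> g x t <= chi x t.
Proof.
move=> cg cgx Dg cchi bnd touch flux init t_gt0; rewrite leNgt; apply/negP => gt.
(* The violation is 4 n: the barrier spends n at (x, t), replacing [g] by its box average costs n /
   4 at each of two points, and at least 2 n are left at the maximum. *)
pose n := (g x t - chi x t) / 4.
have n0 : 0 < n by rewrite divr_gt0// subr_gt0.
pose e := n / (x ^+ 2 + 1 + 3 * t).
have den0 : 0 < x ^+ 2 + 1 + 3 * t.
  by rewrite addr_gt0//; [rewrite ltr_wpDl// sqr_ge0|rewrite mulr_gt0].
have e0 : 0 < e by rewrite divr_gt0.
have en : e * (x ^+ 2 + 1 + 3 * t) = n by rewrite /e mulfVK// gt_eqF.
(* The barrier is a strict supersolution: its time derivative 3 e exceeds its second space
   derivative 2 e. *)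
pose b y s := e * (y ^+ 2 + 1 + 3 * s).
have [M HM] := bnd t.
(* At |y| = X the barrier alone exceeds the bound [M] of [g - chi], so the maximum is not attained
   there. *)
pose X := `|x| + 1 + `|M| / e.
have X1 : 1 <= X by rewrite /X addrAC lerDr addr_ge0// divr_ge0// ltW.
have xX : `|x| < X.
  by rewrite /X -addrA ltrDl ltr_wpDr// divr_ge0// ltW.
have MX : M <= e * X ^+ 2.
  apply: le_trans (ler_norm _) _; rewrite mulrC -ler_pdivrMr//.
  apply: (@le_trans _ _ X); first by rewrite /X lerDr addr_ge0.
  by rewrite expr2 ler_peMr// (le_trans ler01).
have [d0 d0_gt0 Hinit] := @init_unif g chi X n init n0.
(* Times below [d0] are controlled by the initial condition, which keeps the maximum away from
   [s = tau]. *)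
pose tau := Num.min d0 t / 2.
have mt0 : 0 < Num.min d0 t by rewrite lt_min d0_gt0.
have mt1 : Num.min d0 t <= d0 by rewrite ge_min lexx.
have mt2 : Num.min d0 t <= t by rewrite ge_min lexx orbT.
have tau0 : 0 < tau by rewrite divr_gt0.
have taud : tau < d0 by rewrite /tau; move: (Num.min d0 t) mt0 mt1; clear; move=> m; lra.
have taut : tau < t by rewrite /tau; move: (Num.min d0 t) mt0 mt2; clear; move=> m; lra.
have n4 : 0 < n / 4 by rewrite divr_gt0.
have cgK y r : - X <= y <= X -> tau <= r <= t ->
    {for (y, r), continuous (fun z : R * R => g z.1 z.2)} by move=> _ _; exact: cg.
have ccK y r : - X <= y <= X -> tau <= r <= t ->
    {for (y, r), continuous (fun z : R * R => chi z.1 z.2)}.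
  by move=> _ /andP[tr _]; apply: cchi; exact: lt_le_trans tr.
have [k1 k10 Hk1] := cont2_unif cgK n4.
have [k2 k20 Hk2] := cont2_unif ccK n4.
pose k := Num.min k1 k2 / 2.
have mk0 : 0 < Num.min k1 k2 by rewrite lt_min k10.
have mk1 : Num.min k1 k2 <= k1 by rewrite ge_min lexx.
have mk2 : Num.min k1 k2 <= k2 by rewrite ge_min lexx orbT.
have kk1 : k < k1 by rewrite /k; move: (Num.min k1 k2) mk0 mk1; clear; move=> m; lra.
have kk2 : k < k2 by rewrite /k; move: (Num.min k1 k2) mk0 mk2; clear; move=> m; lra.
have k0 : 0 < k by rewrite divr_gt0.
clearbody k; clear mk0 mk1 mk2.
have gbox y r z q : - X <= y <= X -> tau <= r <= t -> y <= z <= y + k -> r <= q <= r + k ->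
    `|g z q - g y r| <= n / 4 /\ `|chi z q - chi y r| <= n / 4.
  move=> yX rt /andP[yz zk] /andP[rq qk].
  have zy : `|z - y| <= k by rewrite ger0_norm ?subr_ge0// lerBlDl.
  have qr : `|q - r| <= k by rewrite ger0_norm ?subr_ge0// lerBlDl.
  by split; [apply: Hk1 => //|apply: Hk2 => //]; apply: le_lt_trans; eassumption.
(* [g] need not be differentiable in time. Its average over the box [y, y + k] x [s, s + k] is
   differentiable in time and twice in space, and these derivatives are the two sides of the flux
   inequality on that box. *)
pose J y s := itg y (y + k) (g ^~ s).
have cJ : cont2 J by apply: cont2_window => //; exact: ltW.
pose Z0 y s := itg s (s + k) (J y).
have cZ0 : cont2 Z0.
  by apply: cont2_swap; apply: (@cont2_window _ (fun s y => J y s)) => //; [exact: ltW|exact: cont2_swap].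
pose c := k^-1 ^+ 2.
have c0 : 0 < c by rewrite exprn_gt0// invr_gt0.
have ck : c * (k * k) = 1 by rewrite /c; field; rewrite gt_eqF.
pose Z y s := c * Z0 y s.
have cZ : cont2 Z by apply: cont2M => // z; exact: cvg_cst.
have lg s : lbm (g ^~ s) by apply: continuous_lbm; exact: cont2_l.
have lJ y : lbm (J y) by apply: continuous_lbm; exact: cont2_r.
have sk s : s <= s + k by rewrite lerDl ltW.
have Zg y s : - X <= y <= X -> tau <= s <= t -> `|Z y s - g y s| <= n / 4.
  move=> yX st.
  have JB q : s <= q <= s + k -> `|J y q - g y s * k| <= n / 4 * k.
    move=> qs; have -> : g y s * k = itg y (y + k) (fun=> g y s) by rewrite itg_cst ?lerDl ?(ltW k0)// addrAC subrr add0r.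
    rewrite -itgB//; last exact: lbm_cst.
    have -> : n / 4 * k = n / 4 * (y + k - y) by rewrite addrAC subrr add0r.
    apply: itg_norm_le => //; first by apply: lbmB => //; exact: lbm_cst.
    by move=> z zy; have [] := gbox _ _ _ _ yX st zy qs.
  have ZB : `|Z0 y s - g y s * k * k| <= n / 4 * k * k.
    have -> : g y s * k * k = itg s (s + k) (fun=> g y s * k) by rewrite itg_cst// addrAC subrr add0r.
    rewrite -itgB//; last exact: lbm_cst.
    have -> : n / 4 * k * k = n / 4 * k * (s + k - s) by rewrite addrAC subrr add0r.
    by apply: itg_norm_le => //; apply: lbmB => //; exact: lbm_cst.
  have -> : Z y s - g y s = c * (Z0 y s - g y s * k * k).
    by rewrite mulrBr -mulrA mulrCA ck mulr1.
  rewrite normrM (gtr0_norm c0); apply: le_trans (ler_wpM2l (ltW c0) ZB) _.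
  by rewrite -mulrA mulrCA ck mulr1.
pose K := (`[- X, X] `*` `[tau, t] : set (R * R)).
have cK : compact K by apply: compact_setX; exact: segment_compact.
have Kxt : K (x, t).
  split; rewrite /= in_itv /= ?lexx ?(ltW taut)//.
  by move: xX; rewrite ltr_norml => /andP[? ?]; rewrite !ltW.
have Kne : K !=set0 by exists (x, t).
have cQ : {within K, continuous (fun z : R * R => Z z.1 z.2 - chi z.1 z.2 - b z.1 z.2)}.
  apply: continuous_in_subspaceT => -[y s]; rewrite inE => -[/= yX st].
  apply: cvgB; first apply: cvgB.
  - exact: cZ.
  - by apply: ccK; [move: yX|move: st]; rewrite in_itv.
  - apply: (@continuousM _ _ (fun=> e) (fun z : R * R => z.1 ^+ 2 + 1 + 3 * z.2) (y, s)).
      exact: cvg_cst.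
    apply: cvgD; last by apply: cvgM; [exact: cvg_cst|exact: cvg_snd].
    apply: cvgD; last exact: cvg_cst.
    by rewrite !expr2; apply: cvgM; exact: cvg_fst.
have [[x0 t0]] := compact_EVT_max Kne cK cQ.
rewrite inE /= => -[/=]; rewrite !in_itv /= => xX0 tt0 Hmax.
have Qmax y s : - X <= y <= X -> tau <= s <= t ->
    Z y s - chi y s - b y s <= Z x0 t0 - chi x0 t0 - b x0 t0.
  by move=> yX st; apply: (Hmax (y, s)); rewrite inE; split; rewrite /= in_itv.
have xX' : - X <= x <= X by move: xX; rewrite ltr_norml => /andP[? ?]; rewrite !ltW.
have tt : tau <= t <= t by rewrite lexx ltW.
have b0 y s : 0 <= s -> 0 <= b y s.
  by move=> s0; rewrite /b mulr_ge0// ?(ltW e0)// !addr_ge0// ?sqr_ge0 ?mulr_ge0.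
have F0 : 2 * n <= g x0 t0 - chi x0 t0 - b x0 t0.
  have := Qmax _ _ xX' tt.
  have := Zg _ _ xX' tt; have := Zg _ _ xX0 tt0.
  have : g x t - chi x t = 4 * n by rewrite /n; field.
  have : b x t = n by rewrite /b en.
  rewrite !ler_norml; move: n0; move: (n) (b x t) (Z x t) (g x t) (chi x t).
  move: (b x0 t0) (Z x0 t0) (g x0 t0) (chi x0 t0); clear.
  by move=> b1 z1 g1 c1 n b2 z2 g2 c2 n0 E1 E2 /andP[A1 A2] /andP[B1 B2] C; lra.
have tau_t0 : tau < t0.
  move: tt0 => /andP[]; rewrite le_eqVlt => /predU1P[tt0' _|//].
  have := Hinit x0 t0 xX0; rewrite -tt0' tau0 taud => /(_ isT).
  have := b0 x0 t0; rewrite -tt0' => /(_ (ltW tau0)); rewrite -tt0' in F0.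
  move: F0 n0; move: (n) (b x0 tau) (g x0 tau) (chi x0 tau); clear.
  by move=> n b g c; lra.
have t00 : 0 < t0 by exact: lt_trans tau_t0.
have x0X : - X < x0 < X.
  have [H|] := boolP (- X < x0 < X); first by [].
  have X0 : 0 <= X by rewrite (le_trans ler01).
  rewrite negb_and -!leNgt => H; exfalso.
  have x2 : x0 ^+ 2 = X ^+ 2.
    move: H xX0 => /orP[H|H] /andP[A B].
      have -> : x0 = - X by apply/eqP; rewrite eq_le H A.
      by rewrite sqrrN.
    by have -> : x0 = X by apply/eqP; rewrite eq_le H B.
  have := HM x0 t0; rewrite t00; move: (tt0) => /andP[_ ->] => /(_ isT).
  move: F0; rewrite /b x2.
  have : 0 <= e * (1 + 3 * t0) by rewrite mulr_ge0 ?(ltW e0)// addr_ge0// mulr_ge0// ltW.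
  have -> : e * (X ^+ 2 + 1 + 3 * t0) = e * X ^+ 2 + e * (1 + 3 * t0) by ring.
  move: n0 MX; move: (n) (e * X ^+ 2) (e * (1 + 3 * t0)) (g x0 t0) (chi x0 t0); clear.
  by move=> n a b g c; lra.
(* The flux inequality is assumed only where [g] exceeds [chi]; the 2 n left at the maximum survive
   an oscillation n / 4 of both functions over the box. *)
have gchi xi s : x0 <= xi <= x0 + k -> t0 <= s <= t0 + k -> chi xi s < g xi s.
  move=> xix st; have [] := gbox _ _ _ _ xX0 tt0 xix st.
  have := b0 x0 t0 (ltW t00); move: F0.
  rewrite !ler_norml; move: n0.
  move: (n) (b x0 t0) (g x0 t0) (chi x0 t0) (g xi s) (chi xi s); clear.
  by move=> n b g c g' c' n0 F0 B /andP[A1 A2] /andP[A3 A4]; lra.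
have FL := flux _ _ _ _ (sk x0) t00 (sk t0) gchi.
have cJr y : continuous (J y) by exact: cont2_r.
pose Zt := c * (J x0 (t0 + k) - J x0 t0).
have DZt : is_derive t0 (1 : R) (Z x0) Zt.
  have := @is_derive_window _ (J x0) k t0 (cJr x0) (ltW k0).
  by move=> H; apply: is_deriveZ.
pose N y := itg t0 (t0 + k) (g y).
pose N1 y := itg t0 (t0 + k) (gx y).
have DN y : is_derive y (1 : R) N (N1 y) by exact: is_derive_param.
have cN : continuous N by move=> y; exact: is_derive_continuous (DN y).
have ZN y : Z y t0 = c * itg y (y + k) N.
  by congr (_ * _); rewrite /N (@itg_swap _ g y (y + k) t0 (t0 + k) (cont2_lbm2 cg) (sk y) (sk t0)).
pose Z1 y := c * (N (y + k) - N y).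
have DZ1 y : is_derive y (1 : R) (Z ^~ t0) (Z1 y).
  rewrite (_ : Z ^~ t0 = (fun y => c * itg y (y + k) N)); last exact/funext.
  have := @is_derive_window _ N k y cN (ltW k0).
  by move=> H; apply: is_deriveZ.
pose Z2 := c * (N1 (x0 + k) - N1 x0).
have DZ2 : is_derive x0 (1 : R) Z1 Z2.
  apply: is_deriveZ; apply: is_deriveB; exact: der_shift.
have ZZ : Zt <= Z2.
  rewrite /Zt /Z2 ler_pM2l// /J /N1 -itgB// -itgB//; apply: continuous_lbm; exact: cont2_r.
(* Replacing [chi] by the function touching it from above keeps the maximum and supplies the
   derivatives that [chi] may lack. *)
have [E [Ex [Exx [Et [[E0 EE] DEx DExx DEt EE2]]]]] := touch x0 t0 t00.
have Emax y s : - X <= y <= X -> tau <= s <= t ->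
    Z y s - E y s - b y s <= Z x0 t0 - E x0 t0 - b x0 t0.
  move=> yX st; rewrite E0; apply: le_trans (Qmax y s yX st).
  have := EE y s (lt_le_trans tau0 (proj1 (andP st))).
  by move=> H; rewrite lerD2r lerD2l lerN2.
have Ht : 0 <= Zt - Et - e * 3.
  have Db : is_derive t0 (1 : R) (b x0) (e * 3).
    apply: is_derive_eps => r r0; exists 1 => // h _.
    have -> : b x0 (t0 + h) - b x0 t0 - e * 3 * h = 0 by rewrite /b; ring.
    by rewrite normr0 mulr_ge0// ltW.
  have DD := derB (derB DZt DEt) Db.
  apply: (left_max_derive DD).
  exists (t0 - tau); first by rewrite subr_gt0.
  move=> s s1 s2; apply: Emax => //; move: tt0 => /andP[_ tt0].
  apply/andP; split; last exact: le_trans tt0.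
  by move: s1; rewrite opprB addrC subrK => /ltW.
have Hx : Z2 - Exx - e * 2 <= 0.
  have Db y : is_derive y (1 : R) (b ^~ t0) (e * 2 * y).
    apply: is_derive_eps => r r0; exists (r / e); first by rewrite divr_gt0.
    move=> h hr; have -> : b (y + h) t0 - b y t0 - e * 2 * y * h = e * h * h by rewrite /b; ring.
    rewrite normrM ler_wpM2r// normrM (gtr0_norm e0) mulrC -ler_pdivlMr//.
    exact: ltW.
  have Db2 : is_derive x0 (1 : R) (fun y => e * 2 * y) (e * 2).
    by apply: der_eq (derZ (e * 2) (der_id x0)) _; rewrite mulr1.
  have DD := derB (derB DZ2 DExx) Db2.
  have DD1 y := derB (derB (DZ1 y) (DEx y)) (Db y).
  apply: (max_second_derive DD1 DD).
  move: x0X => /andP[x0a x0b].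
  exists (Num.min (x0 + X) (X - x0)); first by rewrite lt_min; apply/andP; split; move: (X) x0a x0b; clear; move=> X; lra.
    move=> y; rewrite lt_min !ltr_norml => /andP[/andP[y1 y2] /andP[y3 y4]].
    by apply: Emax => //; apply/andP; split; move: (X) y1 y2 y3 y4; clear; move=> X; lra.
by move: Ht Hx ZZ EE2 e0; move: (Zt) (Z2) (e); clear; move=> a b c; lra.
Qed.
End Comparison.

(** * The self-similar source solution *)

Section GaussianTail.
Context {R : realType}.
Implicit Types (a b c x y z : R).
Local Notation mu := (@lebesgue_measure R).

(** Used with [c = 1 / 4] for [Psi], with [c = 1] for [erfc], and with [c = - (1 / 4)] as
    integrating factor. *)
Definition gs c z : R := expR (- (c * z ^+ 2)).
Definition gtail c y : R := \int[mu]_(z in `[y, +oo[) gs c z.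

Lemma is_derive_gs c z : is_derive z (1 : R) (gs c) (- (2 * c * z) * gs c z).
Proof.
have Dq : is_derive z (1 : R) (fun z => - (c * z ^+ 2)) (- (2 * c * z)).
  apply: is_derive_eps => e e0; exists (e / (`|c| + 1)).
    by rewrite divr_gt0// ltr_wpDl.
  move=> h hd; have -> : - (c * (z + h) ^+ 2) - - (c * z ^+ 2) - - (2 * c * z) * h = - (c * h * h) by ring.
  rewrite normrN normrM ler_wpM2r// normrM.
  apply: (@le_trans _ _ ((`|c| + 1) * `|h|)); first by rewrite ler_wpM2r// lerDl.
  by rewrite mulrC -ler_pdivlMr ?ltr_wpDl// ltW.
by apply: der_eq (derC (is_derive_expR _) Dq) _; rewrite mulrC.
Qed.

Lemma continuous_gs c : continuous (gs c).
Proof. by move=> z; exact: is_derive_continuous (is_derive_gs c z). Qed.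

Lemma gs_gt0 c z : 0 < gs c z.
Proof. exact: expR_gt0. Qed.

Lemma gs_small c (e : R) : 0 < c -> 0 < e ->
  exists2 M, 0 < M & forall y, M <= y -> gs c y <= e.
Proof.
move=> c0 e0; pose M := (`|ln e| + 1) / c + 1.
have A : 0 <= (`|ln e| + 1) / c by rewrite divr_ge0 ?addr_ge0// ltW.
exists M => [|y My]; first by rewrite /M ltr_wpDl.
rewrite -[leRHS]lnK ?posrE// ler_expR lerNl.
apply: (@le_trans _ _ (`|ln e|)); first by rewrite -normrN ler_norm.
have y1 : 1 <= y by apply: le_trans My; rewrite /M lerDr.
have : (`|ln e| + 1) / c <= y by apply: le_trans My; rewrite /M lerDl.
rewrite ler_pdivrMr// => K.
apply: (@le_trans _ _ (y * c)); first by apply: le_trans K; rewrite lerDl.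
by rewrite mulrC ler_wpM2l// ?(ltW c0)// expr2 ler_peMr// (le_trans ler01).
Qed.

(** A multiple of the centred normal density of variance 1 / (2 c). *)
Lemma integrable_gs c (D : set R) : 0 < c -> measurable D -> mu.-integrable D (EFin \o gs c).
Proof.
move=> c0 mD; apply: (@integrableS _ _ _ mu setT) => //.
pose s : R := Num.sqrt (2 * c)^-1.
have c2 : 0 < (2 * c)^-1 by rewrite invr_gt0 mulr_gt0.
have s0 : s != 0 by rewrite gt_eqF// sqrtr_gt0.
have H := @integrable_normal_pdf R 0 s.
have p0 : 0 < normal_peak s by exact: normal_peak_gt0.
have -> : EFin \o gs c = (fun z => ((normal_peak s)^-1)%:E * (normal_pdf 0 s z)%:E)%E.
  apply/funext => z; rewrite /= -EFinM /normal_pdf (negbTE s0) mulKf ?gt_eqF//.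
  congr (expR _)%:E; rewrite subr0 /s sqr_sqrtr ?(ltW c2)//.
  by field; rewrite gt_eqF.
exact: integrableZl.
Qed.

Lemma gtail_sub c a b : 0 < c -> a <= b -> gtail c a - gtail c b = itg a b (gs c).
Proof.
move=> c0 ab; rewrite /gtail -(@Rintegral_itv_obnd_cbnd _ b); last exact: integrable_gs.
rewrite -(@Rintegral_itvB _ _ (BLeft a) +oo%O b) ?bnd_simp//.
  by rewrite opprB addrCA subrr addr0.
exact: integrable_gs.
Qed.

Lemma is_derive_gtail c y : 0 < c -> is_derive y (1 : R) (gtail c) (- gs c y).
Proof.
move=> c0; apply: (@is_derive_itg _ _ (fun z => - gs c z)).
  by move=> z; apply: cvgN; exact: continuous_gs.
move=> a b ab; rewrite itgN; last by apply: continuous_lbm; exact: continuous_gs.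
by rewrite -gtail_sub// opprB.
Qed.

Lemma gtail_ge0 c y : 0 <= gtail c y.
Proof. by apply: Rintegral_ge0 => z _; rewrite ltW// gs_gt0. Qed.

Lemma gtail_lt c a b : 0 < c -> a < b -> gtail c b < gtail c a.
Proof.
move=> c0 ab; have [z _ E] := MVT_le (ltW ab) (fun y _ => is_derive_gtail y c0).
by rewrite -subr_lt0 E nmulr_rlt0 ?subr_gt0// oppr_lt0 gs_gt0.
Qed.

Lemma gtail_le c a b : 0 < c -> a <= b -> gtail c b <= gtail c a.
Proof. by move=> c0; rewrite le_eqVlt => /predU1P[->//|ab]; rewrite ltW// gtail_lt. Qed.

Lemma gtail_gt0 c y : 0 < c -> 0 < gtail c y.
Proof. by move=> c0; apply: le_lt_trans (gtail_ge0 c (y + 1)) _; rewrite gtail_lt// ltrDl. Qed.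

(** For z >= 1 the Gaussian is at most [z * gs c z], whose primitive is explicit. *)
Lemma gtail_small c (e : R) : 0 < c -> 0 < e ->
  exists2 M, 0 < M & forall y, M <= y -> gtail c y <= e.
Proof.
move=> c0 e0.
have ec : 0 < e * (2 * c) by rewrite !mulr_gt0.
have [M0 M00 HM] := gs_small c0 ec.
exists (Num.max 1 M0); first by rewrite lt_max ltr01.
move=> y; rewrite ge_max => /andP[y1 My].
have yy : 0 < y by exact: lt_le_trans y1.
pose F z := - (2 * c)^-1 * gs c z.
have DF z : is_derive z (1 : R) F (z * gs c z).
  by apply: der_eq (derZ _ (is_derive_gs c z)) _; field; rewrite gt_eqF.
have cF : continuous (fun z => z * gs c z).
  by move=> z; apply: cvgM; [exact: cvg_id|exact: continuous_gs].
have F0 : F x @[x --> +oo%R] --> (0 : R).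
  apply/cvgrPdist_le => r r0; have rc : 0 < r * (2 * c) by rewrite !mulr_gt0.
  have [M1 _ HM1] := gs_small c0 rc.
  near=> x; rewrite sub0r normrN /F normrM normrN normrV ?unitfE ?gt_eqF ?mulr_gt0//.
  rewrite (gtr0_norm (gs_gt0 _ _)) (gtr0_norm (_ : 0 < 2 * c)) ?mulr_gt0//.
  rewrite ler_pdivrMl ?mulr_gt0// mulrC; apply: HM1; near: x; apply: nbhs_pinfty_ge; exact: num_real.
have I := @ge0_continuous_FTC2y R (fun z => z * gs c z) F y 0.
have {}I : (\int[mu]_(z in `[y, +oo[) (z * gs c z)%:E = 0%:E - (F y)%:E)%E.
  apply: I => //.
  - by move=> z yz; rewrite mulr_ge0 ?(ltW (gs_gt0 _ _))// (le_trans (ltW yy)).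
  - exact: continuous_subspaceT.
  - by apply: cvg_at_right_filter; exact: is_derive_continuous (DF y).
  - by move=> z _; rewrite derive1E; have [_ ->] := DF z.
have : (\int[mu]_(z in `[y, +oo[) (gs c z)%:E <= \int[mu]_(z in `[y, +oo[) (z * gs c z)%:E)%E.
  apply: ge0_le_integral => //.
  - by move=> z _; rewrite lee_fin ltW// gs_gt0.
  - by apply/measurable_EFinP; apply: measurable_funTS; apply: continuous_measurable_fun; exact: continuous_gs.
  - by apply/measurable_EFinP; apply: measurable_funTS; exact: continuous_measurable_fun.
  - move=> z /=; rewrite in_itv /= andbT => yz; rewrite lee_fin ler_peMl ?(ltW (gs_gt0 _ _))//.
    exact: le_trans yz.
rewrite I -(@fineK _ (\int[mu]_(z in `[y, +oo[) (gs c z)%:E)%E); last first.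
  by apply: integrable_fin_num => //; exact: integrable_gs.
rewrite -EFinB lee_fin sub0r => H; apply: le_trans H _.
by rewrite /F mulNr opprK mulrC ler_pdivrMr ?mulr_gt0//; exact: HM.
Unshelve. all: by end_near. Qed.

End GaussianTail.

Section Profile.
Context {R : realType}.
Variables alpha beta : R.
Hypotheses (alpha_gt0 : 0 < alpha) (beta_gt0 : 0 < beta).
Implicit Types (x t eta : R).
Local Notation Psi := (Psi alpha beta).
Local Notation psi := (psi alpha beta).

Definition Psi_coef : R := alpha * beta / 2 * expR (alpha ^+ 2 / 4).
Local Notation cA := Psi_coef.

Lemma Psi_coef_gt0 : 0 < cA.
Proof. by rewrite /Psi_coef !mulr_gt0// expR_gt0. Qed.
Let cA_gt0 := Psi_coef_gt0.

Let q0 : 0 < 1 / 4 :> R. Proof. by rewrite divr_gt0. Qed.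

Lemma PsiE eta : Psi eta = cA * gtail (1 / 4) (Num.max `|eta| alpha).
Proof.
rewrite /Defs.Psi; congr (_ * _); apply: eq_Rintegral => z _.
by rewrite /gs; congr expR; lra.
Qed.

Lemma PsiN eta : Psi (- eta) = Psi eta.
Proof. by rewrite !PsiE normrN. Qed.

Lemma Psi_gt0 eta : 0 < Psi eta.
Proof. by rewrite PsiE mulr_gt0// gtail_gt0. Qed.

Lemma Psi_le eta eta' : `|eta| <= `|eta'| -> Psi eta' <= Psi eta.
Proof.
move=> e; rewrite !PsiE ler_pM2l//; apply: gtail_le => //.
by rewrite ge_max !le_max e lexx orbT.
Qed.

Lemma Psi_in eta : `|eta| <= alpha -> Psi eta = Psi alpha.
Proof.
move=> e; rewrite !PsiE; congr (_ * gtail _ _).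
by rewrite (max_idPr e) (gtr0_norm alpha_gt0) maxxx.
Qed.

Lemma Psi_le_alpha eta : Psi eta <= Psi alpha.
Proof.
have [e|e] := leP `|eta| alpha; first by rewrite (Psi_in e).
by apply: Psi_le; rewrite (gtr0_norm alpha_gt0) ltW.
Qed.

Lemma Psi_out eta : alpha <= eta -> Psi eta = cA * gtail (1 / 4) eta.
Proof.
move=> ae; rewrite PsiE ger0_norm; last by rewrite (le_trans (ltW alpha_gt0)).
by rewrite (max_idPl ae).
Qed.

Lemma Psi_le_tail eta : Psi eta <= cA * gtail (1 / 4) eta.
Proof. by rewrite PsiE ler_pM2l// gtail_le// le_max ler_norm. Qed.

Lemma Psi_small (e : R) : 0 < e -> exists2 M, alpha < M & forall eta, M <= eta -> Psi eta <= e.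
Proof.
move=> e0; have ec : 0 < e / cA by rewrite divr_gt0.
have [M M0 HM] := gtail_small q0 ec.
exists (alpha + M); first by rewrite ltrDl.
move=> eta; move=> Me; rewrite Psi_out; last first.
  by rewrite (le_trans _ Me)// lerDl ltW.
by rewrite mulrC -ler_pdivlMr//; apply: HM; rewrite (le_trans _ Me)// lerDr ltW.
Qed.

Lemma continuous_gtail (c : R) : 0 < c -> continuous (gtail c).
Proof. by move=> c0 y; exact: is_derive_continuous (is_derive_gtail y c0). Qed.

Lemma continuous_Psi : continuous Psi.
Proof.
move=> x; rewrite (_ : Psi = (fun eta => cA * gtail (1 / 4) (Num.max `|eta| alpha))); last first.
  by apply/funext => z; rewrite PsiE.
apply: cvgM; first exact: cvg_cst.
apply: (@continuous_comp _ _ _ (fun eta => Num.max `|eta| alpha) (gtail (1 / 4))).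
  by apply: continuous_max; [exact: norm_continuous|exact: cvg_cst].
exact: continuous_gtail.
Qed.

Lemma is_derive_Psi eta : alpha < eta -> is_derive eta (1 : R) Psi (- (cA * gs (1 / 4) eta)).
Proof.
move=> ae; have D := derZ cA (is_derive_gtail eta q0).
apply: is_derive_eps => e e0; have [d d0 Hd] := is_derive_epsP D e0.
exists (Num.min d (eta - alpha)); first by rewrite lt_min d0 subr_gt0.
move=> h; rewrite lt_min => /andP[hd]; rewrite ltr_norml => /andP[h1 h2].
rewrite (Psi_out (ltW ae)) Psi_out; last by lra.
by have := Hd h hd; rewrite mulrN.
Qed.

Lemma psi_pos x t : 0 < t -> psi x t = Psi (x / Num.sqrt t).
Proof. by rewrite /Defs.psi => ->. Qed.

Lemma psi_0 x : psi x 0 = if x == 0 then Psi alpha else 0.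
Proof. by rewrite /Defs.psi ltxx. Qed.

Lemma psi_ge0 x t : 0 <= psi x t.
Proof. by rewrite /Defs.psi; case: ifP => _; [|case: ifP => _]; rewrite ?(ltW (Psi_gt0 _)). Qed.

Lemma psi_le x t : psi x t <= Psi alpha.
Proof.
rewrite /Defs.psi; case: ifP => _; first exact: Psi_le_alpha.
by case: ifP => _ //; rewrite ltW// Psi_gt0.
Qed.

Lemma psi_le_t x s t : 0 <= s -> s <= t -> psi x s <= psi x t.
Proof.
rewrite le_eqVlt => /predU1P[<-|s0] st.
  rewrite psi_0; case: eqP => [->|_]; last exact: psi_ge0.
  move: st; rewrite le_eqVlt => /predU1P[<-|t0]; first by rewrite psi_0 eqxx.
  by rewrite psi_pos// mul0r (@Psi_in 0)// normr0 ltW.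
have t0 := lt_le_trans s0 st.
rewrite !psi_pos//; apply: Psi_le; rewrite !normrM ler_wpM2l//.
rewrite !normfV lef_pV2 ?posrE ?normr_gt0 ?gt_eqF ?sqrtr_gt0//.
by rewrite !ger0_norm ?sqrtr_ge0// ler_wsqrtr.
Qed.

Lemma psi_in x t : 0 < t -> `|x| <= alpha * Num.sqrt t -> psi x t = Psi alpha.
Proof.
move=> t0 xt; rewrite psi_pos// Psi_in// normrM normfV (ger0_norm (sqrtr_ge0 _)).
by rewrite ler_pdivrMr// sqrtr_gt0.
Qed.

Lemma is_derive_sqrt t : 0 < t -> is_derive t (1 : R) Num.sqrt (2 * Num.sqrt t)^-1.
Proof. exact: is_derive1_sqrt. Qed.

Lemma cont_psi x t : 0 < t -> {for (x, t), continuous (fun z : R * R => psi z.1 z.2)}.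
Proof.
move=> t0.
have H : {for (x, t), continuous (fun z : R * R => Psi (z.1 / Num.sqrt z.2))}.
  apply: (@continuous_comp _ _ _ (fun z : R * R => z.1 / Num.sqrt z.2) Psi); last exact: continuous_Psi.
  apply: cvgM; first exact: cvg_fst.
  apply: (@continuous_comp _ _ _ (fun z : R * R => Num.sqrt z.2) (fun r => r^-1)).
    apply: (@continuous_comp _ _ _ (fun z : R * R => z.2) Num.sqrt); first exact: cvg_snd.
    exact: is_derive_continuous (is_derive_sqrt t0).
  by apply: inv_continuous; rewrite gt_eqF// sqrtr_gt0.
suff G : psi z.1 z.2 @[z --> (x, t)] --> psi x t by exact: G.
rewrite psi_pos//; apply: cvg_trans H; apply: near_eq_cvg.
exists (setT, [set s | 0 < s]) => /=; first by split; [exact: filterT|exact: lt_nbhsr].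
by move=> [y s] [_ /= s0]; rewrite psi_pos.
Qed.

(** Unlike [psi] it vanishes at all times t <= 0, the origin included. Its strict superlevel sets
    are therefore open or everything, which makes it Borel on the whole plane. *)
Definition psip x t : R := if 0 < t then Psi (x / Num.sqrt t) else 0.

Lemma psipE x t : 0 < t -> psip x t = psi x t.
Proof. by move=> t0; rewrite /psip t0 psi_pos. Qed.

Lemma lbm2_psip : lbm2 psip.
Proof.
have p0 x t : 0 <= psip x t by rewrite /psip; case: ifP => // _; rewrite ltW// Psi_gt0.
split; last first.
  move=> a b c d; exists (Psi alpha) => x t _ _; rewrite ger0_norm//.
  by rewrite /psip; case: ifP => _; [exact: Psi_le_alpha|rewrite ltW// Psi_gt0].
apply: (measurability _ (RGenOInfty.measurableE R)) => //.
move=> _ [_ [a ->] <-]; rewrite setTI; apply: open2_measurable => -[x t] /=.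
rewrite in_itv /= andbT => axt.
have [a0|a0] := ltP a 0.
  exists 1 => [|[y s] _ _ /=]; first exact: ltr01.
  by rewrite in_itv /= andbT; exact: lt_le_trans a0 (p0 y s).
have t0 : 0 < t.
  by move: axt; rewrite /psip; case: ifP => // _; rewrite ltNge a0.
have e0 : 0 < (psip x t - a) / 2 by rewrite divr_gt0// subr_gt0.
have /cvgrPdist_le/(_ _ e0) := @cont_psi x t t0.
move=> [[A B] [/= /nbhs_ballP[d1 /= d10 HA] /nbhs_ballP[d2 /= d20 HB]] AB].
exists (Num.min (Num.min d1 d2) t); first by rewrite !lt_min d10 d20.
move=> [y s] /=; rewrite !lt_min => /andP[/andP[y1 _] _] /andP[/andP[_ s2]].
rewrite ltr_norml => /andP[st _]; have s0 : 0 < s by move: st; rewrite ltrBrDr addNr.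
have := AB (y, s); rewrite /= in_itv /= andbT => /(_ _)/wrap[|].
  by split; [apply: HA|apply: HB]; rewrite /ball /= distrC.
rewrite !psipE// ler_norml => /andP[_]; rewrite psipE// in e0 axt *.
by move=> ?; lra.
Qed.

(* [psi] is the minimum of a constant and of the two caloric functions
   [heatE x t] and [heatE (- x) t]. *)
Definition heatE x t : R := cA * gtail (1 / 4) (x / Num.sqrt t).

Lemma is_derive_heatE_x x t : 0 < t ->
  is_derive x (1 : R) (heatE ^~ t) (- (cA * gs (1 / 4) (x / Num.sqrt t) / Num.sqrt t)).
Proof.
move=> t0; have st0 : Num.sqrt t != 0 by rewrite gt_eqF// sqrtr_gt0.
have Dx : is_derive x (1 : R) (fun x => x / Num.sqrt t) (Num.sqrt t)^-1.
  rewrite (_ : (fun x => x / Num.sqrt t) = (fun x => (Num.sqrt t)^-1 * x)).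
    by apply: der_eq (derZ _ (der_id x)) _; rewrite mulr1.
  by apply/funext => z; rewrite mulrC.
by apply: der_eq (derZ cA (derC (is_derive_gtail _ q0) Dx)) _; field.
Qed.

Lemma is_derive_heatE_xx x t : 0 < t ->
  is_derive x (1 : R) (fun x => - (cA * gs (1 / 4) (x / Num.sqrt t) / Num.sqrt t))
  (cA * gs (1 / 4) (x / Num.sqrt t) * x / (2 * t * Num.sqrt t)).
Proof.
move=> t0; have st0 : Num.sqrt t != 0 by rewrite gt_eqF// sqrtr_gt0.
have Dx : is_derive x (1 : R) (fun x => x / Num.sqrt t) (Num.sqrt t)^-1.
  rewrite (_ : (fun x => x / Num.sqrt t) = (fun x => (Num.sqrt t)^-1 * x)).
    by apply: der_eq (derZ _ (der_id x)) _; rewrite mulr1.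
  by apply/funext => z; rewrite mulrC.
rewrite (_ : (fun x => - _) = (fun x => - (cA / Num.sqrt t) * gs (1 / 4) (x / Num.sqrt t))).
  apply: der_eq (derZ _ (derC (is_derive_gs _ _) Dx)) _.
  have -> : 2 * t * Num.sqrt t = 2 * Num.sqrt t ^+ 2 * Num.sqrt t.
    by rewrite sqr_sqrtr// ltW.
  by field.
by apply/funext => z; field.
Qed.

Lemma is_derive_heatE_t x t : 0 < t ->
  is_derive t (1 : R) (heatE x) (cA * gs (1 / 4) (x / Num.sqrt t) * x / (2 * t * Num.sqrt t)).
Proof.
move=> t0; have st0 : Num.sqrt t != 0 by rewrite gt_eqF// sqrtr_gt0.
have Dt : is_derive t (1 : R) (fun t => x / Num.sqrt t) (- (x / (2 * t * Num.sqrt t))).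
  have DV := is_deriveV st0 (is_derive_sqrt t0).
  apply: der_eq (derZ x DV) _.
  have -> : 2 * t * Num.sqrt t = 2 * Num.sqrt t ^+ 2 * Num.sqrt t.
    by rewrite sqr_sqrtr// ltW.
  by rewrite /GRing.scale /=; field.
by apply: der_eq (derZ cA (derC (is_derive_gtail _ q0) Dt)) _; field; rewrite st0 gt_eqF.
Qed.

(** On the plateau |x| <= alpha sqrt t the constant touches, outside it the caloric function of the
    same side. This is the supersolution hypothesis of [comparison], met in spite of the kink at the
    source. *)
Lemma psi_touch x0 t0 : 0 < t0 -> exists E Ex Exx Et,
  [/\ E x0 t0 = psi x0 t0 /\ (forall x t, 0 < t -> psi x t <= E x t),
      forall x, is_derive x (1 : R) (E ^~ t0) (Ex x),
      is_derive x0 (1 : R) Ex Exx, is_derive t0 (1 : R) (E x0) Et & Exx <= Et].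
Proof.
move=> t00; have st0 : 0 < Num.sqrt t0 by rewrite sqrtr_gt0.
have [xa|xa] := leP `|x0 / Num.sqrt t0| alpha.
  exists (fun _ _ => Psi alpha), (fun _ => 0), 0, 0; split => //; try (by move=> *; exact: der_cst).
  by rewrite psi_pos// Psi_in//; split => // x t _; exact: psi_le.
have [x00|x00] := leP 0 x0.
  exists heatE, (fun x => - (cA * gs (1 / 4) (x / Num.sqrt t0) / Num.sqrt t0)),
    (cA * gs (1 / 4) (x0 / Num.sqrt t0) * x0 / (2 * t0 * Num.sqrt t0)),
    (cA * gs (1 / 4) (x0 / Num.sqrt t0) * x0 / (2 * t0 * Num.sqrt t0)); split.
  - split; last by move=> x t t1; rewrite psi_pos//; exact: Psi_le_tail.
    rewrite (psi_pos _ t00) Psi_out; first by [].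
    by move: xa; rewrite ger0_norm ?divr_ge0 ?sqrtr_ge0// => /ltW.
  - by move=> x; exact: is_derive_heatE_x.
  - exact: is_derive_heatE_xx.
  - exact: is_derive_heatE_t.
  - exact: lexx.
have DN x : is_derive x (1 : R) (fun x : R => - x) (-1) by exact: is_deriveN.
exists (fun x t => heatE (- x) t), (fun x => - (cA * gs (1 / 4) (- x / Num.sqrt t0) / Num.sqrt t0) * -1),
  (cA * gs (1 / 4) (- x0 / Num.sqrt t0) * - x0 / (2 * t0 * Num.sqrt t0)),
  (cA * gs (1 / 4) (- x0 / Num.sqrt t0) * - x0 / (2 * t0 * Num.sqrt t0)); split.
- split; last by move=> x t t1; rewrite psi_pos// -PsiN -mulNr; exact: Psi_le_tail.
  rewrite (psi_pos _ t00) -PsiN -mulNr Psi_out; first by [].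
  by move: xa; rewrite ltr0_norm ?pmulr_llt0 ?invr_gt0// -mulNr => /ltW.
- by move=> x; apply: (derC (is_derive_heatE_x (- x) t00) (DN x)).
- rewrite (_ : (fun x => _) = (fun x => -1 * - (cA * gs (1 / 4) (- x / Num.sqrt t0) / Num.sqrt t0))).
    by apply: der_eq (derZ _ (derC (is_derive_heatE_xx (- x0) t00) (DN x0))) _; ring.
  by apply/funext => x; ring.
- exact: is_derive_heatE_t.
- exact: lexx.
Qed.

End Profile.

(** * Almost everywhere comparison of integrals; smoothed step functions *)

Section Ramp.
Context {R : realType}.
Implicit Types (f F : R -> R) (a b x t z n : R).

Lemma itg_null_le a b f g (N : set R) : lbm f -> lbm g -> measurable N ->
  @lebesgue_measure R N = 0%E ->
  (forall x, a <= x <= b -> ~ N x -> f x <= g x) -> itg a b f <= itg a b g.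
Proof.
move=> lf lg mN N0 fg.
(* [h] is [f] off [N] and [g] on [N]: it has the integral of [f] and is at most [g] on all of
   [a, b]. *)
pose h x := \1_N x * g x + (1 - \1_N x) * f x.
have l1 : lbm (\1_N : R -> R).
  split; first exact: measurable_indic.
  by move=> c d; exists 1 => x _; rewrite indicE; case: (_ \in _); rewrite /= ?normr1 ?normr0.
have lh : lbm h by apply: lbmD; apply: lbmM => //; apply: lbmB => //; exact: lbm_cst.
have -> : itg a b f = itg a b h.
  rewrite /itg /Rintegral; congr fine; apply: (@eq_integral_null _ _ R (@lebesgue_measure R) _ N) => // x _ Nx.
  by rewrite /h indicE memNset//= mul0r add0r subr0 mul1r.
apply: itg_le => // x xab; rewrite /h indicE; have [Nx|Nx] := pselect (N x).
  by rewrite mem_set//= mul1r subrr mul0r addr0.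
by rewrite memNset//= mul0r add0r subr0 mul1r fg.
Qed.

Lemma itg_ae_le a b f g : lbm f -> lbm g ->
  {ae @lebesgue_measure R, forall x, a <= x <= b -> f x <= g x} -> itg a b f <= itg a b g.
Proof.
move=> lf lg [N [mN N0 H]]; apply: (itg_null_le lf lg mN N0) => x xab Nx.
by apply: contrapT => fg; apply: Nx; apply: H => /= /(_ xab).
Qed.

Definition pos (z : R) : R := Num.max 0 z.

Definition sqpos (z : R) : R := pos z ^+ 2.

Lemma is_derive_sqpos z : is_derive z (1 : R) sqpos (2 * pos z).
Proof.
apply: is_derive_eps => e e0; exists e => // h he.
have : `|sqpos (z + h) - sqpos z - 2 * pos z * h| <= `|h| * `|h|.
  rewrite /sqpos -normrM ler_norml ger0_norm -?expr2 ?sqr_ge0// /pos.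
  by have [z0|z0] := leP 0 z; have [h0|h0] := leP 0 (z + h); apply/andP; split; nra.
by move=> H; apply: le_trans H _; rewrite ler_wpM2r// ltW.
Qed.

Lemma continuous_pos : continuous pos.
Proof. by move=> z; apply: continuous_max; [exact: cvg_cst|exact: cvg_id]. Qed.

(** A quadratic spline rising from 0 to 1 on [0, 1]. Its derivative is a tent, hence continuous as
    test functions require. *)
Definition ramp (z : R) : R := 2 * (sqpos z - 2 * sqpos (z - 2^-1) + sqpos (z - 1)).
Definition dramp (z : R) : R := 4 * (pos z - 2 * pos (z - 2^-1) + pos (z - 1)).

Lemma is_derive_ramp z : is_derive z (1 : R) ramp (dramp z).
Proof.
have D (c : R) := @der_shift R sqpos (2 * pos (z + c)) c z (is_derive_sqpos (z + c)).
apply: der_eq (derZ 2 (derD (derB (is_derive_sqpos z) (derZ 2 (D (- 2^-1)))) (D (- 1)))) _.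
by rewrite /dramp; ring.
Qed.

Lemma continuous_dramp : continuous dramp.
Proof.
move=> z; have C c : {for z, continuous (fun z => pos (z + c))}.
  apply: (@continuous_comp _ _ _ (fun z => z + c) pos); last exact: continuous_pos.
  by apply: cvgD; [exact: cvg_id|exact: cvg_cst].
apply: cvgM; first exact: cvg_cst.
apply: cvgD; last exact: C.
apply: cvgB; first exact: continuous_pos.
by apply: cvgM; [exact: cvg_cst|exact: C].
Qed.

Lemma ramp0 z : z <= 0 -> ramp z = 0.
Proof. by move=> z0; rewrite /ramp /sqpos /pos !max_l ?expr0n /=; lra. Qed.

Lemma ramp1 z : 1 <= z -> ramp z = 1.
Proof. by move=> z1; rewrite /ramp /sqpos /pos !max_r; lra. Qed.

Lemma ramp_itv z : 0 <= ramp z <= 1.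
Proof.
have [z0|z0] := leP z 0; first by rewrite ramp0// lexx ler01.
have [z1|z1] := leP 1 z; first by rewrite ramp1// lexx ler01.
rewrite /ramp /sqpos /pos (max_r (ltW z0)) (@max_l _ _ 0 (z - 1)); last lra.
by have [z2|z2] := leP 0 (z - 2^-1); apply/andP; split; nra.
Qed.

Lemma dramp_ge0 z : 0 <= dramp z.
Proof.
rewrite /dramp /pos.
by have [?|?] := leP 0 z; have [?|?] := leP 0 (z - 2^-1); have [?|?] := leP 0 (z - 1); lra.
Qed.

Lemma dramp_out z : z <= 0 \/ 1 <= z -> dramp z = 0.
Proof.
rewrite /dramp /pos => -[H|H].
  by rewrite !max_l; lra.
by rewrite !max_r; lra.
Qed.

Definition rampn n t z : R := ramp (n * (z - t)).
Definition drampn n t z : R := n * dramp (n * (z - t)).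

Lemma is_derive_rampn n t z : is_derive z (1 : R) (rampn n t) (drampn n t z).
Proof.
have D : is_derive z (1 : R) (fun z => n * (z - t)) n.
  by apply: der_eq (derZ n (derB (der_id z) (der_cst t z))) _; rewrite subr0 mulr1.
by apply: der_eq (derC (is_derive_ramp _) D) _; rewrite mulrC.
Qed.

Lemma continuous_drampn n t : continuous (drampn n t).
Proof.
move=> z; apply: cvgM; first exact: cvg_cst.
apply: (@continuous_comp _ _ _ (fun z => n * (z - t)) dramp); last exact: continuous_dramp.
by apply: cvgM; [exact: cvg_cst|apply: cvgB; [exact: cvg_id|exact: cvg_cst]].
Qed.

Lemma continuous_rampn n t : continuous (rampn n t).
Proof. by move=> z; exact: is_derive_continuous (is_derive_rampn n t z). Qed.

Lemma rampn0 n t z : 0 < n -> z <= t -> rampn n t z = 0.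
Proof. by move=> n0 zt; rewrite /rampn ramp0// pmulr_rle0// subr_le0. Qed.

Lemma rampn1 n t z : 0 < n -> t + n^-1 <= z -> rampn n t z = 1.
Proof.
by move=> n0 zt; rewrite /rampn ramp1// mulrC -ler_pdivrMr// mul1r lerBrDr addrC.
Qed.

(** [drampn n t] is nonnegative with integral 1 and support in [t, t + 1/n]: a Dirac mass at [t]
    approximated from the right. *)
Lemma itg_drampn n t a b f (e : R) : 0 < n -> continuous f -> a <= t -> t + n^-1 <= b ->
  (forall z, t <= z <= t + n^-1 -> `|f z - f t| <= e) ->
  `|itg a b (fun z => drampn n t z * f z) - f t| <= e.
Proof.
move=> n0 cf at_ tb fe.
have n1 : 0 < n^-1 by rewrite invr_gt0.
have ab : a <= b by rewrite (le_trans at_)// (le_trans _ tb)// lerDl ltW.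
have ld := continuous_lbm (@continuous_drampn n t).
have lf := continuous_lbm cf.
have E : itg a b (drampn n t) = 1.
  rewrite (itg_FTC (@continuous_drampn n t) (is_derive_rampn n t) ab).
  by rewrite rampn1// rampn0// subr0.
have E1 c : itg a b (fun z => drampn n t z * c) = c.
  rewrite (_ : (fun z => _) = (fun z => c * drampn n t z)); last by apply/funext => z; rewrite mulrC.
  by rewrite itgZ// E mulr1.
rewrite -[X in _ - X]E1 -itgB; [|exact: lbmM|by apply: lbmM => //; exact: lbm_cst].
have K z : `|drampn n t z * f z - drampn n t z * f t| <= drampn n t z * e.
  have d0 : 0 <= drampn n t z by rewrite mulr_ge0 ?dramp_ge0// ltW.
  rewrite -mulrBr normrM (ger0_norm d0).
  have [zt|zt] := leP z t.
    by rewrite /drampn dramp_out ?mulr0 ?mul0r//; left; rewrite pmulr_rle0// subr_le0.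
  have [tz|tz] := leP (t + n^-1) z.
    rewrite /drampn dramp_out ?mulr0 ?mul0r//; right.
    by rewrite mulrC -ler_pdivrMr// mul1r lerBrDr addrC.
  by rewrite ler_wpM2l// fe// (ltW zt) (ltW tz).
have lB : lbm (fun z => drampn n t z * f z - drampn n t z * f t).
  by apply: lbmB; apply: lbmM => //; exact: lbm_cst.
have le_ : lbm (fun z => drampn n t z * e) by apply: lbmM => //; exact: lbm_cst.
rewrite ler_norml -{1}(E1 (- e)) -{2}(E1 e); apply/andP; split; apply: itg_le => //.
- by apply: lbmM => //; exact: lbm_cst.
- by move=> z _; move: (K z); rewrite ler_norml mulrN => /andP[].
- by move=> z _; move: (K z); rewrite ler_norml => /andP[].
Qed.

Lemma itg_rampn n t a b F (M : R) : 0 < n -> lbm F -> a <= t -> t + n^-1 <= b ->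
  (forall z, a <= z <= b -> `|F z| <= M) ->
  `|itg a b (fun z => rampn n t z * F z) - itg t b F| <= M / n.
Proof.
move=> n0 lF at_ tb FM; have n1 : 0 < n^-1 by rewrite invr_gt0.
have tt : t <= t + n^-1 by rewrite lerDl ltW.
have tb' := le_trans tt tb.
have lr := continuous_lbm (@continuous_rampn n t).
have lrF : lbm (fun z => rampn n t z * F z) by exact: lbmM.
rewrite (itg_split lrF at_ tb') (@itg_eq _ a t _ (fun=> 0)); last first.
  by move=> z /andP[_ zt]; rewrite rampn0// mul0r.
rewrite itg_cst// mul0r add0r -itgB// (itg_split _ tt tb); last exact: lbmB.
rewrite (@itg_eq _ (t + n^-1) b _ (fun=> 0)); last first.
  by move=> z /andP[tz _]; rewrite rampn1// mul1r subrr.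
rewrite itg_cst// mul0r addr0.
have -> : M / n = M * (t + n^-1 - t) by rewrite addrAC subrr add0r.
apply: itg_norm_le => //; first exact: lbmB.
move=> z /andP[tz zt]; rewrite -{2}(mul1r (F z)) -mulrBl normrM -[leRHS]mul1r.
apply: ler_pM => //; last by apply: FM; rewrite (le_trans at_ tz) (le_trans zt tb).
by have := ramp_itv (n * (z - t)); rewrite -/(rampn n t z) ler_norml => /andP[? ?]; apply/andP; split; lra.
Qed.

End Ramp.

(** * Translation invariance of integrals *)

Section Translation.
Context {R : realType}.
Implicit Types (a b k : R) (f : R -> R).
Local Notation mu := (@lebesgue_measure R).

Lemma measurable_shift k : @measurable_fun _ _ (measurableTypeR R) (measurableTypeR R) setT (fun s => s + k).
Proof.
apply: (@continuous_measurable_fun R (fun s => s + k)) => s.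
by apply: cvgD; [exact: cvg_id|exact: cvg_cst].
Qed.

Let mshifted k : {measure set (measurableTypeR R) -> \bar R} :=
  measure_function_pushforward__canonical__measure_function_Measure mu (measurable_shift k).

Lemma lebesgue_measure_shift k (A : set (measurableTypeR R)) : measurable A ->
  mu ((fun s => s + k) @^-1` A) = mu A.
Proof.
move=> mA; apply/esym.
apply: (lebesgue_measure_unique (mu := mshifted k)) => // X [[a b] /= _ <-].
rewrite /= /pushforward (_ : _ @^-1` _ = `]a - k, b - k]%classic); last first.
  by apply/seteqP; split => s /=; rewrite !in_itv /= ltrBlDr lerBrDr.
by rewrite !lebesgue_measure_itv /= !lte_fin ltrD2r; case: ifP => // _;
  rewrite -!EFinB; congr EFin; lra.
Qed.

Lemma lbm_shift f k : lbm f -> lbm (fun s => f (s + k)).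
Proof.
move=> [m1 b1]; split; first exact: (measurableT_comp m1 (measurable_shift k)).
move=> a b; have [M HM] := b1 (a + k) (b + k); exists M => s /andP[? ?].
by apply: HM; rewrite !lerD2r; apply/andP.
Qed.

Lemma itg_shift f k a b : lbm f -> itg a b (fun s => f (s + k)) = itg (a + k) (b + k) f.
Proof.
move=> lf; rewrite /itg /Rintegral; congr fine.
have E : (fun s => s + k) @^-1` `[a + k, b + k]%classic = `[a, b]%classic.
  by apply/seteqP; split => s /=; rewrite !in_itv /= !lerD2r//.
transitivity (\int[mshifted k]_(y in `[(a + k)%R, (b + k)%R]) (f y)%:E)%E; last first.
  by apply: eq_measure_integral => A mA _; exact: lebesgue_measure_shift.
rewrite (integral_pushforward (measurable_shift k)) ?E//.
- by apply/measurable_EFinP; case: lf.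
- exact: (lbm_integrable a b (lbm_shift k lf)).
Qed.
End Translation.

(** * Functions whose derivative decreases at a bounded rate *)

Section Semiconvex.
Context {R : realType}.
Implicit Types (c e x y : R).

(** A derivative that cannot drop fast stays large on one side of [x]: to the right if it is
    positive, to the left if it is negative. Over a length [h] this would exceed the range [M]. *)
Lemma semiconvex_derive_bound (f f' : R -> R) c m M x h :
  (forall y, is_derive y (1 : R) f (f' y)) ->
  (forall a b, a <= b -> - c * (b - a) <= f' b - f' a) ->
  (forall y, m <= f y <= m + M) -> 0 <= c -> 0 < h -> `|f' x| <= M / h + c * h.
Proof.
move=> Df fc fb c0 h0.
have xh : x <= x + h by rewrite lerDl ltW.
have hx : x - h <= x by rewrite gerBl ltW.
have [y /andP[y1 y2] E] := MVT_le xh (fun y _ => Df y).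
have [z /andP[z1 z2] F] := MVT_le hx (fun y _ => Df y).
have := fc _ _ y1; have := fc _ _ z2; rewrite !mulNr.
have /andP[] := fb x; have /andP[] := fb (x + h); have /andP[] := fb (x - h).
have K1 : c * (y - x) <= c * h by rewrite ler_wpM2l//; lra.
have K2 : c * (x - z) <= c * h by rewrite ler_wpM2l//; lra.
have E1 : f' y = (f (x + h) - f x) / h by rewrite E; field; lra.
have F1 : f' z = (f x - f (x - h)) / h by rewrite F; field; lra.
have Y : f (x + h) - f x <= M -> f' y <= M / h by move=> ?; rewrite E1 ler_pM2r ?invr_gt0.
have Z : - M <= f x - f (x - h) -> - (M / h) <= f' z by move=> ?; rewrite F1 -mulNr ler_pM2r ?invr_gt0.
move: Y Z K1 K2; move: (M / h) (c * h) (c * (y - x)) (c * (x - z)) (f' x) (f' y) (f' z) => a1 a2 a3 a4 a5 a6 a7 Y Z.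
move=> *; have {}Y := Y ltac:(lra); have {}Z := Z ltac:(lra).
by rewrite ler_norml; apply/andP; split; lra.
Qed.

(** The arithmetic of the next lemma, with all function values abstracted to reals. *)
Lemma secant_squeeze (e h l c cy cz : R) : c <= e / 4 -> 0 < h ->
  forall fy fz fx f0 fp fm H0 Hp Hm : R,
  `|Hp - H0 - l * h| <= e / 4 * h -> `|Hm - H0 - l * - h| <= e / 4 * h ->
  `|H0 - f0| <= e * h / 8 -> `|Hp - fp| <= e * h / 8 -> `|Hm - fm| <= e * h / 8 ->
  fp - f0 = fy * h -> f0 - fm = fz * h ->
  - cy <= fy - fx -> - cz <= fx - fz -> cy <= c -> cz <= c -> `|l - fx| <= e.
Proof.
move=> ce h0 fy fz fx f0 fp fm H0 Hp Hm.
rewrite !ler_norml => /andP[? ?] /andP[? ?] /andP[? ?] /andP[? ?] /andP[? ?] E F G1 G2 C1 C2.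
have Y : fy <= l + e / 2 by rewrite -(ler_pM2r h0) -E mulrDl; lra.
have Z : l - e / 2 <= fz by rewrite -(ler_pM2r h0) -F mulrBl; lra.
by apply/andP; split; lra.
Qed.

(** As for convex functions, the derivative at [x] lies between the left and right secant slopes,
    here up to [c * h]; the secant slopes converge, and those of the limit are close to [l]. *)
Lemma semiconvex_derive_cvg (f f' : R -> R -> R) (H : R -> R) c x l r :
  0 < r -> is_derive x (1 : R) H l -> 0 <= c ->
  (forall y, `|y - x| < r -> f k y @[k --> +oo%R] --> H y) ->
  (\forall k \near +oo%R, forall y, is_derive y (1 : R) (f k) (f' k y)) ->
  (\forall k \near +oo%R, forall a b, a <= b -> - c * (b - a) <= f' k b - f' k a) ->
  f' k x @[k --> +oo%R] --> l.
Proof.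
move=> r0 DH c0 fH Df fc; apply/cvgrPdist_le => e e0.
have e4 : 0 < e / 4 by rewrite divr_gt0.
have [d d0 Hd] := is_derive_epsP DH e4.
(* Secants of length [h] have to see the derivative of [H], to stay where [f] converges, and to lose
   at most [c * h <= e / 4] through semiconvexity. *)
pose h := Num.min (Num.min d r) (e / 4 / (c + 1)) / 2.
have c1 : 0 < c + 1 by rewrite ltr_wpDl.
have m0 : 0 < Num.min (Num.min d r) (e / 4 / (c + 1)) by rewrite !lt_min d0 r0 divr_gt0.
have h0 : 0 < h by rewrite divr_gt0.
have hm : h < Num.min (Num.min d r) (e / 4 / (c + 1)) by rewrite /h; lra.
move: hm; rewrite !lt_min => /andP[/andP[hd hr] hc].
have ch : c * h <= e / 4.
  have : (c + 1) * h < e / 4 by rewrite mulrC -ltr_pdivlMr.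
  by have := ltW h0; lra.
have e' : 0 < e * h / 8 by rewrite !mulr_gt0// invr_gt0.
have C (y : R) : `|y - x| < r -> \forall k \near +oo%R, `|H y - f k y| <= e * h / 8.
  by move=> yr; have /cvgrPdist_le/(_ _ e') := fH y yr.
have Cx : \forall k \near +oo%R, `|H x - f k x| <= e * h / 8 by apply: C; rewrite subrr normr0.
have Cp : \forall k \near +oo%R, `|H (x + h) - f k (x + h)| <= e * h / 8.
  by apply: C; rewrite addrC addKr gtr0_norm.
have Cm : \forall k \near +oo%R, `|H (x - h) - f k (x - h)| <= e * h / 8.
  by apply: C; rewrite addrC addKr normrN gtr0_norm.
have := Hd h; have := Hd (- h); rewrite normrN (gtr0_norm h0) => /(_ hd) Hm /(_ hd) Hp.
near=> k.
have Kx : `|H x - f k x| <= e * h / 8 by near: k.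
have Kp : `|H (x + h) - f k (x + h)| <= e * h / 8 by near: k.
have Km : `|H (x - h) - f k (x - h)| <= e * h / 8 by near: k.
have Dk : forall y, is_derive y (1 : R) (f k) (f' k y) by near: k.
have Fk : forall a b, a <= b -> - c * (b - a) <= f' k b - f' k a by near: k.
have xh : x <= x + h by rewrite lerDl ltW.
have hx : x - h <= x by rewrite gerBl ltW.
have [y /andP[y1 y2] E] := MVT_le xh (fun y _ => Dk y).
have [z /andP[z1 z2] F] := MVT_le hx (fun y _ => Dk y).
have G1 := Fk _ _ y1; have G2 := Fk _ _ z2.
have K1 : c * (y - x) <= c * h by rewrite ler_wpM2l// lerBlDl.
have K2 : c * (x - z) <= c * h by rewrite ler_wpM2l// lerBlDr -lerBlDl.
have E1 : f k (x + h) - f k x = f' k y * h by rewrite E addrAC subrr add0r.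
have F1 : f k x - f k (x - h) = f' k z * h by rewrite F opprB addrCA subrr addr0.
move: Hp Hm Kx Kp Km E1 F1 G1 G2 K1 K2; rewrite mulNr !mulNr.
move: (f' k y) (f' k z) (f' k x) (f k x) (f k (x + h)) (f k (x - h)) (H x) (H (x + h)) (H (x - h)).
move: (c * (y - x)) (c * (x - z)) ch h0; move: (c * h) => ch' yx xz ch h0.
exact: secant_squeeze.
Unshelve. all: by end_near.
Qed.

End Semiconvex.

(** * Limits at infinity and Cesaro means *)

Section AtInfinity.
Context {R : realType}.
Implicit Types (P : R -> Prop) (f : R -> R) (l e : R).

Lemma evtP P : (\forall x \near +oo%R, P x) <-> exists X, forall x, X <= x -> P x.
Proof.
split=> [[X [_ HX]]|[X HX]].
  by exists (X + 1) => x Xx; apply: HX; rewrite (lt_le_trans _ Xx)// ltrDl.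
by exists X; split=> [|x /ltW]; [exact: num_real|exact: HX].
Qed.

Lemma evt_gt X : \forall x \near +oo%R, (X : R) < x.
Proof. by apply: nbhs_pinfty_gt; exact: num_real. Qed.

Lemma evt_ge X : \forall x \near +oo%R, (X : R) <= x.
Proof. by apply: nbhs_pinfty_ge; exact: num_real. Qed.

Lemma cvgyP f l : (forall e, 0 < e -> \forall x \near +oo%R, `|f x - l| <= e) <->
  f x @[x --> +oo%R] --> l.
Proof.
split=> [H|/cvgrPdist_le H e e0].
  by apply/cvgrPdist_le => e /H; apply: filterS => x; rewrite distrC.
by have := H _ e0; apply: filterS => x; rewrite distrC.
Qed.

Lemma near_comp (k : R -> R) P : (forall X, \forall x \near +oo%R, X <= k x) ->
  (\forall x \near +oo%R, P x) -> \forall x \near +oo%R, P (k x).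
Proof. by move=> Hk /evtP[X HX]; have := Hk X; apply: filterS => x /HX. Qed.

Lemma cvgy_comp f l (k : R -> R) : (forall X, \forall x \near +oo%R, X <= k x) ->
  f x @[x --> +oo%R] --> l -> f (k x) @[x --> +oo%R] --> l.
Proof. by move=> Hk /cvgyP H; apply/cvgyP => e /H; apply: near_comp. Qed.

Lemma near_scale (c X : R) : 0 < c -> \forall x \near +oo%R, X <= c * x.
Proof.
move=> c0; apply: filterS (evt_ge (X / c)) => x.
by rewrite ler_pdivrMr// mulrC.
Qed.

Lemma near_sq (c X : R) : 0 < c -> \forall x \near +oo%R, X <= x ^+ 2 * c.
Proof.
move=> c0; apply: filterS2 (evt_ge 1) (near_scale X c0) => x x1 /le_trans; apply.
by rewrite mulrC ler_pM2r// expr2 ler_peMr// (le_trans ler01).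
Qed.

Lemma near_sqrt (c X : R) : 0 < c -> \forall x \near +oo%R, X <= c * Num.sqrt x.
Proof.
move=> c0; apply: filterS (evt_ge ((X / c) ^+ 2)) => x Xx.
have [X0|X0] := leP X 0; first by rewrite (le_trans X0)// mulr_ge0 ?sqrtr_ge0// ltW.
rewrite mulrC -ler_pdivrMr// -(ger0_norm (_ : 0 <= X / c)); last by rewrite divr_ge0// ltW.
by rewrite -sqrtr_sqr ler_wsqrtr.
Qed.

Lemma lt_of_dist_half (a b c : R) : a < c -> `|b - a| <= (c - a) / 2 -> b < c.
Proof. by move=> ac; rewrite ler_norml => /andP[_ ?]; lra. Qed.

(** Between two neighbouring points of a grid fine enough for [f], monotonicity traps [g k]; so
    pointwise convergence at finitely many grid points is enough. *)
Lemma monotone_uniform (g : R -> R -> R) f T e : continuous f -> 0 <= T -> 0 < e ->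
  (\forall k \near +oo%R, forall s t, 0 <= s -> s <= t -> g k t <= g k s) ->
  (forall t, 0 <= t -> g k t @[k --> +oo%R] --> f t) ->
  \forall k \near +oo%R, forall t, 0 <= t <= T -> `|g k t - f t| <= e.
Proof.
move=> cf T0 e0 gm gf; have e4 : 0 < e / 4 by rewrite divr_gt0.
have cF : cont2 (fun x _ => f x).
  by move=> z; apply: (@continuous_comp _ _ _ fst f); [exact: cvg_fst|exact: cf].
have [d d0 Hd] := @cont2_unif _ (fun x _ => f x) 0 (T + 1) 0 0 _ (fun _ _ _ _ => cF _) e4.
have {}Hd s t : 0 <= s -> 0 <= t -> s <= T + 1 -> t <= T + 1 -> `|t - s| < d -> `|f t - f s| <= e / 4.
  move=> s0 t0 sT tT st; apply: (Hd s 0 t 0) => //; rewrite ?lexx ?s0 ?sT//.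
  by rewrite subrr normr0.
pose m := Num.min d 1 / 2.
have m0 : 0 < Num.min d 1 by rewrite lt_min d0 ltr01.
have mm : 0 < m by rewrite divr_gt0.
have [md m1] : m < d /\ m < 1.
  by apply/andP; rewrite -lt_min /m; lra.
have K (n : nat) : \forall k \near +oo%R, forall j, (j <= n)%N -> `|g k (j%:R * m) - f (j%:R * m)| <= e / 4.
  elim: n => [|n IH].
    have /cvgyP/(_ _ e4) := gf 0 (lexx 0); apply: filterS => k H j; rewrite leqn0 => /eqP ->.
    by rewrite mul0r.
  have nm : 0 <= n.+1%:R * m by rewrite mulr_ge0// ltW.
  have /cvgyP/(_ _ e4) := gf _ nm; apply: filterS2 IH => k IH H j.
  by rewrite leq_eqVlt ltnS => /predU1P[->//|]; exact: IH.
have := K (Num.truncn (T / m)).+1; apply: filterS2 gm => k gm Hk t /andP[t0 tT].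
pose j := Num.truncn (t / m).
have tm0 : 0 <= t / m by rewrite divr_ge0// ltW.
have /andP[j1 j2] := truncn_itv tm0.
have jn : (j <= Num.truncn (T / m))%N by apply: le_truncn; rewrite ler_pM2r ?invr_gt0.
have {}j1 : j%:R * m <= t by rewrite -ler_pdivlMr.
have {}j2 : t < j.+1%:R * m by rewrite -ltr_pdivrMr.
have jm : 0 <= j%:R * m by rewrite mulr_ge0// ltW.
have Sj : j.+1%:R * m = j%:R * m + m by rewrite -natr1 mulrDl mul1r.
have H1 := Hk j (leq_trans jn (leqnSn _)).
have H2 := Hk j.+1; rewrite ltnS in H2; have {}H2 := H2 jn.
have G1 := gm _ _ jm j1; have G2 := gm _ _ t0 (ltW j2).
have tT1 : t <= T + 1 by rewrite (le_trans tT)// lerDl.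
have Sj0 : 0 <= j.+1%:R * m by rewrite mulr_ge0// ltW.
have SjT : j.+1%:R * m <= T + 1 by rewrite Sj lerD ?(ltW m1)// (le_trans j1).
have F1 : `|f (j%:R * m) - f t| <= e / 4.
  apply: Hd => //; first exact: le_trans tT1.
  by rewrite distrC ger0_norm ?subr_ge0// ltrBlDl (lt_trans j2)// Sj ltrD2l.
have F2 : `|f (j.+1%:R * m) - f t| <= e / 4.
  by apply: Hd => //; rewrite ger0_norm ?subr_ge0 ?(ltW j2)// ltrBlDl Sj ler_ltD.
move: H1 H2 F1 F2; rewrite !ler_norml => /andP[A1 A2] /andP[B1 B2] /andP[C1 C2] /andP[D1 D2].
by clear -A1 A2 B1 B2 C1 C2 D1 D2 G1 G2; apply/andP; split; lra.
Qed.

End AtInfinity.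

Section Limits.
Context {R : realType}.

Lemma near_le_lim (h1 h2 : R -> R) (l1 l2 : R) : h1 k @[k --> +oo%R] --> l1 -> h2 k @[k --> +oo%R] --> l2 ->
  (\forall k \near +oo%R, h1 k <= h2 k) -> l1 <= l2.
Proof.
move=> /cvgyP H1 /cvgyP H2 H; apply/ler_addgt0Pr => e e0.
have e2 : 0 < e / 2 by rewrite divr_gt0.
have {}H1 := H1 _ e2; have {}H2 := H2 _ e2; near (pinfty_nbhs R) => k.
have K1 : `|h1 k - l1| <= e / 2 by near: k.
have K2 : `|h2 k - l2| <= e / 2 by near: k.
have K : h1 k <= h2 k by near: k.
by move: K1 K2; rewrite !ler_norml => /andP[? ?] /andP[? ?]; lra.
Unshelve. all: by end_near.
Qed.

Lemma lim_unique (h : R -> R) (l1 l2 : R) :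
  h k @[k --> +oo%R] --> l1 -> h k @[k --> +oo%R] --> l2 -> l1 = l2.
Proof.
move=> H1 H2; apply/eqP; rewrite eq_le.
by rewrite (near_le_lim H1 H2) ?(near_le_lim H2 H1)//; exact: filterE.
Qed.

End Limits.

(** * Equalities and derivatives obtained from one side or from increments *)

Section OneSided.
Context {R : realType}.
Implicit Types (f F : R -> R) (x r l : R).

Lemma cont_right_ge0 f x r : 0 < r -> {for x, continuous f} ->
  (forall y, x < y -> y < x + r -> 0 <= f y) -> 0 <= f x.
Proof.
move=> r0 /cont_eps cf H; rewrite leNgt; apply/negP => f0.
have [d d0 Hd] := cf (- f x / 2) ltac:(lra).
pose h := Num.min d r / 2.
have m0 : 0 < Num.min d r by rewrite lt_min d0.
have [hd hr] : h < d /\ h < r by apply/andP; rewrite -lt_min /h; lra.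
have h0 : 0 < h by rewrite /h divr_gt0.
have := Hd (x + h); rewrite addrAC subrr add0r gtr0_norm// => /(_ hd).
by have := H (x + h) ltac:(lra) ltac:(lra); rewrite ler_norml => ? /andP[? ?]; lra.
Qed.

Lemma cont_right_eq f g x r : 0 < r -> {for x, continuous f} -> {for x, continuous g} ->
  (forall y, x < y -> y < x + r -> f y = g y) -> f x = g x.
Proof.
move=> r0 cf cg H; apply/eqP; rewrite eq_le -subr_ge0 -[X in _ && X]subr_ge0.
by apply/andP; split; [apply: (@cont_right_ge0 (fun y => g y - f y) x r r0)|
    apply: (@cont_right_ge0 (fun y => f y - g y) x r r0)];
  try (by apply: cvgB); move=> y y1 y2; rewrite (H y y1 y2) subrr.
Qed.

Lemma cont_left_eq f g x r : 0 < r -> {for x, continuous f} -> {for x, continuous g} ->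
  (forall y, x - r < y -> y < x -> f y = g y) -> f x = g x.
Proof.
move=> r0 cf cg H.
have cN (h : R -> R) : {for x, continuous h} -> {for - x, continuous (fun y => h (- y))}.
  move=> ch; apply: (@continuous_comp _ _ _ (fun y => - y) h); first exact: opp_continuous.
  by rewrite opprK.
have := @cont_right_eq _ _ _ _ r0 (cN _ cf) (cN _ cg); rewrite opprK; apply.
by move=> y y1 y2; apply: H; lra.
Qed.

(** The scaling limit controls increments over [a, b] only by slopes that depend on both endpoints;
    this turns such control into a derivative. *)
Lemma derive_sandwich F (L U : R -> R -> R) x l r : 0 < r ->
  (forall a b, x - r < a -> a <= b -> b < x + r ->
    L a b * (b - a) <= F b - F a <= U a b * (b - a)) ->
  (forall e : R, 0 < e -> exists2 d : R, 0 < d & forall a b, `|a - x| < d -> `|b - x| < d ->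
    l - e <= L a b /\ U a b <= l + e) ->
  is_derive x (1 : R) F l.
Proof.
move=> r0 H K; apply: is_derive_eps => e e0; have [d d0 Hd] := K e e0.
exists (Num.min d r); first by rewrite lt_min d0.
move=> h; rewrite lt_min => /andP[hd]; rewrite ltr_norml => /andP[hr1 hr2].
have [h0|h0] := leP 0 h.
  have [||L1 U1] := Hd x (x + h); [by rewrite subrr normr0|by rewrite addrAC subrr add0r|].
  have /andP[] := H x (x + h) ltac:(lra) ltac:(lra) ltac:(lra).
  have -> : x + h - x = h by ring.
  have := ler_wpM2r h0 L1; have := ler_wpM2r h0 U1; rewrite mulrBl mulrDl.
  by rewrite (ger0_norm h0) ler_norml => *; apply/andP; split; lra.
have [||L1 U1] := Hd (x + h) x; [by rewrite addrAC subrr add0r|by rewrite subrr normr0|].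
have /andP[] := H (x + h) x ltac:(lra) ltac:(lra) ltac:(lra).
have -> : x - (x + h) = - h by ring.
have hN : 0 <= - h by lra.
have := ler_wpM2r hN L1; have := ler_wpM2r hN U1; rewrite mulrBl mulrDl.
by rewrite (ltr0_norm h0) ler_norml => *; apply/andP; split; lra.
Qed.

Lemma zero_derive_const f a b : a <= b ->
  (forall x, a <= x <= b -> is_derive x (1 : R) f 0) -> f a = f b.
Proof.
move=> ab D; have [c _ E] := MVT_le ab D; apply/esym/eqP.
by rewrite -subr_eq0 E mul0r.
Qed.

Lemma der_near f F x l r : 0 < r -> (forall y, `|y - x| < r -> f y = F y) ->
  is_derive x (1 : R) f l -> is_derive x (1 : R) F l.
Proof.
move=> r0 H /is_derive_epsP D; apply: is_derive_eps => e e0; have [d d0 Hd] := D e e0.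
exists (Num.min d r); first by rewrite lt_min d0.
move=> h; rewrite lt_min => /andP[hd hr]; rewrite -!H ?subrr ?normr0//; first exact: Hd.
by rewrite addrAC subrr add0r.
Qed.

Lemma gs_mulV (c z : R) : gs (- c) z * gs c z = 1.
Proof. by rewrite /gs -expRD mulNr opprK subrr expR0. Qed.

Lemma gs_decr (c y z : R) : 0 <= c -> 0 <= y -> y <= z -> gs c z <= gs c y.
Proof.
move=> c0 y0 yz; rewrite ler_expR lerN2 ler_wpM2l// ler_pXn2r ?nnegrE//.
exact: le_trans yz.
Qed.

End OneSided.

(** * Means of a density with weight x^2, and its tails *)

Section Averages.
Context {R : realType}.
Implicit Types (x y r e : R).

(** Dividing by [r] repeatedly brings every x >= X into [X, r X], and [T] does not decrease on the
    way. *)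
Lemma scaling_bound (T : R -> R) X M r : 0 < X -> 1 < r ->
  (forall x, X <= x -> T (r * x) <= T x) ->
  (forall x, X <= x <= r * X -> T x <= M) -> forall x, X <= x -> T x <= M.
Proof.
move=> X0 r1 HT HM; have r0 : 0 < r by lra.
(* As long as x / r >= X, a division by [r] shortens [x] by at least [s], which bounds the number of
   divisions. *)
pose s := X * (r - 1).
have s0 : 0 < s by rewrite mulr_gt0// subr_gt0.
suff K (n : nat) x : X <= x -> x <= r * X + n%:R * s -> T x <= M.
  move=> x Xx; apply: (K (Num.bound (x / s))) => //.
  have xs0 : 0 <= x / s by rewrite divr_ge0 ?(ltW s0)// (le_trans (ltW X0)).
  have /ltW := archi_boundP xs0; rewrite ler_pdivrMr// => H.
  by apply: le_trans H _; rewrite lerDr mulr_ge0// ltW.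
elim: n x => [|n IH] x Xx; first by rewrite mul0r addr0 => xr; apply: HM; rewrite Xx.
rewrite -natr1 mulrDl mul1r => xr; have [xX|xX] := leP x (r * X); first by apply: HM; rewrite Xx.
have -> : x = r * (x / r) by field; rewrite gt_eqF.
have Xy : X <= x / r by rewrite ler_pdivlMr// mulrC ltW.
apply: le_trans (HT _ Xy) _; apply: IH => //.
have : (x / r) * (r - 1) >= X * (r - 1) by rewrite ler_wpM2r// subr_ge0 ltW.
have -> : x / r * (r - 1) = x - x / r by field; rewrite gt_eqF.
by rewrite -/s; lra.
Qed.

Lemma pick_small (A B M : R) : 0 < A -> 0 < M ->
  exists e, [/\ 0 < e, e <= M & e + e * B <= A].
Proof.
move=> A0 M0; have B1 : 0 < 1 + `|B| by rewrite ltr_pwDl.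
exists (Num.min M (A / (1 + `|B|))); split.
- by rewrite lt_min M0 divr_gt0.
- by rewrite ge_min lexx.
set e := Num.min _ _; have e0 : 0 < e by rewrite lt_min M0 divr_gt0.
have : e * (1 + `|B|) <= A by rewrite -ler_pdivlMr// ge_min lexx orbT.
by have := ler_wpM2l (ltW e0) (ler_norm B); rewrite mulrDr mulr1; lra.
Qed.

Variable q : R -> R.
Hypotheses (lq : lbm q) (q01 : forall x, 0 <= q x <= 1).

Let l2q : lbm (fun x => x ^+ 2 * q x).
Proof.
apply: lbmM => //; apply: continuous_lbm => x.
exact: (@exprn_continuous R 2 x).
Qed.

Definition moment x := itg 0 x (fun x => x ^+ 2 * q x).

Lemma momentB x y : 0 <= x -> x <= y -> itg x y (fun x => x ^+ 2 * q x) = moment y - moment x.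
Proof. by move=> x0 xy; rewrite /moment (itg_split l2q x0 xy) addrAC subrr add0r. Qed.

Lemma moment_mono x y : 0 <= x -> x <= y -> moment x <= moment y.
Proof.
move=> x0 xy; rewrite -subr_ge0 -momentB// -[0](mul0r (y - x)) -itg_cst//.
apply: itg_le => //; first exact: lbm_cst.
by move=> z _; have /andP[q0 _] := q01 z; rewrite mulr_ge0// sqr_ge0.
Qed.

Lemma moment_ge0 x : 0 <= x -> 0 <= moment x.
Proof. by move=> x0; have := moment_mono (lexx 0) x0; rewrite /moment itg_xx. Qed.

(** Increments over geometric windows telescope: [moment x - C * x] does not grow from [x] to
    [r * x], so it stays bounded above and is negligible after division by [x]. *)
Lemma mean_upper r C e : 1 < r -> 0 < e ->
  (\forall x \near +oo%R, moment (r * x) - moment x <= C * (r - 1) * x) ->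
  \forall x \near +oo%R, moment x / x <= C + e.
Proof.
move=> r1 e0 /evtP[X0 HX]; pose X := Num.max X0 1.
have X1 : 0 < X by rewrite lt_max ltr01 orbT.
have rX : 0 <= r * X by rewrite mulr_ge0// ?ltW//; lra.
pose M := moment (r * X) + `|C| * (r * X).
have B : forall x, X <= x -> moment x - C * x <= M.
  apply: (@scaling_bound (fun x => moment x - C * x) X M r X1 r1) => x.
    rewrite ge_max => /andP[Xx _]; have := HX x Xx.
    by rewrite (_ : C * (r * x) = C * (r - 1) * x + C * x); [lra|ring].
  move=> /andP[Xx xr]; have x0 : 0 <= x by rewrite (le_trans (ltW X1)).
  have := moment_mono x0 xr; have : - C * x <= `|C| * (r * X).
    by rewrite (le_trans (ler_norm _))// normrM normrN (ger0_norm x0) ler_wpM2l.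
  by rewrite /M; lra.
apply: filterS3 (evt_ge X) (evt_gt 0) (near_scale M e0) => x Xx x0 Me.
by rewrite ler_pdivrMr// mulrDl; have := B x Xx; lra.
Qed.

Lemma mean_lower r C e : 1 < r -> 0 < e ->
  (\forall x \near +oo%R, C * (r - 1) * x <= moment (r * x) - moment x) ->
  \forall x \near +oo%R, C - e <= moment x / x.
Proof.
move=> r1 e0 /evtP[X0 HX]; pose X := Num.max X0 1.
have X1 : 0 < X by rewrite lt_max ltr01 orbT.
have rX : 0 <= r * X by rewrite mulr_ge0// ?ltW//; lra.
pose M := `|C| * (r * X).
have B : forall x, X <= x -> C * x - moment x <= M.
  apply: (@scaling_bound (fun x => C * x - moment x) X M r X1 r1) => x.
    rewrite ge_max => /andP[Xx _]; have := HX x Xx.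
    by rewrite (_ : C * (r * x) = C * (r - 1) * x + C * x); [lra|ring].
  move=> /andP[Xx xr]; have x0 : 0 <= x by rewrite (le_trans (ltW X1)).
  have := moment_ge0 x0; have : C * x <= `|C| * (r * X).
    rewrite (le_trans (ler_norm _))// normrM (ger0_norm x0) ler_wpM2l//.
  by rewrite /M; lra.
apply: filterS3 (evt_ge X) (evt_gt 0) (near_scale M e0) => x Xx x0 Me.
by rewrite ler_pdivlMr// mulrBl; have := B x Xx; lra.
Qed.

Variable gamma : R.
Hypothesis gamma_ge0 : 0 <= gamma.
Hypothesis mean_lim : moment x / x @[x --> +oo%R] --> gamma.

Lemma moment_ratio r e : 1 < r -> 0 < e -> \forall x \near +oo%R,
  `|moment (r * x) - moment x - gamma * (r - 1) * x| <= e * (r + 1) * x.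
Proof.
move=> r1 e0; have r0 : 0 < r by lra.
have /cvgyP/(_ _ e0) H := mean_lim; have H' := near_comp (fun X => near_scale X r0) H.
apply: filterS3 H H' (evt_gt 0) => x + + x0.
have rx0 : 0 < r * x by rewrite mulr_gt0.
have -> : moment x / x - gamma = (moment x - gamma * x) / x by field; rewrite gt_eqF.
have -> : moment (r * x) / (r * x) - gamma = (moment (r * x) - gamma * (r * x)) / (r * x).
  by field; rewrite !gt_eqF.
rewrite !normrM !normfV (gtr0_norm x0) (gtr0_norm rx0) !ler_pdivrMr// !ler_norml.
by move=> /andP[? ?] /andP[? ?]; apply/andP; split; lra.
Qed.

Lemma window_bounds r y : 1 < r -> 0 < y ->
  itg y (r * y) q <= (moment (r * y) - moment y) / y ^+ 2 /\
  (moment (r * y) - moment y) / (r * y) ^+ 2 <= itg y (r * y) q.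
Proof.
move=> r1 y0; have yr : y <= r * y by rewrite ler_peMl// ltW.
have ry0 : 0 < r * y by exact: lt_le_trans yr.
rewrite -momentB ?(ltW y0)// ler_pdivlMr ?exprn_gt0// ler_pdivrMr ?exprn_gt0//.
rewrite !(mulrC (itg y (r * y) q)) -!itgZ//; split; apply: itg_le => //;
  try (by apply: lbmM => //; exact: lbm_cst); move=> z /andP[z1 z2];
  have /andP[q0 _] := q01 z; rewrite ler_wpM2r// ler_pXn2r ?nnegrE ?(ltW y0) ?(ltW ry0)//;
  exact: le_trans (ltW y0) z1.
Qed.

(** On a short geometric window xi^2 is nearly constant, so [y, r y] carries about gamma (r - 1) / y
    of the mass of [q]; these amounts form a geometric series with sum close to gamma / x. *)
Lemma tail_upper e : 0 < e ->
  \forall x \near +oo%R, forall y, x <= y -> x * itg x y q <= gamma + e.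
Proof.
move=> e0.
pose d := Num.min 1 (e / (2 * (2 * gamma + 1))).
have g1 : 0 < 2 * gamma + 1 by rewrite ltr_wpDl// mulr_ge0.
have d0 : 0 < d by rewrite lt_min ltr01 divr_gt0// mulr_gt0.
have d1 : d <= 1 by rewrite ge_min lexx.
have dg : (2 * gamma + 1) * d <= e / 2.
  rewrite mulrC -ler_pdivlMr//; rewrite (le_trans (_ : d <= e / (2 * (2 * gamma + 1)))) ?ge_min ?lexx ?orbT//.
  by rewrite le_eqVlt; apply/orP; left; apply/eqP; field; rewrite !gt_eqF.
pose r := 1 + d; have r1 : 1 < r by rewrite /r; lra.
have r0 : 0 < r by lra.
(* The factor [d] is needed because one window contributes only about gamma d, to which the error
   has to be compared. *)
pose e1 := e * d / 18.
have e10 : 0 < e1 by rewrite divr_gt0// mulr_gt0.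
have /evtP[X HX] := moment_ratio r1 e10.
pose U := gamma * d + 3 * e1.
have U0 : 0 <= U by rewrite addr_ge0// mulr_ge0// ltW.
have W y : X <= y -> 0 < y -> itg y (r * y) q <= U / y.
  move=> Xy y0; have [K _] := window_bounds r1 y0; apply: le_trans K _.
  have := HX y Xy; rewrite ler_norml => /andP[_ K].
  rewrite ler_pdivrMr ?exprn_gt0// (_ : U / y * y ^+ 2 = U * y); last by field; rewrite gt_eqF.
  have : e1 * (r + 1) * y <= 3 * e1 * y.
    by rewrite ler_pM2r// mulrC ler_pM2r// /r; lra.
  by rewrite /U mulrDl; rewrite (_ : r - 1 = d) in K; [lra|rewrite /r; ring].
apply: filterS2 (evt_ge X) (evt_gt 0) => x Xx x0 y xy.
(* Chosen so that A / z = U / z + A / (r z): the term A / z stands for the rest of the geometric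
   series after [z]. *)
pose A := U * r / d.
have A0 : 0 <= A by rewrite divr_ge0 ?mulr_ge0// ltW.
have I a b : x <= a -> a <= b -> itg x b q = itg x a q + itg a b q.
  by move=> xa ab; exact: itg_split.
have P a b : a <= b -> 0 <= itg a b q.
  move=> ab; rewrite -[0](mul0r (b - a)) -itg_cst//; apply: itg_le => //; first exact: lbm_cst.
  by move=> z _; case/andP: (q01 z).
have B : forall z, x <= z -> itg x z q + A / z <= (U + A) / x.
  apply: (@scaling_bound (fun z => itg x z q + A / z) x _ r x0 r1) => z.
    move=> xz; have z0 : 0 < z by exact: lt_le_trans xz.
    have zr : z <= r * z by rewrite ler_peMl// ltW.
    rewrite (I z (r * z) xz zr) -addrA lerD2l.
    have := W z (le_trans Xx xz) z0.
    have -> : A / z = U / z + A / (r * z) by rewrite /A /r; field; rewrite !gt_eqF// -/r; lra.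
    by lra.
  move=> /andP[xz zr]; have z0 : 0 < z by exact: lt_le_trans xz.
  rewrite mulrDl lerD//; last by rewrite ler_wpM2l// lef_pV2.
  apply: le_trans (W x Xx x0).
  by rewrite (I z (r * x) xz zr) lerDl P.
have y0 : 0 < y by exact: lt_le_trans xy.
have Ay : 0 <= A / y by rewrite divr_ge0// ltW.
have K : itg x y q <= (U + A) / x by have := B y xy; lra.
rewrite mulrC -ler_pdivlMr//; apply: le_trans K _; rewrite ler_pM2r ?invr_gt0//.
have AE : A = U / d + U by rewrite /A /r; field; rewrite gt_eqF.
have UE : U / d = gamma + e / 6 by rewrite /U /e1; field; rewrite gt_eqF.
have E1 : e * d <= e by rewrite ler_piMr// ltW.
by rewrite AE UE /U /e1; lra.
Qed.

(** The counterpart of [tail_upper]; cutting the tail at [y] loses at most A / y, so [y] has to be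
    large depending on [x]. *)
Lemma tail_lower e : 0 < e ->
  \forall x \near +oo%R, \forall y \near +oo%R, gamma - e <= x * itg x y q.
Proof.
move=> e0.
pose d := Num.min 1 (e / (2 * (2 * gamma + 1))).
have g1 : 0 < 2 * gamma + 1 by rewrite ltr_wpDl// mulr_ge0.
have d0 : 0 < d by rewrite lt_min ltr01 divr_gt0// mulr_gt0.
have dg : (2 * gamma + 1) * d <= e / 2.
  rewrite mulrC -ler_pdivlMr//; rewrite (le_trans (_ : d <= e / (2 * (2 * gamma + 1)))) ?ge_min ?lexx ?orbT//.
  by rewrite le_eqVlt; apply/orP; left; apply/eqP; field; rewrite !gt_eqF.
have d1 : d <= 1 by rewrite ge_min lexx.
pose r := 1 + d; have r1 : 1 < r by rewrite /r; lra.
have r0 : 0 < r by lra.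
pose e1 := e * d / 18.
have e10 : 0 < e1 by rewrite divr_gt0// mulr_gt0.
have P a b : a <= b -> 0 <= itg a b q.
  move=> ab; rewrite -[0](mul0r (b - a)) -itg_cst//; apply: itg_le => //; first exact: lbm_cst.
  by move=> z _; case/andP: (q01 z).
(* If gamma <= e, positivity of the integral is enough; otherwise the lower window mass [L] is
   nonnegative. *)
have [ge|lt] := leP gamma e.
  apply: filterS (evt_gt 0) => x x0; apply: filterS (evt_ge x) => y xy.
  by have := mulr_ge0 (ltW x0) (P x y xy); lra.
have /evtP[X HX] := moment_ratio r1 e10.
pose L := (gamma * d - 3 * e1) / r ^+ 2.
have N0 : 0 <= gamma * d - 3 * e1.
  have : e * d < gamma * d by rewrite ltr_pM2r.
  by have : 0 < e * d by [rewrite mulr_gt0]; rewrite /e1; lra.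
have L0 : 0 <= L by rewrite divr_ge0// sqr_ge0.
have W y : X <= y -> 0 < y -> L / y <= itg y (r * y) q.
  move=> Xy y0; have [_ K] := window_bounds r1 y0; apply: le_trans K.
  have := HX y Xy; rewrite ler_norml => /andP[K _].
  have ry0 : 0 < r * y by rewrite mulr_gt0.
  rewrite ler_pdivlMr ?exprn_gt0// (_ : L / y * (r * y) ^+ 2 = (gamma * d - 3 * e1) * y); last first.
    by rewrite /L; field; rewrite !gt_eqF// mulr_gt0.
  have : e1 * (r + 1) * y <= 3 * e1 * y.
    by rewrite ler_pM2r// mulrC ler_pM2r// /r; lra.
  by rewrite mulrBl; rewrite (_ : r - 1 = d) in K; [lra|rewrite /r; ring].
apply: filterS2 (evt_ge X) (evt_gt 0) => x Xx x0.
pose A := L * r / d.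
have A0 : 0 <= A by rewrite divr_ge0 ?(ltW d0)// mulr_ge0// ltW.
have I a b : x <= a -> a <= b -> itg x b q = itg x a q + itg a b q.
  by move=> xa ab; exact: itg_split.
have B : forall z, x <= z -> - (itg x z q + A / z) <= - (A / (r * x)).
  apply: (@scaling_bound (fun z => - (itg x z q + A / z)) x _ r x0 r1) => z.
    move=> xz; have z0 : 0 < z by exact: lt_le_trans xz.
    have zr : z <= r * z by rewrite ler_peMl// ltW.
    rewrite (I z (r * z) xz zr) lerN2 -addrA lerD2l.
    have := W z (le_trans Xx xz) z0.
    have -> : A / z = L / z + A / (r * z) by rewrite /A /r; field; rewrite !gt_eqF// -/r; lra.
    by lra.
  move=> /andP[xz zr]; have z0 : 0 < z by exact: lt_le_trans xz.
  rewrite lerN2 -[leLHS]add0r lerD ?P//.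
  by rewrite ler_wpM2l// lef_pV2 ?posrE// mulr_gt0.
have A1 : 0 < e / 3 by rewrite divr_gt0.
apply: filterS3 (evt_ge x) (evt_gt 0) (near_scale (A * x) A1) => y xy y0 Ay.
have K : A / (r * x) - A / y <= itg x y q by have := B y xy; lra.
have : x * (A / (r * x) - A / y) <= x * itg x y q by rewrite ler_wpM2l// ltW.
have -> : x * (A / (r * x) - A / y) = A / r - A * x / y by field; rewrite !gt_eqF.
have : A * x / y <= e / 3 by rewrite ler_pdivrMr.
have : (gamma - e / 6) * (1 - 2 * d) <= A / r.
  have -> : A / r = (gamma - e / 6) / r ^+ 2.
    by rewrite /A /L /e1; field; rewrite !gt_eqF.
  rewrite ler_wpM2l//; first lra.
  rewrite -[leRHS]div1r ler_pdivlMr ?exprn_gt0//.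
  have -> : (1 - 2 * d) * r ^+ 2 = 1 - (3 * d ^+ 2 + 2 * d ^+ 3) by rewrite /r; ring.
  by have : 0 <= d ^+ 3 := exprn_ge0 3 (ltW d0); have := sqr_ge0 d; lra.
have : 0 <= e * d by rewrite mulr_ge0// ltW.
by lra.
Qed.

End Averages.

(** * Flux balance *)

Section StripFunctions.
Context {R : realType}.
Implicit Types (f : R -> R -> R) (x t T : R).

(** The clamp [Num.max 0] is 1-Lipschitz and maps into closed strips, so continuity within strips
    becomes continuity on the plane. *)
Lemma strip_cont2 f : (forall T, 0 < T -> continuous_on_strip T f) ->
  cont2 (fun x t => f x (Num.max 0 t)).
Proof.
move=> H; apply/cont2P => x t e e0.
pose T := Num.max 0 t + 1.
have T0 : 0 < T by rewrite ltr_wpDl// le_max lexx.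
have /subspace_continuousP/(_ (x, Num.max 0 t)) := H T T0.
move=> /(_ _)/wrap[|].
  by rewrite /strip /= le_max lexx /= lerDl.
move=> /cvgrPdist_le/(_ _ e0); rewrite near_withinE.
move=> [[A B] [/= /nbhs_ballP[d1 /= d10 HA] /nbhs_ballP[d2 /= d20 HB]] AB].
exists (Num.min (Num.min d1 d2) 1); first by rewrite !lt_min d10 d20 ltr01.
have M s : `|Num.max 0 s - Num.max 0 t| <= `|s - t|.
  rewrite ler_norml; have := ler_norm (s - t); have := ler_norm (- (s - t)); rewrite normrN => H1 H2.
  by have [?|?] := leP 0 s; have [?|?] := leP 0 t; apply/andP; split; lra.
move=> y s; rewrite !lt_min => /andP[/andP[y1 _] _] /andP[/andP[_ s2] s3].
have := AB (y, Num.max 0 s); rewrite /strip /= => /(_ _ _)/wrap[||].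
- split; [apply: HA|apply: HB]; rewrite /ball /= distrC//.
  exact: le_lt_trans (M s) s2.
- rewrite le_max lexx /=; have := M s; rewrite ler_norml => /andP[_]; rewrite /T; lra.
- by rewrite distrC.
Qed.

End StripFunctions.

Section Reaction.
Context {R : realType}.
Variables alpha beta : R.
Implicit Types (w pb F : R -> R -> R) (x t : R).

(** Equals [u] at positive times; [psip] in place of [psi] makes it Borel on the whole plane. *)
Definition total w x t : R := psip alpha beta x t + w x t.
Definition reaction pb w x t : R := pb x t * total w x t.
Definition absorbed F x t : R := itg 0 t (F x).

End Reaction.

Section FluxBalance.
Context {R : realType}.
Variables alpha beta ustar : R.
Variables u p : R -> R -> R.
Hypotheses (alpha_gt0 : 0 < alpha) (beta_gt0 : 0 < beta).
Hypothesis sol : weak_solution alpha beta ustar u p.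
Implicit Types (x y t s : R) (a : R -> R).
Local Notation mu := (@lebesgue_measure R).
Local Notation psi := (psi alpha beta).

(* [wt] and [wx] extend [u - psi] and its space derivative to negative times,
   so as to be continuous on the whole plane. *)
Definition wt x t : R := u x (Num.max 0 t) - psi x (Num.max 0 t).
Definition wx x t : R := dx (fun x t => u x t - psi x t) x (Num.max 0 t).
Local Notation ut := (total alpha beta wt).

Lemma cont2_wt : cont2 wt.
Proof. by apply: (@strip_cont2 _ (fun x t => u x t - psi x t)) => T T0; have [] := ws_continuous sol T0. Qed.

Lemma cont2_wx : cont2 wx.
Proof. by apply: strip_cont2 => T T0; have [] := ws_continuous sol T0. Qed.

Lemma is_derive_wt x t : is_derive x (1 : R) (wt ^~ t) (wx x t).
Proof.
have T0 : 0 < Num.max 0 t + 1 by rewrite ltr_wpDl// le_max lexx.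
have /(_ x (Num.max 0 t)) := ws_derivable sol T0.
rewrite le_max lexx /= lerDl ler01 => /(_ isT) D.
by rewrite /wx /dx derive1E; apply: DeriveDef.
Qed.

Lemma wtE x t : 0 <= t -> wt x t = u x t - psi x t.
Proof. by move=> t0; rewrite /wt (max_idPr t0). Qed.

Lemma wxE x t : 0 <= t -> wx x t = dx (fun x t => u x t - psi x t) x t.
Proof. by move=> t0; rewrite /wx (max_idPr t0). Qed.

Lemma utE x t : 0 < t -> ut x t = u x t.
Proof. by move=> t0; rewrite /total psipE// wtE ?ltW// addrC subrK. Qed.

Lemma lbm2_ut : lbm2 ut.
Proof. by apply: lbm2D; [exact: lbm2_psip|apply: cont2_lbm2; exact: cont2_wt]. Qed.

Lemma p_itv x t : 0 <= t -> 0 <= p x t <= 1.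
Proof.
move=> t0; have [H|H|H] := ltgtP (running_sup u x t) ustar.
- by rewrite (ws_p_below sol)// lexx ler01.
- by rewrite (ws_p_above sol)// lexx ler01.
- exact: (ws_p_at sol).
Qed.

(** [p] is measurable only for the completion, whereas Fubini needs the Borel version [pb]. The
    exceptional set [N] stays explicit because monotonicity in time and condition (P) are known for
    [p], not for [pb]. *)
Lemma pb_exists : exists pb N, [/\ measurable N, (mu \x mu)%E N = 0%E,
  lbm2 pb, forall x t, 0 <= pb x t <= 1 &
  forall x t, 0 <= t -> ~ N (x, t) -> pb x t = p x t].
Proof.
have mD : measurable [set z : R * R | 0 <= z.2].
  rewrite (_ : mkset _ = ~` [set z : R * R | z.2 < 0]); last first.
    by apply/seteqP; split => z /=; rewrite leNgt => /negP.
  apply: measurableC; apply: open2_measurable => -[x t] /= t0.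
  exists (- t); first by rewrite oppr_gt0.
  by move=> [y s] /= _; rewrite ltr_norml => /andP[_]; lra.
have := completed_measurable_fun_null _ (ws_p_measurable sol).
move=> /(_ mD)[N [mN N0 mp]].
pose pb x t := if (x, t) \in [set z : R * R | 0 <= z.2] `\` N then p x t else 0.
have pb01 x t : 0 <= pb x t <= 1.
  rewrite /pb; case: ifPn => [|_]; last by rewrite lexx ler01.
  by rewrite inE => -[/= t0 _]; exact: p_itv.
exists pb, N; split => //.
  split; last first.
    by exists 1 => x t _ _; have /andP[p0 p1] := pb01 x t; rewrite ger0_norm.
  rewrite (_ : (fun _ => _) = (fun z : R * R => p z.1 z.2) \_ ([set z : R * R | 0 <= z.2] `\` N)).
    have mE : measurable ([set z | 0 <= z.2] `\` N : set (measurableTypeR R * measurableTypeR R)).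
      by apply: measurableD => //; exact: mD.
    by apply: (measurable_restrictT _ _).1; [exact: mE|exact: mp].
  by apply/funext => -[x t]; rewrite patchE.
move=> x t t0 Nxt; rewrite /pb mem_set//.
Qed.

Section WithSource.
Variables (pb : R -> R -> R) (N : set (R * R)).
Hypotheses (mN : measurable N) (N0 : (mu \x mu)%E N = 0%E) (lpb : lbm2 pb).
Hypothesis pb01 : forall x t, 0 <= pb x t <= 1.
Hypothesis pbp : forall x t, 0 <= t -> ~ N (x, t) -> pb x t = p x t.

Local Notation source := (reaction alpha beta pb wt).

Let ls : lbm2 source. Proof. exact: lbm2M lpb lbm2_ut. Qed.

Lemma Rintegral_supp (f : R -> R) r : (forall y, r < `|y| -> f y = 0) ->
  \int[mu]_y f y = itg (- r) r f.
Proof.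
move=> H; rewrite /itg [RHS]Rintegral_mkcond; congr (Rintegral _ _ _).
apply/funext => y; rewrite patchE; case: ifPn => // /negP yr; apply: H.
rewrite ltNge; apply/negP => yr'; apply: yr; rewrite inE /= in_itv /=.
by move: yr'; rewrite ler_norml.
Qed.

(** Products of a function of space and a function of time are all the test functions used; both
    factors will be built from ramps. *)
Lemma weak_product T (a a' b b' : R -> R) (r : R) : 0 < T ->
  (forall y, is_derive y (1 : R) a (a' y)) -> continuous a' ->
  (forall y, is_derive y (1 : R) b (b' y)) -> continuous b' ->
  (forall y, r < `|y| -> a y = 0) -> b T = 0 -> 
  itg 0 T (fun s => b' s * itg (- r) r (fun y => a y * wt y s)) =
  itg 0 T (fun s => b s * itg (- r) r (fun y => a' y * wx y s + a y * source y s)).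
Proof.
move=> T0 Da ca' Db cb' asupp bT.
have ca : continuous a by move=> y; exact: is_derive_continuous (Da y).
have cb : continuous b by move=> y; exact: is_derive_continuous (Db y).
(* [a] vanishes on the open set |y| > r, hence so does its derivative. *)
have a'supp y : r < `|y| -> a' y = 0.
  move=> yr; have := is_derive_epsP (Da y) => H.
  apply/eqP; rewrite -normr_le0; apply/ler_addgt0Pr => e e0; rewrite add0r.
  have [d d0 Hd] := H e e0.
  pose h := Num.min d (`|y| - r) / 2.
  have hm : 0 < Num.min d (`|y| - r) by rewrite lt_min d0 subr_gt0.
  have hd : Num.min d (`|y| - r) <= d by rewrite ge_min lexx.
  have hd' : Num.min d (`|y| - r) <= `|y| - r by rewrite ge_min lexx orbT.
  have h0 : 0 < h by rewrite /h; lra.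
  have := Hd h; rewrite (gtr0_norm h0) => /(_ _)/wrap[|]; first by rewrite /h; lra.
  rewrite (asupp y yr) (asupp (y + h)); last first.
    apply: lt_le_trans (lerB_normD y h); rewrite (gtr0_norm h0) /h; lra.
  by rewrite subrr sub0r normrN normrM (gtr0_norm h0) ler_pM2r.
pose phi y s := a y * b s; pose phit y s := a y * b' s.
have dxphi : dx phi = (fun y s => a' y * b s).
  apply/funext => y; apply/funext => s; rewrite /dx derive1E.
  have D : is_derive y (1 : R) (phi ^~ s) (a' y * b s).
    rewrite (_ : phi ^~ s = (fun y => b s * a y)); last by apply/funext => z; rewrite mulrC.
    by apply: der_eq (derZ _ (Da y)) _; rewrite mulrC.
  by have [_ ->] := D.
have cab (f g : R -> R) : continuous f -> continuous g ->
    continuous_on_strip T (fun y s => f y * g s).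
  move=> cf cg; apply: continuous_subspaceT => -[y s].
  apply: (@cvgM _ _ _ _ (fun z : R * R => f z.1) (fun z : R * R => g z.2)).
    by apply: (@continuous_comp _ _ _ fst f); [exact: cvg_fst|exact: cf].
  by apply: (@continuous_comp _ _ _ snd g); [exact: cvg_snd|exact: cg].
have TF : test_function T phi phit.
  split.
  - split=> [x t tT|x t tT].
      apply/cvgrPdist_le => e e0.
      have e1 : 0 < e / (`|a x| + 1) by rewrite divr_gt0// ltr_wpDl.
      have [d d0 Hd] := is_derive_epsP (Db t) e1.
      rewrite !near_withinE; apply/nbhs_ballP; exists d => //= s.
      rewrite /ball /= distrC => st s_neq sT.
      have st0 : s - t != 0 by rewrite subr_eq0.
      have := Hd _ st; have -> : t + (s - t) = s by ring.
      move=> K.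
      have -> : phit x t - (phi x s - phi x t) / (s - t) = - (a x * (b s - b t - b' t * (s - t)) / (s - t)).
        by rewrite /phit /phi; field.
      rewrite normrN !normrM normfV ler_pdivrMr ?normr_gt0//.
      apply: le_trans (ler_wpM2l (normr_ge0 _) K) _; rewrite mulrA ler_wpM2r//.
      rewrite mulrCA ler_piMr ?(ltW e0)// ler_pdivrMr ?ltr_wpDl// mul1r lerDl.
      done.
    by have [] : is_derive x (1 : R) (phi ^~ t) _ := derM (Da x) (der_cst (b t) x).
  - split; [exact: cab|rewrite dxphi; exact: cab|exact: cab].
  - by exists r => x t xr _; rewrite /phi asupp// mul0r.
  - by move=> x; rewrite /phi bT mulr0.
have := ws_weak sol T0 TF.
have lwt s : lbm (wt ^~ s) by apply: continuous_lbm; apply: cont2_l; exact: cont2_wt.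
have lwx s : lbm (wx ^~ s) by apply: continuous_lbm; apply: cont2_l; exact: cont2_wx.
have la := continuous_lbm ca; have la' := continuous_lbm ca'.
have -> : \int[mu]_(s in `[0, T]) \int[mu]_y (phit y s * (u y s - psi y s)) =
  itg 0 T (fun s => b' s * itg (- r) r (fun y => a y * wt y s)).
  apply: eq_Rintegral => s; rewrite inE /= in_itv /= => /andP[s0 _].
  rewrite (@Rintegral_supp _ r); last by move=> y yr; rewrite /phit asupp// !mul0r.
  rewrite -itgZ; last exact: lbmM.
  by apply: itg_eq => y _; rewrite wtE// /phit; ring.
move=> ->.
rewrite /itg /Rintegral; congr fine.
(* For almost every time the section of [N] is null, and there [p] may be replaced by [pb] under the
   inner integral. Time 0 is removed as well, since [total] agrees with [u] only at positive
   times. *)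
have [M [mM M0 HM]] := @null_ysection _ _ (measurableTypeR R) (measurableTypeR R) R mu mu N mN N0.
have mM0 : measurable (M `|` [set 0]) by exact: measurableU.
have M00 : mu (M `|` [set 0]) = 0%E by apply: (@null_union _ (measurableTypeR R) R mu) => //; exact: lebesgue_measure_set1.
apply: (eq_integral_null mM0 M00) => s /=; rewrite in_itv /= => /andP[s0 _] /not_orP[Ms s_neq0].
have Ns : mu (ysection N s) = 0%E by apply: contrapT => H; apply: Ms; exact: HM.
have s_gt0 : 0 < s by rewrite lt_neqAle s0 andbT eq_sym; apply/eqP.
congr EFin.
transitivity (\int[mu]_y (b s * (a' y * wx y s + a y * source y s))); last first.
  rewrite (@Rintegral_supp _ r); last first.
    by move=> y yr; rewrite asupp// a'supp// !mul0r addr0 mulr0.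
  rewrite itgZ//; apply: lbmD; apply: lbmM => //; exact: lbm2_l.
rewrite /Rintegral; congr fine.
have mNs : @measurable _ (measurableTypeR R) (ysection N s) by exact: measurable_ysection s mN.
apply: (@eq_integral_null _ (measurableTypeR R) R mu _ (ysection N s)) => // y _ yN; congr EFin.
rewrite dxphi -wxE// /reaction utE// pbp//; last first.
  by move=> Nys; apply: yN; rewrite /ysection /= inE.
by rewrite /phi; ring.
Qed.

Local Notation S := (absorbed source).

(** The time factor 1 - [rampn n t] tends to the indicator of [0, t], and its derivative to minus a
    Dirac mass at [t]. *)
Lemma flux_time (a a' : R -> R) (r : R) t : 0 <= r -> 0 <= t ->
  (forall y, is_derive y (1 : R) a (a' y)) -> continuous a' ->
  (forall y, r < `|y| -> a y = 0) ->
  itg (- r) r (fun y => a y * wt y t) +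
  itg 0 t (fun s => itg (- r) r (fun y => a' y * wx y s + a y * source y s)) = 0.
Proof.
move=> r0 t0 Da ca' asupp.
have rr : - r <= r by rewrite (le_trans _ r0)// oppr_le0.
have ca : continuous a by move=> y; exact: is_derive_continuous (Da y).
pose A s := itg (- r) r (fun y => a y * wt y s).
pose B s := itg (- r) r (fun y => a' y * wx y s + a y * source y s).
have cA : continuous A.
  apply: (@itg_param_cont _ (fun s y => a y * wt y s)) => //.
  apply: cont2_swap; apply: cont2M; last exact: cont2_wt.
  move=> z; apply: (@continuous_comp _ _ _ (fun z : R * R => z.1) a); [exact: cvg_fst|exact: ca].
have lB : lbm B.
  apply: (@lbm2_itg _ (fun s y => a' y * wx y s + a y * source y s)) => //.
  apply: lbm2_swap; apply: lbm2D; apply: lbm2M => //.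
  - by apply: lbm_lbm2_l; exact: continuous_lbm.
  - by apply: cont2_lbm2; exact: cont2_wx.
  - by apply: lbm_lbm2_l; exact: continuous_lbm.
have [M HM] := lB.2 0 (t + 1).
rewrite -/(A t) -/(itg 0 t B); apply/eqP; rewrite -normr_le0; apply/ler_addgt0Pr => e e0.
rewrite add0r; have e2 : 0 < e / 2 by rewrite divr_gt0.
have [d d0 Hd] := cont_eps (cA t) e2.
(* The three terms keep the ramp inside [t, t + 1], make it shorter than the modulus [d], and make
   the error M / n at most e / 2. *)
pose n := 1 + d^-1 + `|M| / (e / 2).
have i1 : 0 < d^-1 by rewrite invr_gt0.
have i3 : 0 <= `|M| / (e / 2) by rewrite divr_ge0// ltW.
have n1 : 1 <= n by rewrite /n; lra.
have n0 : 0 < n by exact: lt_le_trans n1.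
have nd : n^-1 < d by rewrite invf_plt ?posrE// /n; lra.
have Mn : M / n <= e / 2.
  rewrite ler_pdivrMr// mulrC -ler_pdivrMr// (le_trans (_ : _ <= `|M| / (e / 2)))//.
    by rewrite ler_pM2r ?invr_gt0// ler_norm.
  by rewrite /n; lra.
have nt : t + n^-1 <= t + 1 by rewrite lerD2l invf_le1.
have T0 : 0 < t + 1 by rewrite ltr_wpDl.
have tT : t <= t + 1 by rewrite lerDl.
have Db s : is_derive s (1 : R) (fun s => 1 - rampn n t s) (- drampn n t s).
  by apply: der_eq (derB (der_cst 1 s) (is_derive_rampn n t s)) _; rewrite sub0r.
have cb' : continuous (fun s => - drampn n t s).
  by move=> s; apply: cvgN; exact: continuous_drampn.
have := @weak_product (t + 1) a a' _ _ r T0 Da ca' Db cb' asupp.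
rewrite (rampn1 n0 nt) subrr => /(_ erefl).
have ld := continuous_lbm (@continuous_drampn _ n t).
have lr := continuous_lbm (@continuous_rampn _ n t).
have lA := continuous_lbm cA.
rewrite -/A -/B.
rewrite (@itg_eq _ _ _ _ (fun s => - (drampn n t s * A s))); last by move=> s _; rewrite mulNr.
rewrite itgN; last exact: lbmM.
rewrite [in RHS](@itg_eq _ _ _ _ (fun s => B s - rampn n t s * B s)); last first.
  by move=> s _; rewrite mulrBl mul1r.
rewrite itgB//; last exact: lbmM.
rewrite (itg_split lB t0 tT) => E.
have I1 := @itg_drampn _ n t 0 (t + 1) A (e / 2) n0 cA t0 nt.
have {}I1 := I1 _; move: (I1) => {I1}/(_ _)/wrap[|I1].
  move=> s /andP[ts sn]; apply: Hd; rewrite ger0_norm ?subr_ge0//.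
  by rewrite ltrBlDl (le_lt_trans sn)// ltrD2l.
have I2 := itg_rampn n0 lB t0 nt HM.
have {}I2 := le_trans I2 Mn.
move: I1 I2 E; rewrite !ler_norml.
move: (itg 0 (t + 1) (fun z => drampn n t z * A z)) (itg 0 (t + 1) (fun z => rampn n t z * B z)).
move: (itg t (t + 1) B) (itg 0 t B) (A t) => a1 a2 a0 a3 a4 /andP[? ?] /andP[? ?] E.
by apply/andP; split; lra.
Qed.

Lemma lbm2_S t : 0 <= t -> lbm (S ^~ t).
Proof. by move=> t0; apply: lbm2_itg. Qed.

(** [flux_time] with a difference of two ramps, which tends to the indicator of [x, y]; its
    derivative picks the flux at the two endpoints. *)
Lemma flux_balance x y t : x <= y -> 0 <= t ->
  itg x y (fun z => wt z t + S z t) = itg 0 t (wx y) - itg 0 t (wx x).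
Proof.
move=> xy t0.
pose F z := wt z t + S z t; pose Nx z := itg 0 t (wx z).
have cN : continuous Nx by apply: itg_param_cont => //; exact: cont2_wx.
have lwt : lbm (wt ^~ t) by apply: continuous_lbm; apply: cont2_l; exact: cont2_wt.
have lS := lbm2_S t0.
have lF : lbm F by exact: lbmD.
pose r := `|x| + `|y| + 1.
have r0 : 0 <= r by rewrite !addr_ge0.
have [M HM] := lF.2 (- r) r.
have xr : - r <= x by rewrite /r; have := ler_norm (- x); rewrite normrN; have := normr_ge0 y; lra.
have yr : - r <= y by rewrite /r; have := ler_norm (- y); rewrite normrN; have := normr_ge0 x; lra.
have xr1 : x + 1 <= r by rewrite /r; have := ler_norm x; have := normr_ge0 y; lra.
have yr1 : y + 1 <= r by rewrite /r; have := ler_norm y; have := normr_ge0 x; lra.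
rewrite -/F -/(Nx x) -/(Nx y); apply/eqP; rewrite -subr_eq0 -normr_le0; apply/ler_addgt0Pr => e e0.
rewrite add0r; have e4 : 0 < e / 4 by rewrite divr_gt0.
have [d1 d10 Hd1] := cont_eps (cN x) e4; have [d2 d20 Hd2] := cont_eps (cN y) e4.
pose n := 1 + d1^-1 + d2^-1 + `|M| / (e / 4).
have i1 : 0 < d1^-1 by rewrite invr_gt0.
have i2 : 0 < d2^-1 by rewrite invr_gt0.
have i3 : 0 <= `|M| / (e / 4) by rewrite divr_ge0// ltW.
have [[n1 nd1'] [nd2' nM]] : (1 <= n /\ d1^-1 < n) /\ (d2^-1 < n /\ `|M| / (e / 4) <= n).
  by move: i1 i2 i3; rewrite /n; move: (d1^-1) (d2^-1) (`|M| / (e / 4)) => *; split; split; lra.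
have n0 : 0 < n by exact: lt_le_trans n1.
have nd1 : n^-1 < d1 by rewrite invf_plt ?posrE.
have nd2 : n^-1 < d2 by rewrite invf_plt ?posrE.
have Mn : M / n <= e / 4.
  rewrite ler_pdivrMr// mulrC -ler_pdivrMr//; apply: le_trans nM.
  by rewrite ler_pM2r ?invr_gt0// ler_norm.
have n1' : n^-1 <= 1 by rewrite invf_le1.
have nx : x + n^-1 <= r by rewrite (le_trans _ xr1)// lerD2l.
have ny : y + n^-1 <= r by rewrite (le_trans _ yr1)// lerD2l.
have Da z := derB (is_derive_rampn n x z) (is_derive_rampn n y z).
have ca' : continuous (fun z => drampn n x z - drampn n y z).
  by move=> z; apply: cvgB; exact: continuous_drampn.
have := @flux_time _ _ r t r0 t0 Da ca'.
move=> /(_ _)/wrap[|].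
  move=> z; have [z0|z0] := leP 0 z.
    rewrite ger0_norm// => rz.
    rewrite !rampn1 ?subrr//; first exact: ltW (le_lt_trans ny rz).
    exact: ltW (le_lt_trans nx rz).
  rewrite ltr0_norm// ltrNr => zr; have z_lt := ltW zr.
  by rewrite (rampn0 n0 (le_trans z_lt xr)) (rampn0 n0 (le_trans z_lt yr)) subrr.
have rr : - r <= r by rewrite (le_trans xr)// (le_trans _ xr1)// lerDl.
have ldr c := continuous_lbm (@continuous_drampn _ n c).
have lr c := continuous_lbm (@continuous_rampn _ n c).
have lN := continuous_lbm cN.
rewrite (@itg_swap _ (fun s z => (drampn n x z - drampn n y z) * wx z s + (rampn n x z - rampn n y z) * source z s))//; last first.
  apply: lbm2_swap; apply: lbm2D; apply: lbm2M => //.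
  - by apply: lbm_lbm2_l; apply: lbmB.
  - by apply: cont2_lbm2; exact: cont2_wx.
  - by apply: lbm_lbm2_l; apply: lbmB.
rewrite (@itg_eq _ _ _ (fun z => itg 0 t _) (fun z => (drampn n x z - drampn n y z) * Nx z + (rampn n x z - rampn n y z) * S z t)); last first.
  move=> z _; rewrite itgD; first by rewrite !itgZ//; [exact: lbm2_r|apply: continuous_lbm; apply: cont2_r; exact: cont2_wx].
    by apply: lbmM; [exact: lbm_cst|apply: continuous_lbm; apply: cont2_r; exact: cont2_wx].
  by apply: lbmM; [exact: lbm_cst|exact: lbm2_r].
rewrite -itgD; [|by apply: lbmM => //; exact: lbmB|by apply: lbmD; apply: lbmM => //; exact: lbmB].
rewrite (@itg_eq _ _ _ _ (fun z => (drampn n x z * Nx z - drampn n y z * Nx z) + (rampn n x z * F z - rampn n y z * F z))); last first.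
  by move=> z _; rewrite /F; ring.
rewrite itgD; [|by apply: lbmB; exact: lbmM|by apply: lbmB; exact: lbmM].
rewrite itgB; [|exact: lbmM|exact: lbmM]; rewrite itgB; [|exact: lbmM|exact: lbmM] => E.
have J c (d : R) : n^-1 < d -> (forall z, `|z - c| < d -> `|Nx z - Nx c| <= e / 4) ->
    - r <= c -> c + n^-1 <= r -> `|itg (- r) r (fun z => drampn n c z * Nx z) - Nx c| <= e / 4.
  move=> nd Hd cr nc; apply: itg_drampn => // z /andP[cz zn].
  by apply: Hd; rewrite ger0_norm ?subr_ge0// ltrBlDl (le_lt_trans zn)// ltrD2l.
have J1 := J x d1 nd1 Hd1 xr nx; have J2 := J y d2 nd2 Hd2 yr ny.
have K1 := le_trans (itg_rampn n0 lF xr nx HM) Mn.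
have K2 := le_trans (itg_rampn n0 lF yr ny HM) Mn.
have yr' : y <= r by rewrite (le_trans _ yr1)// lerDl.
have Sp := itg_split lF xy yr'.
move: J1 J2 K1 K2 E; move: Sp.
move: (itg x r F) (itg x y F) (itg y r F) (Nx x) (Nx y) (itg (- r) r (fun z => drampn n x z * Nx z))
  (itg (- r) r (fun z => drampn n y z * Nx z)) (itg (- r) r (fun z => rampn n x z * F z))
  (itg (- r) r (fun z => rampn n y z * F z)) => a0 a1 a2 a3 a4 a5 a6 a7 a8 Sp.
rewrite !ler_norml => /andP[A1 A2] /andP[B1 B2] /andP[C1 C2] /andP[D1 D2] E.
by clear -Sp A1 A2 B1 B2 C1 C2 D1 D2 E; apply/andP; split; lra.
Qed.

(** The initial condition is contained in the weak equation, whose test functions need not vanish at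
    time 0: the balance at time 0 says that the continuous function [wt ^~ 0] has integral 0 over
    every segment. *)
Lemma wt0 x : wt x 0 = 0.
Proof.
have c0 : continuous (wt ^~ 0) by apply: cont2_l; exact: cont2_wt.
have H y z : y <= z -> itg y z (wt ^~ 0) = 0.
  move=> yz; have -> : itg y z (wt ^~ 0) = itg y z (fun r => wt r 0 + S r 0).
    by apply: itg_eq => r _; rewrite /absorbed itg_xx addr0.
  by rewrite flux_balance// !itg_xx subrr.
have D : is_derive x (1 : R) (fun _ : R => 0 : R) (wt x 0).
  by apply: (is_derive_itg c0) => y z /H ->; rewrite subr0.
have [_ E] := der_cst (0 : R) x; have [_ E'] := D.
by rewrite -E' -[RHS]E.
Qed.

End WithSource.
End FluxBalance.

(** * Kummer's function and the profile equation *)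

Section Kummer.
Context {R : realType}.
Implicit Types (a b z : R) (c d : R ^nat) (n : nat).

Lemma pochhammerS a n : pochhammer a n.+1 = pochhammer a n * (a + n%:R).
Proof. by rewrite /pochhammer big_ord_recr. Qed.

Lemma pochhammer_gt0 a n : 0 < a -> 0 < pochhammer a n.
Proof. by move=> a0; apply: prodr_gt0 => i _; rewrite ltr_pwDl. Qed.

Lemma pochhammer_le a b n : 0 < a -> a <= b -> pochhammer a n <= pochhammer b n.
Proof.
move=> a0 ab; apply: ler_prod => i _; rewrite lerD2r ab andbT.
by rewrite addr_ge0// ltW.
Qed.

Lemma pochhammer_shift a n : a * pochhammer (a + 1) n = pochhammer a n * (a + n%:R).
Proof.
rewrite -pochhammerS /pochhammer big_ord_recl /= addr0; congr (_ * _).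
by apply: eq_bigr => i _; rewrite -addrA /bump /= add1n -natr1 (addrC 1).
Qed.

Definition kummer_coef a b n : R := pochhammer a n / pochhammer b n / n`!%:R.
Local Notation kc := kummer_coef.

Let fact_gt0' n : 0 < n`!%:R :> R. Proof. by rewrite ltr0n fact_gt0. Qed.

Lemma kummer_coefS a b n : 0 < b ->
  kc a b n.+1 * ((b + n%:R) * n.+1%:R) = kc a b n * (a + n%:R).
Proof.
move=> b0; have b1 := pochhammer_gt0 n b0; have f := fact_gt0' n.
have bn : 0 < b + n%:R by rewrite ltr_pwDl.
have n1 : 0 < n.+1%:R :> R by [].
rewrite /kummer_coef !pochhammerS factS natrM; field.
by rewrite !gt_eqF.
Qed.

Lemma kummer_coef_shift a b n : 0 < a -> a * kc (a + 1) b n = kc a b n * (a + n%:R).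
Proof. by move=> a0; rewrite /kummer_coef !mulrA pochhammer_shift; ring. Qed.

(** A class of coefficients stable under formal differentiation whose power series are dominated by
    the exponential series, hence converge everywhere. *)
Definition dominated c := forall n, 0 <= c n <= n`!%:R^-1.

Lemma dominated_kummer a b : 0 < a -> a <= b -> dominated (kc a b).
Proof.
move=> a0 ab n; have b0 := lt_le_trans a0 ab.
have := pochhammer_gt0 n a0; have := pochhammer_gt0 n b0 => b1 a1.
have f : 0 <= (n`!%:R : R)^-1 by rewrite invr_ge0 ltW.
rewrite /kummer_coef; apply/andP; split; first by rewrite !divr_ge0// ltW.
by rewrite ler_piMl// ler_pdivrMr// mul1r pochhammer_le.
Qed.

Lemma dominated_diffs c : dominated c -> dominated (pseries_diffs c).
Proof.
move=> H n; have /andP[c0 c1] := H n.+1; rewrite /pseries_diffs mulr_ge0//=.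
apply: le_trans (ler_wpM2l _ c1) _ => //.
have f := fact_gt0' n; have n1 : 0 < n.+1%:R :> R by [].
by rewrite factS natrM le_eqVlt; apply/orP; left; apply/eqP; field; rewrite !gt_eqF.
Qed.

Lemma dominated_cvg c z : dominated c -> cvgn (pseries c z).
Proof.
move=> H; apply: normed_cvg.
apply: (@series_le_cvg _ _ (exp_coeff `|z|)) => n //=.
- by rewrite /exp_coeff /= divr_ge0// exprn_ge0.
- rewrite /exp_coeff /= normrM normrX mulrC ler_wpM2l ?exprn_ge0//.
  by have /andP[c0 c1] := H n; rewrite ger0_norm.
exact: is_cvg_series_exp_coeff.
Qed.

Lemma dominated_derive c z : dominated c ->
  is_derive z (1 : R) (fun z => limn (pseries c z)) (limn (pseries (pseries_diffs c) z)).
Proof.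
move=> H; apply: (@pseries_snd_diffs R c (`|z| + 1)).
- exact: dominated_cvg.
- by apply: dominated_cvg; exact: dominated_diffs.
- by apply: dominated_cvg; do 2 apply: dominated_diffs.
- by rewrite [ltRHS]ger0_norm ?ltrDl// addr_ge0.
Qed.

Lemma kummerME a b z : kummerM a b z = limn (pseries (kc a b) z).
Proof.
rewrite /kummerM /pseries; congr (limn (series _)); apply/funext => n.
by rewrite /kummer_coef mulrA mulrAC.
Qed.

Lemma kummerM0 a b : kummerM a b 0 = 1.
Proof.
rewrite kummerME; apply: cvg_lim => //.
rewrite -(cvg_shiftS (pseries (kc a b) 0)) (_ : (fun n => _) = (fun=> 1)); first exact: cvg_cst.
apply/funext => n; rewrite /pseries /series /= big_nat_recl//= big1 => [|i _].
  by rewrite addr0 expr0 mulr1 /kummer_coef /pochhammer !big_ord0 fact0 !divr1.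
by rewrite expr0n /= mulr0.
Qed.

Let diffs_sum c z n : z * pseries (pseries_diffs c) z n = \sum_(0 <= i < n.+1) i%:R * c i * z ^+ i.
Proof.
rewrite /pseries /series /= big_nat_recl//= !mul0r add0r mulr_sumr.
by apply: eq_bigr => i _; rewrite /pseries_diffs exprS; ring.
Qed.

Let lim_eq (f g : R ^nat) (l l' : R) : (f @ \oo --> l) -> (g @ \oo --> l') -> f = g -> l = l'.
Proof. by move=> fl gl fg; rewrite -(cvg_lim _ fl)// fg (cvg_lim _ gl). Qed.

Definition kummerD a b z := limn (pseries (pseries_diffs (kc a b)) z).

Lemma is_derive_kummerM a b z : 0 < a -> a <= b ->
  is_derive z (1 : R) (kummerM a b) (kummerD a b z).
Proof.
move=> a0 ab; rewrite (_ : kummerM a b = (fun z => limn (pseries (kc a b) z))).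
  by apply: dominated_derive; exact: dominated_kummer.
by apply/funext => x; rewrite kummerME.
Qed.

Let cvg_kc a b z : 0 < a -> a <= b -> pseries (kc a b) z @ \oo --> kummerM a b z.
Proof. by move=> a0 ab; rewrite kummerME; exact: dominated_cvg (dominated_kummer a0 ab). Qed.

Let cvg_kcd a b z : 0 < a -> a <= b ->
  pseries (pseries_diffs (kc a b)) z @ \oo --> kummerD a b z.
Proof.
by move=> a0 ab; apply: dominated_cvg; apply: dominated_diffs; exact: dominated_kummer.
Qed.

(** Comparison of coefficients. With the next identity it writes Kummer's equation as a first-order
    system for M(a, b, z) and M(a + 1, b, z); these are the two functions that occur in
    [ustar_gamma]. *)
Lemma kummerM_contiguous a b z : 0 < a -> a + 1 <= b ->
  z * kummerD a b z = a * (kummerM (a + 1) b z - kummerM a b z).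
Proof.
move=> a0 ab; have a1 : 0 < a + 1 by rewrite addr_gt0.
have ab' : a <= b by rewrite (le_trans _ ab)// lerDl.
(* Multiplication by [z] raises the degree by one, so [n] terms on the left match [n.+1] terms on
   the right. *)
apply: (@lim_eq (fun n => z * pseries (pseries_diffs (kc a b)) z n)
  (fun n => a * (pseries (kc (a + 1) b) z n.+1 - pseries (kc a b) z n.+1))).
- by apply: cvgM; [exact: cvg_cst|exact: cvg_kcd].
- apply: cvgM; first exact: cvg_cst.
  by apply: cvgB; rewrite cvg_shiftS; exact: cvg_kc.
apply/funext => n; rewrite diffs_sum /pseries /series /= -sumrB mulr_sumr.
apply: eq_bigr => i _; have E := kummer_coef_shift b i a0.
by rewrite mulrBr (mulrA a (kc _ _ _)) E; ring.
Qed.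

Lemma kummerM_contiguous2 a b z : 0 < a -> a + 1 <= b ->
  z * kummerD (a + 1) b z =
  (b - a - 1) * kummerM a b z + (a + 1 - b + z) * kummerM (a + 1) b z.
Proof.
move=> a0 ab; have a1 : 0 < a + 1 by rewrite addr_gt0.
have ab' : a <= b by rewrite (le_trans _ ab)// lerDl.
have b0 := lt_le_trans a0 ab'.
apply: (@lim_eq (fun n => z * pseries (pseries_diffs (kc (a + 1) b)) z n)
  (fun n => (b - a - 1) * pseries (kc a b) z n.+1 + ((a + 1 - b) * pseries (kc (a + 1) b) z n.+1
    + z * pseries (kc (a + 1) b) z n))).
- by apply: cvgM; [exact: cvg_cst|exact: cvg_kcd].
- rewrite (_ : _ + _ * kummerM (a + 1) b z = (b - a - 1) * kummerM a b z
    + ((a + 1 - b) * kummerM (a + 1) b z + z * kummerM (a + 1) b z)); last by ring.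
  have L k : (fun n => k * pseries (kc (a + 1) b) z n.+1) @ \oo --> k * kummerM (a + 1) b z.
    by apply: cvgM; [exact: cvg_cst|rewrite cvg_shiftS; exact: cvg_kc].
  have L' k : (fun n => k * pseries (kc a b) z n.+1) @ \oo --> k * kummerM a b z.
    by apply: cvgM; [exact: cvg_cst|rewrite cvg_shiftS; exact: cvg_kc].
  have L'' : (fun n => z * pseries (kc (a + 1) b) z n) @ \oo --> z * kummerM (a + 1) b z.
    by apply: cvgM; [exact: cvg_cst|exact: cvg_kc].
  exact: cvgD (L' _) (cvgD (L _) L'').
apply/funext => n; rewrite diffs_sum /pseries /series /= !big_nat_recl//=.
rewrite !mul0r add0r !mulrDr !mulr_sumr.
have k0 a' : kc a' b 0 = 1.
  by rewrite /kummer_coef /pochhammer !big_ord0 fact0 !divr1.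
rewrite !k0 expr0 !mulr1.
rewrite (_ : b - a - 1 + _ + _ = \sum_(0 <= i < n) (b - a - 1) * (kc a b i.+1 * z ^+ i.+1)
  + \sum_(0 <= i < n) (a + 1 - b) * (kc (a + 1) b i.+1 * z ^+ i.+1)
  + \sum_(0 <= i < n) z * (kc (a + 1) b i * z ^+ i)); last by ring.
rewrite -!big_split /=; apply: eq_bigr => i _.
rewrite exprS.
have bi : 0 < b + i%:R by rewrite ltr_pwDl.
have ai : 0 < a + i.+1%:R by rewrite ltr_pwDl.
have i1 : 0 < i.+1%:R :> R by [].
have E1 := kummer_coef_shift b i.+1 a0.
have E2 := kummer_coefS (a + 1) i b0.
have F1 : kc a b i.+1 = a * kc (a + 1) b i.+1 / (a + i.+1%:R) by rewrite E1 mulfK// gt_eqF.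
have F2 : kc (a + 1) b i = kc (a + 1) b i.+1 * ((b + i%:R) * i.+1%:R) / (a + i.+1%:R).
  rewrite E2 (_ : a + 1 + i%:R = a + i.+1%:R) ?mulfK ?gt_eqF//.
  by rewrite -natr1; ring.
rewrite F1 F2; move: ai; rewrite -natr1 => ai; field.
by rewrite gt_eqF.
Qed.

End Kummer.

Section Shape.
Context {R : realType}.
Implicit Types (x alpha e : R).

Lemma der_unique (f : R -> R) x (l l' : R) :
  is_derive x (1 : R) f l -> is_derive x (1 : R) f l' -> l = l'.
Proof. by move=> [_ <-] [_ <-]. Qed.

Section Energy.
Variables (gamma b : R) (d d1 : R -> R).
Hypothesis gamma_ge0 : 0 <= gamma.
Hypothesis Dd : forall x, 0 < x -> x < b -> is_derive x (1 : R) d (d1 x).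
Hypothesis Dd1 : forall x, 0 < x -> x < b ->
  is_derive x (1 : R) d1 (gamma * d x / x ^+ 2 - x / 2 * d1 x).

(** The Gaussian factor exp(x^2 / 4) cancels the damping term - x / 2 * d1 and leaves the derivative
    (d1^2 + gamma (d / x)^2) exp(x^2 / 4) >= 0. *)
Definition energy x := d x * d1 x * gs (- (1 / 4)) x.

Lemma energy_mono x y : 0 < x -> x <= y -> y < b -> energy x <= energy y.
Proof.
move=> x0 xy yb.
have D z : x <= z <= y -> is_derive z (1 : R) energy
    ((d1 z ^+ 2 + gamma * (d z / z) ^+ 2) * gs (- (1 / 4)) z).
  move=> /andP[xz zy]; have z0 := lt_le_trans x0 xz; have zb := le_lt_trans zy yb.
  apply: der_eq (derM (derM (Dd z0 zb) (Dd1 z0 zb)) (is_derive_gs (- (1 / 4)) z)) _.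
  by field; rewrite gt_eqF.
have [c _ E] := MVT_le xy D; rewrite -subr_ge0 E mulr_ge0 ?subr_ge0// mulr_ge0 ?(ltW (gs_gt0 _ _))//.
by rewrite addr_ge0 ?sqr_ge0// mulr_ge0// sqr_ge0.
Qed.

Let sq_mono x y : 0 < x -> x <= y -> y < b ->
  (forall z, x <= z <= y -> 0 <= d z * d1 z) -> `|d x| <= `|d y|.
Proof.
move=> x0 xy yb H; rewrite -ler_sqr ?nnegrE// -!normrX !ger0_norm ?sqr_ge0//.
have D z (zxy : x <= z <= y) : is_derive z (1 : R) (fun z => d z * d z) (2 * (d z * d1 z)).
  move: (zxy) => /andP[xz zy]; have z0 := lt_le_trans x0 xz; have zb := le_lt_trans zy yb.
  by apply: der_eq (derM (Dd z0 zb) (Dd z0 zb)) _; ring.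
have [c cxy E] := MVT_le xy D; rewrite -subr_ge0 !expr2 E mulr_ge0 ?subr_ge0//.
by rewrite mulr_ge0// H.
Qed.

Let sq_anti x y : 0 < x -> x <= y -> y < b ->
  (forall z, x <= z <= y -> d z * d1 z <= 0) -> `|d y| <= `|d x|.
Proof.
move=> x0 xy yb H; rewrite -ler_sqr ?nnegrE// -!normrX !ger0_norm ?sqr_ge0//.
have D z (zxy : x <= z <= y) : is_derive z (1 : R) (fun z => d z * d z) (2 * (d z * d1 z)).
  move: (zxy) => /andP[xz zy]; have z0 := lt_le_trans x0 xz; have zb := le_lt_trans zy yb.
  by apply: der_eq (derM (Dd z0 zb) (Dd z0 zb)) _; ring.
have [c cxy E] := MVT_le xy D; rewrite -subr_le0 !expr2 E mulr_le0_ge0 ?subr_ge0//.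
by rewrite mulr_ge0_le0// H.
Qed.

Hypothesis d_zero : forall e, 0 < e -> exists2 r, 0 < r & forall x, 0 < x -> x < r -> `|d x| <= e.
Hypothesis d_end : forall e, 0 < e -> exists2 r, r < b & forall x, r < x -> x < b -> `|d x| <= e.

(* The energy is monotone; positive energy propagates to the right and makes
   [|d|] grow towards [b], negative energy propagates to [0], so both are
   excluded by the boundary conditions. *)
Lemma ode_zero x : 0 < x -> x < b -> d x = 0.
Proof.
have left_zero z : 0 < z -> z < b -> (forall y, 0 < y -> y <= z -> d y * d1 y <= 0) -> d z = 0.
  move=> z0 zb H; apply/eqP; rewrite -normr_le0; apply/ler_addgt0Pr => e e0; rewrite add0r.
  have [r r0 Hr] := d_zero e0; pose y := Num.min z (r / 2).
  have y0 : 0 < y by rewrite lt_min z0 divr_gt0.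
  have yz : y <= z by rewrite ge_min lexx.
  have yr : y <= r / 2 by rewrite ge_min lexx orbT.
  apply: le_trans (sq_anti y0 yz zb _) (Hr y y0 _); last lra.
  by move=> w /andP[yw wz]; apply: H => //; exact: lt_le_trans yw.
have sgn z : (energy z <= 0) = (d z * d1 z <= 0) by rewrite pmulr_lle0// gs_gt0.
have sgn' z : (0 <= energy z) = (0 <= d z * d1 z) by rewrite pmulr_lge0// gs_gt0.
have npos z : 0 < z -> z < b -> energy z <= 0.
  move=> z0 zb; rewrite leNgt; apply/negP => Ez.
  have dz0 : d z = 0.
    apply/eqP; rewrite -normr_le0; apply/ler_addgt0Pr => e e0; rewrite add0r.
    have [r rb Hr] := d_end e0; pose y := (Num.max z r + b) / 2.
    have m : Num.max z r < b by rewrite gt_max zb.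
    have m1 : z <= Num.max z r by rewrite le_max lexx.
    have m2 : r <= Num.max z r by rewrite le_max lexx orbT.
    have [zy ry yb] : [/\ z <= y, r < y & y < b] by split; rewrite /y; lra.
    apply: le_trans (sq_mono z0 zy yb _) (Hr y ry yb) => w /andP[zw wy].
    by rewrite -sgn' (le_trans (ltW Ez))// energy_mono// (le_lt_trans wy).
  by move: Ez; rewrite /energy dz0 !mul0r ltxx.
by move=> x0 xb; apply: left_zero => // y y0 yx; rewrite -sgn npos// (le_lt_trans yx).
Qed.

End Energy.

(** * The solution of the profile equation that vanishes at 0 *)

Variable gamma : R.
Hypothesis gamma_ge0 : 0 <= gamma.
Local Notation k := (kappa gamma).

(** The indicial equation at 0 of v'' + x / 2 * v' = gamma / x^2 * v. *)
Lemma kappa_eq : k * (k - 1) = gamma.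
Proof.
have s : Num.sqrt (4 * gamma + 1) ^+ 2 = 4 * gamma + 1.
  by rewrite sqr_sqrtr// addr_ge0// mulr_ge0.
have -> : k * (k - 1) = (Num.sqrt (4 * gamma + 1) ^+ 2 - 1) / 4 by rewrite /kappa; field.
by rewrite s; field.
Qed.

Lemma kappa_ge1 : 1 <= k.
Proof.
have : 1 <= Num.sqrt (4 * gamma + 1).
  by rewrite -[leLHS]sqrtr1 ler_wsqrtr// lerDr mulr_ge0.
by rewrite /kappa; lra.
Qed.

Let k0 : 0 < k. Proof. exact: lt_le_trans kappa_ge1. Qed.

Definition arg x : R := - x ^+ 2 / 4.
Definition KM x := kummerM (k / 2) (k + 1 / 2) (arg x).
Definition KM1 x := kummerM (k / 2 + 1) (k + 1 / 2) (arg x).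
Definition shape x := x `^ k * KM x.
Definition shape1 x := k * (x `^ (k - 1) * KM1 x).

Lemma is_derive_arg x : is_derive x (1 : R) arg (- x / 2).
Proof.
rewrite (_ : arg = (fun x => - (1 / 4) * (x * x))); last by apply/funext => y; rewrite /arg; field.
by apply: der_eq (derZ _ (derM (der_id x) (der_id x))) _; field.
Qed.

Let a0 : 0 < k / 2. Proof. by rewrite divr_gt0. Qed.
Let ab : k / 2 + 1 <= k + 1 / 2. Proof. by have := kappa_ge1; lra. Qed.
Let ab' : k / 2 <= k + 1 / 2. Proof. by have := kappa_ge1; lra. Qed.
Let a10 : 0 < k / 2 + 1. Proof. by rewrite addr_gt0. Qed.

Let pow1 x : 0 < x -> x `^ k = x `^ (k - 1) * x.
Proof.
move=> x0; rewrite -{3}(powRr1 (ltW x0)) -powRD; first by rewrite subrK.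
by apply/implyP => _; rewrite gt_eqF.
Qed.

Let pow2 x : 0 < x -> x `^ (k - 1) = x `^ (k - 1 - 1) * x.
Proof.
move=> x0; rewrite -{3}(powRr1 (ltW x0)) -powRD; first by rewrite subrK.
by apply/implyP => _; rewrite gt_eqF.
Qed.

Lemma is_derive_shape x : 0 < x -> is_derive x (1 : R) shape (shape1 x).
Proof.
move=> x0.
have DM := derC (is_derive_kummerM (arg x) a0 ab') (is_derive_arg x).
have DP := is_derive1_powR k x0.
apply: der_eq (derM DP DM) _; rewrite /shape1 /KM1.
have E := kummerM_contiguous (arg x) a0 ab.
have E' : kummerD (k / 2) (k + 1 / 2) (arg x) * (- x / 2) * x =
    2 * (k / 2 * (kummerM (k / 2 + 1) (k + 1 / 2) (arg x) - kummerM (k / 2) (k + 1 / 2) (arg x))).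
  by rewrite -E /arg; field.
by rewrite pow1// -[_ * x * _]mulrA (mulrC x) E'; field.
Qed.

Lemma is_derive_shape1 x : 0 < x ->
  is_derive x (1 : R) shape1 (gamma * shape x / x ^+ 2 - x / 2 * shape1 x).
Proof.
move=> x0.
have DM := derC (is_derive_kummerM (arg x) a10 ab) (is_derive_arg x).
have DP := is_derive1_powR (k - 1) x0.
apply: der_eq (derZ k (derM DP DM)) _; rewrite /shape /shape1 /KM /KM1.
have E := kummerM_contiguous2 (arg x) a0 ab.
have E' : kummerD (k / 2 + 1) (k + 1 / 2) (arg x) * (- x / 2) * x =
    2 * ((k + 1 / 2 - k / 2 - 1) * kummerM (k / 2) (k + 1 / 2) (arg x) +
      (k / 2 + 1 - (k + 1 / 2) + arg x) * kummerM (k / 2 + 1) (k + 1 / 2) (arg x)).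
  by rewrite -E /arg; field.
rewrite pow1// pow2// -[_ * x * (kummerD _ _ _ * _)]mulrA (mulrC x) E' /arg.
move: kappa_eq; move: (kappa gamma) => K <-.
by field; rewrite gt_eqF.
Qed.

Let near0 : exists r, [/\ 0 < r, r <= 1 & forall x, 0 < x -> x < r ->
  [/\ 1 / 2 <= KM x, KM x <= 2 & 1 / 2 <= KM1 x]].
Proof.
have h : 0 < 1 / 2 :> R by rewrite divr_gt0.
have c1 : {for 0, continuous KM}.
  exact: is_derive_continuous (derC (is_derive_kummerM (arg 0) a0 ab') (is_derive_arg 0)).
have c2 : {for 0, continuous KM1}.
  exact: is_derive_continuous (derC (is_derive_kummerM (arg 0) a10 ab) (is_derive_arg 0)).
have [d1 d10 H1] := cont_eps c1 h; have [d2 d20 H2] := cont_eps c2 h.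
have arg0 : arg 0 = 0 by rewrite /arg expr0n /= oppr0 mul0r.
exists (Num.min (Num.min d1 d2) 1); split; first by rewrite !lt_min d10 d20 ltr01.
  by rewrite ge_min lexx orbT.
move=> x x0; rewrite !lt_min => /andP[/andP[xd1 xd2] _].
have := H1 x; have := H2 x; rewrite !subr0 (gtr0_norm x0) => /(_ xd2) + /(_ xd1).
rewrite /KM /KM1 arg0 !kummerM0 !ler_norml => /andP[? ?] /andP[? ?]; split; lra.
Qed.

Lemma shape_small e : 0 < e -> exists2 r, 0 < r & forall x, 0 < x -> x < r -> `|shape x| <= e.
Proof.
move=> e0; have [r [r0 r1 H]] := near0.
exists (Num.min r (e / 2)); first by rewrite lt_min r0 divr_gt0.
move=> x x0; rewrite lt_min => /andP[xr xe]; have [M1 M2 _] := H x x0 xr.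
have P : x `^ k <= x.
  rewrite -[leRHS](powRr1 (ltW x0)); apply: ger_powR; last exact: kappa_ge1.
  by rewrite x0 (le_trans (ltW xr)).
have M0 : 0 <= KM x by lra.
rewrite normrM (ger0_norm (powR_ge0 _ _)) (ger0_norm M0).
have := ler_pM (powR_ge0 x k) M0 P M2; lra.
Qed.

(** At negative arguments the Kummer series alternates and does not show its sign. The energy of
    [shape] is positive near 0 and nondecreasing, which excludes zeros of [shape] and [shape1]. *)
Lemma shape_prod_gt0 x : 0 < x -> 0 < shape x * shape1 x.
Proof.
move=> x0; have [r [r0 r1 H]] := near0.
pose y := Num.min x (r / 2).
have y0 : 0 < y by rewrite lt_min x0 divr_gt0.
have yx : y <= x by rewrite ge_min lexx.
have yr : y < r by have : y <= r / 2 by [rewrite ge_min lexx orbT]; lra.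
have [M1 _ M2] := H y y0 yr.
have Ey : 0 < energy shape shape1 y.
  rewrite /energy /shape /shape1 !mulr_gt0// ?gs_gt0// ?powR_gt0//; lra.
have xb : x < x + 1 by rewrite ltrDl.
have := @energy_mono gamma (x + 1) shape shape1 gamma_ge0 (fun z z0 _ => is_derive_shape z0)
  (fun z z0 _ => is_derive_shape1 z0) y x y0 yx xb.
by move=> /(lt_le_trans Ey); rewrite /energy pmulr_lgt0// gs_gt0.
Qed.

(** The multiple [c] of [shape] agrees with [v] at [alpha], and both tend to 0 at 0, so their
    difference falls under [ode_zero]. The slope at [alpha] follows by continuity from the left. *)
Lemma inner_solution alpha (v v1 : R -> R) : 0 < alpha ->
  (forall x, 0 < x -> x < alpha -> is_derive x (1 : R) v (v1 x)) ->
  (forall x, 0 < x -> x < alpha -> is_derive x (1 : R) v1 (gamma * v x / x ^+ 2 - x / 2 * v1 x)) ->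
  {for alpha, continuous v} -> {for alpha, continuous v1} ->
  (forall e, 0 < e -> exists2 r, 0 < r & forall x, 0 < x -> x < r -> `|v x| <= e) ->
  (forall x, 0 < x -> x <= alpha -> v x = v alpha / shape alpha * shape x) /\
  v1 alpha = v alpha / shape alpha * shape1 alpha.
Proof.
move=> al0 Dv Dv1 cv cv1 v0.
have s0 : shape alpha != 0.
  by apply/negP => /eqP E; have := shape_prod_gt0 al0; rewrite E mul0r ltxx.
set c := v alpha / shape alpha.
pose d x := v x - c * shape x; pose d1 x := v1 x - c * shape1 x.
have Dd x : 0 < x -> x < alpha -> is_derive x (1 : R) d (d1 x).
  by move=> x0 xa; exact: derB (Dv x x0 xa) (derZ c (is_derive_shape x0)).
have Dd1 x : 0 < x -> x < alpha -> is_derive x (1 : R) d1 (gamma * d x / x ^+ 2 - x / 2 * d1 x).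
  move=> x0 xa; apply: der_eq (derB (Dv1 x x0 xa) (derZ c (is_derive_shape1 x0))) _.
  by rewrite /d /d1; field; rewrite gt_eqF.
have cs : {for alpha, continuous shape} by exact: is_derive_continuous (is_derive_shape al0).
have cs1 : {for alpha, continuous shape1} by exact: is_derive_continuous (is_derive_shape1 al0).
have dal : d alpha = 0 by rewrite /d /c divfK// subrr.
have cd : {for alpha, continuous d} by apply: cvgB => //; apply: cvgM => //; exact: cvg_cst.
have d_small e : 0 < e -> exists2 r, 0 < r & forall x, 0 < x -> x < r -> `|d x| <= e.
  move=> e0; have e2 : 0 < e / 2 by rewrite divr_gt0.
  have ec : 0 < e / 2 / (`|c| + 1) by rewrite divr_gt0// ltr_wpDl.
  have [r1 r10 H1] := v0 _ e2; have [r2 r20 H2] := shape_small ec.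
  exists (Num.min r1 r2); first by rewrite lt_min r10.
  move=> x x0; rewrite lt_min => /andP[x1 x2].
  apply: le_trans (ler_normB _ _) _; rewrite normrM.
  have K1 := H1 x x0 x1; have K2 := H2 x x0 x2.
  have : `|c| * `|shape x| <= `|c| * (e / 2 / (`|c| + 1)) by rewrite ler_wpM2l.
  have : `|c| * (e / 2 / (`|c| + 1)) <= e / 2.
    by rewrite mulrCA -[leRHS]mulr1 ler_wpM2l ?(ltW e2)// ler_pdivrMr ?ltr_wpDl// mul1r lerDl.
  by lra.
have d_end e : 0 < e -> exists2 r, r < alpha & forall x, r < x -> x < alpha -> `|d x| <= e.
  move=> e0; have [r r0 Hr] := cont_eps cd e0; exists (alpha - r); first by rewrite gtrDl oppr_lt0.
  move=> x x1 x2; have := Hr x; rewrite dal subr0; apply.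
  by rewrite ltr0_norm ?subr_lt0// opprB; lra.
have Z := ode_zero gamma_ge0 Dd Dd1 d_small d_end.
split=> [x x0|].
  rewrite le_eqVlt => /predU1P[->|xa]; first by rewrite /c divfK.
  by apply/eqP; rewrite -subr_eq0; apply/eqP; exact: Z.
apply: (@cont_left_eq _ v1 (fun x => c * shape1 x) alpha alpha al0) => //.
  by apply: cvgM => //; exact: cvg_cst.
move=> y; rewrite subrr => y0 ya.
have yr : 0 < Num.min y (alpha - y) by rewrite lt_min y0 subr_gt0.
have D0 : is_derive y (1 : R) d 0.
  apply: (der_near yr _ (der_cst 0 y)) => z; rewrite lt_min !ltr_norml => /andP[/andP[z1 _] /andP[_ z2]].
  by rewrite Z//; lra.
by have := der_unique (Dd y y0 ya) D0; rewrite /d1 => /eqP; rewrite subr_eq0 => /eqP.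
Qed.

End Shape.

(** * The complementary error function and the jump at the front *)

Section Erfc.
Context {R : realType}.
Implicit Types (x z alpha : R).

Lemma erfcE z : erfc z = 2 / Num.sqrt pi * gtail 1 z.
Proof. by rewrite /erfc; congr (_ * _); apply: eq_Rintegral => y _; rewrite /gs mul1r. Qed.

(** Instead of a substitution: the difference of both sides has derivative 0 and tends to 0 at
    infinity. *)
Lemma gtail_erfc x : gtail (1 / 4) x = Num.sqrt pi * erfc (x / 2).
Proof.
have sp : 0 < Num.sqrt (pi : R) by rewrite sqrtr_gt0 pi_gt0.
rewrite erfcE (_ : Num.sqrt pi * _ = 2 * gtail 1 (x / 2)); last by field; rewrite gt_eqF.
have q0 : 0 < 1 / 4 :> R by rewrite divr_gt0.
pose h (y : R) := gtail (1 / 4) y - 2 * gtail 1 (1 / 2 * y).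
have Dh y : is_derive y (1 : R) h 0.
  apply: der_eq (derB (is_derive_gtail y q0) (derZ 2 (derC (is_derive_gtail _ ltr01) (derZ (1 / 2) (der_id y))))) _.
  have -> : gs 1 (1 / 2 * y) = gs (1 / 4) y by rewrite /gs; congr expR; field.
  by field.
have hx y : x <= y -> h x = h y by move=> xy; exact: zero_derive_const.
suff : h x = 0 by rewrite /h => /eqP; rewrite subr_eq0 => /eqP ->; rewrite mul1r (mulrC 2^-1).
apply/eqP; rewrite -normr_le0; apply/ler_addgt0Pr => e e0; rewrite add0r.
have e4 : 0 < e / 4 by rewrite divr_gt0.
have [M1 _ H1] := gtail_small q0 e4; have [M2 _ H2] := gtail_small ltr01 e4.
pose y := Num.max x (Num.max M1 (2 * M2)).
have xy : x <= y by rewrite le_max lexx.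
have y1 : M1 <= y by rewrite !le_max lexx orbT.
have y2 : M2 <= 1 / 2 * y.
  have : 2 * M2 <= y by rewrite !le_max lexx !orbT.
  lra.
rewrite (hx y xy) /h; have := H1 y y1; have := H2 _ y2.
have := gtail_ge0 (1 / 4) y; have := gtail_ge0 1 (1 / 2 * y).
by move: (gtail _ _) (gtail _ _) => g1 g2 *; rewrite ler_norml; apply/andP; split; lra.
Qed.

Lemma gs_arg x : gs (1 / 4) x = expR (- x ^+ 2 / 4).
Proof. by rewrite /gs; congr expR; field. Qed.

Lemma Psi_coef_gs alpha beta : Psi_coef alpha beta * gs (1 / 4) alpha = alpha * beta / 2.
Proof.
rewrite /Psi_coef gs_arg -mulrA -expRD (_ : _ + _ = 0) ?expR0 ?mulr1//.
by field.
Qed.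

(* The jump condition at [alpha] for the profile [P0 shape / shape alpha] inside
   and [P0 gtail / gtail alpha] outside determines [P0]. *)
Lemma ustar_gammaE alpha beta gamma P0 : 0 < alpha -> 0 < beta -> 0 <= gamma ->
  P0 * (shape1 gamma alpha / shape gamma alpha + gs (1 / 4) alpha / gtail (1 / 4) alpha)
    = alpha * beta / 2 ->
  P0 = ustar_gamma alpha beta gamma /\ 0 < P0.
Proof.
move=> al0 be0 g0 H.
have SP := shape_prod_gt0 g0 al0.
have s0 : shape gamma alpha != 0.
  by apply/negP => /eqP E; move: SP; rewrite E mul0r ltxx.
have Q1 : 0 < shape1 gamma alpha / shape gamma alpha.
  rewrite (_ : _ / _ = shape gamma alpha * shape1 gamma alpha / (shape gamma alpha) ^+ 2); last by field.
  by rewrite divr_gt0// lt_neqAle eq_sym sqrf_eq0 s0 sqr_ge0.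
have t0 := gtail_gt0 alpha (divr_gt0 ltr01 (ltr0n R 4)).
set Q := shape1 gamma alpha / _ + _ in H.
have Q0 : 0 < Q by rewrite addr_gt0// divr_gt0// gs_gt0.
have PE : P0 = Q^-1 * (alpha * beta / 2) by rewrite -H; field; rewrite gt_eqF.
split; last by rewrite PE mulr_gt0 ?invr_gt0// divr_gt0// mulr_gt0.
rewrite PE /ustar_gamma; congr (_^-1 * _).
rewrite /Q -gtail_erfc gs_arg; congr (_ + _).
have K0 : kummerM (kappa gamma / 2) (kappa gamma + 1 / 2) (- alpha ^+ 2 / 4) != 0.
  by apply/negP => /eqP E; move: s0; rewrite /shape /KM /arg E mulr0 eqxx.
rewrite /shape1 /shape /KM /KM1 /arg.
have -> : alpha `^ kappa gamma = alpha * alpha `^ (kappa gamma - 1).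
  by rewrite mulr_powRB1// ?ltW// (lt_le_trans ltr01)// kappa_ge1.
have p0 : alpha `^ (kappa gamma - 1) != 0 by rewrite gt_eqF// powR_gt0.
by field; rewrite K0 p0 gt_eqF.
Qed.

End Erfc.

(** * Sign, monotonicity and decay of the solution *)

Section Flow.
Context {R : realType}.
Variables alpha beta ustar : R.
Variables u p wt wx pb : R -> R -> R.
Variable N : set (R * R).
Local Notation mu := (@lebesgue_measure R).
Local Notation psi := (psi alpha beta).
Local Notation Psi := (Psi alpha beta).
Local Notation Psa := (Psi alpha).
Local Notation ut := (total alpha beta wt).
Local Notation source := (reaction alpha beta pb wt).
Local Notation S := (absorbed source).
Implicit Types (x y t s : R).
Hypotheses (alpha_gt0 : 0 < alpha) (beta_gt0 : 0 < beta).
Hypothesis cont2_wt : cont2 wt.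
Hypothesis cont2_wx : cont2 wx.
Hypothesis is_derive_wt : forall x t, is_derive x (1 : R) (wt ^~ t) (wx x t).
Hypothesis wtE : forall x t, 0 <= t -> wt x t = u x t - psi x t.
Hypothesis wt0 : forall x, wt x 0 = 0.
Hypothesis wt_bounded : forall T, exists M, forall x t, 0 < t <= T -> `|wt x t| <= M.
Hypothesis p_itv : forall x t, 0 <= t -> 0 <= p x t <= 1.
Hypothesis p_nondecreasing : forall x s t, 0 <= s -> s <= t -> p x s <= p x t.
Hypothesis p_one : forall x s t, 0 <= s -> s <= t -> ustar < u x s -> p x t = 1.
Hypothesis p_zero : forall x t c, 0 <= t -> c < ustar ->
  (forall s, 0 <= s <= t -> u x s <= c) -> p x t = 0.
Hypotheses (ustar_gt0 : 0 < ustar) (ustar_lt : ustar < Psa).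
Hypothesis lpb : lbm2 pb.
Hypothesis pb01 : forall x t, 0 <= pb x t <= 1.
Hypotheses (mN : measurable N) (N0 : (mu \x mu)%E N = 0%E).
Hypothesis pbp : forall x t, 0 <= t -> ~ N (x, t) -> pb x t = p x t.
Hypothesis flux_balance : forall x y t, x <= y -> 0 <= t ->
  itg x y (fun z => wt z t + S z t) = itg 0 t (wx y) - itg 0 t (wx x).

Let lu : lbm2 ut.
Proof. by apply: lbm2D; [exact: lbm2_psip|exact: cont2_lbm2]. Qed.

Let ls : lbm2 source. Proof. exact: lbm2M lpb lu. Qed.

Lemma lbm_absorbed t : 0 <= t -> lbm (S ^~ t).
Proof. by move=> t0; apply: lbm2_itg. Qed.

(* Otherwise [//] unfolds [Psi] in positivity side conditions. *)
Opaque Defs.Psi Defs.psi.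

Lemma total_sol x t : 0 < t -> ut x t = u x t.
Proof. by move=> t0; rewrite /total psipE// wtE ?ltW// addrC subrK. Qed.

Lemma flux_increment x y t1 t2 : x <= y -> 0 <= t1 -> t1 <= t2 ->
  itg t1 t2 (fun s => wx y s - wx x s) =
  itg x y (fun z => wt z t2 - wt z t1 + itg t1 t2 (source z)).
Proof.
move=> xy t10 t12; have t20 := le_trans t10 t12.
have lw z : lbm (wx z) by apply: continuous_lbm; exact: cont2_r.
have lwt s : lbm (wt ^~ s) by apply: continuous_lbm; exact: cont2_l.
have lS s : 0 <= s -> lbm (fun z => wt z s + S z s) by move=> s0; apply: lbmD => //; exact: lbm_absorbed.
rewrite itgB// (@itg_eq _ x y _ (fun z => (wt z t2 + S z t2) - (wt z t1 + S z t1))); last first.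
  by move=> z _; rewrite /absorbed (itg_split (lbm2_r z ls) t10 t12); lra.
rewrite itgB; [|exact: lS|exact: lS].
rewrite !flux_balance// (itg_split (lw x) t10 t12) (itg_split (lw y) t10 t12).
lra.
Qed.

Lemma wt_init x0 (e : R) : 0 < e -> exists2 d : R, 0 < d &
  forall x t, `|x - x0| < d -> 0 < t < d -> `|wt x t| <= e.
Proof.
move=> e0; have [d d0 Hd] := (cont2P _).2 cont2_wt x0 0 e e0.
exists d => // x t xd /andP[t0 td]; have := Hd x t xd.
by rewrite wt0 !subr0 (gtr0_norm t0); apply.
Qed.

(** Where [- wt] exceeds [psi], the total is negative and so the source is at most 0; there [- wt]
    is a subsolution, and [comparison] asks for nothing elsewhere. *)
Lemma ut_ge0 x t : 0 < t -> 0 <= ut x t.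
Proof.
move=> t0; rewrite /total psipE// -lerBlDr sub0r.
apply: (@comparison _ (fun x t => - wt x t) (fun x t => - wx x t) psi) => //.
- by apply: cont2N; exact: cont2_wt.
- by apply: cont2N; exact: cont2_wx.
- by move=> y s s0; exact: cont_psi.
- move=> T; have [M HM] := wt_bounded T; exists M => y s sT; have H := HM y s sT.
  rewrite (le_trans _ H)// -normrN (le_trans _ (ler_norm _))// gerBl.
  exact: psi_ge0.
- by move=> x0 t1 t10; exact: psi_touch.
- move=> y z t1 t2 yz t10 t12 H; have t20 := lt_le_trans t10 t12.
  rewrite (@itg_eq _ t1 t2 _ (fun s => - (wx z s - wx y s))); last by move=> s _; lra.
  have lw r : lbm (wx r) by apply: continuous_lbm; exact: cont2_r.
  have lwt s : lbm (wt ^~ s) by apply: continuous_lbm; exact: cont2_l.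
  have lI : lbm (fun z => itg t1 t2 (source z)) by exact: lbm2_itg.
  rewrite itgN; last exact: lbmB.
  rewrite flux_increment ?(ltW t10)// -itgN; last by apply: lbmD => //; exact: lbmB.
  apply: itg_le.
  + by apply: lbmB; exact: lbmN.
  + by apply: lbmN; apply: lbmD => //; exact: lbmB.
  move=> r ryz.
  have : itg t1 t2 (source r) <= itg t1 t2 (fun=> 0).
    apply: itg_le => //; [exact: lbm2_r|exact: lbm_cst|].
    move=> s st; have s0 : 0 < s by apply: lt_le_trans t10 _; case/andP: st.
    have := H r s ryz st; rewrite /reaction /total psipE// => H1.
    by have /andP[p0 _] := pb01 r s; rewrite mulr_ge0_le0//; lra.
  by rewrite itg_cst// mul0r; lra.
- move=> x0 e e0; have [d d0 Hd] := wt_init x0 e0; exists d => // y s yd sd.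
  have := Hd y s yd sd; rewrite ler_norml => /andP[H _].
  by have := psi_ge0 alpha_gt0 beta_gt0 y s; lra.
Qed.

Lemma zero_touch (x0 t0 : R) : 0 < t0 -> exists E Ex Exx Et,
  [/\ E x0 t0 = (0 : R) /\ (forall x t, 0 < t -> 0 <= E x t),
      forall x, is_derive x (1 : R) (E ^~ t0) (Ex x),
      is_derive x0 (1 : R) Ex Exx, is_derive t0 (1 : R) (E x0) Et & Exx <= Et].
Proof.
move=> _; exists (fun _ _ => 0), (fun _ => 0), 0, 0; split => //.
- by move=> x; exact: der_cst.
- exact: der_cst.
- exact: der_cst.
Qed.

(** With [ut_ge0] the source is nonnegative, so [wt] is a subsolution to be compared with 0. *)
Lemma wt_le0 x t : 0 < t -> wt x t <= 0.
Proof.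
move=> t0; apply: (@comparison _ wt wx (fun _ _ => 0)) => //.
- by move=> y s _; exact: cvg_cst.
- move=> T; have [M HM] := wt_bounded T; exists M => y s sT; have H := HM y s sT.
  by rewrite subr0 (le_trans (ler_norm _)).
- exact: zero_touch.
- move=> y z t1 t2 yz t10 t12 _; rewrite flux_increment ?(ltW t10)//.
  have lwt s : lbm (wt ^~ s) by apply: continuous_lbm; exact: cont2_l.
  have lI : lbm (fun z => itg t1 t2 (source z)) by exact: lbm2_itg.
  apply: itg_le; [exact: lbmB|by apply: lbmD => //; exact: lbmB|].
  move=> r ryz; rewrite lerDl -(mul0r (t2 - t1)) -itg_cst//.
  apply: itg_le; [exact: lbm_cst|exact: lbm2_r|].
  move=> s /andP[st _]; have /andP[p0 _] := pb01 r s.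
  by rewrite mulr_ge0// ut_ge0// (lt_le_trans t10).
- move=> x0 e e0; have [d d0 Hd] := wt_init x0 e0; exists d => // y s yd sd.
  by have := Hd y s yd sd; rewrite add0r ler_norml => /andP[].
Qed.

Lemma total_ge0 x t : 0 <= t -> 0 <= ut x t.
Proof.
rewrite le_eqVlt => /predU1P[<-|]; last exact: ut_ge0.
by rewrite /total /psip ltxx wt0 addr0.
Qed.

Lemma wt_npos x t : 0 <= t -> wt x t <= 0.
Proof. by rewrite le_eqVlt => /predU1P[<-|]; [rewrite wt0|exact: wt_le0]. Qed.

Lemma wt_ge_psi x t : 0 < t -> - psi x t <= wt x t.
Proof. by move=> t0; have := ut_ge0 x t0; rewrite /total psipE//; lra. Qed.

Lemma wt_ge x t : 0 <= t -> - Psa <= wt x t.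
Proof.
rewrite le_eqVlt => /predU1P[<-|t0]; first by rewrite wt0 oppr_le0 ltW// Psi_gt0.
by apply: le_trans (wt_ge_psi x t0); rewrite lerN2 psi_le.
Qed.

Lemma source_ge0 x t : 0 <= t -> 0 <= source x t.
Proof. by move=> t0; have /andP[p0 _] := pb01 x t; rewrite mulr_ge0// total_ge0. Qed.

Lemma good_section : {ae mu, forall x, @lebesgue_measure R (xsection N x) = 0%E}.
Proof. exact: (@null_xsection _ _ (measurableTypeR R) (measurableTypeR R) R mu mu N mN N0). Qed.

Lemma good_source x s : 0 < s -> ~ xsection N x s -> source x s = p x s * u x s.
Proof.
by move=> s0 H; rewrite /reaction total_sol// pbp ?ltW// => Nx; apply: H; rewrite /xsection /= inE.
Qed.

(** Where [wt] at time s + k exceeds [wt] at time s, so does [u], because [psi] increases in time;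
    as [p] increases too, the later source is the larger one and the difference is a subsolution. *)
Lemma wt_nonincr x t k : 0 < t -> 0 <= k -> wt x (t + k) <= wt x t.
Proof.
move=> t0 k0; rewrite -subr_le0.
have cs : continuous (fun s : R => s + k).
  by move=> s; apply: cvgD; [exact: cvg_id|exact: cvg_cst].
have ci : continuous (fun y : R => y) by move=> y; exact: cvg_id.
have cw := cont2_comp cont2_wt ci cs; have cwx' := cont2_comp cont2_wx ci cs.
have lwt s : lbm (wt ^~ s) by apply: continuous_lbm; exact: cont2_l.
have lw r : lbm (wx r) by apply: continuous_lbm; exact: cont2_r.
apply: (@comparison _ (fun y s => wt y (s + k) - wt y s)
  (fun y s => wx y (s + k) - wx y s) (fun _ _ => 0)) => //.
- exact: cont2B cw cont2_wt.
- exact: cont2B cwx' cont2_wx.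
- by move=> y s _; exact: cvg_cst.
- move=> T; have [M HM] := wt_bounded T; exists M => y s sT; rewrite subr0.
  have := HM y s sT; rewrite ler_norml => /andP[H _].
  have : wt y (s + k) <= 0 by apply: wt_le0; case/andP: sT => s0 _; rewrite ltr_wpDr.
  lra.
- exact: zero_touch.
- move=> y z t1 t2 yz t10 t12 H.
  have t10' := ltW t10; have t20 := le_trans t10' t12.
  have t1k : 0 <= t1 + k by rewrite addr_ge0.
  have t12k : t1 + k <= t2 + k by rewrite lerD2r.
  have lI : lbm (fun z => itg t1 t2 (source z)) by exact: lbm2_itg.
  have lIk : lbm (fun z => itg (t1 + k) (t2 + k) (source z)) by exact: lbm2_itg.
  rewrite (@itg_eq _ t1 t2 _ (fun s => (fun s => wx z s - wx y s) (s + k) - (wx z s - wx y s))); last first.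
    by move=> s _; lra.
  have lzy : lbm (fun s => wx z s - wx y s) by exact: lbmB.
  rewrite (itgB t1 t2 (lbm_shift k lzy) lzy).
  rewrite (itg_shift k t1 t2 lzy) !flux_increment// -itgB; [|by apply: lbmD => //; exact: lbmB|by apply: lbmD => //; exact: lbmB].
  apply: itg_ae_le.
  + by apply: lbmB; exact: lbmB.
  + by apply: lbmB; apply: lbmD => //; exact: lbmB.
  have [N1 [mN1 N10 HN1]] := good_section; exists N1; split => // r /= Hr.
  apply: HN1 => /= Nr; apply: Hr => ryz.
  suff : itg t1 t2 (source r) <= itg (t1 + k) (t2 + k) (source r) by lra.
  rewrite -itg_shift; last exact: lbm2_r.
  have mNr : @measurable _ (measurableTypeR R) (xsection N r) by exact: measurable_xsection r mN.
  (* [pb] has to agree with [p] at time s and at time s + k, so the null section is joined to its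
     translate. *)
  pose K := xsection N r `|` (fun s => s + k) @^-1` (xsection N r).
  have mshift : @measurable _ (measurableTypeR R) ((fun s => s + k) @^-1` (xsection N r)).
    rewrite -[X in measurable X]setTI; apply: measurable_shift => //.
  apply: (@itg_null_le _ _ _ _ _ K).
  + exact: lbm2_r.
  + by apply: lbm_shift; exact: lbm2_r.
  + exact: measurableU.
  + apply: (@null_union _ (measurableTypeR R) R mu) => //.
    exact: etrans (lebesgue_measure_shift k mNr) Nr.
  move=> s st /not_orP[Ns Nsk]; have s0 : 0 < s by apply: lt_le_trans t10 _; case/andP: st.
  have sk0 : 0 < s + k by rewrite ltr_wpDr.
  rewrite !good_source//.
  have /andP[p0 _] := p_itv r (ltW s0).
  apply: ler_pM => //; first by have := ut_ge0 r s0; rewrite total_sol.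
    by apply: p_nondecreasing; rewrite ?(ltW s0)// lerDl.
  have := H r s ryz st; rewrite !wtE ?(ltW s0) ?(ltW sk0)//.
  have := @psi_le_t _ alpha beta alpha_gt0 beta_gt0 r s (s + k) (ltW s0) _.
  rewrite lerDl => /(_ k0); move: (psi r s) (psi r _) (u r s) (u r _) => a b c d; lra.
- move=> x0 e e0.
  have wk : wt x0 k <= 0.
    by move: k0; rewrite le_eqVlt => /predU1P[<-|/wt_le0//]; rewrite wt0.
  have cg : cont2 (fun y s => wt y (s + k) - wt y s) := cont2B cw cont2_wt.
  have [d d0 Hd] := (cont2P _).2 cg x0 0 e e0.
  exists d => // y s yd /andP[s0 sd]; have := Hd y s yd; rewrite subr0 (gtr0_norm s0) => /(_ sd).
  by rewrite add0r wt0 subr0 ler_norml => /andP[_]; lra.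
Qed.

Lemma wt_mono x s t : 0 <= s -> s <= t -> wt x t <= wt x s.
Proof.
rewrite le_eqVlt => /predU1P[<-|s0] st; first by rewrite wt0 wt_npos.
by have := @wt_nonincr x s (t - s) s0; rewrite subr_ge0 addrC subrK; apply.
Qed.

(** In the balance only the change of [wt] can be negative, and [wt] takes values in
    [- Psi alpha, 0]; hence the bound does not depend on [d]. *)
Lemma flux_lower t d a b : 0 <= t -> 0 <= d -> a <= b ->
  - Psa * (b - a) <= itg t (t + d) (wx b) - itg t (t + d) (wx a).
Proof.
move=> t0 d0 ab; have td : t <= t + d by rewrite lerDl.
have td0 : 0 <= t + d by rewrite addr_ge0.
have lw z : lbm (wx z) by apply: continuous_lbm; exact: cont2_r.
have lwt s : lbm (wt ^~ s) by apply: continuous_lbm; exact: cont2_l.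
have lI : lbm (fun z => itg t (t + d) (source z)) by exact: lbm2_itg.
rewrite -itgB// flux_increment// -itg_cst//; apply: itg_le.
- exact: lbm_cst.
- by apply: lbmD => //; exact: lbmB.
move=> z _; have := wt_ge z td0; have := wt_npos z t0.
have : 0 <= itg t (t + d) (source z).
  rewrite -[0](mul0r (t + d - t)) -itg_cst//; apply: itg_le; [exact: lbm_cst|exact: lbm2_r|].
  by move=> s /andP[ts _]; apply: source_ge0; exact: le_trans ts.
lra.
Qed.

(** [semiconvex_derive_bound] for the time integral of [wt], whose range is Psi alpha * d; the step
    sqrt d balances the two terms of that bound. *)
Lemma flux_bound t d x : 0 <= t -> 0 < d ->
  `|itg t (t + d) (wx x)| <= 2 * Psa * Num.sqrt d.
Proof.
move=> t0 d0; have s0 : 0 < Num.sqrt d by rewrite sqrtr_gt0.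
have td : t <= t + d by rewrite lerDl ltW.
have lwt z : lbm (wt z) by apply: continuous_lbm; exact: cont2_r.
have := @semiconvex_derive_bound R (fun x => itg t (t + d) (wt x)) (fun x => itg t (t + d) (wx x))
  Psa (- Psa * d) (Psa * d) x (Num.sqrt d).
move=> /(_ _ _ _ _ s0)/wrap[||||].
- by move=> y; exact: is_derive_param.
- by move=> a b ab; apply: flux_lower => //; exact: ltW.
- move=> y; have D : d = t + d - t by ring.
  have -> : - Psa * d + Psa * d = 0 * d by ring.
  rewrite {1 4}D -!itg_cst//; apply/andP; split; apply: itg_le => //; try exact: lbm_cst.
    by move=> s /andP[ts _]; apply: wt_ge; exact: le_trans ts.
  by move=> s /andP[ts _]; apply: wt_npos; exact: le_trans ts.
- by rewrite ltW// Psi_gt0.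
have -> : Psa * d / Num.sqrt d = Psa * Num.sqrt d.
  by rewrite -{1}(sqr_sqrtr (ltW d0)); field; rewrite gt_eqF.
by move=> ?; lra.
Qed.

(** Monotonicity in time places the mean of [wt] over [t, t + d] above its final and below its
    initial value, and by [flux_bound] this mean is Lipschitz in space with constant 2 * Psi alpha /
    sqrt d. *)
Lemma wt_le_shift x y t d : 0 <= t -> 0 < d ->
  wt x (t + d) <= wt y t + 2 * Psa * `|x - y| / Num.sqrt d.
Proof.
move=> t0 d0; have s0 : 0 < Num.sqrt d by rewrite sqrtr_gt0.
have td : t <= t + d by rewrite lerDl ltW.
have lwt z : lbm (wt z) by apply: continuous_lbm; exact: cont2_r.
pose A z := itg t (t + d) (wt z).
have DA z : is_derive z (1 : R) A (itg t (t + d) (wx z)) by exact: is_derive_param.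
have L a b : a <= b -> `|A b - A a| <= 2 * Psa * Num.sqrt d * (b - a).
  move=> ab; have [z _ ->] := MVT_le ab (fun y _ => DA y).
  rewrite normrM (ger0_norm (_ : 0 <= b - a)) ?subr_ge0// ler_wpM2r ?subr_ge0//.
  exact: flux_bound.
have L' : A x - A y <= 2 * Psa * Num.sqrt d * `|x - y|.
  apply: le_trans (ler_norm _) _; have [xy|xy] := leP x y.
    by rewrite distrC; have := L _ _ xy; rewrite (distrC x) (ger0_norm (_ : 0 <= y - x)) ?subr_ge0.
  by have := L _ _ (ltW xy); rewrite (gtr0_norm (_ : 0 < x - y)) ?subr_gt0.
have D : d = t + d - t by ring.
have A1 : wt x (t + d) * d <= A x.
  rewrite {2}D -itg_cst//; apply: itg_le => //; first exact: lbm_cst.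
  by move=> s /andP[ts sd]; apply: wt_mono => //; exact: le_trans ts.
have A2 : A y <= wt y t * d.
  rewrite [X in _ <= _ * X]D -itg_cst//; apply: itg_le => //; first exact: lbm_cst.
  by move=> s /andP[ts sd]; apply: wt_mono.
rewrite -(ler_pM2r d0) mulrDl; apply: le_trans A1 _.
have -> : 2 * Psa * `|x - y| / Num.sqrt d * d = 2 * Psa * Num.sqrt d * `|x - y|.
  by rewrite -{2}(sqr_sqrtr (ltW d0)); field; rewrite gt_eqF.
by lra.
Qed.

Definition good x := @lebesgue_measure R (xsection N x) = 0%E.

Lemma ae_good : {ae mu, forall x, good x}.
Proof. exact: good_section. Qed.

Lemma absorbed_window x t1 t2 t : 0 <= t1 -> t1 <= t2 -> t2 <= t ->
  itg t1 t2 (source x) <= S x t.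
Proof.
move=> t10 t12 t2t; have l := lbm2_r x ls.
have P a b : 0 <= a -> a <= b -> 0 <= itg a b (source x).
  move=> a0 ab; rewrite -[0](mul0r (b - a)) -itg_cst//; apply: itg_le; [exact: lbm_cst|exact: l|].
  by move=> s /andP[ts _]; apply: source_ge0; exact: le_trans ts.
have t20 := le_trans t10 t12.
rewrite /absorbed (itg_split l t20 t2t) (itg_split l t10 t12).
by have := P 0 t1 (lexx 0) t10; have := P t2 t t20 t2t; lra.
Qed.

Lemma absorbed_ge x t1 t2 t c : good x -> 0 < t1 -> t1 <= t2 -> t2 <= t -> 0 <= c ->
  (forall s, t1 <= s <= t2 -> p x s = 1 /\ c <= u x s) -> c * (t2 - t1) <= S x t.
Proof.
move=> gx t10 t12 t2t c0 H; apply: le_trans (absorbed_window x (ltW t10) t12 t2t).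
rewrite -itg_cst//.
have mNr : @measurable _ (measurableTypeR R) (xsection N x) by exact: measurable_xsection x mN.
apply: (itg_null_le (lbm_cst c) (lbm2_r x ls) mNr gx) => s st Ns.
have s0 : 0 < s by apply: lt_le_trans t10 _; case/andP: st.
by rewrite good_source//; have [-> ?] := H s st; rewrite mul1r.
Qed.

(** Near the origin [wt] is close to 0 while [psi] takes its plateau value Psi alpha > ustar, so the
    threshold is exceeded at an early time. *)
Lemma near_one : exists r t0, [/\ 0 < r, 0 < t0, r <= alpha * Num.sqrt t0 &
  forall y t, `|y| <= r -> t0 <= t -> p y t = 1].
Proof.
have e0 : 0 < (Psa - ustar) / 2 by rewrite divr_gt0// subr_gt0.
have [d d0 Hd] := (cont2P _).2 cont2_wt 0 0 _ e0.
have d2 : 0 < d / 2 by rewrite divr_gt0.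
have s0 : 0 < alpha * Num.sqrt (d / 2) by rewrite mulr_gt0// sqrtr_gt0.
exists (Num.min (d / 2) (alpha * Num.sqrt (d / 2))), (d / 2); split => //.
- by rewrite lt_min d2 s0.
- by rewrite ge_min lexx orbT.
move=> y t; rewrite le_min => /andP[y1 y2] dt.
apply: (p_one (ltW d2) dt).
have := Hd y (d / 2); rewrite !subr0 (gtr0_norm d2) wt0 subr0 => /(_ _ _)/wrap[||].
- by apply: le_lt_trans y1 _; lra.
- by lra.
rewrite (wtE y (ltW d2)) psi_in// ler_norml => /andP[H _]; lra.
Qed.

(** Otherwise [u] would stay above [e] on the strip where [p = 1]. The amount absorbed there would
    grow linearly in time, whereas the flux that feeds it grows only like the square root. *)
Lemma u0_vanish (e : R) : 0 < e -> exists2 T, 0 < T & forall t, T <= t -> u 0 t <= e.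
Proof.
move=> e0; apply: contrapT => H.
have psi0 t : 0 < t -> psi 0 t = Psa.
  by move=> t0; apply: psi_in => //; rewrite normr0 mulr_ge0 ?sqrtr_ge0// ltW.
have w0 t : 0 < t -> e - Psa <= wt 0 t.
  move=> t0; rewrite leNgt; apply/negP => K; apply: H; exists t => // s ts.
  have s0 := lt_le_trans t0 ts.
  have := wt_mono 0 (ltW t0) ts; rewrite (wtE 0 (ltW s0)) psi0//; lra.
have P0 : 0 < Psa by exact: Psi_gt0.
(* The lower bound at 0 spreads to every [y]: in [wt_le_shift] the error vanishes as the time step
   grows, and the bound at 0 holds at all later times. *)
have wy y t : 0 <= t -> e - Psa <= wt y t.
  move=> t0; apply/ler_addgt0Pr => e' e'0.
  pose a := 2 * Psa * `|y| / e' + 1.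
  have a1 : 0 <= 2 * Psa * `|y| / e' by rewrite divr_ge0 ?(ltW e'0)//; apply: mulr_ge0 => //; lra.
  have a0 : 0 < a by rewrite /a ltr_wpDl.
  have d0 : 0 < a ^+ 2 by rewrite exprn_gt0.
  have := wt_le_shift 0 y t0 d0; rewrite sub0r normrN sqrtr_sqr (gtr0_norm a0).
  have : 2 * Psa * `|y| / a <= e'.
    by rewrite ler_pdivrMr// -ler_pdivrMl// mulrC /a lerDl.
  by have := w0 _ (ltr_wpDl t0 d0); lra.
have [r [t0 [r0 t00 rt p1]]] := near_one.
pose q := r * e.
have q0 : 0 < q by rewrite mulr_gt0.
pose b := r * Psa + q * t0.
have b0 : 0 < b by rewrite /b addr_gt0// mulr_gt0.
(* At time sg^2 the absorption over [0, r] is at least q * sg^2 up to the constant [b], the two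
   fluxes together are at most 4 * Psa * sg, and this [sg] makes the former win. *)
pose sg := (4 * Psa + b) / q + 1.
have sg1 : 1 <= sg.
  have : 0 <= (4 * Psa + b) / q by rewrite divr_ge0 ?(ltW q0)//; lra.
  by rewrite /sg; lra.
have sg0 : 0 < sg by exact: lt_le_trans sg1.
have qs : q * sg = 4 * Psa + b + q by rewrite /sg mulrDr mulr1 mulrC mulfVK// gt_eqF.
have qs2 : q * sg ^+ 2 = (4 * Psa + b + q) * sg by rewrite -qs; ring.
have key : 4 * Psa * sg + b < q * sg ^+ 2.
  have bs : b <= b * sg by rewrite ler_peMr// ltW.
  have qsg : 0 < q * sg by rewrite mulr_gt0.
  by rewrite qs2 (mulrDl _ q) (mulrDl _ b); lra.
have st0 : t0 <= sg ^+ 2.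
  rewrite -(ler_pM2l q0); have : 0 < 4 * Psa * sg by apply: mulr_gt0 => //; lra.
  by have : 0 < r * Psa; [rewrite mulr_gt0|]; rewrite /b in key; lra.
have s20 : 0 < sg ^+ 2 by rewrite exprn_gt0.
have FB := flux_balance (ltW r0) (ltW s20).
have B x : `|itg 0 (sg ^+ 2) (wx x)| <= 2 * Psa * sg.
  by have := flux_bound x (lexx 0) s20; rewrite add0r sqrtr_sqr (gtr0_norm sg0).
have B1 := B r; have B2 := B 0.
have L : (e * (sg ^+ 2 - t0) - Psa) * r <= itg 0 r (fun z => wt z (sg ^+ 2) + S z (sg ^+ 2)).
  rewrite -{1}(subr0 r) -itg_cst ?(ltW r0)//; apply: itg_ae_le.
  - exact: lbm_cst.
  - by apply: lbmD; [apply: continuous_lbm; exact: cont2_l|apply: lbm_absorbed; exact: ltW].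
  have [N1 [mN1 N10 HN1]] := ae_good; exists N1; split => // z /= Hz.
  apply: HN1 => /= gz; apply: Hz => /andP[z0 zr].
  have : e * (sg ^+ 2 - t0) <= S z (sg ^+ 2).
    apply: absorbed_ge => //; first exact: ltW.
    move=> s /andP[ts ss]; have s_gt0 := lt_le_trans t00 ts.
    split; first by apply: p1 => //; rewrite ger0_norm.
    have := wy z s (ltW s_gt0); rewrite (wtE z (ltW s_gt0)) psi_in//.
      by lra.
    rewrite ger0_norm// (le_trans zr)// (le_trans rt)// ler_pM2l// ler_wsqrtr//.
  by have := wt_ge z (ltW s20); lra.
move: B1 B2 FB L; rewrite /b /q in key.
rewrite !ler_norml => /andP[_ B1] /andP[B2 _] -> L.
by lra.
Qed.

(** The first half of the time makes u(0, .) small, the second half pays for the shift from 0 to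
    [x]. *)
Lemma wt_small (e : R) : 0 < e -> exists2 T, 0 < T & forall x t, T <= t ->
  wt x t + Psa <= e + 4 * Psa * `|x| / Num.sqrt t.
Proof.
move=> e0; have [T T0 HT] := u0_vanish e0; exists (2 * T); first by rewrite mulr_gt0.
move=> x t Tt; have t2 : T <= t / 2 by lra.
have h0 := lt_le_trans T0 t2; have t0 : 0 < t by lra.
have P0 : 0 < Psa by exact: Psi_gt0.
have := wt_le_shift x 0 (ltW h0) h0; rewrite subr0 -splitr.
rewrite (wtE 0 (ltW h0)) (@psi_in _ _ _ _ 0 (t / 2))//; last first.
  by rewrite normr0 mulr_ge0 ?sqrtr_ge0// ltW.
have := HT _ t2.
have : 2 * Psa * `|x| / Num.sqrt (t / 2) <= 4 * Psa * `|x| / Num.sqrt t.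
  rewrite ler_pdivrMr ?sqrtr_gt0// [leRHS]mulrAC ler_pdivlMr ?sqrtr_gt0//.
  have : Num.sqrt t <= 2 * Num.sqrt (t / 2).
    rewrite -(@ler_pXn2r _ 2) ?nnegrE ?mulr_ge0 ?sqrtr_ge0//.
    by rewrite exprMn (sqr_sqrtr (ltW t0)) (sqr_sqrtr (ltW h0)); lra.
  have : 0 <= 2 * Psa * `|x| by apply: mulr_ge0 => //; lra.
  have -> : 4 * Psa * `|x| = 2 * (2 * Psa * `|x|) by ring.
  move: (Num.sqrt t) (Num.sqrt (t / 2)) (2 * Psa * `|x|) => a b c; nra.
lra.
Qed.

(** * Scaling limit *)

Local Notation g := (fun k t => wt k (k ^+ 2 * t)).

Variable V : R -> R.
Hypothesis V_lim : {ae mu, forall eta, 0 <= eta ->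
  u (eta * Num.sqrt t) t @[t --> +oo%R] --> V eta}.

(** The substitution t = eta^-2, k = eta * sqrt(time) turns the limits defining [V] into limits of
    [g k t]; a set of [eta] of full measure meets every interval. *)
Lemma good_dense a b : 0 < a -> a < b ->
  exists t (l : R), [/\ a < t, t < b & g k t @[k --> +oo%R] --> l].
Proof.
move=> a0 ab; have b0 := lt_trans a0 ab.
have sa : 0 < Num.sqrt a by rewrite sqrtr_gt0.
have sab : Num.sqrt a < Num.sqrt b by rewrite ltr_sqrt.
have sb := lt_trans sa sab.
have [N1 [mN1 N10 HN1]] := V_lim.
have I : (Num.sqrt b)^-1 < (Num.sqrt a)^-1 by rewrite ltf_pV2.
have [eta [eab etaN]] : exists eta, (Num.sqrt b)^-1 < eta < (Num.sqrt a)^-1 /\ ~ N1 eta.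
  apply: contrapT => H.
  pose J : set R := `](Num.sqrt b)^-1, (Num.sqrt a)^-1[%classic.
  have sub : J `<=` N1.
    move=> eta; rewrite /J /= in_itv /= => eab; apply: contrapT => Ne; apply: H.
    by exists eta.
  have mJ : @measurable _ (measurableTypeR R) J by exact: measurable_itv.
  have : (mu J <= mu N1)%E by exact: (le_measure mu (mem_set mJ) (mem_set mN1) sub).
  by rewrite N10 /J lebesgue_measure_itv /= lte_fin I -EFinB lee_fin subr_le0 leNgt I.
move: eab => /andP[e1 e2].
have eta0 : 0 < eta by apply: lt_trans e1; rewrite invr_gt0.
have {}etaN : u (eta * Num.sqrt t) t @[t --> +oo%R] --> V eta.
  by apply: contrapT => H; apply: etaN; apply: HN1 => /= /(_ (ltW eta0)).
exists (eta ^+ 2)^-1, (V eta - Psi eta).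
have ea : a < (eta ^+ 2)^-1.
  rewrite -[a](sqr_sqrtr (ltW a0)) -[ltLHS]invrK ltf_pV2 ?posrE ?invr_gt0 ?exprn_gt0//.
  by rewrite -exprVn ltr_pXn2r// ?nnegrE ?invr_ge0 ltW.
have eb : (eta ^+ 2)^-1 < b.
  rewrite -[b](sqr_sqrtr (ltW b0)) -[ltRHS]invrK ltf_pV2 ?posrE ?invr_gt0 ?exprn_gt0//.
  by rewrite -exprVn ltr_pXn2r// ?nnegrE ?invr_ge0 ltW.
split => //; have e20 : 0 < (eta ^+ 2)^-1 by rewrite invr_gt0 exprn_gt0.
have := cvgy_comp (fun X => near_sq X e20) etaN => /cvgyP H.
apply/cvgyP => e e0; have := H _ e0; apply: filterS2 (evt_gt 0) => k k0.
have kt : Num.sqrt (k ^+ 2 / eta ^+ 2) = k / eta.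
  by rewrite -expr_div_n sqrtr_sqr ger0_norm// divr_ge0// ltW.
have kt0 : 0 < k ^+ 2 / eta ^+ 2 by rewrite divr_gt0 ?exprn_gt0.
rewrite kt mulrC mulfVK ?gt_eqF// (wtE k (ltW kt0)) psi_pos// kt.
have -> : k / (k / eta) = eta by field; rewrite !gt_eqF.
by move=> K; apply: le_trans K; rewrite le_eqVlt; apply/orP; left; apply/eqP; congr `|_|; ring.
Qed.

Lemma scaled_mono k s t : 0 <= s -> s <= t -> g k t <= g k s.
Proof.
by move=> s0 st; apply: wt_mono; [rewrite mulr_ge0 ?sqr_ge0|rewrite ler_wpM2l ?sqr_ge0].
Qed.

Lemma good_modulus t1 t2 (l1 l2 : R) : 0 < t1 -> t1 < t2 ->
  g k t1 @[k --> +oo%R] --> l1 -> g k t2 @[k --> +oo%R] --> l2 ->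
  l2 <= l1 <= l2 + 2 * Psa * (Num.sqrt (t2 - t1) / t1).
Proof.
move=> t10 t12 G1 G2; have t20 := lt_trans t10 t12.
have h0 : 0 < t2 - t1 by rewrite subr_gt0.
set h := t2 - t1 in h0 *.
have sh0 : 0 < Num.sqrt h by rewrite sqrtr_gt0.
have P0 : 0 < Psa by exact: Psi_gt0.
apply/andP; split; apply/ler_addgt0Pr => e e0; have e2 : 0 < e / 2 by rewrite divr_gt0.
  have /cvgyP/(_ _ e2) H1 := G1; have /cvgyP/(_ _ e2) H2 := G2.
  near (pinfty_nbhs R) => k.
  have K1 : `|g k t1 - l1| <= e / 2 by near: k.
  have K2 : `|g k t2 - l2| <= e / 2 by near: k.
  have := scaled_mono k (ltW t10) (ltW t12); move: K1 K2; rewrite !ler_norml => /andP[? ?] /andP[? ?] ?.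
  by lra.
(* Chosen so that (c k)^2 t1 = k^2 (t2 + h). The limit at [t1] is thus also seen at position c k and
   time k^2 (t2 + h), which [wt_le_shift] compares with position k and time k^2 t2. *)
pose c := Num.sqrt ((t2 + h) / t1).
have q0 : 0 < (t2 + h) / t1 by rewrite divr_gt0// addr_gt0.
have c0 : 0 < c by rewrite sqrtr_gt0.
have c2 : c ^+ 2 = (t2 + h) / t1 by rewrite sqr_sqrtr// ltW.
have cE : c ^+ 2 = 1 + 2 * (h / t1) by rewrite c2 /h; field; rewrite gt_eqF.
have ht0 : 0 < h / t1 by rewrite divr_gt0.
have c1 : 1 <= c by rewrite -(@ler_pXn2r _ 2) ?nnegrE ?ltW// cE expr1n; lra.
have ch : c - 1 <= h / t1.
  rewrite lerBlDl -(@ler_pXn2r _ 2) ?nnegrE ?(ltW c0)//; last by rewrite addr_ge0// ltW.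
  by rewrite cE sqrrD expr1n mul1r -mulr_natl; have := sqr_ge0 (h / t1); lra.
have /cvgyP/(_ _ e2) H1 := cvgy_comp (fun X => near_scale X c0) G1.
have /cvgyP/(_ _ e2) H2 := G2.
near (pinfty_nbhs R) => k.
have k0 : 0 < k by near: k; exact: evt_gt.
have K1 : `|g (c * k) t1 - l1| <= e / 2 by near: k.
have K2 : `|g k t2 - l2| <= e / 2 by near: k.
have d0 : 0 < k ^+ 2 * h by rewrite mulr_gt0// exprn_gt0.
have kt0 : 0 <= k ^+ 2 * t2 by rewrite mulr_ge0 ?sqr_ge0// ltW.
have := wt_le_shift (c * k) k kt0 d0.
have -> : k ^+ 2 * t2 + k ^+ 2 * h = (c * k) ^+ 2 * t1.
  by rewrite exprMn c2; field; rewrite gt_eqF.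
rewrite sqrtrM ?sqr_ge0// sqrtr_sqr (gtr0_norm k0).
have -> : c * k - k = (c - 1) * k by ring.
rewrite normrM (gtr0_norm k0) (ger0_norm (_ : 0 <= c - 1)) ?subr_ge0//.
have -> : 2 * Psa * ((c - 1) * k) / (k * Num.sqrt h) = 2 * Psa * ((c - 1) / Num.sqrt h).
  by field; rewrite !gt_eqF.
have Q : 2 * Psa * ((c - 1) / Num.sqrt h) <= 2 * Psa * (Num.sqrt h / t1).
  have P2 : 0 < 2 * Psa by rewrite mulr_gt0.
  rewrite ler_pM2l// ler_pdivrMr//.
  by rewrite mulrAC -expr2 sqr_sqrtr// ltW.
move: K1 K2; rewrite !ler_norml => /andP[? ?] /andP[? ?] ?.
by lra.
Unshelve. all: by end_near.
Qed.

Lemma good_window t e : 0 < t -> 0 < e -> exists t1 t2 (l1 l2 : R),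
  [/\ 0 < t1 /\ t1 < t, t < t2, g k t1 @[k --> +oo%R] --> l1,
      g k t2 @[k --> +oo%R] --> l2 & l1 <= l2 + e].
Proof.
move=> t0 e0; have P0 : 0 < Psa by exact: Psi_gt0.
have P8 : 0 < 8 * Psa by rewrite mulr_gt0.
(* With sqrt(t2 - t1) <= q and t1 >= t / 2 the bound of [good_modulus] is at most e / 2. *)
pose q := e * t / (8 * Psa).
have q0 : 0 < q by rewrite divr_gt0// mulr_gt0.
pose d := Num.min t (q ^+ 2) / 2.
have m0 : 0 < Num.min t (q ^+ 2) by rewrite lt_min t0 exprn_gt0.
have d0 : 0 < d by rewrite divr_gt0.
have dt : 2 * d <= t.
  by rewrite /d mulrCA divff// mulr1 ge_min lexx.
have dq : 2 * d <= q ^+ 2 by rewrite /d mulrCA divff// mulr1 ge_min lexx orbT.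
have td : 0 < t - d by lra.
have [t1 [l1 [a1 b1 G1]]] := good_dense td (ltac:(lra) : t - d < t).
have [t2 [l2 [a2 b2 G2]]] := good_dense t0 (ltac:(lra) : t < t + d).
have t10 := lt_trans td a1.
exists t1, t2, l1, l2; split => //.
have /andP[_ H] := good_modulus t10 (lt_trans b1 a2) G1 G2.
apply: le_trans H _; rewrite lerD2l.
have s : Num.sqrt (t2 - t1) <= q.
  rewrite -(ger0_norm (ltW q0)) -sqrtr_sqr; apply: ler_wsqrtr; lra.
have -> : e = 2 * Psa * (q / (t / 2)) * 2.
  by rewrite /q; field; rewrite !gt_eqF.
have : Num.sqrt (t2 - t1) / t1 <= q / (t / 2).
  apply: ler_pM; rewrite ?sqrtr_ge0 ?invr_ge0 ?(ltW t10)//.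
  by rewrite lef_pV2 ?posrE//; lra.
have : 0 <= q / (t / 2) by rewrite divr_ge0 ?ltW// divr_gt0.
have P2 : 0 < 2 * Psa by rewrite mulr_gt0.
rewrite -(ler_pM2l P2) mulr0 => H1.
rewrite -(ler_pM2l P2) => H2; lra.
Qed.

(** Monotonicity in [t] squeezes [g k t] between its values at good times on either side, and
    [good_window] makes the limits there as close as desired. *)
Lemma scaled_limit : exists fw : R -> R, (forall t, t <= 0 -> fw t = 0) /\
  forall t, 0 <= t -> g k t @[k --> +oo%R] --> fw t.
Proof.
suff H t : exists l : R, (t <= 0 -> l = 0) /\ (0 <= t -> g k t @[k --> +oo%R] --> l).
  have [fw Hf] := choice H; exists fw; split => t; first by have [] := Hf t.
  by have [] := Hf t.
have [t0|t0] := leP t 0.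
  exists 0; split => // t0'; have -> : t = 0 by apply/eqP; rewrite eq_le t0.
  apply/cvgyP => e e0; apply: filterS (evt_ge 0) => k _.
  by rewrite mulr0 wt0 subrr normr0 ltW.
pose L := [set l : R | exists2 s, t < s & g k s @[k --> +oo%R] --> l].
have mono s1 s2 (l1 l2 : R) : 0 < s1 -> s1 < s2 -> g k s1 @[k --> +oo%R] --> l1 ->
    g k s2 @[k --> +oo%R] --> l2 -> l2 <= l1.
  by move=> s10 s12 G1 G2; have /andP[] := good_modulus s10 s12 G1 G2.
exists (sup L); split => [t0'|_]; first by [].
apply/cvgyP => e e0; have e2 : 0 < e / 2 by rewrite divr_gt0.
have [t1 [t2 [l1 [l2 [[t10 a1] a2 G1 G2 H]]]]] := good_window t0 e2.
have U : ubound L l1.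
  by move=> l [s ts Gs]; apply: (mono _ _ _ _ t10 (lt_trans a1 ts) G1 Gs).
have L2 : L l2 by exists t2.
have s1 : sup L <= l1 by apply: ge_sup => //; exists l2.
have s2 : l2 <= sup L by apply: ub_le_sup => //; exists l1.
have /cvgyP/(_ _ e2) H1 := G1; have /cvgyP/(_ _ e2) H2 := G2.
apply: filterS2 H1 H2 => k; rewrite !ler_norml => /andP[? ?] /andP[? ?].
have := scaled_mono k (ltW t10) (ltW a1); have := scaled_mono k (ltW t0) (ltW a2).
by move=> ? ?; apply/andP; split; lra.
Qed.

Section ScaledLimit.
Variable fw : R -> R.
Hypothesis fw_neg : forall t, t <= 0 -> fw t = 0.
Hypothesis fw_lim : forall t, 0 <= t -> g k t @[k --> +oo%R] --> fw t.

Let Psa_gt0 : 0 < Psa. Proof. exact: Psi_gt0. Qed.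

Lemma fw_npos t : fw t <= 0.
Proof.
have [t0|t0] := leP t 0; first by rewrite fw_neg.
apply: (near_le_lim (fw_lim (ltW t0)) (cvg_cst 0)); apply: filterE => k.
by apply: wt_npos; rewrite mulr_ge0 ?sqr_ge0 ?ltW.
Qed.

Lemma fw_mono s t : s <= t -> fw t <= fw s.
Proof.
move=> st; have [s0|s0] := leP s 0; first by rewrite (fw_neg s0) fw_npos.
apply: (near_le_lim (fw_lim (le_trans (ltW s0) st)) (fw_lim (ltW s0))); apply: filterE => k.
exact: scaled_mono (ltW s0) st.
Qed.

Lemma fw_lower t : 0 < t -> - Psi (1 / Num.sqrt t) <= fw t.
Proof.
move=> t0; have st0 : 0 < Num.sqrt t by rewrite sqrtr_gt0.
apply: (near_le_lim (cvg_cst _) (fw_lim (ltW t0))); apply: filterS (evt_gt 0) => k k0.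
have kt0 : 0 < k ^+ 2 * t by rewrite mulr_gt0 ?exprn_gt0.
apply: le_trans (wt_ge_psi k kt0); rewrite (psi_pos _ _ _ kt0) (sqrtrM _ (sqr_ge0 k)) sqrtr_sqr (gtr0_norm k0).
by have -> : k / (k * Num.sqrt t) = 1 / Num.sqrt t by field; rewrite !gt_eqF.
Qed.

Lemma fw_ge t : - Psa <= fw t.
Proof.
have [t0|t0] := leP t 0; first by rewrite fw_neg// oppr_le0 ltW.
by apply: le_trans (fw_lower t0); rewrite lerN2 Psi_le_alpha.
Qed.

Lemma fw_far t : 0 < t -> fw t + Psa <= 4 * Psa / Num.sqrt t.
Proof.
move=> t0; have st0 : 0 < Num.sqrt t by rewrite sqrtr_gt0.
apply/ler_addgt0Pr => e e0; have [T T0 HT] := wt_small e0.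
apply: (near_le_lim _ (cvg_cst (4 * Psa / Num.sqrt t + e))).
  by apply: cvgD; [exact: fw_lim (ltW t0)|exact: cvg_cst].
apply: filterS2 (evt_gt 0) (near_sq T t0) => k k0 Tk.
have := HT k _ Tk; rewrite sqrtrM ?sqr_ge0// sqrtr_sqr (gtr0_norm k0).
have -> : 4 * Psa * k / (k * Num.sqrt t) = 4 * Psa / Num.sqrt t by field; rewrite !gt_eqF.
by rewrite (addrC e).
Qed.

(** At positive times by [good_window] and monotonicity; at 0 because [fw] lies between - Psi(1 /
    sqrt t) and 0, and [Psi] vanishes at infinity. *)
Lemma fw_continuous : continuous fw.
Proof.
move=> t; apply: epscont => e e0.
have [t0|t0] := leP t 0; last first.
  have [t1 [t2 [l1 [l2 [[t10 a1] a2 G1 G2 H]]]]] := good_window t0 e0.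
  have E1 := lim_unique G1 (fw_lim (ltW t10)).
  have E2 := lim_unique G2 (fw_lim (ltW (lt_trans t0 a2))).
  exists (Num.min (t - t1) (t2 - t)); first by rewrite lt_min !subr_gt0 a1.
  move=> s; rewrite lt_min ltr_norml => /andP[/andP[s1 _]]; rewrite ltr_norml => /andP[_ s2].
  have := fw_mono (ltac:(lra) : t1 <= s); have := fw_mono (ltac:(lra) : s <= t2).
  have := fw_mono (ltW a1); have := fw_mono (ltW a2).
  by move: H; rewrite E1 E2 ler_norml => *; apply/andP; split; lra.
rewrite (fw_neg t0).
have [M aM HM] := Psi_small alpha_gt0 beta_gt0 e0.
have M0 := lt_trans alpha_gt0 aM.
exists (M ^- 2); first by rewrite invr_gt0 exprn_gt0.
move=> s st; rewrite subr0; have [s0|s0] := leP s 0; first by rewrite fw_neg// normr0 ltW.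
rewrite ler0_norm ?fw_npos//; apply: le_trans (HM (1 / Num.sqrt s) _).
  by rewrite lerNl; exact: fw_lower.
have sM : s <= M ^- 2.
  by move: st; rewrite ltr_norml => /andP[_]; lra.
rewrite mul1r -[leLHS]invrK lef_pV2 ?posrE ?invr_gt0 ?sqrtr_gt0//.
rewrite -(ger0_norm (_ : 0 <= M^-1)) ?invr_ge0 ?(ltW M0)// -sqrtr_sqr.
by apply: ler_wsqrtr; rewrite exprVn.
Qed.

Lemma scaled_unif T e : 0 <= T -> 0 < e ->
  \forall k \near +oo%R, forall t, 0 <= t <= T -> `|g k t - fw t| <= e.
Proof.
move=> T0 e0; apply: monotone_uniform => //; first exact: fw_continuous.
by apply: filterE => k s t; exact: scaled_mono.
Qed.

Definition profile (eta : R) : R := if 0 < eta then fw (eta ^- 2) + Psi eta else 0.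

Lemma profileE eta : 0 < eta -> profile eta = fw (eta ^- 2) + Psi eta.
Proof. by rewrite /profile => ->. Qed.

Lemma inv_sq_gt0 (x : R) : 0 < x -> 0 < x ^- 2.
Proof. by move=> x0; rewrite invr_gt0 exprn_gt0. Qed.

Lemma sqrt_inv_sq (x : R) : 0 < x -> Num.sqrt (x ^- 2) = x^-1.
Proof. by move=> x0; rewrite -exprVn sqrtr_sqr gtr0_norm// invr_gt0. Qed.

Lemma profile_ge0 eta : 0 <= profile eta.
Proof.
rewrite /profile; case: ltP => // e0.
have := fw_lower (inv_sq_gt0 e0); rewrite sqrt_inv_sq// div1r invrK; lra.
Qed.

Lemma profile_le eta : 0 <= eta -> profile eta <= 4 * Psa * eta.
Proof.
rewrite le_eqVlt => /predU1P[<-|e0]; first by rewrite /profile ltxx mulr0.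
rewrite profileE//; have := fw_far (inv_sq_gt0 e0); rewrite sqrt_inv_sq// invrK.
by have := Psi_le_alpha alpha_gt0 beta_gt0 eta; lra.
Qed.

Lemma u_scaled eta t : 0 < eta -> 0 < t -> u (eta * Num.sqrt t) t =
  g (eta * Num.sqrt t) (eta ^- 2) + Psi eta.
Proof.
move=> e0 t0; have st0 : 0 < Num.sqrt t by rewrite sqrtr_gt0.
have -> : (eta * Num.sqrt t) ^+ 2 * eta ^- 2 = t.
  by rewrite exprMn (sqr_sqrtr (ltW t0)); field; rewrite gt_eqF.
by rewrite (wtE _ (ltW t0)) psi_pos// mulfK ?gt_eqF// subrK.
Qed.

(** For small [eta] both terms are small by [wt_small] and [profile_le]. All other [eta], however
    large, correspond to eta^-2 in one compact interval [0, eta0^-2], where [scaled_unif]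
    applies. *)
Lemma u_uniform e : 0 < e -> \forall t \near +oo%R,
  forall eta, 0 <= eta -> `|u (eta * Num.sqrt t) t - profile eta| <= e.
Proof.
move=> e0; have P := Psa_gt0; have P8 : 0 < 8 * Psa by lra.
have e2 : 0 < e / 2 by rewrite divr_gt0.
pose eta0 := e / (8 * Psa).
have eta00 : 0 < eta0 by rewrite divr_gt0.
have eE : 4 * Psa * eta0 = e / 2 by rewrite /eta0; field; rewrite gt_eqF.
have [T T0 HT] := wt_small e2.
have := near_comp (fun X => near_sqrt X eta00) (scaled_unif (ltW (inv_sq_gt0 eta00)) e0).
have := near_comp (fun X => near_sqrt X eta00) (scaled_unif (ltW (inv_sq_gt0 eta00)) e0).
move=> /evtP[X HX] _.
have [Y HY] := (evtP _).1 (scaled_unif (ltW (inv_sq_gt0 eta00)) e0).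
have [Z HZ] := (evtP _).1 (near_sqrt Y eta00).
apply: filterS3 (evt_ge T) (evt_ge Z) (evt_gt 0) => t Tt Zt t0 eta eta_ge0.
have st0 : 0 < Num.sqrt t by rewrite sqrtr_gt0.
have [le|lt] := leP eta eta0.
  have p1 := profile_ge0 eta; have p2 := profile_le eta_ge0.
  have p3 : 4 * Psa * eta <= e / 2 by rewrite -eE ler_pM2l// mulr_gt0.
  have u0 := ut_ge0 (eta * Num.sqrt t) t0; rewrite total_sol// in u0.
  have := HT (eta * Num.sqrt t) _ Tt.
  rewrite ger0_norm ?mulr_ge0 ?(ltW st0)// mulrA mulfK ?gt_eqF//.
  rewrite (wtE _ (ltW t0)); have := psi_le alpha_gt0 beta_gt0 (eta * Num.sqrt t) t.
  by rewrite ler_norml => ? ?; apply/andP; split; lra.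
have eta_gt0 : 0 < eta by exact: lt_trans lt.
rewrite u_scaled// profileE// opprD addrACA subrr addr0; apply: HY.
  apply: le_trans (HZ t Zt) _; rewrite ler_pM2r// ltW//.
by rewrite (ltW (inv_sq_gt0 eta_gt0)) lef_pV2 ?posrE ?exprn_gt0// ler_pXn2r ?nnegrE// ltW.
Qed.

Variable G : R -> R.
Hypothesis G0 : G 0 = 0.
Hypothesis is_derive_G : forall t, is_derive t (1 : R) G (fw t).

Definition ww x t := itg 0 t (wt x).
Definition nn x t := itg 0 t (wx x).

Lemma ww_scaled T e : 0 <= T -> 0 < e ->
  \forall k \near +oo%R, forall t, 0 <= t <= T -> `|ww k (k ^+ 2 * t) / k ^+ 2 - G t| <= e.
Proof.
move=> T0 e0; have eT : 0 < e / (T + 1) by rewrite divr_gt0// ltr_wpDl.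
have := scaled_unif T0 eT; apply: filterS2 (evt_gt 0) => k k0 H t /andP[t0 tT].
have [P [DP HP]] := primitive (cont2_r (x := k) cont2_wt).
have k20 : 0 < k ^+ 2 by rewrite exprn_gt0.
have kt0 : 0 <= k ^+ 2 * t by rewrite mulr_ge0// ltW.
(* The mean value theorem for this difference replaces a substitution in the integral. *)
have D s : is_derive s (1 : R) (fun s => (k ^+ 2)^-1 * P (k ^+ 2 * s) - G s) (g k s - fw s).
  apply: derB => //; apply: der_eq (derZ (k ^+ 2)^-1 (derC (DP _) (derZ (k ^+ 2) (der_id s)))) _.
  by field; rewrite gt_eqF.
have [c /andP[c0 ct] E] := MVT_le t0 (fun s _ => D s).
have -> : ww k (k ^+ 2 * t) / k ^+ 2 - G t = (g k c - fw c) * t.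
  by rewrite /ww HP// -[t in RHS]subr0 -E mulr0 G0; field; rewrite gt_eqF.
have := H c; rewrite c0 (le_trans ct tT) => /(_ isT) K.
rewrite normrM (ger0_norm t0); apply: le_trans (_ : e / (T + 1) * T <= _).
  by rewrite ler_pM.
by rewrite mulrAC ler_pdivrMr ?ltr_wpDl// ler_pM2l// lerDl.
Qed.

(* [HH x] is the limit of [k^-2 * ww (k * x) (k^2)]; its derivative [HH1] is the
   limit of the integrated flux [k^-1 * nn (k * x) (k^2)]. *)
Definition HH x := x ^+ 2 * G (x ^- 2).
Definition HH1 x := 2 * x * G (x ^- 2) - 2 / x * fw (x ^- 2).

Lemma is_derive_inv_sq x : 0 < x -> is_derive x (1 : R) (fun x => x ^- 2) (- 2 / x ^+ 3).
Proof.
move=> x0; have x20 : x ^+ 2 != 0 by rewrite gt_eqF// exprn_gt0.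
have D2 : is_derive x (1 : R) (fun x => x ^+ 2) (2 * x).
  by apply: der_eq (derM (der_id x) (der_id x)) _; ring.
have D := is_deriveV (f := fun x : R => x ^+ 2) x20 D2; apply: der_eq D _.
by rewrite /GRing.scale /=; field; rewrite gt_eqF.
Qed.

Lemma is_derive_HH x : 0 < x -> is_derive x (1 : R) HH (HH1 x).
Proof.
move=> x0; have D2 : is_derive x (1 : R) (fun x => x ^+ 2) (2 * x).
  by apply: der_eq (derM (der_id x) (der_id x)) _; ring.
apply: der_eq (derM D2 (derC (is_derive_G _) (is_derive_inv_sq x0))) _.
by rewrite /HH1; field; rewrite gt_eqF.
Qed.

(** The similarity form of w = d/dt [ww]: in the limit [ww] behaves like t * HH(x / sqrt t). *)
Lemma HH_id x : 0 < x -> fw (x ^- 2) = HH x - x / 2 * HH1 x.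
Proof. by move=> x0; rewrite /HH /HH1; field; rewrite gt_eqF. Qed.

Lemma nn_lim x : 0 < x -> nn (k * x) (k ^+ 2) / k @[k --> +oo%R] --> HH1 x.
Proof.
move=> x0.
apply: (@semiconvex_derive_cvg R (fun k x => ww (k * x) (k ^+ 2) / k ^+ 2)
  (fun k x => nn (k * x) (k ^+ 2) / k) HH Psa x (HH1 x) x x0).
- exact: is_derive_HH.
- exact: ltW Psa_gt0.
- move=> y; rewrite ltr_norml => /andP[y1 _]; have y0 : 0 < y by lra.
  apply/cvgyP => e e0.
  have e1 : 0 < e / y ^+ 2 by rewrite divr_gt0 ?exprn_gt0.
  have := near_comp (fun X => near_scale X y0) (ww_scaled (ltW (inv_sq_gt0 y0)) e1).
  apply: filterS2 (evt_gt 0) => k k0 /(_ (y ^- 2)).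
  rewrite lexx (ltW (inv_sq_gt0 y0)) => /(_ isT).
  have -> : (y * k) ^+ 2 * y ^- 2 = k ^+ 2 by field; rewrite gt_eqF.
  rewrite ler_pdivlMr ?exprn_gt0// -{2}(gtr0_norm (_ : 0 < y ^+ 2)) ?exprn_gt0// -normrM.
  rewrite (mulrC y k); apply: le_trans; rewrite le_eqVlt; apply/orP; left; apply/eqP.
  by congr `|_|; rewrite /HH; field; rewrite !gt_eqF.
- apply: filterS (evt_gt 0) => k k0 y.
  have D := @is_derive_param R wt wx 0 (k ^+ 2) (k * y) cont2_wx is_derive_wt cont2_wt (sqr_ge0 k).
  have := derZ (k ^+ 2)^-1 (derC D (derZ k (der_id y))).
  rewrite (_ : (fun y => (k ^+ 2)^-1 * _) = (fun y => ww (k * y) (k ^+ 2) / k ^+ 2)); last first.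
    by apply/funext => z; rewrite mulrC.
  by move=> D'; apply: der_eq D' _; rewrite /nn; field; rewrite gt_eqF.
- apply: filterS (evt_gt 0) => k k0 a b ab.
  have kab : k * a <= k * b by rewrite ler_pM2l.
  have := flux_lower (lexx 0) (sqr_ge0 k) kab; rewrite add0r -/(nn _ _) -/(nn _ _).
  rewrite -mulrBl ler_pdivlMr// => H; apply: le_trans H.
  by rewrite le_eqVlt; apply/orP; left; apply/eqP; ring.
Qed.

Definition mean_absorbed a b k := itg (k * a) (k * b) (S ^~ (k ^+ 2)) / k.

Lemma mean_absorbedE a b k : 0 < k -> a <= b ->
  mean_absorbed a b k = nn (k * b) (k ^+ 2) / k - nn (k * a) (k ^+ 2) / k
    - itg (k * a) (k * b) (wt ^~ (k ^+ 2)) / k.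
Proof.
move=> k0 ab; have kab : k * a <= k * b by rewrite ler_pM2l.
have := flux_balance kab (sqr_ge0 k).
rewrite itgD; [|by apply: continuous_lbm; exact: cont2_l|exact: lbm_absorbed (sqr_ge0 k)].
rewrite /mean_absorbed /nn -!mulrBl => <-; congr (_ / _); ring.
Qed.

(** For z in [k a, k b] the time k^2 lies between z^2 b^-2 and z^2 a^-2, so monotonicity in time
    leaves only limits at the two fixed ratios. *)
Lemma mean_wt a b e : 0 < a -> a <= b -> 0 < e -> \forall k \near +oo%R,
  (fw (a ^- 2) - e) * (b - a) <= itg (k * a) (k * b) (wt ^~ (k ^+ 2)) / k
  <= (fw (b ^- 2) + e) * (b - a).
Proof.
move=> a0 ab e0; have b0 := lt_le_trans a0 ab.
have /cvgyP/(_ _ e0)/evtP[X1 HX1] := fw_lim (ltW (inv_sq_gt0 a0)).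
have /cvgyP/(_ _ e0)/evtP[X2 HX2] := fw_lim (ltW (inv_sq_gt0 b0)).
apply: filterS3 (evt_gt 0) (near_scale X1 a0) (near_scale X2 a0) => k k0 K1 K2.
have kab : k * a <= k * b by rewrite ler_pM2l.
have lwt : lbm (wt ^~ (k ^+ 2)) by apply: continuous_lbm; exact: cont2_l.
have I z : k * a <= z <= k * b -> fw (a ^- 2) - e <= wt z (k ^+ 2) <= fw (b ^- 2) + e.
  move=> /andP[z1 z2]; have z0 : 0 < z by apply: lt_le_trans z1; rewrite mulr_gt0.
  have z1' : X1 <= z by rewrite (le_trans K1)// mulrC.
  have z2' : X2 <= z by rewrite (le_trans K2)// mulrC.
  have := HX1 _ z1'; have := HX2 _ z2'; rewrite !ler_norml => /andP[_ U] /andP[L _].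
  have Ea : k ^+ 2 <= z ^+ 2 * a ^- 2.
    by rewrite ler_pdivlMr ?exprn_gt0// -exprMn ler_pXn2r ?nnegrE ?mulr_ge0 ?(ltW k0) ?(ltW a0) ?(ltW z0).
  have Eb : z ^+ 2 * b ^- 2 <= k ^+ 2.
    by rewrite ler_pdivrMr ?exprn_gt0// -exprMn ler_pXn2r ?nnegrE ?mulr_ge0 ?(ltW k0) ?(ltW b0) ?(ltW z0).
  have := wt_mono z (sqr_ge0 k) Ea.
  have := wt_mono z (ltac:(by rewrite mulr_ge0 ?sqr_ge0// ltW// inv_sq_gt0) : 0 <= z ^+ 2 * b ^- 2) Eb.
  by move=> *; apply/andP; split; lra.
rewrite ler_pdivlMr// ler_pdivrMr// -!mulrA (mulrC (b - a)) mulrBr -!itg_cst//.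
by apply/andP; split; apply: itg_le => //; try exact: lbm_cst; move=> z /I /andP[].
Qed.

Lemma mean_absorbed_bounds a b e : 0 < a -> a <= b -> 0 < e -> \forall k \near +oo%R,
  HH1 b - HH1 a - fw (b ^- 2) * (b - a) - e <= mean_absorbed a b k
  <= HH1 b - HH1 a - fw (a ^- 2) * (b - a) + e.
Proof.
move=> a0 ab e0; have b0 := lt_le_trans a0 ab.
have e4 : 0 < e / 4 by rewrite divr_gt0.
have e1 : 0 < e / 2 / (b - a + 1) by rewrite !divr_gt0// ltr_wpDl// subr_ge0.
have /cvgyP/(_ _ e4) Na := nn_lim a0; have /cvgyP/(_ _ e4) Nb := nn_lim b0.
have Mw := mean_wt a0 ab e1.
near=> k.
have k0 : 0 < k by near: k; exact: evt_gt.
have Ka : `|nn (k * a) (k ^+ 2) / k - HH1 a| <= e / 4 by near: k.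
have Kb : `|nn (k * b) (k ^+ 2) / k - HH1 b| <= e / 4 by near: k.
have Kw : (fw (a ^- 2) - e / 2 / (b - a + 1)) * (b - a) <= itg (k * a) (k * b) (wt ^~ (k ^+ 2)) / k
  <= (fw (b ^- 2) + e / 2 / (b - a + 1)) * (b - a) by near: k.
have E : e / 2 / (b - a + 1) * (b - a) <= e / 2.
  rewrite mulrAC ler_pdivrMr ?ltr_wpDl ?subr_ge0// ler_pM2l ?divr_gt0//; lra.
rewrite mean_absorbedE//; move: Ka Kb Kw; rewrite !ler_norml mulrBl mulrDl.
move=> /andP[? ?] /andP[? ?] /andP[? ?]; apply/andP; split; lra.
Unshelve. all: by end_near.
Qed.

Lemma mean_absorbed_ge0 a b k : 0 < k -> a <= b -> 0 <= mean_absorbed a b k.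
Proof.
move=> k0 ab; have kab : k * a <= k * b by rewrite ler_pM2l.
rewrite divr_ge0 ?(ltW k0)// -[0](mul0r (k * b - k * a)) -itg_cst//; apply: itg_le.
- exact: lbm_cst.
- exact: lbm_absorbed (sqr_ge0 k).
move=> z _; have := absorbed_window z (lexx 0) (lexx 0) (sqr_ge0 k).
by rewrite itg_xx.
Qed.

Lemma HH1_lower a b : 0 < a -> a <= b -> fw (a ^- 2) * (b - a) <= HH1 b - HH1 a.
Proof.
move=> a0 ab; apply/ler_addgt0Pr => e e0.
have B := mean_absorbed_bounds a0 ab e0; near (pinfty_nbhs R) => k.
have k0 : 0 < k by near: k; exact: evt_gt.
have /andP[_ K] : HH1 b - HH1 a - fw (b ^- 2) * (b - a) - e <= mean_absorbed a b k
  <= HH1 b - HH1 a - fw (a ^- 2) * (b - a) + e by near: k.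
by have := mean_absorbed_ge0 k0 ab; lra.
Unshelve. all: by end_near.
Qed.

(** * The profile ahead of the front *)

(** The profile in the variable t = eta^-2. Extended by 0 it is continuous on the whole line, so a
    segment [0, T] handles all large [eta] at once. *)
Definition vt t := fw t + psip alpha beta 1 t.

Lemma psip_neg t : t <= 0 -> psip alpha beta 1 t = 0.
Proof. by move=> t0; rewrite /psip ltNge t0. Qed.

Lemma psip_pos t : 0 < t -> psip alpha beta 1 t = Psi (1 / Num.sqrt t).
Proof. by rewrite /psip => ->. Qed.

Lemma vt_neg t : t <= 0 -> vt t = 0.
Proof. by move=> t0; rewrite /vt fw_neg// psip_neg// addr0. Qed.

Lemma vt_profile eta : 0 < eta -> profile eta = vt (eta ^- 2).
Proof.
move=> e0; rewrite (profileE e0) /vt (psip_pos (inv_sq_gt0 e0)).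
by rewrite (sqrt_inv_sq e0) div1r invrK.
Qed.

Lemma u_vt k t : 0 < k -> 0 < t -> u k (k ^+ 2 * t) = g k t + psip alpha beta 1 t.
Proof.
move=> k0 t0; have kt0 : 0 < k ^+ 2 * t by rewrite mulr_gt0 ?exprn_gt0.
have st0 : 0 < Num.sqrt t by rewrite sqrtr_gt0.
rewrite (wtE _ (ltW kt0)) psi_pos// psip_pos// sqrtrM ?sqr_ge0// sqrtr_sqr (gtr0_norm k0).
have -> : k / (k * Num.sqrt t) = 1 / Num.sqrt t by field; rewrite !gt_eqF.
by rewrite subrK.
Qed.

Lemma vt_continuous : continuous vt.
Proof.
move=> t; apply: cvgD; first exact: fw_continuous.
apply: epscont => e e0; have [t0|t0] := leP t 0; last first.
  have := @cont_psi _ alpha beta 1 t t0 => /cvgrPdist_le/(_ _ e0)/nbhs_ballP[d /= d0 Hd].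
  exists (Num.min d t); first by rewrite lt_min d0.
  move=> s; rewrite lt_min => /andP[sd]; rewrite ltr_norml => /andP[st _].
  rewrite !psipE//; last lra.
  rewrite distrC; apply: (Hd (1, s)); split => /=; first exact: ballxx.
  by rewrite /ball /= distrC.
rewrite (psip_neg t0).
have [M aM HM] := Psi_small alpha_gt0 beta_gt0 e0.
have M0 := lt_trans alpha_gt0 aM.
exists (M ^- 2); first by rewrite invr_gt0 exprn_gt0.
move=> s st; rewrite subr0; have [s0|s0] := leP s 0; first by rewrite psip_neg// normr0 ltW.
rewrite psip_pos// gtr0_norm ?Psi_gt0//; apply: HM.
have sM : s <= M ^- 2.
  by move: st; rewrite ltr_norml => /andP[_]; lra.
rewrite mul1r -[leLHS]invrK lef_pV2 ?posrE ?invr_gt0 ?sqrtr_gt0//.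
rewrite -(ger0_norm (_ : 0 <= M^-1)) ?invr_ge0 ?(ltW M0)// -sqrtr_sqr.
by apply: ler_wsqrtr; rewrite exprVn.
Qed.

Lemma exceed_by_third (c v f0 f2 w0 w2 ws y0 ys z0 zs y : R) :
  0 < (v - c) / 3 -> f0 - (v - c) / 3 <= f2 -> - ((v - c) / 3) <= w2 - f2 ->
  w2 <= ws -> y0 <= ys -> ws = zs - ys -> w0 = z0 - y0 -> z0 = w0 + y -> v = f0 + y -> c < zs.
Proof. by move=> *; lra. Qed.

Lemma le_half_of_dist (c v f w y : R) :
  w - f <= (c - v) / 2 -> f + y <= v -> w + y <= (c + v) / 2.
Proof. by move=> *; lra. Qed.

(** If the profile exceeded [ustar] at [t], then [u > ustar] and [p = 1] on windows [x^2 t, x^2 t2]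
    for large x; the absorbed amount would be of order k^2, while [mean_absorbed] is bounded. *)
Lemma vt_le_ustar t : vt t <= ustar.
Proof.
have [t0|t0] := leP t 0; first by rewrite vt_neg// ltW.
rewrite leNgt; apply/negP => H.
have dl : 0 < (vt t - ustar) / 3 by rewrite divr_gt0// subr_gt0.
have [d d0 Hd] := cont_eps (fw_continuous (x := t)) dl.
pose t2 := t + d / 2.
have tt2 : t < t2 by rewrite /t2 ltrDl divr_gt0.
have t20 := lt_trans t0 tt2.
have F2 : fw t - (vt t - ustar) / 3 <= fw t2.
  have := Hd t2; rewrite /t2 addrAC subrr add0r gtr0_norm ?divr_gt0// => /(_ ltac:(lra)).
  by rewrite ler_norml => /andP[? _]; lra.
have /cvgyP/(_ _ dl)/evtP[X HX] := fw_lim (ltW t20).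
have UX x s : X <= x -> 0 < x -> x ^+ 2 * t <= s -> s <= x ^+ 2 * t2 -> ustar < u x s.
  move=> Xx x0 s1 s2; have xt0 : 0 < x ^+ 2 * t by rewrite mulr_gt0 ?exprn_gt0.
  have s0 := lt_le_trans xt0 s1.
  have W := wt_mono x (ltW s0) s2; have P := psi_le_t alpha_gt0 beta_gt0 x (ltW xt0) s1.
  have := HX _ Xx; rewrite ler_norml => /andP[U0 _].
  have U1 := wtE x (ltW s0); have U2 := wtE x (ltW xt0); have U3 := u_vt x0 t0.
  exact: exceed_by_third dl F2 U0 W P U1 U2 U3 (erefl (vt t)).
(* For z <= k b the window [z^2 t, z^2 t2] lies before time k^2, as b^2 t2 = 1. *)
pose b := (Num.sqrt t2)^-1; have st2 : 0 < Num.sqrt t2 by rewrite sqrtr_gt0.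
have b0 : 0 < b by rewrite invr_gt0.
have bE : b ^+ 2 * t2 = 1 by rewrite /b exprVn sqr_sqrtr ?(ltW t20)// mulVf// gt_eqF.
pose a := b / 2; have a0 : 0 < a by rewrite divr_gt0.
have ab : a <= b by rewrite /a; lra.
pose c := ustar * (a ^+ 2 * (t2 - t)).
have c0 : 0 < c by rewrite !mulr_gt0 ?exprn_gt0// subr_gt0.
have low : \forall k \near +oo%R, c * (b - a) * k ^+ 2 <= mean_absorbed a b k.
  apply: filterS2 (evt_gt 0) (near_scale X a0) => k k0 Xk.
  have kab : k * a <= k * b by rewrite ler_pM2l.
  rewrite /mean_absorbed ler_pdivlMr//.
  have -> : c * (b - a) * k ^+ 2 * k = c * k ^+ 2 * (k * b - k * a) by ring.
  rewrite -itg_cst//; apply: itg_ae_le; [exact: lbm_cst|exact: lbm_absorbed (sqr_ge0 k)|].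
  have [N1 [mN1 N10 HN1]] := ae_good; exists N1; split => // z /= Hz.
  apply: HN1 => /= gz; apply: Hz => /andP[z1 z2].
  have z0 : 0 < z by apply: lt_le_trans z1; rewrite mulr_gt0.
  have Xz : X <= z by rewrite (le_trans Xk)// mulrC.
  have zt0 : 0 < z ^+ 2 * t by rewrite mulr_gt0 ?exprn_gt0.
  have ztt : z ^+ 2 * t <= z ^+ 2 * t2 by rewrite ler_pM2l ?exprn_gt0// ltW.
  have ztk : z ^+ 2 * t2 <= k ^+ 2.
    have : z ^+ 2 <= (k * b) ^+ 2 by rewrite ler_pXn2r ?nnegrE ?(ltW z0)// mulr_ge0// ltW.
    rewrite -(ler_pM2r t20) (_ : (k * b) ^+ 2 * t2 = k ^+ 2 * (b ^+ 2 * t2)); last by ring.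
    by rewrite bE mulr1.
  apply: le_trans (absorbed_ge gz zt0 ztt ztk (ltW ustar_gt0) _); last first.
    move=> s /andP[s1 s2]; have us := UX z s Xz z0 s1 s2; split; last exact: ltW.
    by apply: (p_one (ltW (lt_le_trans zt0 s1)) (lexx s)).
  have -> : c * k ^+ 2 = ustar * ((t2 - t) * (k * a) ^+ 2) by rewrite /c; ring.
  rewrite -mulrBr ler_pM2l// (mulrC (z ^+ 2)) ler_pM2l ?subr_gt0//.
  by rewrite ler_pXn2r ?nnegrE ?(ltW z0)// mulr_ge0// ltW.
have B := mean_absorbed_bounds a0 ab ltr01.
set Q := HH1 b - HH1 a - fw (a ^- 2) * (b - a) + 1 in B.
have cb : 0 < c * (b - a) by rewrite mulr_gt0// subr_gt0 /a; lra.
near (pinfty_nbhs R) => k.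
have K1 : c * (b - a) * k ^+ 2 <= mean_absorbed a b k by near: k.
have /andP[_ K2] : HH1 b - HH1 a - fw (b ^- 2) * (b - a) - 1 <= mean_absorbed a b k <= Q by near: k.
have K3 : Q + 1 <= k ^+ 2 * (c * (b - a)) by near: k; exact: near_sq.
by lra.
Unshelve. all: by end_near.
Qed.

(** On the compact [0, T] strict inequality leaves a margin, and by uniform convergence u(x, .)
    keeps half of it; so the running supremum, too, is strictly below [ustar]. *)
Lemma outer_zero T : 0 <= T -> (forall t, 0 <= t <= T -> vt t < ustar) ->
  \forall x \near +oo%R, forall s, 0 <= s <= x ^+ 2 * T -> p x s = 0.
Proof.
move=> T0 H.
have [c] := @EVT_max R vt 0 T T0 (continuous_subspaceT vt_continuous).
rewrite in_itv /= => cT Hc.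
have e0 : 0 < (ustar - vt c) / 2 by rewrite divr_gt0// subr_gt0 H.
have m0 : 0 <= vt c by rewrite -(vt_neg (lexx 0)); apply: Hc; rewrite in_itv /= lexx.
apply: filterS2 (scaled_unif T0 e0) (evt_gt 0) => x Hx x0 s /andP[s0 sT].
have x20 : 0 < x ^+ 2 by rewrite exprn_gt0.
apply: (@p_zero x s ((ustar + vt c) / 2)) => // [|r /andP[r0 rs]]; first lra.
move: r0; rewrite le_eqVlt => /predU1P[<-|r0].
  by have := wtE x (lexx 0); rewrite wt0 psi_0 gt_eqF//; lra.
have t0 : 0 < r / x ^+ 2 by rewrite divr_gt0.
have tT : r / x ^+ 2 <= T by rewrite ler_pdivrMr// mulrC (le_trans rs).
have := u_vt x0 t0; rewrite (_ : x ^+ 2 * (r / x ^+ 2) = r); last by field; rewrite gt_eqF.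
move=> ->; have := Hx (r / x ^+ 2); rewrite (ltW t0) tT => /(_ isT).
have := Hc (r / x ^+ 2); rewrite in_itv /= (ltW t0) tT => /(_ isT).
rewrite (_ : x ^+ 2 * (r / x ^+ 2) = r); last by field; rewrite gt_eqF.
by rewrite ler_norml => Hv /andP[_ Hw]; exact: le_half_of_dist Hw Hv.
Qed.

Let good_null x : good x -> exists K, [/\ @measurable _ (measurableTypeR R) K, mu K = 0%E &
  forall s, 0 <= s -> ~ K s -> 0 < s /\ source x s = p x s * u x s].
Proof.
move=> gx.
have mNr : @measurable _ (measurableTypeR R) (xsection N x) by exact: measurable_xsection x mN.
exists (xsection N x `|` [set 0]); split.
- exact: measurableU.
- by apply: (@null_union _ (measurableTypeR R) R mu) => //; exact: lebesgue_measure_set1.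
move=> s s0 /not_orP[Ns s_neq0].
have s_gt0 : 0 < s by rewrite lt_neqAle s0 andbT eq_sym; apply/eqP.
by rewrite good_source.
Qed.

Lemma absorbed_le_itg x t h : good x -> 0 <= t -> lbm h ->
  (forall s, 0 < s -> s <= t -> p x s * u x s <= h s) -> S x t <= itg 0 t h.
Proof.
move=> gx t0 lh H; have [K [mK K0 HK]] := good_null gx.
apply: (itg_null_le (lbm2_r x ls) lh mK K0) => s /andP[s0 st] /(HK s s0)[s_gt0 ->].
exact: H.
Qed.

Lemma absorbed_ge_itg x t h : good x -> 0 <= t -> lbm h ->
  (forall s, 0 < s -> s <= t -> h s <= p x s * u x s) -> itg 0 t h <= S x t.
Proof.
move=> gx t0 lh H; have [K [mK K0 HK]] := good_null gx.
apply: (itg_null_le lh (lbm2_r x ls) mK K0) => s /andP[s0 st] /(HK s s0)[s_gt0 ->].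
exact: H.
Qed.

Lemma absorbed_zero x t : good x -> 0 <= t -> (forall s, 0 <= s <= t -> p x s = 0) -> S x t = 0.
Proof.
move=> gx t0 H; have E s : 0 < s -> s <= t -> p x s * u x s = 0.
  by move=> s0 st; rewrite H ?mul0r// (ltW s0).
apply/eqP; rewrite eq_le.
have E1 s : 0 < s -> s <= t -> p x s * u x s <= 0 by move=> s0 st; rewrite E.
have E2 s : 0 < s -> s <= t -> 0 <= p x s * u x s by move=> s0 st; rewrite E.
have := absorbed_le_itg gx t0 (lbm_cst 0) E1; have := absorbed_ge_itg gx t0 (lbm_cst 0) E2.
by rewrite itg_cst// mul0r => -> ->.
Qed.

Lemma cont_inv_sq x : 0 < x -> {for x, continuous (fun x : R => x ^- 2)}.
Proof. by move=> x0; exact: is_derive_continuous (is_derive_inv_sq x0). Qed.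

Lemma cont_om x : 0 < x -> {for x, continuous (fun x => fw (x ^- 2))}.
Proof.
move=> x0; apply: (@continuous_comp _ _ _ (fun x : R => x ^- 2) fw); first exact: cont_inv_sq.
exact: fw_continuous.
Qed.

Lemma cont_HH1 x : 0 < x -> {for x, continuous HH1}.
Proof.
move=> x0.
have D2 : is_derive x (1 : R) (fun x => 2 * x) 2.
  by apply: der_eq (derZ 2 (der_id x)) _; rewrite mulr1.
have cG : {for x, continuous (fun x => G (x ^- 2))}.
  apply: (@continuous_comp _ _ _ (fun x : R => x ^- 2) G); first exact: cont_inv_sq.
  exact: is_derive_continuous (is_derive_G _).
have ci : {for x, continuous (fun x : R => 2 / x)}.
  apply: cvgM; first exact: cvg_cst.
  by apply: cvgV; [rewrite gt_eqF|exact: cvg_id].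
apply: cvgB; apply: cvgM.
- exact: is_derive_continuous D2.
- exact: cG.
- exact: ci.
- exact: cont_om.
Qed.

Lemma om_le_ustar x : 0 < x -> fw (x ^- 2) + Psi x <= ustar.
Proof. by move=> x0; rewrite -profileE// vt_profile//; exact: vt_le_ustar. Qed.

Lemma HH1_outer r a b : 0 < r -> (forall x, r < x -> fw (x ^- 2) + Psi x < ustar) ->
  r < a -> a <= b ->
  fw (a ^- 2) * (b - a) <= HH1 b - HH1 a <= fw (b ^- 2) * (b - a).
Proof.
move=> r0 H ra ab; have a0 := lt_trans r0 ra; have b0 := lt_le_trans a0 ab.
rewrite HH1_lower//=; apply/ler_addgt0Pr => e e0.
have Z : \forall x \near +oo%R, forall s, 0 <= s <= x ^+ 2 * a ^- 2 -> p x s = 0.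
  apply: outer_zero; first exact: ltW (inv_sq_gt0 a0).
  move=> t /andP[]; rewrite le_eqVlt => /predU1P[<- _|t0 ta]; first by rewrite vt_neg.
  have st0 : 0 < Num.sqrt t by rewrite sqrtr_gt0.
  have E : t = ((Num.sqrt t)^-1) ^- 2 by rewrite exprVn invrK sqr_sqrtr// ltW.
  rewrite E -vt_profile ?invr_gt0// profileE ?invr_gt0//; apply: H.
  apply: lt_le_trans ra _; rewrite -[leLHS]invrK lef_pV2 ?posrE ?invr_gt0//.
  by rewrite -(sqrt_inv_sq a0) ler_wsqrtr.
have /evtP[X HX] := Z.
have B := mean_absorbed_bounds a0 ab e0; near (pinfty_nbhs R) => k.
have k0 : 0 < k by near: k; exact: evt_gt.
have Xk : X <= a * k by near: k; exact: near_scale.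
have /andP[K _] : HH1 b - HH1 a - fw (b ^- 2) * (b - a) - e <= mean_absorbed a b k
  <= HH1 b - HH1 a - fw (a ^- 2) * (b - a) + e by near: k.
suff M0 : mean_absorbed a b k <= 0 by lra.
have kab : k * a <= k * b by rewrite ler_pM2l.
rewrite /mean_absorbed pmulr_lle0 ?invr_gt0// -[leRHS](mul0r (k * b - k * a)) -itg_cst//.
apply: itg_ae_le; [exact: lbm_absorbed (sqr_ge0 k)|exact: lbm_cst|].
have [N1 [mN1 N10 HN1]] := ae_good; exists N1; split => // z /= Hz.
apply: HN1 => /= gz; apply: Hz => /andP[z1 z2].
rewrite absorbed_zero ?sqr_ge0// => s /andP[s0 sk].
have z0 : 0 < z by apply: lt_le_trans z1; rewrite mulr_gt0.
apply: (HX z); first by rewrite (le_trans Xk)// mulrC.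
rewrite s0 (le_trans sk)//= ler_pdivlMr ?exprn_gt0// -exprMn ler_pXn2r ?nnegrE ?(ltW z0)//.
by rewrite mulr_ge0// ltW.
Unshelve. all: by end_near.
Qed.

(** Without a source the derivative of [HH1] is fw(x^-2); combined with [HH_id] this is a closed
    first-order system. *)
Lemma outer_ode r : 0 < r -> (forall x, r < x -> fw (x ^- 2) + Psi x < ustar) ->
  exists C, forall x, r < x -> HH1 x - x * fw (x ^- 2) = C * gs (1 / 4) x /\
    is_derive x (1 : R) (fun x => fw (x ^- 2)) (C / 2 * gs (1 / 4) x).
Proof.
move=> r0 H; pose mm x := HH1 x - x * fw (x ^- 2).
have D1 x : r < x -> is_derive x (1 : R) HH1 (fw (x ^- 2)).
  move=> rx; have x0 := lt_trans r0 rx; have xr : 0 < x - r by rewrite subr_gt0.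
  apply: (derive_sandwich (L := fun a _ => fw (a ^- 2)) (U := fun _ b => fw (b ^- 2)) xr).
    by move=> a b ra ab _; apply: (HH1_outer r0 H) => //; lra.
  move=> e e0; have [d d0 Hd] := cont_eps (cont_om x0) e0; exists d => // a b /Hd ax /Hd bx.
  by move: ax bx; rewrite !ler_norml => /andP[? ?] /andP[? ?]; split; lra.
have Dom x : r < x -> is_derive x (1 : R) (fun x => fw (x ^- 2)) (mm x / 2).
  move=> rx; have x0 := lt_trans r0 rx.
  have D := derB (is_derive_HH x0) (derM (derZ (1 / 2) (der_id x)) (D1 x rx)).
  apply: (der_near x0 _ (der_eq D _)) => [y|].
    rewrite ltr_norml => /andP[y1 _]; have y0 : 0 < y by lra.
    by rewrite (HH_id y0); field.
  by rewrite /mm; field.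
(* The derivative of fw(x^-2) is mm / 2 and that of mm is - x / 2 * mm, so exp(x^2 / 4) * mm is
   constant. *)
pose E x := mm x * gs (- (1 / 4)) x.
have DE x : r < x -> is_derive x (1 : R) E 0.
  move=> rx; have D := derM (derB (D1 x rx) (derM (der_id x) (Dom x rx))) (is_derive_gs (- (1 / 4)) x).
  by apply: der_eq D _; rewrite /mm; field.
have Ec x y : r < x -> x <= y -> E x = E y.
  move=> rx xy; apply: (zero_derive_const xy) => z /andP[xz _].
  by apply: DE; exact: lt_le_trans xz.
have mE x : r < x -> mm x = E (r + 1) * gs (1 / 4) x.
  move=> rx; have -> : E (r + 1) = E x.
    by have [xr|xr] := leP x (r + 1); [rewrite (Ec x (r + 1))|rewrite (Ec (r + 1) x)//; [lra|exact: ltW]].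
  by rewrite /E -mulrA gs_mulV mulr1.
exists (E (r + 1)) => x rx; split; first exact: mE.
by apply: der_eq (Dom x rx) _; rewrite mE//; field.
Qed.

Local Notation cA := (Psi_coef alpha beta).

Lemma quarter_lt_of_dist (a c : R) : 0 < c -> `|a - c| <= c / 4 -> c / 4 < a.
Proof. by move=> c0; rewrite ler_norml => /andP[? _]; lra. Qed.

Lemma touching_step (x x1 h K s H0 H1 m0 m1 f0 f1 p0 p1 cg Cg : R) :
  H1 - H0 <= (m1 + s * h) * h -> p1 - p0 <= - cg * h ->
  x / 2 * (f0 * h) <= x / 2 * (m1 - m0) -> (x1 * f1 - K / 4) / 2 * h <= x / 2 * (f0 * h) ->
  f0 + p0 <= f1 + p1 -> f1 = H1 - x1 / 2 * m1 -> f0 = H0 - x / 2 * m0 ->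
  s * h * h <= K / 4 * h -> 0 < K * h -> K * h = (cg - Cg / 2) * h ->
  (m1 - x1 * f1) * h = Cg * h -> x1 * m1 = x * m1 + h * m1 -> False.
Proof.
by move=> *; lra.
Qed.

(* At the largest contact point the profile leaves [ustar] to the right with
   slope [-K < 0].  There [HH1_lower] is an equality, so that the slope from the
   left is at most [-K], and the profile would exceed [ustar] on the left. *)
Lemma om_lt_ustar x0 : alpha < x0 -> fw (x0 ^- 2) + Psi x0 < ustar.
Proof.
move=> ax0; have x00 := lt_trans alpha_gt0 ax0.
rewrite lt_neqAle om_le_ustar// andbT; apply/eqP => E0.
have cP x : 0 < x -> {for x, continuous (fun x => fw (x ^- 2) + Psi x)}.
  by move=> xp; apply: cvgD; [exact: cont_om|exact: continuous_Psi].
have Ple M (c : R) : (forall x, M <= x -> Psi x <= c) -> alpha < M ->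
    forall x, M <= x -> fw (x ^- 2) + Psi x <= c.
  by move=> HM aM x Mx; rewrite -[leRHS]add0r lerD ?fw_npos ?HM.
pose A := [set x | x0 <= x /\ fw (x ^- 2) + Psi x = ustar].
have u2 : 0 < ustar / 2 by rewrite divr_gt0.
have [M aM HM] := Psi_small alpha_gt0 beta_gt0 u2.
have AM : ubound A M.
  move=> x [_ xE]; rewrite leNgt; apply/negP => Mx.
  by have := Ple M _ HM aM x (ltW Mx); rewrite xE; lra.
have Ax0 : A x0 by split.
have supA : has_sup A by split; [exists x0|exists M].
(* The contact set is bounded, since the profile decays, and by continuity its supremum is a contact
   point; beyond it the source-free equation holds. *)
pose x1 := sup A.
have x01 : x0 <= x1 by apply: ub_le_sup => //; exists M.
have ax1 : alpha < x1 := lt_le_trans ax0 x01.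
have x10 : 0 < x1 := lt_le_trans x00 x01.
have E1 : fw (x1 ^- 2) + Psi x1 = ustar.
  apply/eqP; rewrite eq_le om_le_ustar//=; apply/ler_addgt0Pr => e e0.
  have [d d0 Hd] := cont_eps (cP x1 x10) e0.
  have [y [xy Ey] dy] := sup_adherent d0 supA.
  have yx : y <= x1 by apply: ub_le_sup => //; exists M.
  have := Hd y; rewrite ler0_norm ?subr_le0// opprB => /(_ _)/wrap[|]; first by rewrite -/x1 in dy; lra.
  by rewrite Ey ler_norml lerBlDl => /andP[_].
have beyond x : x1 < x -> fw (x ^- 2) + Psi x < ustar.
  move=> x1x; have xp := lt_trans x10 x1x.
  rewrite lt_neqAle om_le_ustar// andbT; apply/eqP => Ex.
  have : x <= x1 by apply: ub_le_sup; [exists M|split => //; rewrite (le_trans x01)// ltW].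
  by rewrite leNgt x1x.
have [C HC] := outer_ode x10 beyond.
pose B := C / 2 - cA.
have DP x : x1 < x -> is_derive x (1 : R) (fun x => fw (x ^- 2) + Psi x) (B * gs (1 / 4) x).
  move=> x1x; have [_ D] := HC x x1x.
  have D' := is_derive_Psi beta alpha_gt0 (lt_trans ax1 x1x).
  by apply: der_eq (derD D D') _; rewrite /B; ring.
(* To the right of [x1] the slope has the sign of [B], and the profile falls from [ustar] to at most
   ustar / 4. *)
have B0 : B < 0.
  have u4 : 0 < ustar / 4 by rewrite divr_gt0.
  have [M' aM' HM'] := Psi_small alpha_gt0 beta_gt0 u4.
  have [d d0 Hd] := cont_eps (cP x1 x10) u4.
  pose a := x1 + d / 2; pose b := Num.max M' (a + 1).
  have ab : a < b by rewrite /b lt_max; apply/orP; right; rewrite ltrDl.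
  have x1a : x1 < a by rewrite /a ltrDl divr_gt0.
  have Pa := Hd a; rewrite E1 (_ : a - x1 = d / 2) in Pa; last by rewrite /a; ring.
  have {}Pa := Pa _; rewrite gtr0_norm ?divr_gt0// in Pa; have {}Pa := Pa ltac:(lra).
  have Pb : fw (b ^- 2) + Psi b <= ustar / 4 by apply: (Ple M' _ HM' aM'); rewrite le_max lexx.
  have [c /andP[c1 c2] Ec] := MVT_le (ltW ab) (fun x (Hx : a <= x <= b) => DP x ltac:(case/andP: Hx => Hx _; exact: lt_le_trans x1a Hx)).
  rewrite ltNge; apply/negP => B0; have : 0 <= B * gs (1 / 4) c * (b - a).
    by rewrite mulr_ge0 ?subr_ge0 ?(ltW ab)// mulr_ge0// ltW// gs_gt0.
  rewrite -Ec subr_ge0 => Pab.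
  by have := lt_le_trans (quarter_lt_of_dist ustar_gt0 Pa) (le_trans Pab Pb); rewrite ltxx.
pose K := - B * gs (1 / 4) x1.
have gs1 : 0 < gs (1 / 4) x1 by exact: gs_gt0.
have K0 : 0 < K by rewrite mulr_gt0// oppr_gt0.
have m1 : HH1 x1 - x1 * fw (x1 ^- 2) = C * gs (1 / 4) x1.
  apply: (@cont_right_eq _ (fun x => HH1 x - x * fw (x ^- 2)) (fun x => C * gs (1 / 4) x) x1 1) => //.
  - apply: cvgB; first exact: cont_HH1.
    by apply: cvgM; [exact: cvg_id|exact: cont_om].
  - by apply: cvgM; [exact: cvg_cst|exact: continuous_gs].
  - by move=> y y1 _; have [] := HC y y1.
have K4 : 0 < K / 4 by rewrite divr_gt0.
have cxo : {for x1, continuous (fun x => x * fw (x ^- 2))}.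
  by apply: cvgM; [exact: cvg_id|exact: cont_om].
have [d d0 Hd] := cont_eps cxo K4.
(* The step keeps x1 - h ahead of the front and makes two errors at most K / 4: the oscillation of x
   * fw(x^-2), and Psi alpha * h from the lower bound of [fw]. *)
pose h := Num.min (Num.min d (x1 - alpha)) (K / 4 / Psa) / 2.
have m0 : 0 < Num.min (Num.min d (x1 - alpha)) (K / 4 / Psa).
  by rewrite !lt_min d0 subr_gt0 ax1 divr_gt0.
have h0 : 0 < h by rewrite divr_gt0.
have hm : h < Num.min (Num.min d (x1 - alpha)) (K / 4 / Psa).
  by rewrite /h ltr_pdivrMr// ltr_pMr// ltr1n.
move: hm; rewrite !lt_min => /andP[/andP[hd ha] hK].
have {}hK : Psa * h < K / 4 by rewrite mulrC -ltr_pdivlMr.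
pose x := x1 - h.
have xx1 : x <= x1 by rewrite /x gerBl ltW.
have ax : alpha < x by rewrite /x ltrBrDl -ltrBrDr.
have xp : 0 < x := lt_trans alpha_gt0 ax.
have hE : x1 - x = h by rewrite /x; ring.
have L1 := HH1_lower xp xx1; rewrite hE in L1.
have D z (Hz : x <= z <= x1) : is_derive z (1 : R) HH (HH1 z).
  by apply: is_derive_HH; case/andP: Hz => Hz _; exact: lt_le_trans Hz.
have [z /andP[z1 z2] Ez] := MVT_le xx1 D; rewrite hE in Ez.
have z0 : 0 < z by exact: lt_le_trans z1.
have L2 := HH1_lower z0 z2.
have L3 : HH1 z <= HH1 x1 + Psa * h.
  have T1 : - (Psa * h) <= fw (z ^- 2) * (x1 - z).
    apply: (@le_trans _ _ (- Psa * (x1 - z))); last by rewrite ler_wpM2r ?subr_ge0// fw_ge.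
    by rewrite mulNr lerN2 -hE; apply: (ler_wpM2l (ltW Psa_gt0)); rewrite lerD2l lerN2.
  by rewrite -lerBlDl -opprB lerNl; exact: le_trans T1 L2.
have [y /andP[y1 y2] Ey] := MVT_le xx1 (fun y (Hy : x <= y <= x1) => is_derive_Psi beta alpha_gt0
  (ltac:(case/andP: Hy => Hy _; exact: lt_le_trans ax Hy) : alpha < y)).
have gy : gs (1 / 4) x1 <= gs (1 / 4) y.
  by apply: gs_decr => //; exact: le_trans (ltW xp) y1.
have L4 : Psi x1 - Psi x <= - (cA * gs (1 / 4) x1) * h.
  rewrite Ey hE ler_wpM2r ?(ltW h0)// lerN2 ler_wpM2l//.
  exact: ltW (Psi_coef_gt0 alpha_gt0 beta_gt0).
have L5 : HH x1 - HH x <= (HH1 x1 + Psa * h) * h by rewrite Ez ler_wpM2r// ltW.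
have L6 : x / 2 * (fw (x ^- 2) * h) <= x / 2 * (HH1 x1 - HH1 x).
  by rewrite ler_wpM2l// divr_ge0// ltW.
have := Hd x; rewrite distrC hE (gtr0_norm h0) => /(_ hd); rewrite ler_norml => /andP[L7 _].
have L8 : x / 2 * (fw (x ^- 2) * h) >= (x1 * fw (x1 ^- 2) - K / 4) / 2 * h.
  rewrite (_ : x / 2 * (fw (x ^- 2) * h) = x * fw (x ^- 2) / 2 * h); last by ring.
  apply: (ler_wpM2r (ltW h0)); rewrite ler_pM2r ?invr_gt0 ?ltr0n//.
  by move: L7; rewrite lerBrDr addrC.
have L9 := om_le_ustar xp; rewrite -E1 in L9.
have W1 := HH_id x10; have W2 := HH_id xp.
have hK' : Psa * h * h <= K / 4 * h by rewrite ler_wpM2r ?ltW.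
have Kh : 0 < K * h by rewrite mulr_gt0.
have KE : K * h = (cA * gs (1 / 4) x1 - C * gs (1 / 4) x1 / 2) * h by rewrite /K /B; ring.
have m1h : (HH1 x1 - x1 * fw (x1 ^- 2)) * h = C * gs (1 / 4) x1 * h by rewrite m1.
have X1 : x1 * HH1 x1 = x * HH1 x1 + h * HH1 x1 by rewrite -hE; ring.
exact: touching_step L5 L4 L6 L8 L9 W1 W2 hK' Kh KE m1h X1.
Qed.

(** * The profile behind the front *)

Variable q : R -> R.
Hypotheses (lq : lbm q) (q01 : forall x, 0 <= q x <= 1).
Hypothesis q_p : {ae mu, forall x, 0 < x -> forall t, x ^+ 2 / alpha ^+ 2 < t -> p x t = q x}.

(** The integral of fw + Psi alpha over [s, t]. Behind the front fw + Psi alpha is the limit of [u],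
    and [ct] starts at alpha^-2, the scaled time at which the front passes. *)
Definition cw s t := G t - G s + Psa * (t - s).
Local Notation ct := (cw (alpha ^- 2)).

Lemma G_incr s t : s <= t -> - Psa * (t - s) <= G t - G s <= 0.
Proof.
move=> st; have [c _ ->] := MVT_le st (fun x _ => is_derive_G x).
by rewrite ler_wpM2r ?subr_ge0 ?fw_ge// mulr_le0_ge0 ?subr_ge0 ?fw_npos.
Qed.

Lemma cw_mono s t1 t2 : t1 <= t2 -> cw s t1 <= cw s t2.
Proof. by move=> /G_incr/andP[? _]; rewrite /cw; lra. Qed.

Lemma cw_le s t : s <= t -> cw s t <= Psa * (t - s).
Proof. by move=> /G_incr/andP[_ ?]; rewrite /cw; lra. Qed.

Definition settled x := forall t, x ^+ 2 / alpha ^+ 2 < t -> p x t = q x.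

Lemma ae_settled : exists N1 : set R, [/\ @measurable _ (measurableTypeR R) N1, mu N1 = 0%E &
  forall x, 0 < x -> ~ N1 x -> good x /\ settled x].
Proof.
have [A [mA A0 HA]] := ae_good; have [B [mB B0 HB]] := q_p.
exists (A `|` B); split.
- exact: (@measurableU _ (measurableTypeR R)).
- exact: (@null_union _ (measurableTypeR R) R mu).
move=> x x0 /not_orP[Ax Bx]; split.
  by apply: contrapT => H; apply: Ax; exact: HA.
by apply: contrapT => H; apply: Bx; apply: HB => /= /(_ x0).
Qed.

Lemma p_le_settled x t : settled x -> 0 <= t -> p x t <= q x.
Proof.
move=> sx t0; have x0 : 0 <= x ^+ 2 / alpha ^+ 2 by rewrite divr_ge0 ?sqr_ge0.
by rewrite -(sx (t + x ^+ 2 / alpha ^+ 2 + 1)); [apply: p_nondecreasing => //|]; lra.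
Qed.

Let lwtP x : lbm (fun s => wt x s + Psa).
Proof. by apply: lbmD; [apply: continuous_lbm; exact: cont2_r|exact: lbm_cst]. Qed.

Let lwt x : lbm (wt x).
Proof. by apply: continuous_lbm; exact: cont2_r. Qed.

Let ww_window x s t c : 0 <= s -> s <= t ->
  itg s t (fun r => c * (wt x r + Psa)) = c * (ww x t - ww x s + Psa * (t - s)).
Proof.
move=> s0 st; rewrite itgZ// itgD//; last exact: lbm_cst.
by rewrite itg_cst// /ww (itg_split (lwt x) s0 st); ring.
Qed.

(** Condition (P) is silent before the front has passed, but there monotonicity still gives p <= q,
    and [psi] is nowhere above Psi alpha. *)
Lemma absorbed_upper x t s0 : good x -> settled x -> 0 <= s0 -> s0 <= t ->
  (forall s, 0 <= s <= s0 -> p x s = 0) ->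
  S x t <= q x * (ww x t - ww x s0 + Psa * (t - s0)).
Proof.
move=> gx sx s00 s0t H; rewrite /absorbed (itg_split (lbm2_r x ls) s00 s0t).
rewrite -/(S x s0) absorbed_zero// add0r -ww_window//.
have [K [mK K0 HK]] := good_null gx.
have lr : lbm (fun s => q x * (wt x s + Psa)) by apply: lbmM => //; exact: lbm_cst.
apply: (itg_null_le (lbm2_r x ls) lr mK K0) => s /andP[s0s st].
have s_ge0 := le_trans s00 s0s; move=> /(HK s s_ge0)[s_gt0 ->].
have /andP[p0 _] := p_itv x s_ge0.
have u0 := ut_ge0 x s_gt0; rewrite total_sol// in u0.
apply: ler_pM => //; first exact: p_le_settled.
by rewrite wtE//; have := psi_le alpha_gt0 beta_gt0 x s; lra.
Qed.

Lemma absorbed_lower x t : 0 < x -> good x -> settled x -> x ^+ 2 * alpha ^- 2 <= t ->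
  q x * (ww x t - ww x (x ^+ 2 * alpha ^- 2) + Psa * (t - x ^+ 2 * alpha ^- 2)) <= S x t.
Proof.
move=> x0 gx sx; set s1 := x ^+ 2 * alpha ^- 2 => s1t.
have s10 : 0 < s1 by rewrite mulr_gt0 ?exprn_gt0// inv_sq_gt0.
apply: le_trans (absorbed_window x (ltW s10) s1t (lexx t)); rewrite -ww_window ?(ltW s10)//.
have [K [mK K0 HK]] := good_null gx.
have lr : lbm (fun s => q x * (wt x s + Psa)) by apply: lbmM => //; exact: lbm_cst.
have mK1 : @measurable _ (measurableTypeR R) (K `|` [set s1]) by exact: measurableU.
have K10 : mu (K `|` [set s1]) = 0%E.
  by apply: (@null_union _ (measurableTypeR R) R mu) => //; exact: lebesgue_measure_set1.
apply: (itg_null_le lr (lbm2_r x ls) mK1 K10) => s /andP[s1s st] /not_orP[Ks ss1].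
have s0 : 0 < s by exact: lt_le_trans s1s.
have [_ ->] := HK s (ltW s0) Ks.
have s1s' : s1 < s by rewrite lt_neqAle s1s andbT eq_sym; apply/eqP.
rewrite sx// wtE ?(ltW s0)// psi_in// ?subrK//.
rewrite gtr0_norm// -(@ler_pXn2r _ 2) ?nnegrE ?(ltW x0)//; last by rewrite mulr_ge0 ?sqrtr_ge0// ltW.
by rewrite exprMn (sqr_sqrtr (ltW s0)) mulrC -ler_pdivrMr ?exprn_gt0// ltW.
Qed.

Lemma vt_outer t : 0 <= t -> t < alpha ^- 2 -> vt t < ustar.
Proof.
rewrite le_eqVlt => /predU1P[<- _|t0 ta]; first by rewrite vt_neg.
have st0 : 0 < Num.sqrt t by rewrite sqrtr_gt0.
have E : t = ((Num.sqrt t)^-1) ^- 2 by rewrite exprVn invrK sqr_sqrtr// ltW.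
rewrite E -vt_profile ?invr_gt0// profileE ?invr_gt0//; apply: om_lt_ustar.
rewrite -[ltLHS]invrK ltf_pV2 ?posrE ?invr_gt0//.
by rewrite -(sqrt_inv_sq alpha_gt0) ltr_sqrt// inv_sq_gt0.
Qed.

Lemma cw_lower (c1 c2 e y g0 g1 w0 w1 r : R) : 0 < e * y -> c1 * y <= c2 * y ->
  c2 * y = g1 * y - g0 * y + r -> (g1 - e / 4) * y <= w1 -> w0 <= (g0 + e / 4) * y ->
  (c1 - e) * y <= w1 - w0 + r.
Proof. by move=> *; lra. Qed.

Lemma cw_upper (c1 c2 e y g0 g1 w0 w1 r : R) : c2 * y <= (c1 + e / 2) * y ->
  c2 * y = g1 * y - g0 * y + r -> w1 <= (g1 + e / 4) * y -> (g0 - e / 4) * y <= w0 ->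
  w1 - w0 + r <= (c1 + e) * y.
Proof. by move=> *; lra. Qed.

(** At x in [k a, k b] the amount absorbed up to time k^2 is about x^2 q(x) * ct(k^2 / x^2), with
    k^2 / x^2 in [b^-2, a^-2] and [ct] monotone. *)
Lemma absorbed_sandwich a b e : 0 < a -> a <= b -> b <= alpha -> 0 < e ->
  exists N1 : set R, [/\ @measurable _ (measurableTypeR R) N1, mu N1 = 0%E &
  \forall k \near +oo%R, forall x, k * a <= x <= k * b -> ~ N1 x ->
    (ct (b ^- 2) - e) * (x ^+ 2 * q x) <= S x (k ^+ 2)
      <= (ct (a ^- 2) + e) * (x ^+ 2 * q x)].
Proof.
move=> a0 ab ba e0; have b0 := lt_le_trans a0 ab.
have e4 : 0 < e / 4 by rewrite divr_gt0.
have eP : 0 < e / (2 * Psa) by rewrite divr_gt0// mulr_gt0.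
have [d d0 Hd] := cont_eps (cont_inv_sq alpha_gt0) eP.
(* The profile may equal [ustar] at [alpha], so [outer_zero] is applied only up to c^-2 with [c]
   slightly ahead of the front; the gap up to alpha^-2 costs at most e / 2. *)
pose c := alpha + d / 2.
have ac : alpha < c by rewrite /c ltrDl divr_gt0.
have c0 : 0 < c := lt_trans alpha_gt0 ac.
have cd : Psa * (alpha ^- 2 - c ^- 2) <= e / 2.
  have := Hd c; rewrite (_ : c - alpha = d / 2); last by rewrite /c; ring.
  rewrite gtr0_norm ?divr_gt0// => /(_ ltac:(lra)); rewrite ler_norml => /andP[H _].
  have -> : e / 2 = Psa * (e / (2 * Psa)) by field; rewrite gt_eqF.
  by rewrite ler_pM2l//; lra.
have inv x y : 0 < x -> x <= y -> y ^- 2 <= x ^- 2.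
  move=> x0 xy; have y0 := lt_le_trans x0 xy.
  by rewrite lef_pV2 ?posrE ?exprn_gt0// ler_pXn2r ?nnegrE ?(ltW x0) ?(ltW y0).
have [N1 [mN1 N10 HN1]] := ae_settled; exists N1; split => //.
have Z : \forall x \near +oo%R, forall s, 0 <= s <= x ^+ 2 * c ^- 2 -> p x s = 0.
  apply: outer_zero; first exact: ltW (inv_sq_gt0 c0).
  move=> t /andP[t0 tc]; apply: vt_outer => //; apply: le_lt_trans tc _.
  by rewrite ltf_pV2 ?posrE ?exprn_gt0// ltr_pXn2r ?nnegrE ?ltW.
have Wn := ww_scaled (ltW (inv_sq_gt0 a0)) e4.
have /evtP[X HX] : \forall x \near +oo%R,
    (forall s, 0 <= s <= x ^+ 2 * c ^- 2 -> p x s = 0) /\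
    (forall t, 0 <= t <= a ^- 2 -> `|ww x (x ^+ 2 * t) / x ^+ 2 - G t| <= e / 4).
  by apply: filterS2 Z Wn.
apply: filterS2 (evt_gt 0) (near_scale X a0) => k k0 Xk x /andP[x1 x2] Nx.
have x0 : 0 < x by apply: lt_le_trans x1; rewrite mulr_gt0.
have x20 : 0 < x ^+ 2 by rewrite exprn_gt0.
have [gx sx] := HN1 x x0 Nx.
have [] := HX x; first by rewrite (le_trans Xk)// mulrC.
move=> px Wx.
pose t := k ^+ 2 / x ^+ 2.
have tE : k ^+ 2 = x ^+ 2 * t by rewrite /t; field; rewrite gt_eqF.
have tb : b ^- 2 <= t.
  rewrite /t ler_pdivlMr// mulrC ler_pdivrMr ?exprn_gt0// -exprMn.
  by rewrite ler_pXn2r ?nnegrE ?(ltW x0)// mulr_ge0// ltW.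
have ta : t <= a ^- 2.
  rewrite /t ler_pdivrMr// mulrC ler_pdivlMr ?exprn_gt0// -exprMn.
  by rewrite ler_pXn2r ?nnegrE ?(ltW x0)// mulr_ge0// ltW.
have bal := inv _ _ b0 ba; have alc := inv _ _ alpha_gt0 (ltW ac).
have aal := inv _ _ a0 (le_trans ab ba).
have t0 : 0 <= t by rewrite (le_trans _ tb)// ltW// inv_sq_gt0.
have WE r : 0 <= r -> r <= a ^- 2 -> (G r - e / 4) * x ^+ 2 <= ww x (x ^+ 2 * r) <= (G r + e / 4) * x ^+ 2.
  move=> r0 ra; have := Wx r; rewrite r0 ra => /(_ isT).
  rewrite ler_norml lerNl opprB => /andP[B1 B2].
  rewrite -(ler_pdivlMr _ _ x20) -(ler_pdivrMr _ _ x20) -[X in _ && X]lerBlDl B2 andbT.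
  by rewrite lerBlDr -lerBlDl.
have /andP[T1 T2] := WE t t0 ta.
have /andP[A1 A2] := WE _ (ltW (inv_sq_gt0 alpha_gt0)) aal.
have /andP[C1 C2] := WE _ (ltW (inv_sq_gt0 c0)) (le_trans alc aal).
have /andP[q0 _] := q01 x.
apply/andP; split.
  have H1 : x ^+ 2 * alpha ^- 2 <= k ^+ 2 by rewrite tE ler_pM2l// (le_trans bal).
  apply: le_trans (absorbed_lower x0 gx sx H1).
  rewrite mulrA (mulrC _ (q x)) ler_wpM2l// tE.
  have M : cw (alpha ^- 2) (b ^- 2) * x ^+ 2 <= cw (alpha ^- 2) t * x ^+ 2.
    by rewrite ler_pM2r// cw_mono.
  have E2 : cw (alpha ^- 2) t * x ^+ 2 = G t * x ^+ 2 - G (alpha ^- 2) * x ^+ 2 + Psa * (x ^+ 2 * t - x ^+ 2 * alpha ^- 2).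
    by rewrite /cw; ring.
  have ex : 0 < e * x ^+ 2 by rewrite mulr_gt0.
  exact: cw_lower ex M E2 T1 A2.
have s00 : 0 <= x ^+ 2 * c ^- 2 by rewrite mulr_ge0// ltW// inv_sq_gt0.
have s0k : x ^+ 2 * c ^- 2 <= k ^+ 2 by rewrite tE ler_pM2l// (le_trans alc)// (le_trans bal).
apply: le_trans (absorbed_upper gx sx s00 s0k px) _.
rewrite mulrA (mulrC (q x)) ler_wpM2r// tE.
have M : cw (c ^- 2) t <= cw (alpha ^- 2) (a ^- 2) + e / 2.
  apply: le_trans (cw_mono _ ta) _.
  have -> : cw (c ^- 2) (a ^- 2) = cw (alpha ^- 2) (a ^- 2) + cw (c ^- 2) (alpha ^- 2).
    by rewrite /cw; ring.
  by rewrite lerD2l (le_trans (cw_le alc)).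
have {}M : cw (c ^- 2) t * x ^+ 2 <= (cw (alpha ^- 2) (a ^- 2) + e / 2) * x ^+ 2 by rewrite ler_pM2r.
have E2 : cw (c ^- 2) t * x ^+ 2 = G t * x ^+ 2 - G (c ^- 2) * x ^+ 2 + Psa * (x ^+ 2 * t - x ^+ 2 * c ^- 2).
  by rewrite /cw; ring.
exact: cw_upper M E2 T2 C1.
Qed.

Local Notation mom := (moment q).

Definition window_moment a b k := (mom (k * b) - mom (k * a)) / k.

Lemma mean_sandwich a b e : 0 < a -> a <= b -> b <= alpha -> 0 < e ->
  \forall k \near +oo%R, (ct (b ^- 2) - e) * window_moment a b k <= mean_absorbed a b k
    <= (ct (a ^- 2) + e) * window_moment a b k.
Proof.
move=> a0 ab ba e0; have [N1 [mN1 N10 H]] := absorbed_sandwich a0 ab ba e0.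
apply: filterS2 (evt_gt 0) H => k k0 {}H.
have ka0 : 0 <= k * a by rewrite mulr_ge0// ltW.
have kab : k * a <= k * b by rewrite ler_pM2l.
have lm : lbm (fun x => x ^+ 2 * q x).
  by apply: lbmM => //; apply: continuous_lbm => x; exact: (@exprn_continuous R 2 x).
have lS := lbm_absorbed (sqr_ge0 k).
rewrite /window_moment /mean_absorbed !mulrA !ler_pM2r ?invr_gt0//.
rewrite -(momentB lq)// -!itgZ//; apply/andP; split.
  apply: (itg_null_le _ lS mN1 N10); first by apply: lbmM => //; exact: lbm_cst.
  by move=> x xk Nx; have /andP[] := H x xk Nx.
apply: (itg_null_le lS _ mN1 N10); first by apply: lbmM => //; exact: lbm_cst.
by move=> x xk Nx; have /andP[] := H x xk Nx.
Qed.

Lemma ct_gt0 b : 0 < fw (alpha ^- 2) + Psa -> 0 < b -> b < alpha -> 0 < ct (b ^- 2).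
Proof.
move=> f0 b0 ba; set s := alpha ^- 2 in f0 *.
have sb : s < b ^- 2 by rewrite ltf_pV2 ?posrE ?exprn_gt0// ltr_pXn2r ?nnegrE ?ltW.
have f2 : 0 < (fw s + Psa) / 2 by rewrite divr_gt0.
have [d d0 Hd] := cont_eps (fw_continuous (x := s)) f2.
pose t := Num.min (b ^- 2) (s + d / 2).
have st : s < t by rewrite lt_min sb ltrDl divr_gt0.
have tb : t <= b ^- 2 by rewrite ge_min lexx.
have td : t <= s + d / 2 by rewrite ge_min lexx orbT.
apply: lt_le_trans (cw_mono s tb); rewrite /cw.
have [c /andP[c1 c2] ->] := MVT_le (ltW st) (fun x _ => is_derive_G x).
have := Hd c; rewrite ger0_norm ?subr_ge0// => /(_ ltac:(lra)).
rewrite ler_norml => /andP[Hc _].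
rewrite -mulrDl mulr_gt0 ?subr_gt0//; lra.
Qed.

Lemma slope_upper (l g c K e f0 f1 : R) : l <= g * c -> g * (c - K) <= e / 4 * K ->
  - (e / 4 * K) <= f0 - f1 -> l + (f1 - f0) <= g * K + e / 2 * K.
Proof. by move=> *; lra. Qed.

Section Touching.
Hypothesis touch : fw (alpha ^- 2) + Psa = ustar.

(** The windows [a, b] end strictly behind the front: [ct] vanishes at [alpha], and values of [ct]
    are divided by below. *)
Let b := alpha / 2.
Let b0 : 0 < b. Proof. by rewrite divr_gt0. Qed.
Let ba : b < alpha. Proof. by rewrite /b; move: alpha_gt0; lra. Qed.

Let ct_pos a : 0 < a -> a <= b -> 0 < ct (a ^- 2).
Proof. by move=> a0 ab; apply: ct_gt0 => //; [rewrite touch|exact: le_lt_trans ba]. Qed.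

Let slope a := (HH1 b - HH1 a) / (b - a).
(** [up] and [low] come from solving [mean_absorbed_bounds] and [mean_sandwich] on [k a, k b] for
    the mean of xi^2 q. These windows are geometric with ratio b / a, so [mean_upper] and
    [mean_lower] carry the bounds over to mom x / x. *)
Let up a := (slope a - fw (a ^- 2)) / ct (b ^- 2).
Let low a := (slope a - fw (b ^- 2)) / ct (a ^- 2).

Let windowE a x : 0 < a -> window_moment a b (x / a) = (mom (b / a * x) - mom x) / (x / a).
Proof.
move=> a0; rewrite /window_moment.
have -> : x / a * b = b / a * x by rewrite mulrAC [x * b]mulrC mulrAC.
by rewrite divfK// gt_eqF.
Qed.

Let mean_le_up a e : 0 < a -> a < b -> 0 < e -> \forall x \near +oo%R, mom x / x <= up a + e.
Proof.
move=> a0 ab e0; have e2 : 0 < e / 2 by rewrite divr_gt0.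
have h0 : 0 < b - a by rewrite subr_gt0.
have K0 := ct_pos b0 (lexx b); set K := ct (b ^- 2) in K0.
have r1 : 1 < b / a by rewrite ltr_pdivlMr// mul1r.
rewrite (_ : up a + e = up a + e / 2 + e / 2); last by lra.
apply: (mean_upper lq q01 r1 e2).
have A0 : 0 < e / 2 * (b - a) * K by rewrite !mulr_gt0.
have K2 : 0 < K / 2 by rewrite divr_gt0.
have [e' [e'0 e'K e'B]] := pick_small ((up a + e / 2) * (b - a)) A0 K2.
have M := mean_absorbed_bounds a0 (ltW ab) e'0.
have Sw := mean_sandwich a0 (ltW ab) (ltW ba) e'0.
have ia : 0 < a^-1 by rewrite invr_gt0.
have M' := near_comp (fun X => near_scale X ia) M.
have Sw' := near_comp (fun X => near_scale X ia) Sw.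
apply: filterS3 (evt_gt 0) M' Sw' => x x0.
rewrite (mulrC a^-1) windowE// -/K => /andP[_ M2] /andP[S1 _].
have xa : 0 < x / a by rewrite divr_gt0.
set D := (_ - mom x) / (x / a) in S1.
have upE : up a * K * (b - a) = HH1 b - HH1 a - fw (a ^- 2) * (b - a).
  by rewrite /up /slope -/K; field; rewrite !gt_eqF.
have Ke : 0 < K - e' by lra.
have D1 : (K - e') * D <= (K - e') * ((up a + e / 2) * (b - a)).
  apply: le_trans S1 _; apply: le_trans M2 _; rewrite -upE; lra.
rewrite ler_pM2l// in D1.
move: D1; rewrite /D ler_pdivrMr// => D1; apply: le_trans D1 _.
by rewrite le_eqVlt; apply/orP; left; apply/eqP; field; rewrite gt_eqF.
Qed.

Let mean_ge_low a e : 0 < a -> a < b -> 0 < e -> \forall x \near +oo%R, low a - e <= mom x / x.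
Proof.
move=> a0 ab e0; have e2 : 0 < e / 2 by rewrite divr_gt0.
have h0 : 0 < b - a by rewrite subr_gt0.
have K0 := ct_pos a0 (ltW ab); set K := ct (a ^- 2) in K0.
have r1 : 1 < b / a by rewrite ltr_pdivlMr// mul1r.
rewrite (_ : low a - e = low a - e / 2 - e / 2); last by lra.
apply: (mean_lower lq q01 r1 e2).
have A0 : 0 < e / 2 * (b - a) * K by rewrite !mulr_gt0.
have [e' [e'0 _ e'B]] := pick_small ((low a - e / 2) * (b - a)) A0 ltr01.
have M := mean_absorbed_bounds a0 (ltW ab) e'0.
have Sw := mean_sandwich a0 (ltW ab) (ltW ba) e'0.
have ia : 0 < a^-1 by rewrite invr_gt0.
have M' := near_comp (fun X => near_scale X ia) M.
have Sw' := near_comp (fun X => near_scale X ia) Sw.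
apply: filterS3 (evt_gt 0) M' Sw' => x x0.
rewrite (mulrC a^-1) windowE// -/K => /andP[M1 _] /andP[_ S2].
have xa : 0 < x / a by rewrite divr_gt0.
set D := (_ - mom x) / (x / a) in S2.
have lowE : low a * K * (b - a) = HH1 b - HH1 a - fw (b ^- 2) * (b - a).
  by rewrite /low /slope -/K; field; rewrite !gt_eqF.
have Ke : 0 < K + e' by lra.
have D1 : (K + e') * ((low a - e / 2) * (b - a)) <= (K + e') * D.
  apply: le_trans S2; apply: le_trans M1; rewrite -lowE; lra.
rewrite ler_pM2l// in D1.
move: D1; rewrite /D ler_pdivlMr// => D1; apply: le_trans D1.
by rewrite le_eqVlt; apply/orP; left; apply/eqP; field; rewrite gt_eqF.
Qed.

(** gamma is the supremum of [low], and every [low] is at most every [up]. [slope a] is not known to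
    converge as a tends to b; eliminating it gives up a * ct(b^-2) = low a * ct(a^-2) + fw(b^-2) -
    fw(a^-2), and the gap closes by continuity. *)
Lemma mean_touch : exists2 gamma : R, 0 <= gamma & mom x / x @[x --> +oo%R] --> gamma.
Proof.
have low_le_up a a' : 0 < a -> a < b -> 0 < a' -> a' < b -> low a <= up a'.
  move=> a0 ab a'0 a'b; apply/ler_addgt0Pr => e e0; have e2 : 0 < e / 2 by rewrite divr_gt0.
  have H1 := mean_ge_low a0 ab e2; have H2 := mean_le_up a'0 a'b e2.
  near (pinfty_nbhs R) => x.
  have K1 : low a - e / 2 <= mom x / x by near: x.
  have K2 : mom x / x <= up a' + e / 2 by near: x.
  by lra.
pose A := [set low a | a in [set a | 0 < a < b]].
have b2 : 0 < b / 2 < b by apply/andP; split; move: b0; lra.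
have A1 : A (low (b / 2)) by exists (b / 2).
have Au : has_ubound A.
  exists (up (b / 2)) => _ [a /andP[a0 ab] <-]; case/andP: b2 => *; exact: low_le_up.
pose gamma := sup A.
have gl a : 0 < a -> a < b -> low a <= gamma.
  by move=> a0 ab; apply: ub_le_sup => //; exists a => //; rewrite /= a0.
have G1 e : 0 < e -> \forall x \near +oo%R, gamma - e <= mom x / x.
  move=> e0; have e2 : 0 < e / 2 by rewrite divr_gt0.
  have sA : has_sup A by split => //; exists (low (b / 2)).
  have [_ [a /andP[a0 ab] <-] H] := sup_adherent e2 sA.
  apply: filterS (mean_ge_low a0 ab e2) => x; rewrite -/gamma in H; lra.
have K0 := ct_pos b0 (lexx b).
have G2 e : 0 < e -> \forall x \near +oo%R, mom x / x <= gamma + e.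
  move=> e0; have e4 : 0 < e / 4 by rewrite divr_gt0.
  set K := ct (b ^- 2) in K0.
  have e1 : 0 < e / 4 * K by rewrite mulr_gt0.
  have [c cE] : exists c, c = e / 4 * K / (`|gamma| + 1) by eexists.
  have c0 : 0 < c by rewrite cE divr_gt0// ltr_wpDl.
  have [d1 d10 Hd1] := cont_eps (cont_om b0) e1.
  have cC : {for b, continuous (fun x => G (x ^- 2))}.
    apply: (@continuous_comp _ _ _ (fun x : R => x ^- 2) G); first exact: cont_inv_sq.
    exact: is_derive_continuous (is_derive_G _).
  have c2 : 0 < c / 2 by rewrite divr_gt0.
  have cP : 0 < c / 2 / Psa by rewrite divr_gt0.
  have [d2 d20 Hd2] := cont_eps cC c2; have [d3 d30 Hd3] := cont_eps (cont_inv_sq b0) cP.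
  pose h := Num.min (Num.min (Num.min d1 d2) d3) b / 2.
  have m0 : 0 < Num.min (Num.min (Num.min d1 d2) d3) b by rewrite !lt_min d10 d20 d30 b0.
  have h0 : 0 < h by rewrite divr_gt0.
  have hm : h < Num.min (Num.min (Num.min d1 d2) d3) b by rewrite /h; lra.
  move: hm; rewrite !lt_min => /andP[/andP[/andP[h1 h2] h3] hb].
  pose a := b - h.
  have a0 : 0 < a by rewrite subr_gt0.
  have ab : a < b by rewrite /a gtrDl oppr_lt0.
  have ha : `|a - b| = h by rewrite /a addrAC subrr add0r normrN gtr0_norm.
  have := Hd1 a; rewrite ha => /(_ h1); rewrite ler_norml => /andP[F1 _].
  have := Hd2 a; rewrite ha => /(_ h2); rewrite ler_norml => /andP[_ F2].
  have := Hd3 a; rewrite ha => /(_ h3); rewrite ler_norml => /andP[_ F3].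
  have F3' : Psa * (a ^- 2 - b ^- 2) <= c / 2.
    by rewrite mulrC -ler_pdivlMr.
  have F4 : ct (a ^- 2) - K <= c.
    rewrite (_ : ct (a ^- 2) - K = (G (a ^- 2) - G (b ^- 2)) + Psa * (a ^- 2 - b ^- 2)).
      by rewrite [leRHS]splitr lerD.
    by rewrite /K /cw; ring.
  have F5 : 0 <= ct (a ^- 2) - K.
    by rewrite subr_ge0; apply: cw_mono; rewrite lef_pV2 ?posrE ?exprn_gt0// ler_pXn2r ?nnegrE ?(ltW a0) ?(ltW b0)// ltW.
  have upE : up a * K = low a * ct (a ^- 2) + (fw (b ^- 2) - fw (a ^- 2)).
    have := ct_pos a0 (ltW ab); rewrite /up /low -/K => ?.
    by field; rewrite !gt_eqF.
  have L1 : low a * ct (a ^- 2) <= gamma * ct (a ^- 2) by rewrite ler_wpM2r ?gl// ltW// ct_pos// ltW.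
  have L2 : gamma * (ct (a ^- 2) - K) <= e / 4 * K.
    have : gamma * (ct (a ^- 2) - K) <= `|gamma| * c.
      by apply: le_trans (ler_wpM2r F5 (ler_norm _)) _; rewrite ler_wpM2l.
    have : `|gamma| * c <= e / 4 * K.
      by rewrite cE mulrCA -[leRHS]mulr1 ler_wpM2l ?(ltW e1)// ler_pdivrMr ?ltr_wpDl// mul1r lerDl.
    by move=> h2' h1'; exact: le_trans h1' h2'.
  have U : up a <= gamma + e / 2.
    by rewrite -(ler_pM2r K0) mulrDl upE; exact: slope_upper L1 L2 F1.
  have e2 : 0 < e / 2 by rewrite divr_gt0.
  apply: filterS (mean_le_up a0 ab e2) => x Hx; apply: le_trans Hx _.
  by rewrite [in leRHS](splitr e) addrA lerD2r.
exists gamma.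
  apply/ler_addgt0Pr => e e0; have H := G2 e e0; near (pinfty_nbhs R) => x.
  have x0 : 0 < x by near: x; exact: evt_gt.
  have H1 : mom x / x <= gamma + e by near: x.
  by apply: le_trans H1; rewrite divr_ge0 ?(ltW x0)// (moment_ge0 lq q01)// ltW.
apply/cvgyP => e e0; apply: filterS2 (G1 e e0) (G2 e e0) => x ? ?.
by rewrite ler_norml; apply/andP; split; lra.
Unshelve. all: by end_near.
Qed.

End Touching.

(** Strict inequality at the front persists a little later, so [p] still vanishes at times when
    condition (P) already identifies it with [q]. Hence [q] vanishes far out up to a null set, and
    [mom] stays bounded. *)
Lemma mean_below : fw (alpha ^- 2) + Psa < ustar -> mom x / x @[x --> +oo%R] --> (0 : R).
Proof.
move=> H; have [s sE] : exists s : R, s = alpha ^- 2 by exists (alpha ^- 2).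
have s0 : 0 < s by rewrite sE; exact: inv_sq_gt0.
have vs : vt s < ustar by rewrite sE -vt_profile// profileE.
have v0 : 0 < (ustar - vt s) / 2 by rewrite divr_gt0// subr_gt0.
have [d d0 Hd] := cont_eps (vt_continuous (x := s)) v0.
have d2 : 0 < d / 2 by rewrite divr_gt0.
have T0 : 0 <= s + d / 2 by rewrite addr_ge0// ltW.
have /evtP[X HX] : \forall x \near +oo%R, forall t, 0 <= t <= x ^+ 2 * (s + d / 2) -> p x t = 0.
  apply: (outer_zero T0) => t /andP[t0 ts]; have [lt|ge] := ltP t s.
    by apply: vt_outer; rewrite -?sE.
  apply: (lt_of_dist_half vs (Hd t _)); rewrite ger0_norm ?subr_ge0// ltrBlDl.
  by apply: le_lt_trans ts _; rewrite ltrD2l ltr_pdivrMr// ltr_pMr// ltr1n.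
pose Y := Num.max X 1; have Y0 : 0 < Y by rewrite lt_max ltr01 orbT.
have [N1 [mN1 N10 HN1]] := ae_settled.
have lm : lbm (fun x => x ^+ 2 * q x).
  by apply: lbmM => //; apply: continuous_lbm => x; exact: (@exprn_continuous R 2 x).
have M x : Y <= x -> mom x <= mom Y.
  move=> Yx; rewrite -subr_le0 -(momentB lq) ?(ltW Y0)// -[leRHS](mul0r (x - Y)) -itg_cst//.
  apply: (itg_null_le lm (lbm_cst 0) mN1 N10) => z /andP[z1 z2] Nz.
  have z0 : 0 < z by exact: lt_le_trans z1.
  have [_ sz] := HN1 z z0 Nz.
  have zs : z ^+ 2 / alpha ^+ 2 < z ^+ 2 * (s + d / 2).
    by rewrite -sE ltr_pM2l ?exprn_gt0// ltrDl.
  rewrite -(sz _ zs) HX ?mulr0//.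
    by apply: le_trans z1; rewrite le_max lexx.
  by rewrite lexx mulr_ge0 ?sqr_ge0.
apply/cvgyP => e e0; apply: filterS3 (evt_ge Y) (evt_gt 0) (near_scale (mom Y) e0) => x Yx x0 H1.
rewrite subr0 ger0_norm; last by rewrite divr_ge0 ?(moment_ge0 lq q01)// ltW.
by rewrite ler_pdivrMr// (le_trans (M x Yx)).
Qed.

Lemma mean_exists : exists gamma : R, [/\ 0 <= gamma, mom x / x @[x --> +oo%R] --> gamma &
  0 < gamma -> fw (alpha ^- 2) + Psa = ustar].
Proof.
have := om_le_ustar alpha_gt0; rewrite le_eqVlt => /predU1P[H|H].
  by have [gamma g0 Hg] := mean_touch H; exists gamma.
by exists 0; split => //; [exact: mean_below|rewrite ltxx].
Qed.

Section Mean.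
Variable gamma : R.
Hypotheses (gamma_ge0 : 0 <= gamma) (mean_lim : mom x / x @[x --> +oo%R] --> gamma).

Lemma window_lim a b : 0 < a -> 0 < b -> window_moment a b k @[k --> +oo%R] --> gamma * (b - a).
Proof.
move=> a0 b0.
have E : \forall k \near +oo%R, b * (mom (b * k) / (b * k)) - a * (mom (a * k) / (a * k)) = window_moment a b k.
  apply: filterS (evt_gt 0) => k k0; rewrite /window_moment (mulrC k) (mulrC k).
  by field; rewrite !gt_eqF.
have L c : 0 < c -> c * (mom (c * k) / (c * k)) @[k --> +oo%R] --> c * gamma.
  move=> c0; apply: cvgM; first exact: cvg_cst.
  exact: (cvgy_comp (fun X => near_scale X c0) mean_lim).
rewrite (_ : gamma * (b - a) = b * gamma - a * gamma); last by ring.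
have /cvgyP H : b * (mom (b * k) / (b * k)) - a * (mom (a * k) / (a * k)) @[k --> +oo%R]
    --> b * gamma - a * gamma by apply: cvgB; exact: L.
by apply/cvgyP => e e0; apply: filterS2 E (H e e0) => k <-.
Qed.

(** [window_moment a b] tends to gamma (b - a), so the limit of [mean_sandwich] no longer contains
    [q] and controls the increments of [HH1]. *)
Lemma HH1_inner a b : 0 < a -> a <= b -> b <= alpha ->
  (fw (a ^- 2) + gamma * ct (b ^- 2)) * (b - a) <= HH1 b - HH1 a
  <= (fw (b ^- 2) + gamma * ct (a ^- 2)) * (b - a).
Proof.
move=> a0 ab ba; have b0 := lt_le_trans a0 ab.
have WL := window_lim a0 b0; set g := gamma * (b - a) in WL.
have g0 : 0 <= g by rewrite mulr_ge0// subr_ge0.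
have L c : c * window_moment a b k @[k --> +oo%R] --> c * g.
  by apply: cvgM => //; exact: cvg_cst.
have key e : 0 < e -> (ct (b ^- 2) - e) * g <= HH1 b - HH1 a - fw (a ^- 2) * (b - a) + e /\
    HH1 b - HH1 a - fw (b ^- 2) * (b - a) - e <= (ct (a ^- 2) + e) * g.
  move=> e0; have B := mean_absorbed_bounds a0 ab e0; have Sw := mean_sandwich a0 ab ba e0.
  split.
    apply: (near_le_lim (L _) (cvg_cst _)); apply: filterS2 B Sw => k /andP[? ?] /andP[? ?]; lra.
  apply: (near_le_lim (cvg_cst _) (L _)); apply: filterS2 B Sw => k /andP[? ?] /andP[? ?]; lra.
have g1 : 0 < g + 1 by rewrite ltr_wpDl.
apply/andP; split; apply/ler_addgt0Pr => e e0; have e1 : 0 < e / (g + 1) by rewrite divr_gt0.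
  have [K _] := key _ e1.
  have : e / (g + 1) * (g + 1) = e by rewrite divfK// gt_eqF.
  by move: K; rewrite /g; move: (ct _) (e / _) => c1 c2; lra.
have [_ K] := key _ e1.
have : e / (g + 1) * (g + 1) = e by rewrite divfK// gt_eqF.
by move: K; rewrite /g; move: (ct _) (e / _) => c1 c2; lra.
Qed.

Lemma cont_ct x : 0 < x -> is_derive x (1 : R) (fun x => ct (x ^- 2)) (- 2 / x ^+ 3 * (fw (x ^- 2) + Psa)).
Proof.
move=> x0.
have Dc t : is_derive t (1 : R) ct (fw t + Psa).
  have D := derD (derB (is_derive_G t) (der_cst (G (alpha ^- 2)) t)) (derZ Psa (derB (der_id t) (der_cst (alpha ^- 2) t))).
  by apply: der_eq D _; ring.
by apply: der_eq (derC (Dc _) (is_derive_inv_sq x0)) _; ring.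
Qed.

Lemma is_derive_HH1_inner x : 0 < x -> x < alpha ->
  is_derive x (1 : R) HH1 (fw (x ^- 2) + gamma * ct (x ^- 2)).
Proof.
move=> x0 xa; have r0 : 0 < Num.min x (alpha - x) by rewrite lt_min x0 subr_gt0.
apply: (derive_sandwich (L := fun a b => fw (a ^- 2) + gamma * ct (b ^- 2))
  (U := fun a b => fw (b ^- 2) + gamma * ct (a ^- 2)) r0).
  move=> a b ax ab bx; apply: HH1_inner => //.
    by have : Num.min x (alpha - x) <= x by [rewrite ge_min lexx]; lra.
  by have : Num.min x (alpha - x) <= alpha - x by [rewrite ge_min lexx orbT]; lra.
move=> e e0; have e2 : 0 < e / 2 by rewrite divr_gt0.
have [d1 d10 H1] := cont_eps (cont_om x0) e2.
have cc : {for x, continuous (fun x => gamma * ct (x ^- 2))}.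
  by apply: cvgM; [exact: cvg_cst|exact: is_derive_continuous (cont_ct x0)].
have [d2 d20 H2] := cont_eps cc e2.
exists (Num.min d1 d2); first by rewrite lt_min d10.
move=> a b; rewrite !lt_min => /andP[a1 a2] /andP[b1 b2].
have := H1 a a1; have := H1 b b1; have := H2 a a2; have := H2 b b2.
by rewrite !ler_norml => /andP[? ?] /andP[? ?] /andP[? ?] /andP[? ?]; split; lra.
Qed.

Lemma profile_Phi : (forall eta, 0 <= eta -> profile eta = Phi alpha beta gamma eta) /\
  0 < fw (alpha ^- 2) + Psa.
Proof.
pose v x := fw (x ^- 2) + Psa.
(* The derivative of [HH x - x / 2 * HH1 x], with the derivative of [HH1] valid behind the front. *)
pose v1 x := HH1 x / 2 - x / 2 * (fw (x ^- 2) + gamma * ct (x ^- 2)).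
have Dv x : 0 < x -> x < alpha -> is_derive x (1 : R) v (v1 x).
  move=> x0 xa.
  have D := derB (is_derive_HH x0) (derM (derZ (1 / 2) (der_id x)) (is_derive_HH1_inner x0 xa)).
  have D' := derD D (der_cst Psa x).
  apply: (der_near x0 _ (der_eq D' _)) => [y|].
    rewrite ltr_norml => /andP[y1 _]; have y0 : 0 < y by lra.
    by rewrite /v (HH_id y0); field.
  by rewrite /v1; field.
have Dv1 x : 0 < x -> x < alpha -> is_derive x (1 : R) v1 (gamma * v x / x ^+ 2 - x / 2 * v1 x).
  move=> x0 xa.
  have Dx : is_derive x (1 : R) (fun y => HH1 y / 2) ((fw (x ^- 2) + gamma * ct (x ^- 2)) / 2).
    rewrite (_ : (fun y => HH1 y / 2) = (fun y => 1 / 2 * HH1 y)); last by apply/funext => y; ring.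
    by apply: der_eq (derZ (1 / 2) (is_derive_HH1_inner x0 xa)) _; field.
  have Do : is_derive x (1 : R) (fun x => fw (x ^- 2)) (v1 x).
    apply: (der_near (ltr01) _ (der_eq (derB (Dv x x0 xa) (der_cst Psa x)) _)) => [y _|].
      by rewrite /v addrK.
    by rewrite subr0.
  have D2 : is_derive x (1 : R) (fun y => y / 2) (1 / 2).
    rewrite (_ : (fun y => y / 2) = (fun y => 1 / 2 * y)); last by apply/funext => y; ring.
    by apply: der_eq (derZ (1 / 2) (der_id x)) _; rewrite mulr1.
  apply: der_eq (derB Dx (derM D2 (derD Do (derZ gamma (cont_ct x0))))) _.
  by rewrite /v; field; rewrite gt_eqF.
have cv : {for alpha, continuous v} by apply: cvgD; [exact: cont_om|exact: cvg_cst].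
have c2 x : {for x, continuous (fun y : R => y / 2)}.
  by apply: cvgM; [exact: cvg_id|exact: cvg_cst].
have cv1 : {for alpha, continuous v1}.
  apply: cvgB.
    by apply: cvgM; [exact: cont_HH1|exact: cvg_cst].
  apply: cvgM; first exact: c2.
  apply: cvgD; first exact: cont_om.
  by apply: cvgM; [exact: cvg_cst|exact: is_derive_continuous (cont_ct alpha_gt0)].
have vprof x : 0 < x -> x <= alpha -> v x = profile x.
  by move=> x0 xa; rewrite (profileE x0) /v Psi_in// gtr0_norm.
have v0 e : 0 < e -> exists2 r, 0 < r & forall x, 0 < x -> x < r -> `|v x| <= e.
  move=> e0; have P4 : 0 < 4 * Psa by rewrite mulr_gt0.
  exists (Num.min alpha (e / (4 * Psa))); first by rewrite lt_min alpha_gt0 divr_gt0.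
  move=> x x0; rewrite lt_min => /andP[xa xe].
  rewrite vprof ?(ltW xa)// ger0_norm ?profile_ge0// (le_trans (profile_le (ltW x0)))//.
  by rewrite mulrC -ler_pdivlMr// ltW.
have [inner jump] := inner_solution gamma_ge0 alpha_gt0 Dv Dv1 cv cv1 v0.
have [C HC] := outer_ode alpha_gt0 om_lt_ustar.
have mC : HH1 alpha - alpha * fw (alpha ^- 2) = C * gs (1 / 4) alpha.
  apply: (@cont_right_eq _ (fun x => HH1 x - x * fw (x ^- 2)) (fun x => C * gs (1 / 4) x) alpha 1) => //.
  - apply: cvgB; first exact: cont_HH1.
    by apply: cvgM; [exact: cvg_id|exact: cont_om].
  - by apply: cvgM; [exact: cvg_cst|exact: continuous_gs].
  - by move=> y y1 _; have [] := HC y y1.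
pose B := C / 2 - cA.
have q0 : 0 < 1 / 4 :> R by rewrite divr_gt0.
pose P x := fw (x ^- 2) + Psi x.
have DP x : alpha < x -> is_derive x (1 : R) (fun x => P x + B * gtail (1 / 4) x) 0.
  move=> ax; have [_ D] := HC x ax.
  have D' := is_derive_Psi beta alpha_gt0 ax.
  by apply: der_eq (derD (derD D D') (derZ B (is_derive_gtail x q0))) _; rewrite /B; ring.
have P_out x : alpha < x -> P x = - B * gtail (1 / 4) x.
  move=> ax; have x0 := lt_trans alpha_gt0 ax.
  apply/eqP; rewrite -subr_eq0 mulNr opprK -normr_le0; apply/ler_addgt0Pr => e e0; rewrite add0r.
  have e2 : 0 < e / 2 by rewrite divr_gt0.
  have eB : 0 < e / 2 / (`|B| + 1) by rewrite divr_gt0// ltr_wpDl.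
  have [M1 aM1 H1] := Psi_small alpha_gt0 beta_gt0 e2; have [M2 _ H2] := gtail_small q0 eB.
  pose y := Num.max x (Num.max M1 M2).
  have xy : x <= y by rewrite le_max lexx.
  have y1 : M1 <= y by rewrite !le_max lexx orbT.
  have y2 : M2 <= y by rewrite !le_max lexx !orbT.
  have y0 : 0 < y by exact: lt_le_trans xy.
  have -> : P x + B * gtail (1 / 4) x = P y + B * gtail (1 / 4) y.
    apply: (@zero_derive_const _ (fun x => P x + B * gtail (1 / 4) x) x y xy) => z /andP[xz _].
    by apply: DP; exact: lt_le_trans xz.
  apply: le_trans (ler_normD _ _) _; rewrite normrM (ger0_norm (gtail_ge0 _ _)).
  have Py : 0 <= P y by rewrite /P -profileE// profile_ge0.
  have Py2 : P y <= e / 2 by rewrite /P; have := H1 y y1; have := fw_npos (y ^- 2); lra.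
  have : `|B| * gtail (1 / 4) y <= `|B| * (e / 2 / (`|B| + 1)) by rewrite ler_wpM2l// H2.
  have : `|B| * (e / 2 / (`|B| + 1)) <= e / 2.
    by rewrite mulrCA -[leRHS]mulr1 ler_wpM2l ?(ltW e2)// ler_pdivrMr ?ltr_wpDl// mul1r lerDl.
  move=> h1 h2; rewrite (ger0_norm Py).
  by apply: le_trans (lerD Py2 (le_trans h2 h1)) _; rewrite -splitr.
have P_al : v alpha = - B * gtail (1 / 4) alpha.
  have -> : v alpha = P alpha by [].
  apply: (@cont_right_eq _ P (fun x => - B * gtail (1 / 4) x) alpha 1 ltr01).
  - by apply: cvgD; [exact: cont_om|exact: continuous_Psi].
  - by apply: cvgM; [exact: cvg_cst|exact: continuous_gtail].
  - by move=> y y1 _; exact: P_out.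
have t0 : 0 < gtail (1 / 4) alpha by exact: gtail_gt0.
(* The absorption term vanishes at the front, so the inner slope there takes the value supplied by
   the outer equation. *)
have ct0 : ct (alpha ^- 2) = 0 by rewrite /cw !subrr mulr0 addr0.
have v1E : v1 alpha = C / 2 * gs (1 / 4) alpha.
  have -> : v1 alpha = (HH1 alpha - alpha * fw (alpha ^- 2)) / 2 by rewrite /v1 ct0; field.
  by rewrite mC; ring.
(* Inner slope C / 2 * gs minus outer slope B * gs at [alpha] is cA * gs = alpha * beta / 2: the
   slope of fw(x^-2) is continuous and only that of [Psi] jumps. *)
have J : v alpha * (shape1 gamma alpha / shape gamma alpha + gs (1 / 4) alpha / gtail (1 / 4) alpha)
    = alpha * beta / 2.
  rewrite mulrDr (_ : v alpha * (shape1 gamma alpha / shape gamma alpha) = v1 alpha); last first.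
    by rewrite jump; ring.
  rewrite v1E P_al -Psi_coef_gs /B; field.
  by rewrite gt_eqF.
have [vE vpos] := ustar_gammaE alpha_gt0 beta_gt0 gamma_ge0 J.
split; last exact: vpos.
move=> eta; rewrite le_eqVlt => /predU1P[<-|e0].
  rewrite /profile ltxx /Phi alpha_gt0 powR0 ?mulr0 ?mul0r//.
  by rewrite gt_eqF// (lt_le_trans ltr01)// kappa_ge1.
have [ea|ea] := ltP eta alpha.
  rewrite -vprof ?(ltW ea)// (inner eta e0 (ltW ea)) /Phi ea -vE /shape /KM /arg.
  by ring.
rewrite /Phi ltNge ea /= -vE.
have sp : 0 < Num.sqrt (pi : R) by rewrite sqrtr_gt0 pi_gt0.
have E x : erfc (x / 2) = gtail (1 / 4) x / Num.sqrt pi :> R.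
  by rewrite gtail_erfc [RHS]mulrC (mulKf (lt0r_neq0 sp)).
rewrite !E profileE// (_ : v alpha / _ * _ = - B * gtail (1 / 4) eta); last first.
  by rewrite P_al; field; rewrite !gt_eqF.
by move: ea; rewrite le_eqVlt => /predU1P[<-|ea]; [exact: P_al|exact: P_out].
Qed.

Lemma mean_conclusion :
  [/\ forall e, 0 < e -> \forall t \near +oo%R, forall eta, 0 <= eta ->
        `|u (eta * Num.sqrt t) t - Phi alpha beta gamma eta| <= e,
      Phi alpha beta gamma alpha = fw (alpha ^- 2) + Psa
    & 0 < Phi alpha beta gamma alpha <= ustar].
Proof.
have [prof pos] := profile_Phi.
have E : Phi alpha beta gamma alpha = fw (alpha ^- 2) + Psa.
  by rewrite -(prof _ (ltW alpha_gt0)) profileE.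
split => //; last by rewrite E pos om_le_ustar.
move=> e e0; apply: filterS (u_uniform e0) => t H eta eta0.
by rewrite -prof//; exact: H.
Qed.

End Mean.

Lemma profile_conclusion : exists gamma : R,
  [/\ 0 <= gamma, mom x / x @[x --> +oo%R] --> gamma,
      forall e, 0 < e -> \forall t \near +oo%R, forall eta, 0 <= eta ->
        `|u (eta * Num.sqrt t) t - Phi alpha beta gamma eta| <= e,
      0 < gamma -> Phi alpha beta gamma alpha = ustar
    & 0 < Phi alpha beta gamma alpha <= ustar].
Proof.
have [gamma [g0 glim gE]] := mean_exists.
have [H1 H2 H3] := mean_conclusion g0 glim.
by exists gamma; split => // /gE <-.
Qed.

End ScaledLimit.

Lemma flow_conclusion (q : R -> R) : lbm q -> (forall x, 0 <= q x <= 1) ->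
  {ae mu, forall x, 0 < x -> forall t, x ^+ 2 / alpha ^+ 2 < t -> p x t = q x} ->
  exists gamma : R,
  [/\ 0 <= gamma, moment q x / x @[x --> +oo%R] --> gamma,
      forall e, 0 < e -> \forall t \near +oo%R, forall eta, 0 <= eta ->
        `|u (eta * Num.sqrt t) t - Phi alpha beta gamma eta| <= e,
      0 < gamma -> Phi alpha beta gamma alpha = ustar
    & 0 < Phi alpha beta gamma alpha <= ustar].
Proof.
move=> lq q01 qp; have [fw [fw_neg fw_lim]] := scaled_limit.
have [P [DP _]] := primitive (fw_continuous fw_neg fw_lim).
have DG t : is_derive t (1 : R) (fun t => P t - P 0) (fw t).
  by apply: der_eq (derB (DP t) (der_cst (P 0) t)) _; rewrite subr0.
by apply: (profile_conclusion fw_neg fw_lim _ DG lq q01 qp); rewrite subrr.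
Qed.

End Flow.

(** * Conclusion *)

Section IntegralLimits.
Context {R : realType}.
Local Notation mu := (@lebesgue_measure R).
Implicit Types (F : R -> \bar R) (q : R -> R) (x y l c : R).

Lemma near_ereal_cvg F l : (forall e, 0 < e -> \forall x \near +oo%R,
    ((l - e)%:E <= F x)%E /\ (F x <= (l + e)%:E)%E) -> F x @[x --> +oo%R] --> l%:E.
Proof.
move=> H; have fin e x : ((l - e)%:E <= F x)%E -> (F x <= (l + e)%:E)%E -> F x \is a fin_num.
  by move=> H1 H2; rewrite fin_numElt (lt_le_trans (ltNyr _) H1) (le_lt_trans H2 (ltry _)).
apply/fine_cvgP; split; first by apply: filterS (H 1 ltr01) => x []; exact: fin.
apply/cvgyP => e e0; apply: filterS (H e e0) => x [H1 H2].
have := fin _ _ H1 H2; move: H1 H2; rewrite /=; case: (F x) => // r; rewrite !lee_fin /= => H1 H2 _.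
by rewrite ler_norml; apply/andP; split; lra.
Qed.

(** Monotone convergence along ]x, x + n], the bound being uniform in the right endpoint. *)
Lemma tail_integral_le q x c : lbm q -> (forall y, 0 <= q y) ->
  (forall y, x <= y -> itg x y q <= c) -> (\int[mu]_(y in `]x, +oo[) (q y)%:E <= c%:E)%E.
Proof.
move=> lq q0 H; have mq : measurable_fun setT (EFin \o q) by apply/measurable_EFinP; exact: lq.1.
have -> : `]x, +oo[%classic = \bigcup_n `]x, x + n%:R]%classic.
  apply/seteqP; split => y /=; rewrite in_itv /= ?andbT; last by case=> n _; rewrite /= in_itv /= => /andP[].
  move=> xy; exists (Num.bound (y - x)) => //=; rewrite in_itv /= xy -lerBlDl ltW//.
  by rewrite archi_boundP// subr_ge0 ltW.
have C := @ge0_nondecreasing_set_cvg_integral _ (measurableTypeR R) R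
  (fun n : nat => `]x, x + n%:R]%classic) (EFin \o q) mu.
have C' : (\int[mu]_(y in `]x, (x + n%:R)%R]) (q y)%:E @[n --> \oo] -->
    \int[mu]_(y in \bigcup_n `]x, (x + n%:R)%R]%classic) (q y)%:E)%E.
  apply: C => [|n|n|n y _ /=].
  - apply/nondecreasing_seqP => n; rewrite subsetEset => y /=; rewrite !in_itv /= => /andP[-> /= yn].
    by rewrite (le_trans yn)// lerD2l ler_nat.
  - exact: measurable_itv.
  - exact: measurable_funTS.
  - by rewrite lee_fin.
rewrite -(cvg_lim _ C')//; apply: lime_le; first by apply/cvg_ex; eexists; exact: C'.
apply: nearW => n; rewrite integral_itv_obnd_cbnd; last exact: measurable_funTS.
by rewrite -itgE// lee_fin; apply: H; rewrite lerDl.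
Qed.

Section Moments.
Variable q : R -> R.
Hypotheses (lq : lbm q) (q01 : forall x, 0 <= q x <= 1).
Variable gamma : R.
Hypothesis gamma_ge0 : 0 <= gamma.
Hypothesis mean_lim : moment q x / x @[x --> +oo%R] --> gamma.

Let q0 x : 0 <= q x. Proof. by have /andP[] := q01 x. Qed.
Let mq : measurable_fun setT (EFin \o q). Proof. by apply/measurable_EFinP; exact: lq.1. Qed.

Lemma tail_integral_cvg :
  (x%:E * \int[mu]_(xi in `]x, +oo[) (q xi)%:E)%E @[x --> +oo%R] --> gamma%:E.
Proof.
apply: near_ereal_cvg => e e0.
apply: filterS3 (evt_gt 0) (tail_upper lq q01 gamma_ge0 mean_lim e0)
  (tail_lower lq q01 gamma_ge0 mean_lim e0) => x x0 Hu Hl.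
split; last first.
  have : (\int[mu]_(y in `]x, +oo[) (q y)%:E <= ((gamma + e) / x)%:E)%E.
    by apply: tail_integral_le => // y xy; rewrite ler_pdivlMr// mulrC; exact: Hu.
  move=> /(lee_wpmul2l (x := x%:E)); rewrite lee_fin => /(_ (ltW x0))/le_trans; apply.
  by rewrite -EFinM mulrC divfK// gt_eqF.
have [y [xy Hy]] : exists y, x <= y /\ gamma - e <= x * itg x y q.
  near (pinfty_nbhs R) => y; exists y; split; first by near: y; exact: evt_ge.
  by near: y.
apply: (@le_trans _ _ (x * itg x y q)%:E); first by rewrite lee_fin.
rewrite EFinM; apply: lee_wpmul2l; first by rewrite lee_fin ltW.
rewrite itgE// -integral_itv_obnd_cbnd; last exact: measurable_funTS.
apply: ge0_subset_integral => //.
- exact: measurable_funTS.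
- by move=> z _; rewrite lee_fin.
- by move=> z /=; rewrite !in_itv /= andbT => /andP[].
Unshelve. all: by end_near. Qed.

Lemma moment_integral_cvg :
  ((x^-1)%:E * \int[mu]_(xi in `]0%R, x]) (xi ^+ 2 * q xi)%:E)%E @[x --> +oo%R] --> gamma%:E.
Proof.
have l2q : lbm (fun x => x ^+ 2 * q x).
  by apply: lbmM => //; apply: continuous_lbm => x; exact: (@exprn_continuous R 2 x).
apply: near_ereal_cvg => e e0.
move/cvgyP/(_ e e0): mean_lim; apply: filterS => x.
rewrite integral_itv_obnd_cbnd; last first.
  by apply: measurable_funTS; apply/measurable_EFinP; exact: l2q.1.
rewrite -itgE// -EFinM !lee_fin mulrC -/(moment q x) ler_norml => /andP[? ?].
by split; lra.
Qed.

End Moments.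
End IntegralLimits.

(** * Weak solutions satisfy the hypotheses of the flow analysis *)

Section WeakSolutions.
Context {R : realType}.
Variables alpha beta ustar : R.
Variables u p : R -> R -> R.
Hypotheses (alpha_gt0 : 0 < alpha) (beta_gt0 : 0 < beta).
Hypothesis sol : weak_solution alpha beta ustar u p.
Local Notation mu := (@lebesgue_measure R).

Lemma u_bounded x t : 0 <= t -> has_ubound [set u x s | s in `[0, t]].
Proof.
move=> t0; have T0 : 0 < t + 1 by rewrite ltr_wpDl.
have [M HM] := ws_bounded sol T0; exists (M + Psi alpha beta alpha) => _ [s /= + <-].
rewrite in_itv /= => /andP[s0 st].
have := HM x s; rewrite s0 (le_trans st) ?lerDl ?ler01// => /(_ isT).
rewrite ler_norml => /andP[_]; have := psi_le alpha_gt0 beta_gt0 x s; lra.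
Qed.

Lemma p_one x s t : 0 <= s -> s <= t -> ustar < u x s -> p x t = 1.
Proof.
move=> s0 st us; have t0 := le_trans s0 st; apply: (ws_p_above sol) => //.
apply: lt_le_trans us _; apply: ub_le_sup; first exact: u_bounded.
by exists s => //=; rewrite in_itv /= s0.
Qed.

Lemma p_zero x t c : 0 <= t -> c < ustar -> (forall s, 0 <= s <= t -> u x s <= c) -> p x t = 0.
Proof.
move=> t0 cu H; apply: (ws_p_below sol) => //; apply: le_lt_trans cu.
apply: ge_sup; first by exists (u x 0), 0 => //=; rewrite in_itv /= lexx.
by move=> _ [s /= + <-]; rewrite in_itv /= => /H.
Qed.

Lemma wt_bounded T : exists M, forall x t, 0 < t <= T -> `|wt alpha beta u x t| <= M.
Proof.
have T0 : 0 < Num.max 1 T by rewrite lt_max ltr01.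
have [M HM] := ws_bounded sol T0; exists M => x t /andP[t0 tT].
by rewrite (wtE _ _ _ x (ltW t0)); apply: HM; rewrite (ltW t0) le_max tT orbT.
Qed.

(** [pstar] is measurable only for the completion and arbitrary on a null set. Clamping a Borel
    version to [0, 1] changes it only on a null set, because the values of [p] lie in [0, 1]. *)
Lemma settled_density pstar : conditionP alpha p pstar -> exists q N,
  [/\ lbm q, forall x, 0 <= q x <= 1, @measurable _ (measurableTypeR R) N, mu N = 0%E &
   forall x, 0 < x -> ~ N x -> q x = pstar x /\
     forall t, x ^+ 2 / alpha ^+ 2 < t -> p x t = q x].
Proof.
move=> [mp [M [mM M0 HM]]].
have [N [mN N0 mpN]] := @completed_measurable_fun_null _ (measurableTypeR R) R mu _ _ (measurable_itv `]0, +oo[) mp.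
pose q x := Num.max 0 (Num.min 1 ((pstar \_ (`]0, +oo[ `\` N)) x)).
have q01 x : 0 <= q x <= 1.
  by rewrite /q le_max lexx /= ge_max ler01 ge_min lexx.
have mq : measurable_fun setT q.
  apply: measurable_maxr; first exact: measurable_cst.
  apply: measurable_minr; first exact: measurable_cst.
  have mE : @measurable _ (measurableTypeR R) (`]0, +oo[ `\` N).
    by apply: measurableD => //; exact: measurable_itv.
  by apply: (measurable_restrictT _ _).1; [exact: mE|exact: mpN].
exists q, (M `|` N); split => //.
- split => // a b; exists 1 => x _; have /andP[? ?] := q01 x; by rewrite ger0_norm.
- exact: (@measurableU _ (measurableTypeR R)).
- exact: (@null_union _ (measurableTypeR R) R mu).
move=> x x0 /not_orP[Mx Nx].
have Hx : forall t, x ^+ 2 / alpha ^+ 2 < t -> p x t = pstar x.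
  by apply: contrapT => H; apply: Mx; apply: HM => /= /(_ x0).
have px : 0 <= pstar x <= 1.
  rewrite -(Hx (x ^+ 2 / alpha ^+ 2 + 1)) ?ltrDl//.
  by apply: (p_itv sol); rewrite ltW// ltr_wpDl// divr_ge0// sqr_ge0.
suff E : q x = pstar x by rewrite E.
rewrite /q patchE mem_set; last by split => //=; rewrite in_itv /= x0.
have /andP[p0 p1] := px.
by rewrite (min_idPr p1) (max_idPr p0).
Qed.

End WeakSolutions.

Lemma near_sup_cvg (R : realType) (f : R -> R -> R) :
  (forall e, 0 < e -> \forall t \near +oo%R, forall eta, 0 <= eta -> `|f eta t| <= e) ->
  ereal_sup [set `|f eta t|%:E | eta in `[0%R, +oo[] @[t --> +oo%R] --> 0%:E.
Proof.
move=> H; apply: near_ereal_cvg => e e0; apply: filterS (H e e0) => t Ht.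
rewrite sub0r add0r; split.
  apply: (@le_trans _ _ `|f 0 t|%:E); first by rewrite lee_fin (le_trans _ (normr_ge0 _))// oppr_le0 ltW.
  by apply: ereal_sup_ubound; exists 0 => //=; rewrite in_itv /= lexx.
by apply: ge_ereal_sup => _ [eta /= + <-]; rewrite in_itv /= andbT lee_fin => /Ht.
Qed.

Lemma weak_solution_limit (R : realType) (alpha beta ustar : R) (u p : R -> R -> R)
    (V q : R -> R) : 0 < alpha -> 0 < beta -> 0 < ustar ->
  weak_solution alpha beta ustar u p -> ustar < Psi alpha beta alpha ->
  {ae @lebesgue_measure R, forall eta : R, 0 <= eta ->
    u (eta * Num.sqrt t) t @[t --> +oo%R] --> V eta} ->
  lbm q -> (forall x, 0 <= q x <= 1) ->
  {ae @lebesgue_measure R, forall x, 0 < x ->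
    forall t, x ^+ 2 / alpha ^+ 2 < t -> p x t = q x} ->
  exists gamma : R,
  [/\ 0 <= gamma, moment q x / x @[x --> +oo%R] --> gamma,
      forall e, 0 < e -> \forall t \near +oo%R, forall eta, 0 <= eta ->
        `|u (eta * Num.sqrt t) t - Phi alpha beta gamma eta| <= e,
      0 < gamma -> Phi alpha beta gamma alpha = ustar
    & 0 < Phi alpha beta gamma alpha <= ustar].
Proof.
move=> alpha_gt0 beta_gt0 ustar_gt0 sol ustar_lt V_lim lq q01 q_p.
have [pb [N [mN N0 lpb pb01 pbp]]] := pb_exists sol.
apply: (flow_conclusion alpha_gt0 beta_gt0 (cont2_wt sol) (cont2_wx sol) (is_derive_wt sol) _
  (wt0 alpha_gt0 beta_gt0 sol mN N0 lpb pbp) (wt_bounded sol) (p_itv sol)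
  (ws_p_nondecreasing sol) (p_one alpha_gt0 beta_gt0 sol) (p_zero sol)
  ustar_gt0 ustar_lt lpb pb01 mN N0 pbp
  (flux_balance alpha_gt0 beta_gt0 sol mN N0 lpb pbp) V_lim lq q01 q_p).
exact: wtE.
Qed.

Theorem theorem17 (R : realType) (alpha beta ustar : R)
    (alpha_gt0 : 0 < alpha) (beta_gt0 : 0 < beta) (ustar_gt0 : 0 < ustar)
    (u p : R -> R -> R) (pstar V : R -> R)
    (u_p_sol : weak_solution alpha beta ustar u p)
    (ustar_lt : ustar < Psi alpha beta alpha)
    (p_condP : conditionP alpha p pstar)
    (V_lim : {ae @lebesgue_measure R, forall eta : R, 0 <= eta ->
       u (eta * Num.sqrt t) t @[t --> +oo%R] --> V eta}) :
  exists gamma : R,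
    [/\ 0 <= gamma,
        ((x^-1)%:E * \int[@lebesgue_measure R]_(xi in `]0%R, x])
           (xi ^+ 2 * pstar xi)%:E)%E @[x --> +oo%R] --> gamma%:E
        /\
        (x%:E * \int[@lebesgue_measure R]_(xi in `]x, +oo[)
           (pstar xi)%:E)%E @[x --> +oo%R] --> gamma%:E,
        forall eta : R, 0 <= eta ->
          u (eta * Num.sqrt t) t @[t --> +oo%R] --> V eta ->
          V eta = Phi alpha beta gamma eta,
        ereal_sup [set `|u (eta * Num.sqrt t) t - Phi alpha beta gamma eta|%:E
                  | eta in `[0%R, +oo[] @[t --> +oo%R] --> 0%:E
      & (0 < gamma -> Phi alpha beta gamma alpha = ustar) /\
        (gamma = 0 -> 0 < Phi alpha beta gamma alpha <= ustar)].
Proof.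
have [q [N [lq q01 mN N0 qN]]] := settled_density u_p_sol p_condP.
have q_p : {ae @lebesgue_measure R, forall x, 0 < x ->
    forall t, x ^+ 2 / alpha ^+ 2 < t -> p x t = q x}.
  exists N; split => // x /= H; apply: contrapT => Nx; apply: H => x0.
  by have [] := qN x x0 Nx.
have [gamma [g0 glim unif gE gle]] :=
  weak_solution_limit alpha_gt0 beta_gt0 ustar_gt0 u_p_sol ustar_lt V_lim lq q01 q_p.
(* [pstar] may fail to be Borel, so its integrals are exchanged for those of [q], with [k] covering
   both integrands of the statement. *)
have Eq D (k : R -> R -> R) : (forall x, D x -> 0 < x) ->
    (\int[@lebesgue_measure R]_(xi in D) (k xi (q xi))%:E =
     \int[@lebesgue_measure R]_(xi in D) (k xi (pstar xi))%:E)%E.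
  move=> D0; apply: (@eq_integral_null _ (measurableTypeR R) R _ _ N) => // x Dx Nx.
  by have [->] := qN x (D0 x Dx) Nx.
exists gamma; split => //.
- split.
    apply: cvg_trans (moment_integral_cvg lq glim); apply: near_eq_cvg.
    apply: nearW => x; rewrite (Eq _ (fun xi z => xi ^+ 2 * z))//.
    by move=> y /=; rewrite in_itv /= => /andP[].
  apply: cvg_trans (tail_integral_cvg lq q01 g0 glim); apply: near_eq_cvg.
  apply: filterS (evt_gt 0) => x x0; rewrite (Eq _ (fun=> id))// => y /=.
  by rewrite in_itv /= andbT => /(lt_trans x0).
- move=> eta eta0 Veta; apply: lim_unique Veta _.
  apply/cvgyP => e e0; apply: filterS (unif e e0) => t; exact.
- exact: (near_sup_cvg (f := fun eta t => u (eta * Num.sqrt t) t - Phi alpha beta gamma eta)).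
Qed.
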